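(* Let $\{L^x_t\}$ and $\{\widetilde L^x_t\}$, $(x,t)\in\mathbb{R}\times\mathbb{R}_+$, be the jointly continuous local times of two independent one-dimensional Brownian motions started at $0$. Let $\beta_{s,t}=\int_{-\infty}^{\infty}L^x_s\,\widetilde L^x_t\,dx$, let $\eta$ be a standard normal random variable $N(0,1)$ independent of $\beta_{s,t}$, and let $\widetilde C=(32/3)^{1/2}$. Then for each fixed $s,t\ge 0$, $$\frac{\int_{-\infty}^{\infty}(L^{x+h}_s-L^x_s)(\widetilde L^{x+h}_t-\widetilde L^x_t)\,dx}{h^{3/2}}\ \longrightarrow\ \widetilde C\,\sqrt{\beta_{s,t}}\,\eta\quad\text{in law as } h\downarrow 0.$$ Consequently, $$\frac{\int_{-\infty}^{\infty}(L^{x+1}_t-L^x_t)(\widetilde L^{x+1}_t-\widetilde L^x_t)\,dx}{t^{3/4}}\ \longrightarrow\ \widetilde C\,\sqrt{\beta_{1,1}}\,\eta\quad\text{in law as } t\to\infty,$$ where in the second limit $\eta$ is independent of $\beta_{1,1}$.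
   Context: Brownian motion is standard one-dimensional Brownian motion $W$ with $W_0=0$ and transition density $p_t(x)=e^{-x^2/(2t)}/\sqrt{2\pi t}$. Its local time $L^x_t$ is the jointly continuous occupation density with respect to Lebesgue measure: $\int_0^t f(W_r)\,dr=\int_{-\infty}^{\infty} f(x)L^x_t\,dx$ for all bounded measurable $f$. *)

(* Defs.v *)
From mathcomp Require Import all_boot all_order all_algebra.
From mathcomp Require Import all_classical all_reals all_analysis.

Set Implicit Arguments.
Unset Strict Implicit.
Unset Printing Implicit Defensive.

Import Order.TTheory GRing.Theory Num.Theory.
Import numFieldNormedType.Exports.

Local Open Scope classical_set_scope.
Local Open Scope ring_scope.

Definition independent_systems (d : measure_display) (T : measurableType d)
    (R : realType) (P : probability T R) (F G : set (set T)) : Prop :=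
  forall A B, F A -> G B -> P (A `&` B) = (P A * P B)%E.

Definition sigma_var (T : Type) (R : realType) (X : T -> R) : set (set T) :=
  preimage_set_system setT X measurable.

Definition sigma_process (T : Type) (R : realType) (D : set R)
    (X : R -> T -> R) : set (set T) :=
  <<s \bigcup_(t in D) sigma_var (X t) >>.

(* Processes are indexed by R, but only times t >= 0 are ever constrained or
   used.  [normal_prob 0 (Num.sqrt v)] has density
   x |-> expR (- x ^+ 2 / (2 * v)) / Num.sqrt (2 * pi * v): the second
   parameter of [normal_prob] is the standard deviation. *)
Record brownian_motion (d : measure_display) (T : measurableType d)
    (R : realType) (P : probability T R) (W : R -> T -> R) : Prop := {
  bm_measurable : forall t, 0 <= t -> measurable_fun setT (W t) ;
  bm_start : {ae P, forall w, W 0 w = 0} ;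
  bm_continuous :
    {ae P, forall w, {within `[0, +oo[, continuous (fun t => W t w)}} ;
  bm_indep_increments : forall s t, 0 <= s -> s <= t ->
    independent_systems P (sigma_process `[0, s] W)
                          (sigma_var (fun w => W t w - W s w)) ;
  bm_gaussian_increments : forall s t, 0 <= s -> s < t ->
    forall A : set R, measurable A ->
      P ((fun w => W t w - W s w) @^-1` A) = normal_prob 0 (Num.sqrt (t - s)) A
}.

(* [L x t w] is the local time at level x and time t.  Joint continuity is
   required for every w, so that integrals of L over the level are random
   variables (not merely almost surely equal to one); the occupation formula
   is required almost surely, simultaneously for all t and f.  It is an equality
   of extended reals with a finite left-hand side, hence it also says that
   x |-> f x * L x t w is integrable. *)
Record local_time (d : measure_display) (T : measurableType d)
    (R : realType) (P : probability T R) (W : R -> T -> R)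
    (L : R -> R -> T -> R) : Prop := {
  lt_measurable : forall x t, 0 <= t -> measurable_fun setT (L x t) ;
  lt_continuous : forall w,
    {within [set xt : R * R | 0 <= xt.2],
      continuous (fun xt : R * R => L xt.1 xt.2 w)} ;
  lt_occupation : {ae P, forall w, forall (t : R) (f : R -> R),
    0 <= t -> measurable_fun setT f -> bounded_fun f ->
    (\int[lebesgue_measure]_(r in `[0%R, t]) (f (W r w))%:E =
     \int[lebesgue_measure]_x (f x * L x t w)%:E)%E}
}.

Definition intersection_local_time (T : Type) (R : realType)
    (L L' : R -> R -> T -> R) (s t : R) (w : T) : R :=
  \int[lebesgue_measure]_x (L x s w * L' x t w).

Definition increment_product (T : Type) (R : realType)
    (L L' : R -> R -> T -> R) (h s t : R) (w : T) : R :=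
  \int[lebesgue_measure]_x ((L (x + h) s w - L x s w) *
                            (L' (x + h) t w - L' x t w)).

Definition same_law (d d' : measure_display) (T : measurableType d)
    (T' : measurableType d') (R : realType) (P : probability T R)
    (P' : probability T' R) (X : T -> R) (X' : T' -> R) : Prop :=
  forall A : set R, measurable A -> P (X @^-1` A) = P' (X' @^-1` A).

Definition standard_normal (d : measure_display) (T : measurableType d)
    (R : realType) (P : probability T R) (X : T -> R) : Prop :=
  forall A : set R, measurable A -> P (X @^-1` A) = normal_prob 0 1 A.

(* The X i and the limit Y may live on different probability spaces. *)
Definition cvg_in_law (d d' : measure_display) (T : measurableType d)
    (T' : measurableType d') (R : realType) (P : probability T R)
    (P' : probability T' R) (I : Type) (F : set_system I)
    (X : I -> T -> R) (Y : T' -> R) : Prop :=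
  [/\ \forall i \near F, measurable_fun setT (X i),
      measurable_fun setT Y &
      forall f : R -> R, continuous f -> bounded_fun f ->
        (\int[P]_w (f (X i w))%:E)%E @[i --> F] -->
        (\int[P']_w (f (Y w))%:E)%E].

(* Main.v *)
(** Smooth the tent [x |-> (h - |x|)^+] at a scale [e << h] to a C^2 kernel Theta. By the
    occupation formula, minus the integral of the product of the increments is the limit,
    as [e] tends to 0, of the double time integral of [Theta''(W_r - W'_u)], hence of its
    Riemann sums along grids. Expanding to second order first along [W'] and then along [W]
    turns such a sum into the double martingale sum of [Theta(V_j - V'_k) xi_j xi'_k] over
    the increments of both grids, with an error that is negligible against [h^(3/2)].
    Given [W'], it is, after normalisation, a martingale sum along [W] whose bracket
    tends to [32/3] times the intersection local time: [16 h^(-3)] times the integral of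
    the square of the tent is [32/3].

    After truncation of the bracket, [Z_h = exp(lam^2/2 <M>_h) cos(lam M_h + ph)] has mean
    [cos ph], and [Ex (Z_h Z_h')] tends to [(cos ph)^2] as [h] tends to 0 with [h'] fixed,
    because the integral of the coefficients of [M_h] against time is small. By Renyi's
    mixing lemma [Z_h] converges weakly to [cos ph], which gives the characteristic
    function of the limit. The second limit follows by Brownian scaling, as the law of
    the integral at [s = t = 1] only depends on [h], being a limit of functionals of
    independent normal variables. *)

Require Import Defs.
From HB Require Import structures.
From mathcomp Require Import all_boot all_order all_algebra.
From mathcomp Require Import all_classical all_reals all_analysis.
From mathcomp Require Import measurable_realfun.
From mathcomp Require Import ring lra zify.

Set Implicit Arguments.
Unset Strict Implicit.
Unset Printing Implicit Defensive.

Import Order.TTheory GRing.Theory Num.Theory.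
Import numFieldNormedType.Exports.

Local Open Scope classical_set_scope.
Local Open Scope ring_scope.

(** * Expectations, independence and freezing *)

(** The bracket has a random limit, so the mean of [Z_h] alone does not determine the limit law. The
    weak limit of [Z_h] is tested against exp(-lam^2/2 sigma^2), with sigma^2 the limit bracket:
    this undoes the factor exp(lam^2/2 <M>_h) and leaves the cosine of the martingale.

    The product estimate puts martingales with different h on one filtration. The grids are
    therefore dyadic with nondecreasing exponents, and earlier coefficients are constant on blocks
    of the later grid. Each filtration contains the other motion from time 0 on, so conditioning on
    it is freezing of an independent variable.

    The scales are chosen in the order h, smoothing scale (at most h^2), mesh: negative powers of
    the smoothing scale in the errors are absorbed by the mesh. The factor 16 is 4^2, as each of the
    two second order expansions brings a factor 1/2.

    In the second limit the rescaled motions change with t while the first limit is about one fixed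
    pair, hence the detour through laws. A free phase in the cosine carries sine and cosine together
    and replaces complex exponentials. *)

Section expectation.
Context d (T : measurableType d) (R : realType) (P : probability T R).
Implicit Types f g : T -> R.

Definition Ex f : R := Rintegral P setT f.

Definition Intg f := P.-integrable setT (EFin \o f).

Lemma Intg_le f g : measurable_fun setT f -> (forall w, `|f w| <= g w) ->
  Intg g -> Intg f.
Proof.
move=> mf fg ig; apply: (le_integrable _ _ _ ig) => //.
  exact/measurable_EFinP.
by move=> w _ /=; rewrite lee_fin (le_trans (fg w))// ler_norm.
Qed.

Lemma Intg_cst (c : R) : Intg (fun _ => c).
Proof. exact: finite_measure_integrable_cst. Qed.

Lemma Intg_bd f (M : R) : measurable_fun setT f -> (forall w, `|f w| <= M) ->
  Intg f.
Proof. by move=> mf fM; apply: (Intg_le mf fM); exact: Intg_cst. Qed.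

Lemma IntgD f g : Intg f -> Intg g -> Intg (fun w => f w + g w).
Proof.
move=> If Ig; have := integrableD measurableT If Ig.
by apply: eq_integrable => // w _ /=; rewrite EFinD.
Qed.

Lemma IntgZ (c : R) f : Intg f -> Intg (fun w => c * f w).
Proof.
move=> If; have := integrableZl measurableT c If.
by apply: eq_integrable => // w _ /=; rewrite EFinM.
Qed.

Lemma IntgN f : Intg f -> Intg (fun w => - f w).
Proof.
move=> If; have := integrableN If.
by apply: eq_integrable => // w _ /=; rewrite EFinN.
Qed.

Lemma Intg_norm f : Intg f -> Intg (fun w => `|f w|).
Proof. by move=> If; have := integrable_norm If. Qed.

Lemma Ex_cst (c : R) : Ex (fun _ => c) = c.
Proof.
by rewrite /Ex Rintegral_cst// [X in fine X](_ : _ = 1%E) ?mulr1//; exact: probability_setT.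
Qed.

Lemma eq_Ex f g : f =1 g -> Ex f = Ex g.
Proof. by move=> fg; congr Ex; apply/funext. Qed.

Lemma ExD f g : Intg f -> Intg g -> Ex (fun w => f w + g w) = Ex f + Ex g.
Proof. by move=> If Ig; rewrite /Ex RintegralD. Qed.

Lemma ExB f g : Intg f -> Intg g -> Ex (fun w => f w - g w) = Ex f - Ex g.
Proof. by move=> If Ig; rewrite /Ex RintegralB. Qed.

Lemma ExZ (c : R) f : Intg f -> Ex (fun w => c * f w) = c * Ex f.
Proof. by move=> If; rewrite /Ex RintegralZl. Qed.

Lemma le_Ex f g : Intg f -> Intg g -> (forall w, f w <= g w) -> Ex f <= Ex g.
Proof. by move=> If Ig fg; rewrite /Ex le_Rintegral. Qed.

Lemma Ex_ge0 f : (forall w, 0 <= f w) -> 0 <= Ex f.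
Proof. by move=> f0; apply: Rintegral_ge0. Qed.

Lemma le_norm_Ex f : Intg f -> `|Ex f| <= Ex (fun w => `|f w|).
Proof. by move=> If; apply: le_normr_Rintegral. Qed.

Lemma Intg_sum (I : Type) (r : seq I) (f : I -> T -> R) :
  (forall i, Intg (f i)) -> Intg (fun w => \sum_(i <- r) f i w).
Proof.
move=> If; elim: r => [|i r IH].
  by under [X in Intg X]eq_fun do rewrite big_nil; exact: Intg_cst.
by under [X in Intg X]eq_fun do rewrite big_cons; apply: IntgD.
Qed.

Lemma Ex_sum (I : Type) (r : seq I) (f : I -> T -> R) :
  (forall i, Intg (f i)) ->
  Ex (fun w => \sum_(i <- r) f i w) = \sum_(i <- r) Ex (f i).
Proof.
move=> If; elim: r => [|i r IH].
  by under eq_Ex do rewrite big_nil; rewrite Ex_cst big_nil.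
under eq_Ex do rewrite big_cons.
by rewrite ExD ?IH ?big_cons//; exact: Intg_sum.
Qed.

Lemma measurable_fun_bigsum (I : Type) (r : seq I) (f : I -> T -> R) :
  (forall i, measurable_fun setT (f i)) ->
  measurable_fun setT (fun w => \sum_(i <- r) f i w).
Proof.
move=> mf; elim: r => [|i r IH].
  by under eq_fun do rewrite big_nil; exact: measurable_cst.
by under eq_fun do rewrite big_cons; apply: measurable_funD.
Qed.

Lemma Ex_eq_ae f g : measurable_fun setT f -> measurable_fun setT g ->
  {ae P, forall w, f w = g w} -> Ex f = Ex g.
Proof.
move=> mf mg fg; rewrite /Ex /Rintegral; congr fine.
apply: ae_eq_integral => //; [exact/measurable_EFinP|exact/measurable_EFinP|].
by apply: filterS fg => w /= ->.
Qed.

Lemma Ex_cvg_dom (f : nat -> T -> R) (g : T -> R) (M : R) :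
  (forall n, measurable_fun setT (f n)) -> measurable_fun setT g ->
  (forall n w, `|f n w| <= M) ->
  {ae P, forall w, f n w @[n --> \oo] --> g w} ->
  Ex (f n) @[n --> \oo] --> Ex g.
Proof.
move=> mf mg fM fg.
have [|||||ig _ cv] := @dominated_convergence _ _ _ P setT measurableT
  (fun n w => (f n w)%:E) (fun w => (g w)%:E) (fun _ => M%:E).
- by move=> n; exact/measurable_EFinP.
- exact/measurable_EFinP.
- by apply: filterS fg => w h _; apply: cvg_EFin => //; near=> n; done.
- exact: finite_measure_integrable_cst.
- by apply: aeW => w n _; rewrite lee_fin.
- have := cv; rewrite /Ex /Rintegral => h; apply: fine_cvg.
  rewrite fineK//; exact: integrable_fin_num.
Unshelve. all: by end_near. Qed.

End expectation.

(** * Exchange of two expectations of a bounded function *)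

Section Ex_fubini.
Context (R : realType) d1 d2 (T : measurableType d1) (U : measurableType d2).
Context (P : probability T R) (Q : probability U R).
Variables (H : T -> U -> R) (M : R).
Hypotheses (mH : measurable_fun setT (fun z : T * U => H z.1 z.2))
  (HM : forall w x, `|H w x| <= M).

(** Adding the bound [M] makes the integrand nonnegative, so that Tonelli's theorem applies to it;
    the constant is subtracted again at the end. *)
Let H2 (z : T * U) : \bar R := (H z.1 z.2 + M)%:E.

Let mH2 : measurable_fun setT H2.
Proof. by apply/measurable_EFinP; exact: measurable_funD. Qed.

Let H20 z : (0 <= H2 z)%E.
Proof.
rewrite lee_fin -lerBlDr sub0r lerNl.
by apply: (le_trans _ (HM z.1 z.2)); rewrite -normrN ler_norm.
Qed.

Let mHl w : measurable_fun setT (H w).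
Proof. by apply: (measurableT_comp mH (pair1_measurable w)). Qed.

Let mHr x : measurable_fun setT (H^~ x).
Proof. by apply: (measurableT_comp mH (pair2_measurable x)). Qed.

Let Ql w : (\int[Q]_x H2 (w, x) = (Ex Q (H w) + M)%:E)%E.
Proof.
have I1 : Intg Q (H w) by exact: (@Intg_bd _ _ _ _ _ M).
have I2 := IntgD I1 (Intg_cst Q M).
have <- : Ex Q (fun z => H w z + M) = Ex Q (H w) + M by rewrite ExD ?Ex_cst//; exact: Intg_cst.
by rewrite /Ex /Rintegral fineK//; exact: integrable_fin_num.
Qed.

Let Pr x : (\int[P]_w H2 (w, x) = (Ex P (H^~ x) + M)%:E)%E.
Proof.
have I1 : Intg P (H^~ x) by exact: (@Intg_bd _ _ _ _ _ M).
have I2 := IntgD I1 (Intg_cst P M).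
have <- : Ex P (fun z => H z x + M) = Ex P (H^~ x) + M by rewrite ExD ?Ex_cst//; exact: Intg_cst.
by rewrite /Ex /Rintegral fineK//; exact: integrable_fin_num.
Qed.

Lemma measurable_Ex : measurable_fun setT (fun w => Ex Q (H w)).
Proof.
have := @measurable_fun_fubini_tonelli_F _ _ T U R Q H2 mH2 H20.
rewrite (_ : fubini_F Q H2 = (fun w => (Ex Q (H w) + M)%:E)); last first.
  by apply/funext => w; exact: Ql.
move=> /measurable_EFinP m.
rewrite (_ : (fun w => _) = fun w => Ex Q (H w) + M - M); first exact: measurable_funB.
by apply/funext => w; rewrite addrK.
Qed.

Lemma measurable_Ex_r : measurable_fun setT (fun x => Ex P (H^~ x)).
Proof.
have := @measurable_fun_fubini_tonelli_G _ _ T U R P H2 mH2 H20.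
rewrite (_ : fubini_G P H2 = (fun x => (Ex P (H^~ x) + M)%:E)); last first.
  by apply/funext => x; exact: Pr.
move=> /measurable_EFinP m.
rewrite (_ : (fun x => _) = fun x => Ex P (H^~ x) + M - M); first exact: measurable_funB.
by apply/funext => x; rewrite addrK.
Qed.

Lemma Ex_le_bound (w : T) : `|Ex Q (H w)| <= M.
Proof.
have I1 : Intg Q (H w) by exact: (@Intg_bd _ _ _ _ _ M).
apply: (le_trans (le_norm_Ex I1)); rewrite -[leRHS](Ex_cst Q).
by apply: le_Ex => //; [exact: Intg_norm|exact: Intg_cst].
Qed.

Lemma Ex_swap : Ex P (fun w => Ex Q (H w)) = Ex Q (fun x => Ex P (H^~ x)).
Proof.
have I1 : Intg P (fun w => Ex Q (H w)).
  by apply: (@Intg_bd _ _ _ _ _ M); [exact: measurable_Ex|exact: Ex_le_bound].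
have I2 : Intg Q (fun x => Ex P (H^~ x)).
  apply: (@Intg_bd _ _ _ _ _ M); first exact: measurable_Ex_r.
  move=> x; have I1' : Intg P (H^~ x) by exact: (@Intg_bd _ _ _ _ _ M).
  apply: (le_trans (le_norm_Ex I1')); rewrite -[leRHS](Ex_cst P).
  by apply: le_Ex => //; [exact: Intg_norm|exact: Intg_cst].
have := @fubini_tonelli _ _ T U R P Q H2 mH2 H20.
under eq_integral do rewrite Ql; under [X in _ = X]eq_integral do rewrite Pr.
move=> e; apply: (addIr M).
have <- : Ex P (fun w => Ex Q (H w) + M) = Ex P (fun w => Ex Q (H w)) + M.
  by rewrite ExD ?Ex_cst//; exact: Intg_cst.
have <- : Ex Q (fun x => Ex P (H^~ x) + M) = Ex Q (fun x => Ex P (H^~ x)) + M.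
  by rewrite ExD ?Ex_cst//; exact: Intg_cst.
by rewrite {1}/Ex [in RHS]/Ex /Rintegral e.
Qed.

End Ex_fubini.

(** * Conditioning as freezing of the past *)

Section freezing.
Context d (T : measurableType d) (R : realType) (P : probability T R).

Definition Fm (G : set (set T)) (f : T -> R) :=
  measurable_fun (setT : set (g_sigma_algebraType G)) f.

Definition has_law (mu : set R -> \bar R) (xi : T -> R) :=
  forall A : set R, measurable A -> P (xi @^-1` A) = mu A.

Definition indep_of (G : set (set T)) (xi : T -> R) :=
  independent_systems P <<s G >> (sigma_var xi).

Lemma sub_meas (G : set (set T)) : G `<=` measurable ->
  <<s G >> `<=` (measurable : set (set T)).
Proof. by move=> Gm; apply: smallest_sub => //; exact: sigma_algebra_measurable. Qed.

Lemma Fm_meas G f : G `<=` measurable -> Fm G f -> measurable_fun setT f.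
Proof.
move=> Gm mf _ B mB; rewrite setTI; apply: (sub_meas Gm).
by have := mf measurableT B mB; rewrite setTI.
Qed.

Lemma Fm_sub G G' f : <<s G >> `<=` <<s G' >> -> Fm G f -> Fm G' f.
Proof.
move=> GG' mf _ B mB; rewrite setTI; apply: GG'.
by have := mf measurableT B mB; rewrite setTI.
Qed.

Lemma Fm_sigma_var (G : set (set T)) f : sigma_var f `<=` <<s G >> -> Fm G f.
Proof. by move=> h _ B mB; apply: h; exists B. Qed.

Variables (G : set (set T)) (xi : T -> R) (mu : probability (measurableTypeR R) R).
Hypotheses (Gm : G `<=` measurable) (mxi : measurable_fun setT xi)
  (ind : indep_of G xi) (lxi : has_law mu xi).

(** The first coordinate of [Phi] is the sample point itself, seen only through the sigma-algebra
    generated by [G]. Independence of [xi] from [G] then says exactly that the law of [Phi] is a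
    product. *)
Let TG := g_sigma_algebraType G.

Let MR := measurableTypeR R.

Let Phi (w : T) : TG * MR := (w, xi w).

Let mid : measurable_fun (setT : set T) (fun w : T => w : TG).
Proof.
move=> _ B mB; rewrite setTI; exact: (sub_meas Gm mB).
Qed.

Let mPhi : measurable_fun setT Phi.
Proof.
exact: (@measurable_fun_pair _ _ _ T TG MR (fun w => w) xi mid mxi).
Qed.

HB.instance Definition _ := isMeasurableFun.Build _ _ _ _ Phi mPhi.

Let idG (w : T) : TG := w.

HB.instance Definition _ := isMeasurableFun.Build _ _ _ _ idG mid.

Let PG : probability TG R := distribution P idG.

Let PP : probability (TG * MR)%type R := distribution P Phi.

Let prod_law (X : set (TG * MR)) : measurable X -> (PG \x mu)%E X = PP X.
Proof.
apply: product_measure_unique => A B mA mB.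
transitivity (P (A `&` xi @^-1` B)) => //.
rewrite ind//; last by exists B => //; rewrite setTI.
by rewrite lxi.
Qed.

(** Fubini for the product law of [Phi]. This takes the place of conditional expectations
    throughout: what is known from [G] is held fixed while [xi] is integrated out. *)
Lemma freezing (H : T -> R -> R) :
  measurable_fun setT (fun z : g_sigma_algebraType G * measurableTypeR R => H z.1 z.2) ->
  (forall w, mu.-integrable setT (EFin \o H w)) ->
  Intg P (fun w => H w (xi w)) ->
  Intg P (fun w => Rintegral mu setT (H w)) /\
  Ex P (fun w => H w (xi w)) = Ex P (fun w => Rintegral mu setT (H w)).
Proof.
move=> mH iH IH.
pose H' (z : TG * R) := (H z.1 z.2)%:E.
have mH' : measurable_fun setT H' by exact/measurable_EFinP.
have e1 : (\int[PP]_z H' z = \int[P]_w (H w (xi w))%:E)%E.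
  rewrite integral_distribution//.
have i1 : (PG \x mu)%E.-integrable setT H'.
  have ip : (PP).-integrable setT H' by apply: integrable_pushforward.
  apply/integrableP; split => //.
  have /integrableP[_] := ip; apply: le_lt_trans; rewrite le_eqVlt; apply/orP; left.
  by apply/eqP; apply: eq_measure_integral => //= A mA _; exact: prod_law.
have e2 : (\int[PG \x mu]_z H' z = \int[PP]_z H' z)%E.
  by apply: eq_measure_integral => //= A mA _; exact: prod_law.
have FE w : (\int[mu]_x H' (w, x) = (Rintegral mu setT (H w))%:E)%E.
  by rewrite /Rintegral fineK//; apply: integrable_fin_num => //; exact: iH.
have iF := integrable_fubini_F i1.
have mF : measurable_fun (setT : set TG) (fun w : TG => Rintegral mu setT (H w)).
  apply/measurable_EFinP; apply: (eq_measurable_fun (fubini_F mu H')).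
    by move=> w _; rewrite /fubini_F FE.
  exact: (measurable_int _ iF).
have mF' : measurable_fun (setT : set T) (fun w : T => Rintegral mu setT (H w)).
  by apply: (@Fm_meas G).
have iF' : Intg P (fun w => Rintegral mu setT (H w)).
  apply/integrableP; split; first exact/measurable_EFinP.
  have /integrableP[_] := iF; apply: le_lt_trans.
  rewrite ge0_integral_pushforward//; last first.
    by apply: measurableT_comp => //; exact: (measurable_int _ iF).
  by rewrite preimage_setT; under [leRHS]eq_integral do rewrite /= /fubini_F FE.
split => //.
rewrite /Ex /Rintegral -e1 -e2 -integral12_prod_meas1//; congr fine.
rewrite integral_pushforward//=; [| |].
- by rewrite preimage_setT; apply: eq_integral => w _ /=; rewrite /fubini_F FE.
- exact: (measurable_int _ iF).
- rewrite preimage_setT; apply: eq_integrable iF' => // w _ /=.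
  by rewrite /fubini_F FE.
Qed.

Let xiM (w : T) : MR := xi w.

Lemma law_integrable (g : R -> R) : measurable_fun setT g ->
  Intg P (fun w => g (xi w)) ->
  mu.-integrable setT (EFin \o g) /\
  Ex P (fun w => g (xi w)) = Rintegral mu setT g.
Proof.
move=> mg Ig.
have e A : measurable A -> pushforward P xiM A = mu A by exact: lxi.
have e' (h : R -> \bar R) : (\int[mu]_x h x = \int[pushforward P xiM]_x h x)%E.
  by apply: eq_measure_integral => //= A mA _; rewrite -e.
have ip : (pushforward P xiM).-integrable setT (EFin \o g).
  by apply: integrable_pushforward => //; exact/measurable_EFinP.
split.
  apply/integrableP; split; first exact/measurable_EFinP.
  by rewrite e'; case/integrableP : ip.
rewrite /Ex /Rintegral e' integral_pushforward//; exact/measurable_EFinP.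
Qed.

Lemma integrable_law (g : R -> R) : measurable_fun setT g ->
  mu.-integrable setT (EFin \o g) -> Intg P (fun w => g (xi w)).
Proof.
move=> mg /integrableP[_ Ig]; apply/integrableP; split.
  by apply/measurable_EFinP; exact: measurableT_comp.
apply: le_lt_trans Ig.
have e' (h : R -> \bar R) : (\int[mu]_x h x = \int[pushforward P xiM]_x h x)%E.
  by apply: eq_measure_integral => //= A mA _; rewrite -lxi.
rewrite e' ge0_integral_pushforward//.
by apply: measurableT_comp => //; exact/measurable_EFinP.
Qed.

Lemma indep_ExM (f : T -> R) (g : R -> R) : Fm G f -> measurable_fun setT g ->
  Intg P (fun w => f w * g (xi w)) -> Intg P (fun w => g (xi w)) ->
  Ex P (fun w => f w * g (xi w)) =
    Ex P (fun w => f w * Ex P (fun w => g (xi w))).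
Proof.
move=> mf mg Ifg Ig.
have [ig eg] := law_integrable mg Ig.
have := @freezing (fun w x => f w * g x).
case => //.
- apply: measurable_funM.
    by apply: (measurableT_comp mf); exact: measurable_fst.
  by apply: (measurableT_comp mg); exact: measurable_snd.
- move=> w; have := integrableZl measurableT (f w) ig.
  by apply: eq_integrable => // x _ /=; rewrite EFinM.
- move=> _ ->; apply: eq_Ex => w.
  by rewrite RintegralZl// eg.
Qed.

End freezing.

(** * Gaussian variables *)

Section normal_integrals.
Context (R : realType).
Local Notation leb := (@lebesgue_measure R).

(** Change of variables holds with the Radon-Nikodym derivative, which equals the explicit density
    almost everywhere because both have the same integral over every measurable set. *)
Lemma ge0_integral_normal (m s : R) (f : R -> \bar R) :
  measurable_fun setT f -> (forall x, 0 <= f x)%E ->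
  (\int[normal_prob m s]_x f x = \int[leb]_x (f x * (normal_pdf m s x)%:E))%E.
Proof.
move=> mf f0.
have dom := normal_prob_dominates m s.
rewrite -(Radon_Nikodym_SigmaFinite.change_of_variables dom)//.
have mRN := measurable_int _ (Radon_Nikodym_SigmaFinite.f_integrable dom).
apply: ae_eq_integral => //.
- by apply: emeasurable_funM.
- apply: emeasurable_funM => //.
  by apply/measurable_EFinP; exact: measurable_normal_pdf.
apply: ae_eqe_mul2l.
apply: integral_ae_eq => //.
- exact: Radon_Nikodym_SigmaFinite.f_integrable.
- by apply/measurable_EFinP; exact: measurable_normal_pdf.
- by move=> E _ mE; rewrite -(Radon_Nikodym_SigmaFinite.f_integral dom).
Qed.

Lemma normal_integrable (m s : R) (g : R -> R) : measurable_fun setT g ->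
  leb.-integrable setT (fun x => (g x * normal_pdf m s x)%:E) ->
  (normal_prob m s).-integrable setT (EFin \o g).
Proof.
move=> mg /integrableP[_ ig].
apply/integrableP; split; first exact/measurable_EFinP.
rewrite ge0_integral_normal//; last first.
  by apply: measurableT_comp => //; exact/measurable_EFinP.
apply: le_lt_trans ig; rewrite le_eqVlt; apply/orP; left; apply/eqP.
apply: eq_integral => x _ /=; rewrite -EFinM normrM.
by rewrite (ger0_norm (normal_pdf_ge0 m s x)).
Qed.

Lemma Rintegral_normal (m s : R) (g : R -> R) : measurable_fun setT g ->
  leb.-integrable setT (fun x => (g x * normal_pdf m s x)%:E) ->
  \int[normal_prob m s]_x g x = \int[leb]_x (g x * normal_pdf m s x).
Proof.
move=> mg ig; rewrite /Rintegral; congr fine.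
rewrite integralE [RHS]integralE; congr (_ - _)%E.
- rewrite ge0_integral_normal//; last by apply: measurable_funepos; exact/measurable_EFinP.
  apply: eq_integral => x _; rewrite !funeposE /= -!EFin_max -EFinM.
  by congr EFin; rewrite maxr_pMl ?normal_pdf_ge0// mul0r.
- rewrite ge0_integral_normal//; last by apply: measurable_funeneg; exact/measurable_EFinP.
  apply: eq_integral => x _; rewrite !funenegE /= -!EFin_max -EFinM.
  by congr EFin; rewrite maxr_pMl ?normal_pdf_ge0// mul0r mulNr.
Qed.

Lemma pow_le_expR (p : nat) (x : R) : 0 <= x -> x ^+ p <= p`!%:R * expR x.
Proof.
move=> x0; case: p => [|p]; first by rewrite fact0 expr0 mul1r -[leLHS]expR0 ler_expR.
rewrite mulrC -ler_pdivrMr ?ltr0n ?fact_gt0//.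
by apply: le_trans (expR_ge1Dxn p x0); rewrite lerDr.
Qed.

Definition npdf (x : R) := normal_pdf 0 1 x.

Lemma npdfE x : npdf x = normal_peak 1 * expR (- (x ^+ 2 / 2)).
Proof.
rewrite /npdf normal_pdfE ?oner_neq0// /normal_fun subr0 expr1n.
by congr (_ * expR _); rewrite mulNr.
Qed.

Lemma npdf_ge0 x : 0 <= npdf x. Proof. exact: normal_pdf_ge0. Qed.

(** The density of N(0, 2) is a ready-made integrable majorant: [|x| ^+ p] is at most p! exp |x|,
    and |x| - x^2/2 <= 1 - x^2/4 because (|x| - 2)^2 >= 0. *)
Lemma npdf_dom (p : nat) : exists2 K : R, 0 <= K &
  forall x, `|x| ^+ p * npdf x <= K * normal_pdf 0 (Num.sqrt 2) x.
Proof.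
have s2 : Num.sqrt 2 != 0 :> R by rewrite gt_eqF// sqrtr_gt0.
have pk1 : 0 < normal_peak 1 :> R by apply: normal_peak_gt0; exact: oner_neq0.
have pk2 : 0 < normal_peak (Num.sqrt 2) :> R by apply: normal_peak_gt0.
exists (p`!%:R * expR 1 * normal_peak 1 / normal_peak (Num.sqrt 2)) => [|x].
  by rewrite !mulr_ge0 ?invr_ge0 ?expR_ge0 ?ler0n ?(ltW pk1) ?(ltW pk2).
rewrite npdfE normal_pdfE// /normal_fun subr0 sqr_sqrtr ?ler0n//.
rewrite [leRHS](_ : _ = p`!%:R * normal_peak 1 * (expR (1 + - x ^+ 2 / 4))); last first.
  rewrite expRD (_ : 2 *+ 2 = 4 :> R); last by rewrite -mulr_natr; lra.
  by field; rewrite gt_eqF.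
rewrite mulrCA -mulrA [leRHS]mulrCA ler_pM2l//.
apply: (@le_trans _ _ (p`!%:R * expR `|x| * expR (- (x ^+ 2 / 2)))).
  by rewrite ler_wpM2r ?expR_ge0// pow_le_expR.
rewrite -mulrA -expRD ler_wpM2l// ler_expR.
have := sqr_ge0 (`|x| - 2); have : `|x| ^+ 2 = x ^+ 2 by rewrite real_normK ?num_real.
by move=> h; rewrite sqrrB h; lra.
Qed.

Lemma measurable_npdf : measurable_fun setT npdf.
Proof. exact: measurable_normal_pdf. Qed.

Lemma npdf_integrable (g : R -> R) (C : R) (p : nat) : measurable_fun setT g ->
  (forall x, `|g x| <= C * (1 + `|x| ^+ p)) ->
  leb.-integrable setT (fun x => (g x * npdf x)%:E).
Proof.
move=> mg gC.
have C0 : 0 <= C.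
  have := le_trans (normr_ge0 _) (gC 0).
  by rewrite pmulr_lge0// ltr_pwDl ?exprn_ge0.
have [K0 K00 h0] := npdf_dom 0; have [K1 K10 h1] := npdf_dom p.
have i := integrableZl measurableT (C * (K0 + K1)) (integrable_normal_pdf 0 (Num.sqrt 2 : R)).
apply: (le_integrable _ _ _ i) => //.
  by apply/measurable_EFinP/measurable_funM => //; exact: measurable_npdf.
move=> x _ /=.
rewrite [leRHS](_ : _ = (`|C * (K0 + K1) * normal_pdf 0 (Num.sqrt 2) x|)%:E)//.
rewrite lee_fin normrM (ger0_norm (npdf_ge0 x)).
rewrite [leRHS]ger0_norm ?mulr_ge0 ?addr_ge0 ?normal_pdf_ge0//.
apply: (@le_trans _ _ (C * (1 + `|x| ^+ p) * npdf x)).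
  by rewrite ler_wpM2r ?npdf_ge0.
rewrite -!mulrA ler_wpM2l// !mulrDl lerD//.
by have := h0 x; rewrite expr0.
Qed.

Lemma FTC_R (F g : R -> R) : (forall x : R, is_derive x (1:R) F (g x)) ->
  continuous g -> leb.-integrable setT (EFin \o g) ->
  F n%:R @[n --> \oo] --> 0 -> F (- n%:R) @[n --> \oo] --> 0 ->
  \int[leb]_x g x = 0.
Proof.
move=> dF cg ig Fp Fn.
have mg : measurable_fun setT g by exact: continuous_measurable_fun.
(* The shift to [n.+1] keeps the interval nondegenerate for n = 0, as the fundamental theorem of
   calculus requires. *)
pose A (n : nat) : set R := `[(- n.+1%:R)%R, n.+1%:R]%classic.
have e n : (\int[leb]_(x in A n) (g x)%:E = (F n.+1%:R)%:E - (F (- n.+1%:R))%:E)%E.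
  have cF : continuous F.
    move=> x; apply/differentiable_continuous/derivable1_diffP.
    by case: (dF x).
  apply: continuous_FTC2.
  - by rewrite gtrN ?ltr0n//.
  - exact: continuous_subspaceT.
  - split.
    + by move=> x _; case: (dF x).
    + by apply: cvg_at_right_filter; exact: cF.
    + by apply: cvg_at_left_filter; exact: cF.
  - by move=> x _; rewrite derive1E; case: (dF x).
have [||||| _ _ cv] := @dominated_convergence _ _ _ leb setT measurableT
  (fun n x => ((g \_ (A n)) x)%:E) (EFin \o g) (abse \o (EFin \o g)).
- move=> n; apply/measurable_EFinP; have [h1 _] := measurable_restrictT g (measurable_itv _ : measurable (A n)).
  apply: h1; exact: measurable_funTS.
- exact/measurable_EFinP.
- apply: aeW => x _; apply: cvg_near_cst.
  near=> n; rewrite /= patchE mem_set// /A /= in_itv/= -ler_norml.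
  near: n; exists (Num.truncn `|x|) => // n /= xn.
  apply: le_trans (ltW (truncnS_gt _)) _; by rewrite ler_nat.
- exact: integrable_abse.
- apply: aeW => x n _ /=; rewrite lee_fin patchE; case: ifP => //.
  by rewrite normr0.
have e2 n : (\int[leb]_x ((g \_ (A n)) x)%:E = (F n.+1%:R - F (- n.+1%:R))%:E)%E.
  by rewrite EFinB -e [RHS]integral_mkcond restrict_EFin.
have cv2 : (\int[leb]_x ((g \_ (A n)) x)%:E)%E @[n --> \oo] --> 0%E.
  under eq_fun do rewrite e2.
  apply: cvg_EFin; first by near=> n.
  rewrite -[X in _ --> X](subr0 0).
  apply: cvgB; [have := Fp | have := Fn]; by rewrite -(cvg_shiftS (fun n => _)).
have h : (\int[leb]_x (g x)%:E = 0)%E by exact: (cvg_unique _ cv cv2).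
by rewrite /Rintegral h.
Unshelve. all: by end_near. Qed.

End normal_integrals.

(** * Stein's identity and the characteristic function of N(0, 1) *)

Section gaussian.
Context (R : realType).
Local Notation leb := (@lebesgue_measure R).
Local Notation npdf := (@npdf R).

Global Instance is_derive_npdf (x : R) : is_derive x (1:R) npdf (- (x * npdf x)).
Proof.
have -> : npdf = (fun x => normal_peak 1 * expR (- (x ^+ 2 / 2))).
  by apply/funext => y; rewrite npdfE.
apply: is_derive_eq.
by rewrite /GRing.scale /=; field.
Qed.

(** The function [|x| * |f x * npdf x|] is bounded, whence a decay of order 1/n along [u]. *)
Lemma npdf_vanish (f : R -> R) (C : R) (u : nat -> R) :
  (forall x, `|f x| <= C * (1 + `|x|)) -> (forall n, `|u n| = n%:R) ->
  f (u n) * npdf (u n) @[n --> \oo] --> 0.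
Proof.
move=> fC un.
have C0 : 0 <= C.
  by have := le_trans (normr_ge0 _) (fC 0); rewrite normr0 addr0 mulr1.
have [K1 K10 h1] := npdf_dom R 1; have [K2 K20 h2] := npdf_dom R 2.
have s2 : Num.sqrt 2 != 0 :> R by rewrite gt_eqF// sqrtr_gt0.
pose M := C * (K1 + K2) * normal_peak (Num.sqrt 2).
have b (x : R) : `|x| * `|f x * npdf x| <= M.
  rewrite normrM (ger0_norm (npdf_ge0 x)).
  apply: (@le_trans _ _ (`|x| * (C * (1 + `|x|) * npdf x))).
    by rewrite ler_wpM2l// ler_wpM2r ?npdf_ge0.
  apply: (@le_trans _ _ (C * (K1 + K2) * normal_pdf 0 (Num.sqrt 2) x)).
    rewrite [leLHS](_ : _ = C * (`|x| ^+ 1 * npdf x + `|x| ^+ 2 * npdf x)); last by ring.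
    by rewrite -mulrA ler_wpM2l// mulrDl lerD ?h1 ?h2.
  by rewrite ler_wpM2l ?mulr_ge0 ?addr_ge0// normal_pdf_ub.
have cv : M * n.+1%:R^-1 @[n --> \oo] --> (0:R).
  rewrite -[X in _ --> X](mulr0 M).
  by apply: cvgM; [exact: cvg_cst|exact: cvg_harmonic].
rewrite -(cvg_shiftS (fun n => f (u n) * npdf (u n))).
apply: norm_cvg0; apply: (squeeze_cvgr _ (cvg_cst 0) cv).
near=> n; rewrite normr_ge0/=.
by rewrite ler_pdivlMr ?ltr0n// mulrC -(un n.+1) b.
Unshelve. all: by end_near. Qed.

(** The integrand is the derivative of [f * npdf], which vanishes at both ends. The first two
    moments and the characteristic function of normal variables are obtained from this identity. *)
Lemma stein (f f' : R -> R) (C : R) :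
  (forall x : R, is_derive x (1:R) f (f' x)) -> continuous f' ->
  (forall x, `|f x| <= C * (1 + `|x|)) -> (forall x, `|f' x| <= C * (1 + `|x|)) ->
  leb.-integrable setT (fun x => ((f' x - x * f x) * npdf x)%:E) /\
  \int[leb]_x ((f' x - x * f x) * npdf x) = 0.
Proof.
move=> df cf' fC f'C.
have C0 : 0 <= C.
  by have := le_trans (normr_ge0 _) (fC 0); rewrite normr0 addr0 mulr1.
have cf : continuous f.
  by move=> x; apply/differentiable_continuous/derivable1_diffP; case: (df x).
have cn : continuous npdf by apply: continuous_normal_pdf; exact: oner_neq0.
have cg : continuous (fun x : R => f' x - x * f x).
  move=> x; apply: cvgB; first exact: cf'.
  by apply: cvgM; [exact: cvg_id|exact: cf].
have mg : measurable_fun setT (fun x : R => f' x - x * f x) by exact: continuous_measurable_fun.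
have ig : leb.-integrable setT (fun x => ((f' x - x * f x) * npdf x)%:E).
  apply: (@npdf_integrable _ _ (C * 4) 2) => // x.
  apply: (le_trans (ler_normB _ _)); rewrite normrM.
  apply: (@le_trans _ _ (C * (1 + `|x|) + `|x| * (C * (1 + `|x|)))).
    by rewrite lerD// ler_wpM2l.
  have := normr_ge0 x; set y := `|x| => y0.
  rewrite mulrCA -mulrDr -mulrA ler_wpM2l//.
  by have := sqr_ge0 (y - 1); nra.
split => //.
apply: (@FTC_R _ (fun x => f x * npdf x)) => //.
- move=> x; have dx := df x; apply: is_derive_eq.
  by rewrite /GRing.scale /=; ring.
- by move=> x; apply: cvgM; [exact: cg|exact: cn].
- apply: (npdf_vanish (u := fun n => n%:R) fC) => n.
  by rewrite ger0_norm.
- apply: (npdf_vanish (u := fun n => - n%:R) fC) => n.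
  by rewrite normrN ger0_norm.
Qed.

Lemma npdf_cos_integrable (c b : R) :
  leb.-integrable setT (fun x => (cos (c + b * x) * npdf x)%:E).
Proof.
apply: (@npdf_integrable _ _ 1 0) => [|x].
  apply: continuous_measurable_fun => x.
  apply: continuous_comp; last exact: continuous_cos.
  by apply: cvgD; [exact: cvg_cst|apply: cvgM; [exact: cvg_cst|exact: cvg_id]].
rewrite mul1r expr0 ler_norml; have := cos_le1 (c + b * x); have := cos_geN1 (c + b * x); lra.
Qed.

(** As a function of [b] the integral satisfies phi' = - b phi: differentiate under the integral
    sign and apply Stein's identity to the resulting sine. Hence [phi b * expR (b ^+ 2 / 2)] is
    constant. *)
Lemma gauss_cos (c b : R) :
  \int[leb]_x (cos (c + b * x) * npdf x) = cos c * expR (- (b ^+ 2 / 2)).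
Proof.
pose phi b := \int[leb]_x (cos (c + b * x) * npdf x).
have dcos (x y : R) : is_derive y (1:R) (fun b : R => cos (c + b * x) * npdf x)
    (- (x * sin (c + y * x)) * npdf x).
  apply: is_derive_eq; rewrite /GRing.scale /=; ring.
have dphi (y : R) : is_derive y (1:R) phi (- y * phi y).
  have e x z : 'D_1 (fun b : R => cos (c + b * x) * npdf x) z = - (x * sin (c + z * x)) * npdf x.
    by case: (dcos x z).
  have Iy : (`](y - 1), (y + 1)[%classic : set R) y.
    by rewrite /= in_itv/=; apply/andP; split; lra.
  have iG : leb.-integrable setT (EFin \o (fun x : R => `|x| * npdf x)).
    apply: (@npdf_integrable _ _ 1 1) => [|x]; first exact: normr_measurable.
    by rewrite normr_id expr1 mul1r lerDr.
  have H1 x : (`](y - 1), (y + 1)[%classic : set R) x ->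
      leb.-integrable setT (EFin \o (fun z => cos (c + x * z) * npdf z)).
    by move=> _; exact: npdf_cos_integrable.
  have H2 (x z : R) : (`](y - 1), (y + 1)[%classic : set R) x -> (setT : set R) z ->
      derivable (fun b : R => cos (c + b * z) * npdf z) x 1.
    by move=> _ _; case: (dcos z x).
  have H3 (x z : R) : (`](y - 1), (y + 1)[%classic : set R) x -> (setT : set R) z ->
      `|partial1of2 (fun b z : R => cos (c + b * z) * npdf z) x z| <= `|z| * npdf z.
    move=> _ _; rewrite partial1of2E e normrM normrN normrM (ger0_norm (npdf_ge0 z)).
    rewrite ler_wpM2r ?npdf_ge0// ler_piMr// ler_norml sin_le1 andbT.
    exact: sin_geN1.
  have H0 x : 0 <= `|x| * npdf x by rewrite mulr_ge0 ?npdf_ge0.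
  have D := @derivable_under_integral _ _ _ leb _ _ measurableT y _ _ Iy H1 H2 _ H0 iG H3.
  have E := @differentiation_under_integral _ _ _ leb _ _ measurableT y _ _ Iy H1 H2 _ H0 iG H3.
  split => //; rewrite -derive1E E.
  have [] := @stein (fun x => sin (c + y * x)) (fun x => y * cos (c + y * x)) (1 + `|y|).
  - move=> x; apply: is_derive_eq; rewrite /GRing.scale /=; ring.
  - move=> x; apply: cvgM; first exact: cvg_cst.
    apply: continuous_comp; last exact: continuous_cos.
    by apply: cvgD; [exact: cvg_cst|apply: cvgM; [exact: cvg_cst|exact: cvg_id]].
  - move=> x; apply: (@le_trans _ _ 1).
      by rewrite ler_norml sin_le1 andbT; exact: sin_geN1.
    by have := normr_ge0 x; have := normr_ge0 y; nra.
  - move=> x; rewrite normrM; apply: (@le_trans _ _ (`|y| * 1)).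
      by rewrite ler_wpM2l// ler_norml cos_le1 andbT; exact: cos_geN1.
    by have := normr_ge0 x; have := normr_ge0 y; nra.
  move=> I0 J0.
  have i1 := npdf_cos_integrable c y.
  have i2 := integrableZl measurableT y i1.
  have h : \int[leb]_x (- (x * sin (c + y * x)) * npdf x) =
     \int[leb]_x (((y * cos (c + y * x) - x * sin (c + y * x)) * npdf x)
        - y * (cos (c + y * x) * npdf x)).
    by apply: eq_Rintegral => x _; ring.
  have -> : \int[leb]_x partial1of2 (fun b z : R => cos (c + b * z) * npdf z) y x =
      \int[leb]_x (- (x * sin (c + y * x)) * npdf x).
    by apply: eq_Rintegral => x _; rewrite partial1of2E e.
  rewrite h RintegralB//.
  by rewrite J0 RintegralZl// sub0r mulNr.
have hc : forall x : R, is_derive x (1:R) (fun b => phi b * expR (b ^+ 2 / 2)) 0.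
  by move=> x; have := dphi x => ?; apply: is_derive_eq; rewrite /GRing.scale /=; field.
have := is_derive_0_is_cst b 0 hc.
rewrite expr0n /= mul0r expR0 mulr1.
have -> : phi 0 = cos c.
  have -> : phi 0 = \int[leb]_x (cos c * npdf x).
    by apply: eq_Rintegral => x _; rewrite mul0r addr0.
  rewrite RintegralZl//; last exact: integrable_normal_pdf.
  by rewrite /Rintegral integral_normal_pdf mulr1.
move=> h; rewrite -/(phi b) -h -mulrA -expRD subrr expR0 mulr1//.
Qed.

End gaussian.

(** * Affine changes of variable *)

Section affine.
Context (R : realType).
Local Notation leb := (@lebesgue_measure R).

Lemma lebesgue_affine (a b : R) (A : set R) : 0 < a -> measurable A ->
  leb A = (a%:E * leb ((fun x => (a * x + b)%R) @^-1` A))%E.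
Proof.
move=> a0 mA.
pose f (x : measurableTypeR R) : measurableTypeR R := a * x + b.
have mf : measurable_fun setT f.
  by apply: measurable_funD => //; exact: measurable_funM.
pose m : {measure set (measurableTypeR R) -> \bar R} :=
  mscale (NngNum (ltW a0)) (pushforward leb f).
rewrite [LHS](@lebesgue_measure_unique _ (m mf))// => _ [[x y]] _ <-.
rewrite /m /mscale /= /pushforward.
have e : (fun x => a * x + b) @^-1` `]x, y]%classic =
    `](x - b) / a, (y - b) / a]%classic :> set R.
  apply/seteqP; split => z /=; rewrite !in_itv/= /f => /andP[h1 h2]; apply/andP; split.
  - by rewrite ltr_pdivrMr// mulrC; lra.
  - by rewrite ler_pdivlMr// mulrC; lra.
  - by move: h1; rewrite ltr_pdivrMr// mulrC; lra.
  - by move: h2; rewrite ler_pdivlMr// mulrC; lra.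
pose J : set R := `](x - b) / a, (y - b) / a]%classic.
transitivity (a%:E * leb J)%E; last by rewrite /J -e.
rewrite /J.
rewrite !lebesgue_measure_itv/= !lte_fin ltr_pM2r ?invr_gt0// ltrD2r.
case: ifP => _; last by rewrite mule0.
by rewrite -!EFinB -EFinM; congr EFin; field; rewrite gt_eqF.
Qed.

Lemma ge0_integral_affine (a b : R) (f : R -> \bar R) : 0 < a ->
  measurable_fun setT f -> (forall x, 0 <= f x)%E ->
  (\int[leb]_x f x = a%:E * \int[leb]_x f (a * x + b)%R)%E.
Proof.
move=> a0 mf f0.
pose g (x : measurableTypeR R) : measurableTypeR R := a * x + b.
have mg : measurable_fun setT g.
  by apply: measurable_funD => //; exact: measurable_funM.
pose m : {measure set (measurableTypeR R) -> \bar R} := pushforward leb g.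
pose ma : {measure set (measurableTypeR R) -> \bar R} :=
  mscale (NngNum (ltW a0)) (m mg).
transitivity (\int[ma]_x f x)%E.
  by apply: eq_measure_integral => //= A mA _; exact: lebesgue_affine.
rewrite ge0_integral_mscale//; congr (_ * _)%E.
by rewrite /m ge0_integral_pushforward.
Qed.

Lemma integral_shift (b : R) (f : R -> \bar R) : measurable_fun setT f ->
  (\int[leb]_x f (x + b)%R = \int[leb]_x f x)%E.
Proof.
move=> mf.
have h (g : R -> \bar R) : measurable_fun setT g -> (forall x, 0 <= g x)%E ->
    (\int[leb]_x g (x + b)%R = \int[leb]_x g x)%E.
  move=> mg g0; rewrite (@ge0_integral_affine 1 b g)// mul1e.
  by under [RHS]eq_integral do rewrite mul1r.
rewrite integralE [RHS]integralE; congr (_ - _)%E.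
  rewrite -(h f^\+%E)//; first by apply: eq_integral => x _; rewrite !funeposE.
  exact: measurable_funepos.
rewrite -(h f^\-%E)//; first by apply: eq_integral => x _; rewrite !funenegE.
exact: measurable_funeneg.
Qed.

Lemma Rintegral_shift (b : R) (f : R -> R) : measurable_fun setT f ->
  \int[leb]_x f (x + b) = \int[leb]_x f x.
Proof.
move=> mf; rewrite /Rintegral; congr fine.
by rewrite (@integral_shift b (EFin \o f))//; exact/measurable_EFinP.
Qed.

Lemma integrable_shift (b : R) (f : R -> R) :
  leb.-integrable setT (EFin \o f) ->
  leb.-integrable setT (EFin \o (fun x => f (x + b))).
Proof.
move=> /integrableP[/measurable_EFinP mf i].
have ms : measurable_fun setT (fun x : R => f (x + b)).
  by apply: measurableT_comp => //; exact: measurable_funD.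
apply/integrableP; split; first exact/measurable_EFinP.
rewrite (@integral_shift b (fun x => `|(f x)%:E|)%E)//.
by apply: measurableT_comp => //; exact/measurable_EFinP.
Qed.

Lemma normal_pdf_scale (s x : R) : 0 < s ->
  s * normal_pdf 0 s (s * x) = normal_pdf 0 1 x.
Proof.
move=> s0; have sN0 : s != 0 by rewrite gt_eqF.
rewrite !normal_pdfE ?oner_neq0// /normal_fun !subr0 /normal_peak.
have -> : - (s * x) ^+ 2 / (s ^+ 2 *+ 2) = - x ^+ 2 / (1 ^+ 2 *+ 2).
  rewrite expr1n exprMn -[s ^+ 2 *+ 2]mulr_natr invfM mulNr mulrACA divff ?expf_neq0//.
  by rewrite mul1r mulNr.
rewrite mulrA; congr (_ * _).
rewrite expr1n mul1r -mulrnAr sqrtrM ?sqr_ge0// sqrtr_sqr gtr0_norm// invfM.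
by rewrite mulrA mulfV// mul1r.
Qed.

Lemma normal_scale (s : R) (A : set R) : 0 < s -> measurable A ->
  normal_prob 0 s ((fun x => x / s) @^-1` A) = normal_prob 0 1 A.
Proof.
move=> s0 mA.
have ms : measurable_fun setT (fun x : R => x / s) by exact: measurable_funM.
have mB : measurable ((fun x : R => x / s) @^-1` A).
  by rewrite -[X in measurable X]setTI; exact: ms.
have sN0 : s != 0 by rewrite gt_eqF.
have mr m (t : R) B : measurable B ->
    measurable_fun setT ((fun x => (normal_pdf m t x)%:E) \_ B).
  move=> mB'; have [h _] := measurable_restrictT (fun x => (normal_pdf m t x)%:E) mB'.
  apply: h; apply: measurable_funTS.
  by apply/measurable_EFinP; exact: measurable_normal_pdf.
rewrite /normal_prob integral_mkcond [RHS]integral_mkcond/=.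
rewrite (@ge0_integral_affine s 0)//.
- rewrite -ge0_integralZl//.
  + apply: eq_integral => x _.
    rewrite /patch addr0.
    have -> : (s * x \in (fun x => x / s) @^-1` A) = (x \in A).
      have e : s * x / s = x by field.
      by apply/idP/idP => /set_mem h; apply/mem_set; move: h; rewrite /preimage /mkset e.
    case: ifPn => _; last by rewrite mule0.
    by rewrite -EFinM normal_pdf_scale.
  + apply: (measurableT_comp (mr 0 s _ mB)).
    by apply: measurable_funD => //; exact: measurable_funM.
  + by move=> x _; rewrite patchE; case: ifP => // _; rewrite lee_fin normal_pdf_ge0.
  + by rewrite lee_fin ltW.
- exact: (mr 0 s _ mB).
- by move=> x; rewrite patchE; case: ifP => // _; rewrite lee_fin normal_pdf_ge0.
Qed.

End affine.

(** * Random variables with finite moments of all orders *)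

Section moments.
Context d (T : measurableType d) (R : realType) (P : probability T R).
Implicit Types f g : T -> R.

(** Unlike integrability, finiteness of all moments is stable under products. Integrability of any
    polynomial in the increments then follows by closure rules alone, which [momt] applies. *)
Definition mom f :=
  measurable_fun setT f /\ forall p : nat, Intg P (fun w => `|f w| ^+ p).

Lemma mom_meas f : mom f -> measurable_fun setT f.
Proof. by case. Qed.

Lemma mom_Intg f : mom f -> Intg P f.
Proof.
by move=> [mf /(_ 1)]; apply: Intg_le => // w; rewrite expr1.
Qed.

Lemma mom_le f g : measurable_fun setT f -> (forall w, `|f w| <= g w) ->
  mom g -> mom f.
Proof.
move=> mf fg [mg ig]; split => // p; apply: (Intg_le _ _ (ig p)).
  by apply: measurable_funX; exact: measurableT_comp.
move=> w; rewrite ger0_norm ?exprn_ge0// lerXn2r ?nnegrE//.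
by rewrite (le_trans (fg w))// ler_norm.
Qed.

Lemma mom_bd f (M : R) : measurable_fun setT f -> (forall w, `|f w| <= M) -> mom f.
Proof.
move=> mf fM; split => // p; apply: (@Intg_bd _ _ _ _ _ (M ^+ p)).
  by apply: measurable_funX; exact: measurableT_comp.
move=> w; have M0 := le_trans (normr_ge0 _) (fM w).
by rewrite ger0_norm ?exprn_ge0// lerXn2r ?nnegrE.
Qed.

Lemma mom_cst (c : R) : mom (fun _ => c).
Proof. exact: (@mom_bd _ `|c|). Qed.

Lemma momN f : mom f -> mom (fun w => - f w).
Proof.
move=> [mf h]; split; first exact: measurable_funN.
by move=> p; under eq_fun do rewrite normrN.
Qed.

Lemma mom_norm f : mom f -> mom (fun w => `|f w|).
Proof.
move=> [mf h]; split; first exact: measurableT_comp.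
by move=> p; under eq_fun do rewrite normr_id.
Qed.

Lemma momM f g : mom f -> mom g -> mom (fun w => f w * g w).
Proof.
move=> [mf If] [mg Ig]; split; first exact: measurable_funM.
move=> p; apply: (@Intg_le _ _ _ _ _ (fun w => `|f w| ^+ (p + p) + `|g w| ^+ (p + p))).
- apply: measurable_funX; apply: measurableT_comp => //; exact: measurable_funM.
- move=> w /=; rewrite normrX normr_id normrM exprMn !exprD.
  have := sqr_ge0 (`|f w| ^+ p - `|g w| ^+ p).
  by have := sqr_ge0 (`|f w| ^+ p + `|g w| ^+ p); nra.
- exact: IntgD.
Qed.

Lemma momD f g : mom f -> mom g -> mom (fun w => f w + g w).
Proof.
move=> [mf If] [mg Ig]; split; first exact: measurable_funD.
move=> p; apply: (@Intg_le _ _ _ _ _ (fun w => 2 ^+ p * (`|f w| ^+ p + `|g w| ^+ p))).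
- apply: measurable_funX; apply: measurableT_comp => //; exact: measurable_funD.
- move=> w /=; rewrite normrX normr_id.
  apply: (@le_trans _ _ ((2 * Num.max `|f w| `|g w|) ^+ p)).
    rewrite lerXn2r ?nnegrE ?mulr_ge0 ?le_max ?normr_ge0//.
    apply: (le_trans (ler_normD _ _)).
    have h1 : `|f w| <= Num.max `|f w| `|g w| by rewrite le_max lexx.
    have h2 : `|g w| <= Num.max `|f w| `|g w| by rewrite le_max lexx orbT.
    by rewrite mulr_natl mulr2n lerD.
  rewrite exprMn ler_wpM2l ?exprn_ge0//.
  by rewrite maxEle; case: ifP => _; rewrite ?lerDl ?lerDr exprn_ge0.
- by apply: IntgZ; exact: IntgD.
Qed.

Lemma momB f g : mom f -> mom g -> mom (fun w => f w - g w).
Proof. by move=> mf mg; apply: momD => //; exact: momN. Qed.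

Lemma momX f n : mom f -> mom (fun w => f w ^+ n).
Proof.
move=> mf; elim: n => [|n IH]; first by under eq_fun do rewrite expr0; exact: mom_cst.
by under eq_fun do rewrite exprS; exact: momM.
Qed.

Lemma mom_sum (I : Type) (r : seq I) (f : I -> T -> R) :
  (forall i, mom (f i)) -> mom (fun w => \sum_(i <- r) f i w).
Proof.
move=> If; elim: r => [|i r IH].
  by under [X in mom X]eq_fun do rewrite big_nil; exact: mom_cst.
by under [X in mom X]eq_fun do rewrite big_cons; apply: momD.
Qed.

(** The variance is nonnegative. *)
Lemma Ex_sqr f : mom f -> Ex P f ^+ 2 <= Ex P (fun w => f w ^+ 2).
Proof.
move=> mf; set m := Ex P f.
have : 0 <= Ex P (fun w => (f w - m) ^+ 2) by apply: Ex_ge0 => w; exact: sqr_ge0.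
have -> : Ex P (fun w => (f w - m) ^+ 2) =
    Ex P (fun w => (f w ^+ 2 + (- (2 * m)) * f w) + m ^+ 2).
  by apply: eq_Ex => w; ring.
have i1 : Intg P (fun w => f w ^+ 2) by apply/mom_Intg/momX.
have i2 : Intg P (fun w => - (2 * m) * f w) by apply/IntgZ/mom_Intg.
rewrite ExD//; [|exact: IntgD|exact: Intg_cst].
rewrite ExD// ExZ ?Ex_cst -/m; last exact: mom_Intg.
by nra.
Qed.

Lemma Ex_norm_le f (e : R) : 0 <= e -> mom f -> Ex P (fun w => f w ^+ 2) <= e ^+ 2 ->
  Ex P (fun w => `|f w|) <= e.
Proof.
move=> e0 mf fe.
have h := Ex_sqr (mom_norm mf).
have e1 : Ex P (fun w => `|f w| ^+ 2) = Ex P (fun w => f w ^+ 2).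
  by apply: eq_Ex => w; rewrite real_normK ?num_real.
rewrite e1 in h.
have := le_trans h fe; rewrite ler_pXn2r// nnegrE//.
by apply: Ex_ge0.
Qed.

End moments.

Ltac momt := repeat first
  [ assumption
  | (match goal with H : forall _, mom _ _ |- _ => exact: H end)
  | (match goal with H : forall _ _, mom _ _ |- _ => exact: H end)
  | exact: mom_cst | apply: momD | apply: momB | apply: momM
  | apply: momN | apply: momX | apply: mom_norm
  | (apply: mom_sum => ?) ].

(** * Centred normal variables *)

Section gauss_law.
Context d (T : measurableType d) (R : realType) (P : probability T R).

Definition gauss (v : R) (xi : T -> R) :=
  measurable_fun setT xi /\ has_law P (normal_prob 0 (Num.sqrt v)) xi.

Variables (v : R) (xi : T -> R).
Hypotheses (v0 : 0 < v) (gxi : gauss v xi).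

Let s := Num.sqrt v.
Let s0 : 0 < s. Proof. by rewrite sqrtr_gt0. Qed.
Let s2 : s ^+ 2 = v. Proof. by rewrite sqr_sqrtr ?ltW. Qed.
Let mxi : measurable_fun setT xi. Proof. by case: gxi. Qed.

Lemma gauss_std : has_law P (normal_prob 0 1) (fun w => xi w / s).
Proof.
move=> A mA; rewrite -(normal_scale s0 mA).
have [_ <-//] := gxi.
rewrite -[X in measurable X]setTI.
have ms : measurable_fun setT (fun x : R => x / s) by exact: measurable_funM.
exact: ms.
Qed.

Let mz : measurable_fun setT (fun w => xi w / s).
Proof. exact: measurable_funM. Qed.

Lemma gauss_Ex (g : R -> R) (C : R) (p : nat) : measurable_fun setT g ->
  (forall x, `|g x| <= C * (1 + `|x| ^+ p)) ->
  Intg P (fun w => g (xi w / s)) /\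
  Ex P (fun w => g (xi w / s)) = \int[lebesgue_measure]_x (g x * npdf x).
Proof.
move=> mg gC; have i := npdf_integrable mg gC.
have i2 := normal_integrable mg i.
have I1 : Intg P (fun w => g (xi w / s)).
  exact: (integrable_law mz gauss_std mg i2).
split => //.
have [_ ->] := law_integrable mz gauss_std mg I1.
exact: Rintegral_normal.
Qed.

Let xiE w : xi w = s * (xi w / s).
Proof. by rewrite mulrC divfK// gt_eqF. Qed.

Lemma mom_gauss : mom P xi.
Proof.
split => // p.
have [||h _] := @gauss_Ex (fun x => `|x| ^+ p) 1 p.
- exact: measurable_funX.
- by move=> x; rewrite mul1r normrX normr_id lerDr.
have := IntgZ (s ^+ p) h; congr Intg; apply/funext => w.
by rewrite [in RHS]xiE [in RHS]normrM (gtr0_norm s0) exprMn.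
Qed.

Lemma Ex_gauss_cos (c b : R) :
  Ex P (fun w => cos (c + b * xi w)) = cos c * expR (- (b ^+ 2 * v / 2)).
Proof.
have [|x|_ h] := @gauss_Ex (fun x => cos (c + b * s * x)) 1 0.
- apply: continuous_measurable_fun => x.
  apply: continuous_comp; last exact: continuous_cos.
  by apply: cvgD; [exact: cvg_cst|apply: cvgM; [exact: cvg_cst|exact: cvg_id]].
- rewrite mul1r expr0 ler_norml.
  have := cos_le1 (c + b * s * x); have := cos_geN1 (c + b * s * x); lra.
rewrite gauss_cos exprMn s2 in h; rewrite -h; apply: eq_Ex => w.
by rewrite -mulrA -xiE.
Qed.

Lemma Ex_gauss1 : Ex P xi = 0.
Proof.
have [|i h] := @gauss_Ex (fun x => x) 1 1 (@measurable_id _ _ _).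
  by move=> x; rewrite mul1r expr1 lerDr.
have : Ex P (fun w => s * (xi w / s)) = 0.
  rewrite ExZ// h.
  have D (x : R) : is_derive x (1:R) (fun=> -1 : R) 0 by exact: is_derive_cst.
  have [|x|x|_] := stein (C := 1) D.
  - by move=> x; exact: cvg_cst.
  - by rewrite normrN1 mul1r lerDl.
  - by rewrite normr0 mul1r addr_ge0.
  under eq_Rintegral do rewrite mulrN1 opprK add0r.
  by move=> ->; rewrite mulr0.
by under eq_Ex do rewrite -xiE.
Qed.

Lemma Ex_gauss2 : Ex P (fun w => xi w ^+ 2) = v.
Proof.
have [|i h] := @gauss_Ex (fun x => x ^+ 2) 1 2 (@exprn_measurable _ _ _).
  by move=> x; rewrite mul1r normrX lerDr.
have e : Ex P (fun w => v * (xi w / s) ^+ 2) = v.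
  rewrite ExZ// h.
  have D (x : R) : is_derive x (1:R) (fun x => x) 1 by exact: is_derive_id.
  have [|x|x|i0 h0] := stein (C := 1) D.
  - by move=> x; exact: cvg_cst.
  - by rewrite mul1r lerDr.
  - by rewrite normr1 mul1r lerDl.
  have i1 : (@lebesgue_measure R).-integrable setT (EFin \o @npdf R).
    exact: integrable_normal_pdf.
  have e : \int[lebesgue_measure]_x (x ^+ 2 * npdf x) =
     \int[lebesgue_measure]_x (npdf x - (1 - x * x) * npdf x) :> R.
    by apply: eq_Rintegral => x _; ring.
  rewrite e RintegralB// h0 subr0.
  by rewrite /Rintegral integral_normal_pdf mulr1.
rewrite -[RHS]e; apply: eq_Ex => w; by rewrite -s2 -exprMn -xiE.
Qed.

(* Moments of N(0, 1): only their finiteness matters. *)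
Definition gq2 : R := \int[lebesgue_measure]_x ((x ^+ 2 - 1) ^+ 2 * npdf x).
Definition gq6 : R := \int[lebesgue_measure]_x (x ^+ 6 * npdf x).

Lemma Ex_gauss_sqr_dev : Ex P (fun w => (xi w ^+ 2 - v) ^+ 2) = gq2 * v ^+ 2.
Proof.
have [||i h] := @gauss_Ex (fun x => (x ^+ 2 - 1) ^+ 2) 2 4.
- by apply: measurable_funX; apply: measurable_funB => //; exact: exprn_measurable.
- move=> x; rewrite ger0_norm ?sqr_ge0//.
  have -> : `|x| ^+ 4 = x ^+ 4 by rewrite -normrX ger0_norm// exprn_even_ge0.
  by have := sqr_ge0 (x ^+ 2 + 1); nra.
rewrite mulrC /gq2 -h -ExZ//; apply: eq_Ex => w.
by rewrite [in LHS]xiE exprMn s2; ring.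
Qed.

Lemma Ex_gauss6 : Ex P (fun w => xi w ^+ 6) = gq6 * v ^+ 3.
Proof.
have [|i h] := @gauss_Ex (fun x => x ^+ 6) 1 6 (@exprn_measurable _ _ _).
  by move=> x; rewrite mul1r normrX lerDr.
rewrite mulrC /gq6 -h -ExZ//; apply: eq_Ex => w.
by rewrite [in LHS]xiE exprMn -s2; ring.
Qed.

(** The event is an interval of length [2 * dl], and the density is bounded by its peak, which is at
    most [s^-1]. *)
Lemma gauss_ball (y dl : R) : 0 <= dl ->
  (normal_prob 0%R s [set x | (`|y + x| <= dl)%R] <= (2 * dl / s)%:E)%E.
Proof.
move=> dl0.
have -> : [set x | `|y + x| <= dl] = `[- y - dl, - y + dl]%classic.
  by apply/seteqP; split => x /=; rewrite in_itv/= ler_norml => /andP[? ?];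
     apply/andP; split; lra.
apply: (@le_trans _ _ (\int[lebesgue_measure]_(x in `[(- y - dl)%R, (- y + dl)%R]) (s^-1)%:E)%E).
  apply: ge0_le_integral => //=.
  - by move=> x _; rewrite lee_fin normal_pdf_ge0.
  - by apply/measurable_funTS/measurable_EFinP; exact: measurable_normal_pdf.
  - move=> x _; rewrite lee_fin; apply: le_trans (normal_pdf_ub _ _ _) _; first by rewrite gt_eqF.
    have q0 : 0 < s ^+ 2 * pi *+ 2 by rewrite mulrn_wgt0// mulr_gt0 ?pi_gt0// exprn_even_gt0//= gt_eqF.
    have q1 : 0 < Num.sqrt (s ^+ 2 * pi *+ 2) by rewrite sqrtr_gt0.
    rewrite /normal_peak lef_pV2 ?posrE//.
    rewrite -[leLHS](gtr0_norm s0) -sqrtr_sqr ler_wsqrtr// -mulr_natr.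
    have := pi_ge2 R; have := sqr_ge0 s; nra.
rewrite integral_cst//= lebesgue_measure_itv/= lte_fin.
case: ifP => h; last by rewrite mule0 lee_fin divr_ge0 ?mulr_ge0 ?(ltW s0).
by rewrite -EFinB -EFinM lee_fin mulrC ler_wpM2r ?invr_ge0 ?(ltW s0)//; lra.
Qed.

End gauss_law.

(** * Gaussian random walks *)

Definition b2r (R : realType) (b : bool) : R := b%:R.

Lemma b2r_ge0 (R : realType) b : 0 <= b2r R b. Proof. by case: b. Qed.
Lemma b2r_le1 (R : realType) b : b2r R b <= 1. Proof. by case: b => //=. Qed.

Section measurability.
Context d (T : measurableType d) (R : realType).
Implicit Types f g : T -> R.

Lemma measurable_nat_of_bool (b : T -> bool) : measurable_fun setT b ->
  measurable_fun setT (fun w => b2r R (b w)).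
Proof.
move=> mb.
have -> : (fun w => b2r R (b w)) = (fun w => if b w then 1 else 0).
  by apply/funext => w; case: (b w).
exact: measurable_fun_ifT.
Qed.

Lemma measurable_ler_ind f g : measurable_fun setT f -> measurable_fun setT g ->
  measurable_fun setT (fun w => b2r R (f w <= g w)).
Proof. by move=> mf mg; apply: measurable_nat_of_bool; exact: measurable_fun_ler. Qed.

End measurability.

Section Fm_closure.
Context d (T : measurableType d) (R : realType) (G : set (set T)).
Implicit Types f g : T -> R.
Local Notation Fm := (Fm G).

Lemma Fm_cst (c : R) : Fm (fun _ => c). Proof. exact: measurable_cst. Qed.
Lemma FmD f g : Fm f -> Fm g -> Fm (fun w => f w + g w).
Proof. exact: measurable_funD. Qed.
Lemma FmB f g : Fm f -> Fm g -> Fm (fun w => f w - g w).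
Proof. exact: measurable_funB. Qed.
Lemma FmM f g : Fm f -> Fm g -> Fm (fun w => f w * g w).
Proof. exact: measurable_funM. Qed.
Lemma FmX f n : Fm f -> Fm (fun w => f w ^+ n).
Proof. exact: measurable_funX. Qed.
Lemma Fm_comp (h : R -> R) f : measurable_fun setT h -> Fm f -> Fm (fun w => h (f w)).
Proof. by move=> mh mf; exact: (measurableT_comp mh mf). Qed.
Lemma Fm_norm f : Fm f -> Fm (fun w => `|f w|).
Proof. by apply: Fm_comp; exact: normr_measurable. Qed.
Lemma Fm_ler f g : Fm f -> Fm g -> Fm (fun w => b2r R (f w <= g w)).
Proof. exact: measurable_ler_ind. Qed.
Lemma Fm_sum (I : Type) (r : seq I) (f : I -> T -> R) :
  (forall i, Fm (f i)) -> Fm (fun w => \sum_(i <- r) f i w).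
Proof. exact: measurable_fun_bigsum. Qed.
(** The restriction to indices in range is what adapted sums need: in a partial sum up to time [k]
    the later terms are not known at time [k]. *)
Lemma Fm_sum_nat (m n : nat) (f : nat -> T -> R) :
  (forall i, (m <= i < n)%N -> Fm (f i)) -> Fm (fun w => \sum_(m <= i < n) f i w).
Proof.
move=> mf.
have -> : (fun w => \sum_(m <= i < n) f i w) =
   (fun w => \sum_(m <= i < n) (if (m <= i < n)%N then f i w else 0)).
  by apply/funext => w; rewrite big_nat big_mkcond.
by apply: Fm_sum => i; case E : (m <= i < n)%N; [exact: (mf i E)|exact: Fm_cst].
Qed.

End Fm_closure.

Section walk.
Context d (T : measurableType d) (R : realType) (P : probability T R).

(* [G k] is larger than the natural filtration in the application: it also contains all
   of an independent Brownian motion. *)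
Record walk (G : nat -> set (set T)) (V : nat -> T -> R) (v : R) : Prop := {
  walk_gt0 : 0 < v ;
  walk_sub : forall k, G k `<=` measurable ;
  walk_mono : forall k l, (k <= l)%N -> <<s G k >> `<=` <<s G l >> ;
  walk_adapted : forall k, Fm (G k) (V k) ;
  walk_indep : forall k l, (k < l)%N -> indep_of P (G k) (fun w => V l w - V k w) ;
  walk_gauss : forall k l, (k < l)%N ->
    gauss P ((l - k)%:R * v) (fun w => V l w - V k w) }.

Arguments walk_sub {G V v} _ k _ _.

Variables (G : nat -> set (set T)) (V : nat -> T -> R) (v : R).
Hypothesis wk : walk G V v.

Definition incr k (w : T) : R := V k.+1 w - V k w.

Lemma incrE k w : incr k w = V k.+1 w - V k w. Proof. by []. Qed.

Lemma walk_lift k l (f : T -> R) : (k <= l)%N -> Fm (G k) f -> Fm (G l) f.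
Proof. by move=> kl; apply: Fm_sub; exact: (walk_mono wk). Qed.

Lemma Fm_incr k l : (k < l)%N -> Fm (G l) (incr k).
Proof.
move=> kl; apply: FmB.
  by apply: (@walk_lift k.+1) => //; exact: (walk_adapted wk).
by apply: (@walk_lift k); [exact: ltnW|exact: (walk_adapted wk)].
Qed.

Lemma incr_gauss k : gauss P v (incr k).
Proof. by have := walk_gauss wk (ltnSn k); rewrite subSnn mul1r. Qed.

Lemma incr_indep k : indep_of P (G k) (incr k).
Proof. exact: (walk_indep wk). Qed.

Lemma Fm_measT k (f : T -> R) : Fm (G k) f -> measurable_fun setT f.
Proof. by apply: Fm_meas; exact: (walk_sub wk k). Qed.

Lemma walk_meas k : measurable_fun setT (V k).
Proof. by apply: (@Fm_measT k); exact: (walk_adapted wk). Qed.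

Let v0 := walk_gt0 wk.

Lemma mom_incr k : mom P (incr k).
Proof. exact: (mom_gauss v0 (incr_gauss k)). Qed.

Lemma walk_ExM k (f : T -> R) (g : R -> R) : Fm (G k) f -> measurable_fun setT g ->
  mom P f -> mom P (fun w => g (incr k w)) ->
  Ex P (fun w => f w * g (incr k w)) = Ex P f * Ex P (fun w => g (incr k w)).
Proof.
move=> mf mg momf momg.
have [mi li] := incr_gauss k.
rewrite (indep_ExM (walk_sub wk _) mi (@incr_indep k) li)//.
- under eq_Ex do rewrite mulrC.
  by rewrite ExZ 1?mulrC//; exact: mom_Intg.
- by apply: mom_Intg; exact: momM.
- exact: mom_Intg.
Qed.

(** The newest increment is independent of all that precedes it and [g] of it is centred, so the
    cross term of the square vanishes. It is used with [g x = x] (martingale sums) and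
    [g x = x ^+ 2 - v] (quadratic variation). *)
Lemma orthogonality (g : R -> R) (q : R) (b : nat -> T -> R) n :
  measurable_fun setT g -> (forall k, mom P (fun w => g (incr k w))) ->
  (forall k, Ex P (fun w => g (incr k w)) = 0) ->
  (forall k, Ex P (fun w => g (incr k w) ^+ 2) = q) ->
  (forall k, (k < n)%N -> Fm (G k) (b k)) -> (forall k, (k < n)%N -> mom P (b k)) ->
  Ex P (fun w => (\sum_(0 <= k < n) b k w * g (incr k w)) ^+ 2) =
  q * \sum_(0 <= k < n) Ex P (fun w => b k w ^+ 2).
Proof.
move=> mg momg eg0 eg2; elim: n => [|n IH] mb momb.
  under eq_Ex do rewrite big_geq// expr0n/=.
  by rewrite Ex_cst big_geq// mulr0.
have mbn := mb n (ltnSn n). have mmbn := momb n (ltnSn n).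
have {}IH := IH (fun k kn => mb k (ltnW kn)) (fun k kn => momb k (ltnW kn)).
pose S w := \sum_(0 <= k < n) b k w * g (incr k w).
have momS : mom P S.
  have -> : S = (fun w => \sum_(0 <= k < n) (if (k < n)%N then b k w else 0) * g (incr k w)).
    by apply/funext => w; apply: eq_big_nat => k /andP[_ ->].
  apply: mom_sum => k; apply: momM => //.
  by case kn : (k < n)%N; [exact: (momb k (ltnW kn))|exact: mom_cst].
have FS : Fm (G n) S.
  apply: Fm_sum_nat => k /andP[_ kn]; apply: FmM.
    by apply: (walk_lift (ltnW kn)); exact: (mb k (ltnW kn)).
  by apply: Fm_comp => //; exact: Fm_incr.
have -> : Ex P (fun w => (\sum_(0 <= k < n.+1) b k w * g (incr k w)) ^+ 2) =
    Ex P (fun w => (S w ^+ 2 + 2 * ((S w * b n w) * g (incr n w))) +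
        (b n w ^+ 2 * (g (incr n w) ^+ 2))).
  by apply: eq_Ex => w; rewrite big_nat_recr//= -/(S w); ring.
have i1 : mom P (fun w => S w * b n w * g (incr n w)) by momt.
have i2 : mom P (fun w => S w ^+ 2) by momt.
have i3 : mom P (fun w => b n w ^+ 2 * (g (incr n w) ^+ 2)) by momt.
rewrite ExD; [|by apply/mom_Intg; momt|exact: mom_Intg].
rewrite ExD; [|exact: mom_Intg|by apply/mom_Intg; momt].
rewrite ExZ; last exact: mom_Intg.
rewrite walk_ExM//; [|exact: FmM|by momt].
rewrite eg0 !mulr0 addr0 IH.
rewrite (@walk_ExM _ (fun w => b n w ^+ 2) (fun x => g x ^+ 2)); last first.
- by momt.
- by momt.
- exact: measurable_funX.
- exact: FmX.
by rewrite eg2 big_nat_recr//= mulrDr [X in _ + X]mulrC.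
Qed.

Lemma orthogonality1 (b : nat -> T -> R) n :
  (forall k, (k < n)%N -> Fm (G k) (b k)) -> (forall k, (k < n)%N -> mom P (b k)) ->
  Ex P (fun w => (\sum_(0 <= k < n) b k w * incr k w) ^+ 2) =
  v * \sum_(0 <= k < n) Ex P (fun w => b k w ^+ 2).
Proof.
apply: (@orthogonality (fun x => x)) => //.
- exact: mom_incr.
- by move=> k; exact: (Ex_gauss1 v0 (incr_gauss k)).
- by move=> k; exact: (Ex_gauss2 v0 (incr_gauss k)).
Qed.

Lemma orthogonality2 (b : nat -> T -> R) n :
  (forall k, (k < n)%N -> Fm (G k) (b k)) -> (forall k, (k < n)%N -> mom P (b k)) ->
  Ex P (fun w => (\sum_(0 <= k < n) b k w * (incr k w ^+ 2 - v)) ^+ 2) =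
  gq2 R * v ^+ 2 * \sum_(0 <= k < n) Ex P (fun w => b k w ^+ 2).
Proof.
have mi := mom_incr.
apply: (@orthogonality (fun x => x ^+ 2 - v)) => //.
- by apply: measurable_funB => //; exact: exprn_measurable.
- by move=> k /=; have := mi k => ?; momt.
- move=> k; have := mi k => ?; rewrite ExB; [|by apply/mom_Intg; momt|exact: Intg_cst].
  by rewrite (Ex_gauss2 v0 (incr_gauss k)) Ex_cst subrr.
- by move=> k; exact: (Ex_gauss_sqr_dev v0 (incr_gauss k)).
Qed.

(** Freeze all that is known at time [k]: what remains is a normal increment of variance
    [(l - k)%:R * v], to which [gauss_ball] applies whatever the centre. The weight [Y] makes room
    for indicators and for squares of earlier martingale sums. *)
Lemma walk_ball k l (Y U : T -> R) (dl : R) : (k < l)%N -> 0 <= dl ->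
  Fm (G k) U -> Fm (G k) Y -> mom P Y -> (forall w, 0 <= Y w) ->
  Ex P (fun w => Y w * b2r R (`|V l w - U w| <= dl)) <=
  Ex P Y * (2 * dl / Num.sqrt ((l - k)%:R * v)).
Proof.
move=> kl dl0 mU mY momY Y0.
have kv0 : 0 < (l - k)%:R * v by rewrite mulr_gt0// ltr0n subn_gt0.
have [mD lD] := walk_gauss wk kl.
pose nu := normal_prob 0 (Num.sqrt ((l - k)%:R * v)) : probability (measurableTypeR R) R.
pose H w (x : R) := Y w * b2r R (`|(V k w - U w) + x| <= dl).
have mVU : Fm (G k) (fun w => V k w - U w) by apply: FmB => //; exact: (walk_adapted wk).
have mA (y : R) : measurable [set x : R | (`|y + x| <= dl)].
  rewrite (_ : mkset _ = `[- y - dl, - y + dl]%classic)//.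
  by apply/seteqP; split => x /=; rewrite in_itv/= ler_norml => /andP[? ?];
     apply/andP; split; lra.
have ibd (g : R -> R) (M : R) : measurable_fun setT g -> (forall x, `|g x| <= M) ->
    nu.-integrable setT (EFin \o g).
  move=> mg gM; apply: measurable_bounded_integrable => //.
    by apply: (le_lt_trans (@probability_le1 _ _ _ nu _ _)) => //; exact: ltry.
  exists M; split; first exact: num_real.
  by move=> x Mx y _ /=; rewrite (le_trans _ (ltW Mx)).
have mV j : measurable_fun setT (V j) by apply: (@Fm_measT j); exact: (walk_adapted wk).
have [|w||i e] := freezing (walk_sub wk k) mD (walk_indep wk kl) lD (H := H).
- apply: measurable_funM.
    by apply: (measurableT_comp mY); exact: measurable_fst.
  apply: measurable_ler_ind => //.
  apply: measurableT_comp => //; apply: measurable_funD.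
    by apply: (measurableT_comp mVU); exact: measurable_fst.
  exact: measurable_snd.
- apply: (@ibd _ `|Y w|).
  + apply: measurable_funM => //; apply: measurable_ler_ind => //.
    by apply: measurableT_comp => //; exact: measurable_funD.
  + move=> x; rewrite normrM ler_piMr//.
    by rewrite ger0_norm ?b2r_ge0 ?b2r_le1.
- apply: (@Intg_le _ _ _ _ _ Y); last exact: mom_Intg.
    apply: measurable_funM; first exact: Fm_measT mY.
    apply: measurable_ler_ind => //; apply: measurableT_comp => //.
    by apply: measurable_funD; [exact: Fm_measT mVU|exact: mD].
  move=> w; rewrite normrM (ger0_norm (Y0 w)) ler_piMr//.
  by rewrite ger0_norm ?b2r_ge0 ?b2r_le1.
have -> : Ex P (fun w => Y w * b2r R (`|V l w - U w| <= dl)) =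
    Ex P (fun w => H w (V l w - V k w)).
  apply: eq_Ex => w; rewrite /H; do 4 f_equal; ring.
rewrite e [leRHS]mulrC -ExZ; last exact: mom_Intg.
apply: le_Ex => // [|w]; first by apply: IntgZ; exact: mom_Intg.
rewrite /H.
have -> : \int[nu]_x (Y w * b2r R (`|V k w - U w + x| <= dl)) =
    Y w * \int[nu]_x (\1_[set x : R | `|(V k w - U w) + x| <= dl] x).
  rewrite -RintegralZl//; last first.
    apply: (@ibd _ 1) => [|x]; first exact: measurable_indic.
    by rewrite indicE; case: (_ \in _); rewrite ?normr1 ?normr0.
  apply: eq_Rintegral => x _; congr (_ * _); rewrite indicE.
  congr (_%:R); congr nat_of_bool; apply/idP/idP; rewrite inE//.
rewrite mulrC ler_wpM2r// /Rintegral integral_indic//; last exact: mA.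
rewrite setIT.
have := gauss_ball kv0 (V k w - U w) dl0; rewrite /nu/=.
case: (normal_prob _ _ _) => [r| |] //=.
by rewrite divr_ge0 ?mulr_ge0 ?sqrtr_ge0.
Qed.

End walk.

Arguments walk_sub {d T R P G V v} _ k _ _.
Arguments incr_indep {d T R P G V v} wk k _ _.

Lemma sum_sqr_le (R : realType) (f : nat -> R) n :
  (\sum_(0 <= k < n) f k) ^+ 2 <= n%:R * \sum_(0 <= k < n) f k ^+ 2.
Proof.
elim: n => [|n IH]; first by rewrite !big_geq// expr0n mulr0.
rewrite !big_nat_recr//=.
have h a : 2 * (\sum_(0 <= k < n) f k) * a <=
    \sum_(0 <= k < n) f k ^+ 2 + n%:R * a ^+ 2.
  elim: {IH} n => [|m IH]; first by rewrite !big_geq// mulr0 !mul0r addr0.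
  rewrite !big_nat_recr//= -natr1.
  by have := sqr_ge0 (f m - a); nra.
have := h (f n); rewrite -natr1; move: IH; nra.
Qed.

Lemma sqrD_le (R : realType) (a b : R) : (a + b) ^+ 2 <= 2 * (a ^+ 2 + b ^+ 2).
Proof. by have := sqr_ge0 (a - b); nra. Qed.

(** * Exponential martingales and a discrete Ito formula *)

Section walk2.
Context d (T : measurableType d) (R : realType) (P : probability T R).
Variables (G : nat -> set (set T)) (V : nat -> T -> R) (v : R).
Hypothesis wk : walk P G V v.
Local Notation incr := (incr V).
Let v0 := walk_gt0 wk.

Lemma freeze_cos k (Y th a : T -> R) (M : R) :
  Fm (G k) Y -> Fm (G k) th -> Fm (G k) a -> (forall w, `|Y w| <= M) ->
  Ex P (fun w => Y w * cos (th w + a w * incr k w)) =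
  Ex P (fun w => Y w * (cos (th w) * expR (- (a w ^+ 2 * v / 2)))).
Proof.
move=> mY mth ma YM.
have gi := incr_gauss wk k.
have [mi li] := gi.
have mcos : measurable_fun setT (@cos R).
  by apply: continuous_measurable_fun; exact: continuous_cos.
have bcos (x : R) : `|cos x| <= 1 by rewrite ler_norml cos_le1 cos_geN1.
pose nu := normal_prob 0 (Num.sqrt v) : probability (measurableTypeR R) R.
have hc (c b : R) : nu.-integrable setT (EFin \o (fun x => cos (c + b * x))) /\
    \int[nu]_x cos (c + b * x) = cos c * expR (- (b ^+ 2 * v / 2)).
  have mc : measurable_fun setT (fun x : R => cos (c + b * x)).
    apply: continuous_measurable_fun => x.
    apply: continuous_comp; last exact: continuous_cos.
    by apply: cvgD; [exact: cvg_cst|apply: cvgM; [exact: cvg_cst|exact: cvg_id]].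
  have I1 : Intg P (fun w => cos (c + b * incr k w)).
    by apply: (@Intg_bd _ _ _ _ _ 1) => //; exact: (measurableT_comp mc mi).
  have [h1 h2] := law_integrable mi li mc I1; split => //.
  by rewrite -h2 (Ex_gauss_cos v0 gi).
pose H w (x : R) := Y w * cos (th w + a w * x).
have [|w||i e] := freezing (walk_sub wk k) mi (incr_indep wk k) li (H := H).
- have m1 (f : T -> R) : Fm (G k) f ->
     measurable_fun setT (fun z : g_sigma_algebraType (G k) * measurableTypeR R => f z.1).
    by move=> mf; apply: (measurableT_comp mf); exact: measurable_fst.
  apply: measurable_funM; first exact: m1.
  apply: measurableT_comp => //; apply: measurable_funD; first exact: m1.
  by apply: measurable_funM; [exact: m1|exact: measurable_snd].
- have [h _] := hc (th w) (a w).
  have := integrableZl measurableT (Y w) h.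
  by apply: eq_integrable => // x _ /=; rewrite EFinM.
- apply: (@Intg_bd _ _ _ _ _ M).
    apply: measurable_funM; first exact: (Fm_measT wk mY).
    apply: measurableT_comp => //; apply: measurable_funD; first exact: (Fm_measT wk mth).
    by apply: measurable_funM => //; exact: (Fm_measT wk ma).
  move=> w; rewrite normrM -[M]mulr1 ler_pM//.
rewrite e; apply: eq_Ex => w.
have [h1 h2] := hc (th w) (a w).
by rewrite RintegralZl// h2.
Qed.

(** Integrating out the last increment multiplies the cosine by exp(- b_n^2 v / 2), which is exactly
    the inverse of the newest exponential factor. The bound [K] on the bracket keeps the products
    bounded. *)
Lemma exp_martingale (b : nat -> T -> R) n (K ph : R) :
  (forall k, (k < n)%N -> Fm (G k) (b k)) ->
  (forall w, \sum_(0 <= k < n) b k w ^+ 2 * v <= K) ->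
  Ex P (fun w => expR ((\sum_(0 <= k < n) b k w ^+ 2 * v) / 2) *
                 cos (ph + \sum_(0 <= k < n) b k w * incr k w)) = cos ph.
Proof.
elim: n => [|n IH] mb bK.
  under eq_Ex do rewrite !big_geq// mul0r expR0 mul1r addr0.
  by rewrite Ex_cst.
have bK' w : \sum_(0 <= k < n) b k w ^+ 2 * v <= K.
  apply: le_trans (bK w); rewrite big_nat_recr//= lerDl.
  by rewrite mulr_ge0 ?sqr_ge0 ?ltW.
rewrite -[RHS](IH (fun k kn => mb k (ltnW kn)) bK').
pose A w := \sum_(0 <= k < n) b k w ^+ 2 * v.
pose S w := \sum_(0 <= k < n) b k w * incr k w.
have mbn := mb n (ltnSn n).
have mA : Fm (G n) A.
  apply: Fm_sum_nat => k /andP[_ kn]; apply: FmM; last exact: Fm_cst.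
  by apply: FmX; apply: (walk_lift wk (ltnW kn)); exact: (mb k (ltnW kn)).
have mS : Fm (G n) S.
  apply: Fm_sum_nat => k /andP[_ kn]; apply: FmM; last exact: (Fm_incr wk).
  by apply: (walk_lift wk (ltnW kn)); exact: (mb k (ltnW kn)).
pose Y w := expR ((A w + b n w ^+ 2 * v) / 2).
have mY : Fm (G n) Y.
  apply: (Fm_comp (h := expR)); first exact: measurable_expR.
  apply: FmM; last exact: Fm_cst.
  by apply: FmD => //; apply: FmM; [exact: FmX|exact: Fm_cst].
transitivity (Ex P (fun w => Y w * cos ((ph + S w) + b n w * incr n w))).
  by apply: eq_Ex => w; rewrite !big_nat_recr//= addrA.
rewrite (@freeze_cos n _ _ _ (expR (K / 2)))//.
- apply: eq_Ex => w; rewrite /Y [cos _ * _]mulrC mulrA -expRD -/(A w) -/(S w).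
  by congr (expR _ * _); field.
- by apply: FmD => //; exact: Fm_cst.
- move=> w; rewrite ger0_norm ?expR_ge0// ler_expR ler_wpM2r//.
  by have := bK w; rewrite big_nat_recr.
Qed.

(** Telescoping with a second order Taylor expansion leaves two errors. The cubic remainders are
    summed by Cauchy-Schwarz and give n^2 v^3; replacing squared increments by [v] gives an
    orthogonal sum and n v^2. For fixed n v both are of order v, so any constants [K] and [M] can be
    beaten by a fine grid. *)
Lemma ito_remainder (F0 F1 F2 : R -> R) (K M : R) (y : T -> R) n :
  measurable_fun setT F0 -> measurable_fun setT F1 -> measurable_fun setT F2 ->
  (forall x u, `|F0 (x + u) - F0 x - F1 x * u - F2 x * u ^+ 2 / 2| <= K * `|u| ^+ 3) ->
  (forall x, `|F2 x| <= M) -> Fm (G 0) y ->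
  let Rn := fun w => F0 (V n w - y w) - F0 (V 0%N w - y w)
    - \sum_(0 <= k < n) F1 (V k w - y w) * incr k w
    - \sum_(0 <= k < n) F2 (V k w - y w) * v / 2 in
  mom P Rn /\
  Ex P (fun w => Rn w ^+ 2) <=
    2 * K ^+ 2 * gq6 R * n%:R ^+ 2 * v ^+ 3 + M ^+ 2 * gq2 R * n%:R * v ^+ 2.
Proof.
move=> mF0 mF1 mF2 ty F2M my Rn.
pose Z k w := V k w - y w.
have mZ k : Fm (G k) (Z k).
  by apply: FmB; [exact: (walk_adapted wk)|exact: (walk_lift wk (leq0n k))].
pose rho k w := F0 (Z k.+1 w) - F0 (Z k w) - F1 (Z k w) * incr k w
   - F2 (Z k w) * incr k w ^+ 2 / 2.
pose b k w := F2 (Z k w) / 2.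
have ZS k w : Z k.+1 w = Z k w + incr k w by rewrite /Z incrE; ring.
have RnE w : Rn w = \sum_(0 <= k < n) rho k w +
    \sum_(0 <= k < n) b k w * (incr k w ^+ 2 - v).
  have t : F0 (V n w - y w) - F0 (V 0%N w - y w) =
      \sum_(0 <= k < n) (F0 (Z k.+1 w) - F0 (Z k w)).
    by rewrite (telescope_sumr (fun k => F0 (Z k w))).
  rewrite /Rn t -!sumrB -big_split/=.
  by apply: eq_bigr => k _; rewrite /rho /b -!/(Z _ w); field.
have M0 : 0 <= M := le_trans (normr_ge0 _) (F2M 0).
have mi k := mom_incr wk k.
have mFz (F : R -> R) k : measurable_fun setT F -> measurable_fun setT (fun w => F (Z k w)).
  by move=> mF; apply: (measurableT_comp mF); exact: (Fm_measT wk (mZ k)).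
have rhoK k w : `|rho k w| <= K * `|incr k w| ^+ 3 by rewrite /rho ZS; exact: ty.
have momrho k : mom P (rho k).
  apply: (@mom_le _ _ _ _ _ (fun w => K * `|incr k w| ^+ 3)) => //; last by have := mi k => ?; momt.
  have mik : measurable_fun setT (incr k) by exact: mom_meas (mi k).
  apply: measurable_funB; first apply: measurable_funB; first apply: measurable_funB;
    try exact: mFz.
    by apply: measurable_funM => //; exact: mFz.
  apply: measurable_funM => //; apply: measurable_funM; first exact: mFz.
  exact: measurable_funX.
have momb k : mom P (b k).
  apply: (@mom_bd _ _ _ _ _ (M / 2)); first by apply: measurable_funM => //; exact: mFz.
  by move=> w; rewrite normrM [`|2^-1|]ger0_norm ?invr_ge0// ler_wpM2r.
have Fb k : Fm (G k) (b k) by apply: FmM; [exact: Fm_comp|exact: Fm_cst].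
pose S1 w := \sum_(0 <= k < n) rho k w.
pose S2 w := \sum_(0 <= k < n) b k w * (incr k w ^+ 2 - v).
have momS1 : mom P S1 by apply: mom_sum.
have momS2 : mom P S2.
  by apply: mom_sum => k; have := mi k => ?; have := momb k => ?; momt.
have RnE' : Rn = fun w => S1 w + S2 w by apply/funext.
split; first by rewrite RnE'; exact: momD.
have e2 : Ex P (fun w => S2 w ^+ 2) <= gq2 R * v ^+ 2 * (n%:R * (M ^+ 2 / 4)).
  rewrite (orthogonality2 wk)//.
  have q0 : 0 <= gq2 R.
    apply: Rintegral_ge0 => x _; by rewrite mulr_ge0 ?sqr_ge0 ?npdf_ge0.
  rewrite ler_wpM2l ?mulr_ge0 ?sqr_ge0 ?(ltW v0)//.
  rewrite mulr_natl -[n in leRHS]subn0 -sumr_const_nat; apply: ler_sum => k _.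
  rewrite -[leRHS](Ex_cst P); apply: le_Ex.
  - by apply: mom_Intg; have := momb k => ?; momt.
  - exact: Intg_cst.
  - move=> w; rewrite /b; have := F2M (Z k w); rewrite ler_norml => /andP[h1 h2]; nra.
have e1 : Ex P (fun w => S1 w ^+ 2) <= K ^+ 2 * gq6 R * n%:R ^+ 2 * v ^+ 3.
  apply: (@le_trans _ _ (Ex P (fun w => n%:R * \sum_(0 <= k < n) K ^+ 2 * (incr k w ^+ 6)))).
    apply: le_Ex; [by apply/mom_Intg; momt| |].
      by apply: mom_Intg; momt.
    move=> w; apply: (le_trans (sum_sqr_le _ _)); rewrite ler_wpM2l//.
    apply: ler_sum => k _; rewrite -real_normK ?num_real//.
    have K0 : 0 <= K * `|incr k w| ^+ 3 := le_trans (normr_ge0 _) (rhoK k w).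
    apply: (@le_trans _ _ ((K * `|incr k w| ^+ 3) ^+ 2)).
      by rewrite lerXn2r ?nnegrE.
    have e6 : `|incr k w| ^+ 6 = incr k w ^+ 6.
      by rewrite -normrX ger0_norm// exprn_even_ge0.
    by rewrite exprMn -exprM e6.
  rewrite ExZ; last by apply: mom_Intg; momt.
  rewrite Ex_sum; last by move=> k; apply: mom_Intg; momt.
  have -> : \sum_(0 <= k < n) Ex P (fun w => K ^+ 2 * incr k w ^+ 6) =
     n%:R * (K ^+ 2 * (gq6 R * v ^+ 3)).
    rewrite mulr_natl -[n in RHS]subn0 -sumr_const_nat; apply: eq_bigr => k _.
    rewrite ExZ; last by apply: mom_Intg; momt.
    by rewrite (Ex_gauss6 v0 (incr_gauss wk k)).
  rewrite le_eqVlt; apply/orP; left; apply/eqP; ring.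
have : Ex P (fun w => Rn w ^+ 2) <= 2 * (Ex P (fun w => S1 w ^+ 2) + Ex P (fun w => S2 w ^+ 2)).
  rewrite -ExD; [|by apply/mom_Intg; momt..].
  rewrite -ExZ; last by apply: IntgD; apply/mom_Intg; momt.
  rewrite RnE'; apply: le_Ex; [by apply/mom_Intg; momt| |by move=> w; exact: sqrD_le].
  by apply: IntgZ; apply: IntgD; apply/mom_Intg; momt.
move=> h; apply: (le_trans h).
pose q := gq2 R * (n%:R * M ^+ 2 * v ^+ 2).
have q0 : 0 <= q.
  rewrite mulr_ge0 ?mulr_ge0 ?sqr_ge0 ?(ltW v0)//.
  by apply: Rintegral_ge0 => x _; rewrite mulr_ge0 ?sqr_ge0 ?npdf_ge0.
have e2' : Ex P (fun w => S2 w ^+ 2) <= q / 4.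
  by apply: (le_trans e2); rewrite le_eqVlt; apply/orP; left; apply/eqP; rewrite /q; field.
rewrite [leRHS](_ : _ = 2 * (K ^+ 2 * gq6 R * n%:R ^+ 2 * v ^+ 3) + q); last first.
  by rewrite /q; ring.
move: e1 e2' q0; set E1 := Ex P _; set E2 := Ex P _; set b1 := _ * v ^+ 3.
move=> e1 e2' q0; clear -e1 e2' q0; lra.
Qed.

End walk2.

(** * Smoothed tent functions *)

Section kernels.
Context (R : realType).
Implicit Types (F f : R -> R) (x y z h e : R).

Lemma mvt_between F f (a b : R) : (forall x : R, is_derive x (1:R) F (f x)) ->
  exists c, [/\ `|c - a| <= `|b - a|, `|c - b| <= `|b - a| & F b - F a = f c * (b - a)].
Proof.
move=> dF.
have cF (x y : R) : {within `[x, y], continuous F}.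
  apply: continuous_subspaceT => z; apply/differentiable_continuous/derivable1_diffP.
  by case: (dF z).
have [ab|ba] := leP a b.
- have [c] := MVT_segment ab (fun x _ => dF x) (cF a b).
  rewrite in_itv/= => /andP[ac cb] e; exists c; split => //.
    by rewrite !ger0_norm ?subr_ge0// lerB.
  by rewrite distrC !ger0_norm ?subr_ge0// lerB.
- have [c] := MVT_segment (ltW ba) (fun x _ => dF x) (cF b a).
  rewrite in_itv/= => /andP[bc ca] e; exists c; split.
  + by rewrite distrC [leRHS]distrC !ger0_norm ?subr_ge0 ?(ltW ba)// lerB.
  + by rewrite [leRHS]distrC !ger0_norm ?subr_ge0 ?(ltW ba)// lerB.
  + by rewrite -opprB e -mulrN opprB.
Qed.

(** The mean value theorem is applied to the remainder and then to its derivative, each time gaining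
    a factor [|u|]. The piecewise polynomial kernels have a Lipschitz second derivative but not a
    third one everywhere. *)
Lemma taylor2 (F0 F1 F2 : R -> R) (K : R) :
  (forall x : R, is_derive x (1:R) F0 (F1 x)) -> (forall x : R, is_derive x (1:R) F1 (F2 x)) ->
  (forall x y, `|F2 x - F2 y| <= K * `|x - y|) ->
  forall x u, `|F0 (x + u) - F0 x - F1 x * u - F2 x * u ^+ 2 / 2| <= K * `|u| ^+ 3.
Proof.
move=> d0 d1 l2 x u.
have K0 : 0 <= K by have := le_trans (normr_ge0 _) (l2 1 0); rewrite subr0 normr1 mulr1.
pose D t := F0 (x + t) - F1 x * t - F2 x * t ^+ 2 / 2.
pose D1 t := F1 (x + t) - F1 x - F2 x * t.
have shf F f (t : R) : (forall x : R, is_derive x (1:R) F (f x)) ->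
    is_derive t (1:R) (fun t => F (x + t)) (f (x + t)).
  move=> dF; have dx : is_derive t (1:R) (fun t : R => x + t) 1.
    by apply: is_derive_eq; rewrite add0r mulr1.
  have dFx := dF (x + t).
  by have := is_derive1_comp dFx dx; rewrite mulr1.
have dD (t : R) : is_derive t (1:R) D (D1 t).
  have h := shf _ _ t d0.
  by apply: is_derive_eq; rewrite /D1 /GRing.scale /=; field.
have dD1 (t : R) : is_derive t (1:R) D1 (F2 (x + t) - F2 x).
  have h := shf _ _ t d1.
  by apply: is_derive_eq; rewrite /GRing.scale /=; ring.
have b1 t : `|D1 t| <= K * `|t| ^+ 2.
  have [c [c1 c2 ]] := mvt_between 0 t dD1.
  rewrite !subr0 in c1 *; rewrite {2}/D1 addr0 mulr0 !subr0 subrr subr0 => ->.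
  rewrite normrM expr2 mulrA ler_wpM2r//.
  by apply: (le_trans (l2 _ _)); rewrite addrAC subrr add0r ler_wpM2l.
have [c [c1 c2]] := mvt_between 0 u dD.
rewrite !subr0 in c1 *; rewrite {2}/D addr0 mulr0 expr0n mulr0 mul0r !subr0 => e.
rewrite (_ : _ - _ = D u - F0 x); last by rewrite /D; ring.
rewrite e normrM exprSr mulrA ler_wpM2r//.
apply: (le_trans (b1 _)); rewrite ler_wpM2l// lerXn2r ?nnegrE//.
Qed.

Definition d2 h F z := F (z + h) - 2 * F z + F (z - h).

Lemma d2C h e F z : d2 h (d2 e F) z = d2 e (d2 h F) z.
Proof.
rewrite /d2.
have -> : z + h + e = z + e + h by ring.
have -> : z + h - e = z - e + h by ring.
have -> : z - h + e = z + e - h by ring.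
have -> : z - h - e = z - e - h by ring.
by ring.
Qed.

Lemma is_derive_comp_shift F f (a t : R) : (forall x : R, is_derive x (1:R) F (f x)) ->
    is_derive t (1:R) (fun t => F (t + a)) (f (t + a)).
Proof.
move=> dF; have dx : is_derive t (1:R) (fun t : R => t + a) 1.
  by apply: is_derive_eq; rewrite ?addr0 ?mulr1.
have dFx := dF (t + a).
by have := @is_derive1_comp _ F (fun t : R => t + a) t _ _ dFx dx; rewrite mulr1.
Qed.

Lemma is_derive_d2 h F f : (forall x : R, is_derive x (1:R) F (f x)) ->
  forall x : R, is_derive x (1:R) (d2 h F) (d2 h f x).
Proof.
move=> dF x.
have i1 := is_derive_comp_shift h x dF; have i2 := is_derive_comp_shift (- h) x dF.
have i0 := dF x.
by apply: is_derive_eq; rewrite /d2 /GRing.scale /=; ring.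
Qed.

(** A second difference is a difference of first differences: one mean value theorem for [D], a
    second one for [F1]. *)
Lemma d2_mvt h F F1 F2 z : 0 <= h ->
  (forall x : R, is_derive x (1:R) F (F1 x)) -> (forall x : R, is_derive x (1:R) F1 (F2 x)) ->
  exists2 c, `|c - z| <= h & d2 h F z = h ^+ 2 * F2 c.
Proof.
move=> h0 d0 d1.
pose D t := F (t + h) - F t; pose D1 t := F1 (t + h) - F1 t.
have dD (t : R) : is_derive t (1:R) D (D1 t).
  have i1 := is_derive_comp_shift h t d0; have i0 := d0 t.
  by apply: is_derive_eq.
have [c [c1 c2 e]] := mvt_between (z - h) z dD.
have [c' [c1' c2' e']] := mvt_between c (c + h) d1.
exists c'; last first.
  rewrite (_ : d2 h F z = D z - D (z - h)); last by rewrite /D /d2 subrK; ring.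
  by rewrite e /D1 e'; ring.
move: c1 c2 c1' c2'.
rewrite (_ : z - (z - h) = h); last by ring.
rewrite (_ : c + h - c = h); last by ring.
rewrite (ger0_norm h0) !ler_norml => /andP[a1 a2] /andP[a3 a4] /andP[a5 a6] /andP[a7 a8].
by apply/andP; split; lra.
Qed.

(** Truncated powers. Differentiation lowers [m] by one and commutes with second differences, so
    this one family yields the smoothed tent together with its primitive and its derivatives. *)
Definition pp (m : nat) z : R := Num.max z 0 ^+ m / m`!%:R.

Lemma max0_lip x y : `|Num.max x 0 - Num.max y 0| <= `|x - y|.
Proof.
by rewrite !maxEle; case: (lerP x 0) => hx; case: (lerP y 0) => hy; rewrite ?subrr ?normr0 ?subr0 ?sub0r ?normrN//;
  rewrite ler_norml; apply/andP; have := ler_norm (x - y); have := lerNnormlW (lexx `|x - y|);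
  split; lra.
Qed.

Lemma pp1E z : pp 1 z = Num.max z 0.
Proof. by rewrite /pp expr1 (_ : 1`! = 1%N)// divr1. Qed.

Lemma pp_le0 m z : z <= 0 -> pp m.+1 z = 0.
Proof. by move=> z0; rewrite /pp (max_idPr z0) expr0n mul0r. Qed.

Lemma pp_ge0 m z : 0 <= z -> pp m z = z ^+ m / m`!%:R.
Proof. by move=> z0; rewrite /pp (max_idPl z0). Qed.

Lemma is_derive_pp m x : is_derive x (1:R) (pp m.+2) (pp m.+1 x).
Proof.
have fm : (m.+2)`!%:R = m.+2%:R * (m.+1)`!%:R :> R by rewrite factS natrM.
have f0 : (m.+1)`!%:R != 0 :> R by rewrite pnatr_eq0 -lt0n fact_gt0.
have [x0|x0|->] := ltgtP x 0.
- rewrite pp_le0 ?ltW//.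
  have dc : is_derive x (1:R) (cst 0 : R -> R) 0 by exact: is_derive_cst.
  apply: (near_eq_is_derive _ dc); near=> y.
  rewrite pp_le0//; apply: ltW; near: y; exact: lt_nbhsl.
- rewrite [X in is_derive _ _ _ X]pp_ge0 ?ltW//.
  have dp : is_derive x (1:R) (fun y : R => y ^+ m.+2 / (m.+2)`!%:R)
      (x ^+ m.+1 / (m.+1)`!%:R).
    have := is_deriveZ ((m.+2)`!%:R^-1) (is_deriveX m.+2 (is_derive_id x (1:R))).
    rewrite /GRing.scale /= mulr1 => h.
    have <- : (m.+2)`!%:R^-1 * (m.+2%:R * x ^+ m.+1) = x ^+ m.+1 / (m.+1)`!%:R :> R.
      by rewrite fm; field; rewrite f0 -natrD pnatr_eq0.
    rewrite (_ : (fun y : R => _) = (m.+2)`!%:R^-1 \*: id ^+ m.+2)//.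
    by apply/funext => y; rewrite mulrC fctE.
  apply: (near_eq_is_derive _ dp); near=> y.
  rewrite pp_ge0//; apply: ltW; near: y; exact: lt_nbhsr.
(* At the origin the difference quotient is at most [|h| ^+ m.+1] in absolute value, which tends to
   0. *)
- rewrite pp_le0//.
  have H : h^-1 *: (pp m.+2 (h *: 1 + 0) - pp m.+2 0) @[h --> (0:R)^'] --> (0:R).
    apply: norm_cvg0.
    have C : `|h : R| ^+ m.+1 @[h --> (0:R)^'] --> (0:R).
      have cc : continuous (fun h : R => `|h| ^+ m.+1).
        move=> z; apply: (@continuous_comp _ _ _ (fun h : R => `|h|) (fun h : R => h ^+ m.+1));
          [exact: norm_continuous|exact: exprn_continuous].
      by have := cvg_within_filter _ (cc 0); rewrite normr0 expr0n; exact.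
    apply: (squeeze_cvgr _ (cvg_cst 0) C).
    near=> h; rewrite normr_ge0/=.
    have h0 : h != 0 by near: h; exact: nbhs_dnbhs_neq.
    rewrite (@pp_le0 _ 0)// subr0 addr0 /GRing.scale/= mulr1.
    rewrite normrM normfV ler_pdivrMl ?normr_gt0// -exprS.
    rewrite /pp normrM normrX.
    have a1 : `|Num.max h 0| <= `|h|.
      by have := max0_lip h 0; rewrite maxxx subr0 subr0.
    rewrite -[leRHS]mulr1 ler_pM//.
      by rewrite lerXn2r ?nnegrE.
    rewrite ger0_norm ?invr_ge0// invf_le1 ?ltr0n ?fact_gt0// ler1n fact_gt0//.
  by split; [apply/cvg_ex; exists 0; exact: H|apply: cvg_lim => //; exact: H].
Unshelve. all: by end_near. Qed.

Definition tent h := d2 h (pp 1).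

Lemma tentE h z : 0 <= h -> tent h z = Num.max (h - `|z|) 0.
Proof.
move=> h0; rewrite /tent /d2 !pp1E !maxEle.
by have [z0|z0] := ger0P z; case: (lerP (z + h) 0) => ?; case: (lerP z 0) => ?;
  case: (lerP (z - h) 0) => ?; case: (lerP (h - _) 0) => ?; lra.
Qed.

Lemma tent_ge0 h z : 0 <= h -> 0 <= tent h z.
Proof. by move=> h0; rewrite tentE// le_max lexx orbT. Qed.

Lemma tent_le h z : 0 <= h -> tent h z <= h.
Proof. by move=> h0; rewrite tentE// ge_max h0 gerBl normr_ge0. Qed.

Lemma tent_lip h x y : 0 <= h -> `|tent h x - tent h y| <= `|x - y|.
Proof.
move=> h0; rewrite !tentE//; apply: (le_trans (max0_lip _ _)).
rewrite opprB addrC addrA subrK -normrN opprB distrC.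
rewrite [leRHS]distrC; exact: ler_dist_dist.
Qed.

Lemma tent0 h z : 0 <= h -> h <= `|z| -> tent h z = 0.
Proof. by move=> h0 hz; rewrite tentE//; apply/max_idPr; rewrite subr_le0. Qed.

(* [kern h e 3] is the tent function of width h smoothed at scale e (a C^2 cubic spline);
   [kern h e 2], [kern h e 1] are its first two derivatives and [kern h e 4] its primitive. *)
Definition kern h e m z := e ^- 2 * d2 e (d2 h (pp m)) z.

Variables (h e : R).
Hypotheses (h0 : 0 < h) (e0 : 0 < e).

Let e2 : 0 < e ^- 2. Proof. by rewrite invr_gt0 exprn_gt0. Qed.

Lemma is_derive_kern m x : is_derive x (1:R) (kern h e m.+2) (kern h e m.+1 x).
Proof.
have i := is_derive_d2 e (is_derive_d2 h (is_derive_pp m)) x.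
by apply: is_derive_eq; rewrite /kern /GRing.scale/=; ring.
Qed.

Lemma kern_continuous m : continuous (kern h e m.+2).
Proof.
move=> x; apply/differentiable_continuous/derivable1_diffP.
by case: (is_derive_kern m x).
Qed.

(** The second derivative of [d2 h (pp 3)] is the tent, and [e ^- 2 * d2 e] is a mean value of a
    second derivative. Sign, height, support and accuracy of the smoothed tent all follow from
    this. *)
Lemma kern3_tent z : exists2 c, `|c - z| <= e & kern h e 3 z = tent h c.
Proof.
have [c cz E] := @d2_mvt e _ _ _ z (ltW e0) (is_derive_d2 h (is_derive_pp 1))
   (is_derive_d2 h (is_derive_pp 0)).
exists c => //; rewrite /kern E mulrA mulVf ?mul1r// expf_neq0// gt_eqF//.
Qed.

Lemma kern3_ge0 z : 0 <= kern h e 3 z.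
Proof. by have [c _ ->] := kern3_tent z; rewrite tent_ge0 ?ltW. Qed.

Lemma kern3_le z : kern h e 3 z <= h.
Proof. by have [c _ ->] := kern3_tent z; rewrite tent_le ?ltW. Qed.

Lemma kern3_supp z : h + e <= `|z| -> kern h e 3 z = 0.
Proof.
have [c cz ->] := kern3_tent z => hz; apply: tent0; first exact: ltW.
have := ler_normD c (z - c); rewrite [c + _]addrC subrK [`|z - c|]distrC.
move: cz hz; set a := `|c - z|; set b := `|z|; set k := `|c|; lra.
Qed.

Lemma kern3_near z : `|kern h e 3 z - tent h z| <= e.
Proof.
have [c cz ->] := kern3_tent z; apply: le_trans cz.
by apply: tent_lip; exact: ltW.
Qed.

(** It is [h] times the difference of two values of the positive part, taken at points less than or
    equal to [2 * h] apart. *)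
Lemma d2pp2 c : 0 <= d2 h (pp 2) c <= 2 * h ^+ 2.
Proof.
have [a [a1 a2 ea]] := mvt_between c (c + h) (is_derive_pp 0).
have [b [b1 b2 eb]] := mvt_between (c - h) c (is_derive_pp 0).
have -> : d2 h (pp 2) c = h * (pp 1 a - pp 1 b).
  rewrite (_ : d2 h (pp 2) c = (pp 2 (c + h) - pp 2 c) - (pp 2 c - pp 2 (c - h))).
    rewrite ea eb (_ : c + h - c = h); last by ring.
    by rewrite (_ : c - (c - h) = h); [ring|ring].
  by rewrite /d2; ring.
move: a1 a2 b1 b2; rewrite (_ : c + h - c = h); last by ring.
rewrite (_ : c - (c - h) = h); last by ring.
rewrite (gtr0_norm h0) !ler_norml => /andP[? ?] /andP[? ?] /andP[? ?] /andP[? ?].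
have ba : b <= a by lra.
have := max0_lip a b; rewrite !pp1E.
have mono : Num.max b 0 <= Num.max a 0 by rewrite ge_max !le_max ba lexx orbT.
rewrite !ger0_norm ?subr_ge0// => lip.
apply/andP; split; first by rewrite mulr_ge0 ?subr_ge0// ltW.
have : Num.max a 0 - Num.max b 0 <= 2 * h by lra.
have := h0; nra.
Qed.

Lemma kern4_bd z : `|kern h e 4 z| <= 2 * h ^+ 2.
Proof.
have [c cz E] := @d2_mvt e _ _ _ z (ltW e0) (is_derive_d2 h (is_derive_pp 2))
   (is_derive_d2 h (is_derive_pp 1)).
rewrite /kern E mulrA mulVf ?mul1r ?expf_neq0 ?gt_eqF//.
by have /andP[h1 h2] := d2pp2 c; rewrite ger0_norm.
Qed.

(** This bound and the next ones blow up as [e] tends to 0. That is harmless, because they only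
    enter terms that vanish with the mesh, which is chosen after [e]. *)
Lemma kern1_bd z : `|kern h e 1 z| <= 4 * h * e ^- 2.
Proof.
rewrite /kern normrM (gtr0_norm e2) mulrC ler_wpM2r ?(ltW e2)// -/(tent h) /d2.
have b t : `|tent h t| <= h by rewrite ger0_norm ?tent_ge0 ?tent_le ?ltW.
have := b (z + e); have := b z; have := b (z - e).
rewrite !ler_norml => /andP[? ?] /andP[? ?] /andP[? ?]; apply/andP; split; lra.
Qed.

Lemma kern1_lip x y : `|kern h e 1 x - kern h e 1 y| <= 4 * e ^- 2 * `|x - y|.
Proof.
rewrite /kern -mulrBr normrM (gtr0_norm e2) -mulrA mulrCA ler_wpM2l ?(ltW e2)// -/(tent h) /d2.
have l1 := tent_lip (x + e) (y + e) (ltW h0).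
have l2 := tent_lip x y (ltW h0).
have l3 := tent_lip (x - e) (y - e) (ltW h0).
rewrite (_ : x + e - (y + e) = x - y) in l1; last by ring.
rewrite (_ : x - e - (y - e) = x - y) in l3; last by ring.
move: l1 l2 l3; set q := `|x - y|; rewrite !ler_norml.
move=> /andP[? ?] /andP[? ?] /andP[? ?]; apply/andP; split; lra.
Qed.

Lemma kern2_bd z : `|kern h e 2 z| <= 8 * h ^+ 2 * e ^- 2.
Proof.
rewrite /kern normrM (gtr0_norm e2) mulrC ler_wpM2r ?(ltW e2)// {1}/d2.
have /andP[? ?] := d2pp2 (z + e); have /andP[? ?] := d2pp2 z; have /andP[? ?] := d2pp2 (z - e).
by rewrite ler_norml; apply/andP; split; nra.
Qed.

Lemma kern_lip_step m K : (forall z, `|kern h e m.+1 z| <= K) ->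
  forall x y, `|kern h e m.+2 x - kern h e m.+2 y| <= K * `|x - y|.
Proof.
move=> bK x y; have [c [_ _ ->]] := mvt_between y x (is_derive_kern m).
by rewrite normrM ler_wpM2r.
Qed.

End kernels.

(** * Double sums over two independent walks *)

Lemma inv_sqrt_sum (R : realType) N :
  \sum_(0 <= i < N) (Num.sqrt i.+1%:R)^-1 <= 2 * Num.sqrt N%:R :> R.
Proof.
elim: N => [|N IH]; first by rewrite big_geq// sqrtr0 mulr0.
rewrite big_nat_recr//=; apply: (le_trans (lerD IH (lexx _))).
set a := Num.sqrt N%:R; set b := Num.sqrt N.+1%:R.
have a0 : 0 <= a := sqrtr_ge0 _.
have b0 : 0 < b by rewrite sqrtr_gt0 ltr0n.
have a2 : a ^+ 2 = N%:R by rewrite sqr_sqrtr.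
have b2 : b ^+ 2 = N%:R + 1 by rewrite sqr_sqrtr// natr1.
(* Since b^2 - a^2 = 1, the increment 1/b is at most 2 (b - a), which amounts to (b - a)^2 >= 0. *)
rewrite -(ler_pM2r b0) mulrDl mulVf ?gt_eqF//.
by have := sqr_ge0 (b - a); nra.
Qed.

Lemma sum_nat_split (R : realType) (f : nat -> R) m p :
  \sum_(0 <= l < m + p) f l = \sum_(0 <= l < m) f l + \sum_(0 <= i < p) f (m + i)%N.
Proof.
rewrite (@big_cat_nat _ _ _ m)//= ?leq_addr//; congr (_ + _).
by rewrite -{1}[m]add0n big_addn addKn; apply: eq_bigr => i _; rewrite addnC.
Qed.

Lemma big_sum_le (R : realType) (f : nat -> R) n (c : R) :
  (forall k, (k < n)%N -> f k <= c) -> \sum_(0 <= k < n) f k <= n%:R * c.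
Proof.
move=> fc; rewrite mulr_natl -[n in leRHS]subn0 -sumr_const_nat.
by apply: ler_sum_nat => k /andP[_ kn]; exact: fc.
Qed.

Section walk_counts.
Context d (T : measurableType d) (R : realType) (P : probability T R).

Lemma walk_shift (G : nat -> set (set T)) (V : nat -> T -> R) (v : R) m :
  walk P G V v -> walk P (fun k => G (m + k)%N) (fun k => V (m + k)%N) v.
Proof.
move=> [v0 sG mG aG iG gG]; split => //.
- by move=> k l kl; apply: mG; rewrite leq_add2l.
- by move=> k l kl; apply: iG; rewrite ltn_add2l.
- by move=> k l kl; have := gG (m + k)%N (m + l)%N; rewrite ltn_add2l subnDl; exact.
Qed.

Lemma mom_b2r (b : T -> bool) : measurable_fun setT (fun w => b2r R (b w)) ->
  mom P (fun w => b2r R (b w)).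
Proof.
move=> mb; apply: (@mom_bd _ _ _ _ _ 1) => // w.
by rewrite ger0_norm ?b2r_ge0 ?b2r_le1.
Qed.

Lemma b2rM (a b : bool) : b2r R a * b2r R b = b2r R (a && b).
Proof. by case: a; case: b; rewrite /b2r ?mulr1 ?mulr0. Qed.

Section one_walk.
Variables (G : nat -> set (set T)) (V : nat -> T -> R) (v : R).
Hypothesis wk : walk P G V v.
Let v0 := walk_gt0 wk.

(** This bounds the expected time spent near [U]. The step [l = 0] is counted in full and gives [v];
    the steps [l > 0] have probability at most 2 rho / sqrt(l v), and the sum of 1/sqrt l is at most
    2 sqrt N. *)
Lemma walk_count (Y U : T -> R) (rho : R) N : 0 <= rho ->
  Fm (G 0%N) U -> Fm (G 0%N) Y -> mom P Y -> (forall w, 0 <= Y w) ->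
  \sum_(0 <= l < N) v * Ex P (fun w => Y w * b2r R (`|V l w - U w| <= rho)) <=
  Ex P Y * (v + 4 * rho * Num.sqrt (N%:R * v)).
Proof.
move=> rho0 mU mY momY Y0.
have EY0 : 0 <= Ex P Y by apply: Ex_ge0.
case: N => [|N].
  by rewrite big_geq// mulr_ge0// addr_ge0 ?mulr_ge0 ?sqrtr_ge0 ?(ltW v0).
rewrite big_nat_recl//= mulrDr lerD//.
  rewrite mulrC ler_wpM2r ?(ltW v0)//; apply: le_Ex.
  - apply: (@Intg_le _ _ _ _ _ Y); last exact: mom_Intg.
      apply: measurable_funM; first exact: mom_meas momY.
      apply: measurable_ler_ind => //; apply: measurableT_comp => //.
      apply: measurable_funB; first exact: (walk_meas wk).
      exact: (Fm_measT wk mU).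
    move=> w; rewrite normrM (ger0_norm (Y0 w)) ler_piMr//.
    by rewrite ger0_norm ?b2r_ge0 ?b2r_le1.
  - exact: mom_Intg.
  - by move=> w; rewrite ler_piMr ?b2r_le1.
have sv : 0 < Num.sqrt v by rewrite sqrtr_gt0.
apply: (@le_trans _ _ (\sum_(0 <= l < N) Ex P Y * (2 * rho * Num.sqrt v) * (Num.sqrt l.+1%:R)^-1)).
  apply: ler_sum => l _.
  have := walk_ball wk (ltn0Sn l) rho0 mU mY momY Y0.
  rewrite subn0 sqrtrM// => h.
  apply: (@le_trans _ _ (v * (Ex P Y * (2 * rho / (Num.sqrt l.+1%:R * Num.sqrt v))))).
    by rewrite ler_wpM2l ?(ltW v0).
  rewrite le_eqVlt; apply/orP; left; apply/eqP.
  have l0 : Num.sqrt l.+1%:R != 0 :> R by rewrite gt_eqF// sqrtr_gt0.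
  have vs : v = Num.sqrt v ^+ 2 by rewrite sqr_sqrtr ?(ltW v0).
  rewrite {1}vs; field; by rewrite l0 gt_eqF.
rewrite -mulr_sumr -mulrA ler_wpM2l//.
apply: (@le_trans _ _ (2 * rho * Num.sqrt v * (2 * Num.sqrt N%:R))).
  by rewrite ler_wpM2l ?inv_sqrt_sum// mulr_ge0 ?mulr_ge0 ?(ltW sv).
rewrite sqrtrM// (_ : 2 * rho * Num.sqrt v * (2 * Num.sqrt N%:R) =
  4 * rho * (Num.sqrt N%:R * Num.sqrt v)); last by ring.
rewrite ler_wpM2l ?mulr_ge0// ler_wpM2r ?(ltW sv)// ler_wsqrtr// ler_nat.
by [].
Qed.

Variables (U Y : T -> R) (C : nat -> T -> R) (rho ka : R).
Hypotheses (rho0 : 0 < rho) (ka0 : 0 <= ka).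
Hypotheses (mC : forall l, Fm (G l) (C l)) (momC : forall l, mom P (C l)).
Hypothesis CU : forall l w, C l w ^+ 2 <= ka * b2r R (`|V l w - U w| <= rho).
Hypotheses (mU : Fm (G 0%N) U) (mY : Fm (G 0%N) Y) (momY : mom P Y).
Hypotheses (Y0 : forall w, 0 <= Y w) (YY : forall w, Y w ^+ 2 = Y w).

Let chi l w := b2r R (`|V l w - U w| <= rho).

Let mV l : measurable_fun setT (V l).
Proof. exact: (walk_meas wk l). Qed.

Let mUT : measurable_fun setT U. Proof. exact: (Fm_measT wk mU). Qed.

Let momchi l : mom P (chi l).
Proof.
apply: mom_b2r; apply: measurable_ler_ind => //; apply: measurableT_comp => //.
exact: measurable_funB.
Qed.

(** [Y] is an indicator known at time 0, so it moves into the coefficients; orthogonality then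
    reduces the square to the expected time spent near [U]. *)
Lemma mart_sqr N :
  Ex P (fun w => Y w * (\sum_(0 <= l < N) C l w * incr V l w) ^+ 2) <=
  ka * (Ex P Y * (v + 4 * rho * Num.sqrt (N%:R * v))).
Proof.
have mi := mom_incr wk.
have -> : Ex P (fun w => Y w * (\sum_(0 <= l < N) C l w * incr V l w) ^+ 2) =
   Ex P (fun w => (\sum_(0 <= l < N) (Y w * C l w) * incr V l w) ^+ 2).
  apply: eq_Ex => w; rewrite -[X in X * _]YY -exprMn mulr_sumr; congr (_ ^+ 2).
  by apply: eq_bigr => l _; rewrite mulrA.
rewrite (orthogonality1 wk); [|by move=> k _; apply: FmM => //; exact: (walk_lift wk (leq0n k))|
  by move=> k _; momt].
apply: (@le_trans _ _ (ka * \sum_(0 <= l < N) v * Ex P (fun w => Y w * chi l w))); last first.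
  by rewrite ler_wpM2l//; apply: walk_count => //; exact: ltW.
rewrite !mulr_sumr; apply: ler_sum => l _.
rewrite mulrCA ler_wpM2l ?(ltW v0)// -ExZ; last by apply: mom_Intg; momt.
apply: le_Ex; [by apply: mom_Intg; momt|by apply: IntgZ; apply: mom_Intg; momt|].
move=> w; rewrite exprMn YY [leRHS]mulrCA ler_wpM2l//; exact: CU.
Qed.

Let N_ k w := \sum_(0 <= l < k) C l w * incr V l w.

Let FmN k : Fm (G k) (N_ k).
Proof.
apply: Fm_sum_nat => l /andP[_ lk]; apply: FmM; last exact: (Fm_incr wk).
exact: (walk_lift wk (ltnW lk)).
Qed.

Let momN k : mom P (N_ k).
Proof. by have mi := mom_incr wk; rewrite /N_; momt. Qed.

End one_walk.

(* Conditioning the squared martingale at time [k - p]: the part before is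
   independent of where the walk is at time [k], the part after is short. *)
Lemma mart_sqr_local (G : nat -> set (set T)) (V : nat -> T -> R) (v : R)
    (U Y : T -> R) (C : nat -> T -> R) (rho ka : R) n p k :
  walk P G V v -> 0 < rho -> 0 <= ka ->
  (forall l, Fm (G l) (C l)) -> (forall l, mom P (C l)) ->
  (forall l w, C l w ^+ 2 <= ka * b2r R (`|V l w - U w| <= rho)) ->
  Fm (G 0%N) U -> Fm (G 0%N) Y -> mom P Y ->
  (forall w, 0 <= Y w) -> (forall w, Y w ^+ 2 = Y w) -> (0 < p)%N -> (k <= n)%N ->
  Ex P (fun w => Y w * ((\sum_(0 <= l < k) C l w * incr V l w) ^+ 2 *
       b2r R (`|V k w - U w| <= rho))) <=
  2 * ka * Ex P Y * ((v + 4 * rho * Num.sqrt (n%:R * v)) * (2 * rho / Num.sqrt (p%:R * v))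
    + (v + 4 * rho * Num.sqrt (p%:R * v))).
Proof.
move=> wk rho0 ka0 mC momC CU mU mY momY Y0 YY p0 kn.
have v0 := walk_gt0 wk.
have mi := mom_incr wk.
have EY0 : 0 <= Ex P Y by apply: Ex_ge0.
have mVT l : measurable_fun setT (V l) by exact: (walk_meas wk l).
have mUT : measurable_fun setT U by exact: (Fm_measT wk mU).
have momchi l : mom P (fun w => b2r R (`|V l w - U w| <= rho)).
  apply: mom_b2r; apply: measurable_ler_ind => //; apply: measurableT_comp => //.
  exact: measurable_funB.
have pv : 0 < p%:R * v by rewrite mulr_gt0 ?ltr0n.
have sp : 0 < Num.sqrt (p%:R * v) by rewrite sqrtr_gt0.
have hrho : 0 <= 4 * rho by rewrite mulr_ge0// ltW.
have A1 : 0 <= (v + 4 * rho * Num.sqrt (n%:R * v)) * (2 * rho / Num.sqrt (p%:R * v)).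
  by rewrite mulr_ge0 ?addr_ge0 ?mulr_ge0 ?invr_ge0 ?sqrtr_ge0 ?(ltW v0) ?(ltW rho0).
have A2 : 0 <= v + 4 * rho * Num.sqrt (p%:R * v).
  by rewrite addr_ge0 ?mulr_ge0 ?sqrtr_ge0 ?(ltW v0) ?(ltW rho0).
(* With at most [p] steps behind there is no early part: the indicator at time [k] is dropped and
   the short sum is small by itself. *)
have [kp|pk] := leqP k p.
  apply: (@le_trans _ _ (Ex P (fun w => Y w * (\sum_(0 <= l < k) C l w * incr V l w) ^+ 2))).
    apply: le_Ex; [by apply: mom_Intg; momt|by apply: mom_Intg; momt|].
    by move=> w; rewrite ler_wpM2l// ler_piMr ?sqr_ge0 ?b2r_le1.
  apply: (le_trans (mart_sqr wk rho0 ka0 mC momC CU mU mY momY Y0 YY k)).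
  have sk : Num.sqrt (k%:R * v) <= Num.sqrt (p%:R * v).
    by rewrite ler_wsqrtr// ler_wpM2r ?(ltW v0)// ler_nat.
  have : v + 4 * rho * Num.sqrt (k%:R * v) <= v + 4 * rho * Num.sqrt (p%:R * v).
    by rewrite lerD2l ler_wpM2l.
  have kaY : 0 <= ka * Ex P Y by rewrite mulr_ge0.
  set a := v + _; set b := v + 4 * rho * Num.sqrt (p%:R * v) in A2 *.
  set c := (_ * (2 * rho / _)) in A1 *; move=> ab.
  rewrite mulrA (_ : 2 * ka * Ex P Y * (c + b) = (ka * Ex P Y) * (2 * (c + b))); last by ring.
  by rewrite ler_wpM2l//; lra.
have [m km] : exists m, k = (m + p)%N by exists (k - p)%N; rewrite subnK// ltnW.
pose Nm w := \sum_(0 <= l < m) C l w * incr V l w.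
pose Np w := \sum_(0 <= i < p) C (m + i)%N w * incr V (m + i)%N w.
have wks := walk_shift m wk.
have momNm : mom P Nm by rewrite /Nm; momt.
have momNp : mom P Np by rewrite /Np; apply: mom_sum => i; apply: momM.
have FNm : Fm (G m) Nm.
  apply: Fm_sum_nat => l /andP[_ lk]; apply: FmM; last exact: (Fm_incr wk).
  exact: (walk_lift wk (ltnW lk)).
have incrE i w : incr (fun k => V (m + k)%N) i w = incr V (m + i)%N w.
  by rewrite !incrE addnS.
(* The last [p] steps: the indicator is dropped, and the walk restarted at time [m] has only [p]
   terms. *)
have E2 : Ex P (fun w => Y w * Np w ^+ 2) <=
    ka * (Ex P Y * (v + 4 * rho * Num.sqrt (p%:R * v))).
  have lU : Fm (G (m + 0)%N) U by apply: (walk_lift wk (leq0n _)).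
  have lY : Fm (G (m + 0)%N) Y by apply: (walk_lift wk (leq0n _)).
  have := @mart_sqr _ _ _ wks U Y (fun l => C (m + l)%N) rho ka rho0 ka0
    (fun l => mC _) (fun l => momC _) (fun l => CU _) lU lY momY Y0 YY p.
  apply: le_trans; rewrite le_eqVlt; apply/orP; left; apply/eqP.
  apply: eq_Ex => w; congr (_ * _ ^+ 2); apply: eq_bigr => i _; by rewrite incrE.
(* The early part is known [p] steps before [k], so being near [U] at time [k] costs a further
   factor 2 rho / sqrt(p v). *)
have E1 : Ex P (fun w => (Y w * Nm w ^+ 2) * b2r R (`|V k w - U w| <= rho)) <=
    ka * (Ex P Y * (v + 4 * rho * Num.sqrt (n%:R * v))) * (2 * rho / Num.sqrt (p%:R * v)).
  have mk : (m < k)%N by rewrite km -{1}[m]addn0 ltn_add2l.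
  have := walk_ball wk mk (ltW rho0) (walk_lift wk (leq0n m) mU)
    (FmM (walk_lift wk (leq0n m) mY) (FmX 2 FNm)).
  move=> /(_ _ _)/le_trans; apply; [by momt|by move=> w; rewrite mulr_ge0 ?sqr_ge0|].
  rewrite km addKn ler_wpM2r ?divr_ge0 ?mulr_ge0 ?(ltW rho0) ?(ltW sp)//.
  apply: (le_trans (mart_sqr wk rho0 ka0 mC momC CU mU mY momY Y0 YY m)).
  rewrite ler_wpM2l// ler_wpM2l// lerD2l ler_wpM2l// ler_wsqrtr// ler_wpM2r ?(ltW v0)//.
  by rewrite ler_nat (leq_trans _ kn)// ltnW.
apply: (@le_trans _ _ (2 * (Ex P (fun w => (Y w * Nm w ^+ 2) * b2r R (`|V k w - U w| <= rho)) +
   Ex P (fun w => Y w * Np w ^+ 2)))); last first.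
  rewrite (_ : 2 * ka * _ * _ = 2 * (ka * (Ex P Y * (v + 4 * rho * Num.sqrt (n%:R * v))) *
     (2 * rho / Num.sqrt (p%:R * v)) + ka * (Ex P Y * (v + 4 * rho * Num.sqrt (p%:R * v)))));
    last by ring.
  by rewrite ler_wpM2l// lerD.
rewrite -ExD; [|by apply: mom_Intg; momt|by apply: mom_Intg; momt].
rewrite -ExZ; last by apply: mom_Intg; momt.
apply: le_Ex; [by apply: mom_Intg; momt|by apply: mom_Intg; momt|].
move=> w /=; rewrite km sum_nat_split -/(Nm w) -/(Np w).
have := sqrD_le (Nm w) (Np w).
have c0 := b2r_ge0 R (`|V (m + p)%N w - U w| <= rho).
have c1 := b2r_le1 R (`|V (m + p)%N w - U w| <= rho).
set c := b2r _ _ in c0 c1 *; set a := Nm w; set b := Np w; move=> h.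
rewrite -mulrA -mulrDr [leRHS]mulrCA ler_wpM2l//.
apply: (@le_trans _ _ (2 * (a ^+ 2 + b ^+ 2) * c)); first by rewrite ler_wpM2r.
by have := sqr_ge0 b; nra.
Qed.

End walk_counts.

(** Each product [x i * x j] is at most half the sum of the squares, but only pairs allowed by [y]
    contribute. Retaining [y] is the point: it later gains a factor h over plain Cauchy-Schwarz. *)
Lemma sqr_sum_sym (R : realType) (x : nat -> R) (y : nat -> nat -> R) n :
  (forall i j, x i * x j = x i * x j * y i j) -> (forall i j, y i j = y j i) ->
  (forall i j, 0 <= y i j) ->
  (\sum_(0 <= i < n) x i) ^+ 2 <= \sum_(0 <= i < n) \sum_(0 <= j < n) x i ^+ 2 * y i j.
Proof.
move=> xy ys y0.
pose A := \sum_(0 <= i < n) \sum_(0 <= j < n) x i ^+ 2 * y i j.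
have AE : A = \sum_(0 <= i < n) \sum_(0 <= j < n) x j ^+ 2 * y i j.
  rewrite /A exchange_big/=; apply: eq_bigr => i _; apply: eq_bigr => j _.
  by rewrite ys.
have : (\sum_(0 <= i < n) x i) ^+ 2 <= 2^-1 * (A + A).
  rewrite {2}AE -big_split/= mulr_sumr expr2 mulr_suml.
  apply: ler_sum => i _; rewrite mulr_sumr -big_split/= mulr_sumr.
  apply: ler_sum => j _; rewrite xy.
  by have := sqr_ge0 (x i - x j); have := y0 i j; nra.
by rewrite -/A; lra.
Qed.

Lemma sqr_sum_expand (R : realType) (x : nat -> R) n :
  (\sum_(0 <= i < n) x i) ^+ 2 = \sum_(0 <= i < n) x i ^+ 2 +
    2 * \sum_(0 <= i < n) (\sum_(0 <= l < i) x l) * x i.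
Proof.
elim: n => [|n IH]; first by rewrite !big_geq// expr0n mulr0 addr0.
by rewrite !big_nat_recr//= sqrrD IH; ring.
Qed.

Lemma measurable_kern (R : realType) (h e : R) m : measurable_fun setT (kern h e m).
Proof.
have mpp : measurable_fun setT (@pp R m).
  apply: measurable_funM => //; apply: measurable_funX.
  exact: measurable_maxr.
have md2 (c : R) (F : R -> R) : measurable_fun setT F -> measurable_fun setT (d2 c F).
  move=> mF; apply: measurable_funD; first apply: measurable_funB.
  - by apply: (measurableT_comp mF); exact: measurable_funD.
  - exact: measurable_funM.
  - by apply: (measurableT_comp mF); exact: measurable_funB.
by apply: measurable_funM => //; do 2 apply: (md2).
Qed.

Lemma norm_sum5_le (R : realType) (a a' b c d x : R) : 0 <= a -> 0 <= a' -> `|x| <= d ->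
  `|2^-1 * a - 2^-1 * a' - b + c - 2^-1 * x| <= a + a' + (`|b| + (`|c| + d)).
Proof.
move=> a0 a0' xd.
have := ler_norm b; have := ler_norm (- b); have := ler_norm c; have := ler_norm (- c).
have := ler_norm x; have := ler_norm (- x); rewrite !normrN => *.
by rewrite ler_norml; apply/andP; split; lra.
Qed.

(** * Estimates for the double martingale sum at one scale *)

Section biwalk.
#[local] Opaque kern.
Context d (T : measurableType d) (R : realType) (P : probability T R).
Variables (G G' : nat -> set (set T)) (V V' : nat -> T -> R) (v v' : R).
Hypotheses (wk : walk P G V v) (wk' : walk P G' V' v').
Hypotheses (cGV : forall j k, Fm (G j) (V' k)) (cGV' : forall k j, Fm (G' k) (V j)).
Variables (n : nat) (r e h kap : R).
Hypotheses (r0 : 0 < r) (r1 : r <= 1) (e0 : 0 < e).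
Hypotheses (hE : h = r ^+ 2) (kapE : kap = 4 / r ^+ 3).
Hypotheses (eh : e <= h) (vh : v <= h ^+ 2) (vh' : v' <= h ^+ 2).
Let S := n%:R * v.
Let S' := n%:R * v'.

(* [kap] is [4 h^(-3/2)], and Theta stands for the smoothed tent [kern h e 3].
   [DD] is the Riemann sum of Theta'' whose limit is minus the integral of the product of
   the increments, [SS] the double martingale sum that replaces [- kap / 4 * DD], [BB]
   the bracket of [SS] in the first walk, and [QQ] the Riemann sum of
   [kap^2 Theta^2] that replaces [BB]. *)
Definition cc j k w := kap * kern h e 3 (V j w - V' k w).
Definition aa j w := \sum_(0 <= k < n) cc j k w * incr V' k w.
Definition SS w := \sum_(0 <= j < n) aa j w * incr V j w.
Definition BB w := \sum_(0 <= j < n) aa j w ^+ 2 * v.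
Definition QQ w := \sum_(0 <= j < n) \sum_(0 <= k < n) cc j k w ^+ 2 * v * v'.
Definition DD w := \sum_(0 <= j < n) \sum_(0 <= k < n)
  v * v' * kern h e 1 (V j w - V' k w).

(** As [e <= h], the smoothed tent lives on [|z| <= 2 * h], which [chi] records. Two points of the
    first walk seen by the same point of the second are within [4 * h] of each other, which [Yy]
    records. The variable [r] is the square root of [h], so that h^(3/2) is [r ^+ 3]. *)
Let chi j k w := b2r R (`|V' k w - V j w| <= 2 * h).
Let Yy i j w := b2r R (`|V j w - V i w| <= 4 * h).

Let v0 := walk_gt0 wk.
Let v0' := walk_gt0 wk'.
Let h0 : 0 < h. Proof. by rewrite hE exprn_gt0. Qed.
Let h1 : h <= 1. Proof. by rewrite hE exprn_ile1 ?(ltW r0). Qed.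
Let hr : h <= r. Proof. by rewrite hE expr2 ler_piMl ?(ltW r0). Qed.
Let hh : h ^+ 2 <= h. Proof. by rewrite [leLHS]expr2 ler_piMl ?(ltW h0) ?h1. Qed.
Let S0 : 0 <= S. Proof. by rewrite mulr_ge0 ?(ltW v0). Qed.
Let S0' : 0 <= S'. Proof. by rewrite mulr_ge0 ?(ltW v0'). Qed.
Let mV := walk_meas wk.
Let mV' := walk_meas wk'.
Let mi := mom_incr wk.
Let mi' := mom_incr wk'.
Let kap0 : 0 < kap. Proof. by rewrite kapE divr_gt0// exprn_gt0. Qed.
Let kh : (kap * h) ^+ 2 = 16 / h.
Proof. by rewrite kapE hE; field; rewrite gt_eqF. Qed.

Let chi01 j k w : 0 <= chi j k w <= 1. Proof. by rewrite b2r_ge0 b2r_le1. Qed.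

Let kern_chi j k w : 0 <= kern h e 3 (V j w - V' k w) <= h * chi j k w.
Proof.
rewrite kern3_ge0//=; rewrite /chi distrC; case: (lerP `|V j w - V' k w| (2 * h)) => hx.
  by rewrite /b2r mulr1; exact: kern3_le.
rewrite /b2r mulr0 kern3_supp//; move: hx eh; set q := `| _ |; lra.
Qed.

Let cc_chi j k w : 0 <= cc j k w <= kap * h * chi j k w.
Proof.
have /andP[a b] := kern_chi j k w.
apply/andP; split; first by rewrite /cc mulr_ge0 ?(ltW kap0).
by rewrite /cc -[leRHS]mulrA ler_wpM2l ?(ltW kap0).
Qed.

Let cc2_chi j k w : cc j k w ^+ 2 <= 16 / h * chi j k w.
Proof.
have /andP[a b] := cc_chi j k w; have /andP[c d'] := chi01 j k w.
rewrite -kh; apply: (@le_trans _ _ ((kap * h * chi j k w) ^+ 2)).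
  by rewrite lerXn2r ?nnegrE// mulr_ge0// mulr_ge0 ?(ltW kap0) ?(ltW h0).
rewrite exprMn ler_wpM2l ?sqr_ge0// /chi /b2r.
by case: (`|V' k w - V j w| <= 2 * h); rewrite ?expr1n ?expr0n.
Qed.

Let Fm_kern m j k (H : set (set T)) : Fm H (V j) -> Fm H (V' k) ->
  Fm H (fun w => kern h e m (V j w - V' k w)).
Proof. by move=> a b; apply: Fm_comp; [exact: measurable_kern|exact: FmB]. Qed.

Let Fm_cc j k (H : set (set T)) : Fm H (V j) -> Fm H (V' k) -> Fm H (cc j k).
Proof. by move=> a b; apply: FmM; [exact: Fm_cst|exact: Fm_kern]. Qed.

Let mcc j k : measurable_fun setT (cc j k).
Proof.
apply: measurable_funM => //; apply: (measurableT_comp (@measurable_kern _ _ _ _)).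
exact: measurable_funB.
Qed.

Let mom_cc j k : mom P (cc j k).
Proof.
apply: (@mom_bd _ _ _ _ _ (kap * h)) => // w.
have /andP[a b] := cc_chi j k w; have /andP[c d'] := chi01 j k w.
rewrite ger0_norm//; apply: (le_trans b); rewrite ler_piMr//.
by rewrite mulr_ge0 ?(ltW kap0) ?(ltW h0).
Qed.

Let mom_aa j : mom P (aa j).
Proof. by apply: mom_sum => k; apply: momM; [exact: mom_cc|exact: mi']. Qed.

Let mom_chi j k : mom P (chi j k).
Proof.
apply: mom_b2r; apply: measurable_ler_ind => //; apply: measurableT_comp => //.
by apply: measurable_funB.
Qed.

Let mom_Yy i j : mom P (Yy i j).
Proof.
apply: mom_b2r; apply: measurable_ler_ind => //; apply: measurableT_comp => //.
by apply: measurable_funB.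
Qed.

Let Fm_Yy i j k : Fm (G' k) (Yy i j).
Proof. by apply: Fm_ler; [apply: Fm_norm; exact: FmB|exact: Fm_cst]. Qed.

Let chi_Yy i j k w : chi i k w * chi j k w = chi i k w * chi j k w * Yy i j w.
Proof.
rewrite /chi /Yy !b2rM; congr b2r.
case: lerP => //= a; case: lerP => //= b; apply/esym.
have := ler_normB (V' k w - V i w) (V' k w - V j w).
rewrite (_ : _ - _ - (_ - _) = V j w - V i w); last by ring.
by move: a b; set p := `|_|; set q := `|_|; set u := `|_|; lra.
Qed.

Let cc_Yy i j k w : cc i k w * cc j k w = cc i k w * cc j k w * Yy i j w.
Proof.
have z (l : nat) : cc l k w = cc l k w * chi l k w.
  have /andP[a b] := cc_chi l k w; move: b; rewrite /chi.
  case: (`|V' k w - V l w| <= 2 * h); first by move=> _; rewrite /b2r mulr1.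
  by rewrite /b2r !mulr0 => b; apply/eqP; rewrite eq_le a b.
by rewrite (z i) (z j) mulrACA [in LHS]chi_Yy; ring.
Qed.

Let Yys i j w : Yy i j w = Yy j i w. Proof. by rewrite /Yy distrC. Qed.
Let Yy0 i j w : 0 <= Yy i j w. Proof. exact: b2r_ge0. Qed.
Let YyYy i j w : Yy i j w ^+ 2 = Yy i j w.
Proof. by rewrite /Yy /b2r; case: (`|V j w - V i w| <= 4 * h); rewrite ?expr1n ?expr0n. Qed.

Definition K1 : R := 1 + 8 * Num.sqrt (n%:R * v').
Let K10 : 0 <= K1. Proof. by rewrite /K1 addr_ge0 ?mulr_ge0 ?sqrtr_ge0. Qed.

Let count_chi (Y : T -> R) j : Fm (G' 0%N) Y -> mom P Y -> (forall w, 0 <= Y w) ->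
  \sum_(0 <= k < n) v' * Ex P (fun w => Y w * chi j k w) <= Ex P Y * (h * K1).
Proof.
move=> mY momY Y0.
have rho0 : 0 <= 2 * h by rewrite mulr_ge0 ?(ltW h0).
have H := walk_count wk' n rho0 (@cGV' 0%N j) mY momY Y0.
rewrite /chi; apply: (le_trans H).
rewrite ler_wpM2l ?Ex_ge0// /K1 mulrDr mulr1 lerD ?(le_trans vh' hh)//.
by rewrite le_eqVlt; apply/orP; left; apply/eqP; rewrite -/S'; ring.
Qed.

Definition K4 : R := 1 + 32 * Num.sqrt (n%:R * v).
Let K40 : 0 <= K4. Proof. by rewrite /K4 addr_ge0 ?mulr_ge0 ?sqrtr_ge0. Qed.

(** The time spent within [4 * h] of [V i] is counted separately after [i] (walk restarted at [i])
    and before [i] (the later point is near the earlier one). Each half contributes 16, hence the 32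
    in [K4]. *)
Let count_Yy1 i : (i <= n)%N -> \sum_(0 <= j < n) v * Ex P (Yy i j) <= h * K4.
Proof.
move=> iN; have -> : n = (i + (n - i))%N by rewrite subnKC.
rewrite sum_nat_split.
have m1 (H : set (set T)) : Fm H (fun _ => 1 : R) by exact: Fm_cst.
have mo1 : mom P (fun _ => 1 : R) by exact: mom_cst.
have o1 (w : T) : 0 <= (1 : R) by [].
have rho0 : 0 <= 4 * h by rewrite mulr_ge0 ?(ltW h0).
have sv : 0 < Num.sqrt v by rewrite sqrtr_gt0.
have sS k : (k <= n)%N -> Num.sqrt (k%:R * v) <= Num.sqrt S.
  by move=> kn; rewrite ler_wsqrtr// ler_wpM2r ?(ltW v0)// ler_nat.
have A2 : \sum_(0 <= k < n - i) v * Ex P (Yy i (i + k)) <= v + 16 * h * Num.sqrt S.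
  have := @walk_count _ _ _ _ _ _ _ (walk_shift i wk) (fun _ => 1) (V i) (4 * h) (n - i) rho0.
  move=> /(_ _ (m1 _) mo1 o1).
  rewrite Ex_cst mul1r => H; apply: le_trans (le_trans (H _) _).
  - by rewrite le_eqVlt; apply/orP; left; apply/eqP; apply: eq_bigr => k _;
      congr (_ * _); apply: eq_Ex => w; rewrite mul1r.
  - by apply: (walk_lift wk (_ : (i <= i + 0)%N)); [exact: leq_addr|exact: (walk_adapted wk)].
  - rewrite lerD2l (_ : 4 * (4 * h) = 16 * h); last by ring.
    by rewrite ler_wpM2l ?sS ?leq_subr// mulr_ge0 ?(ltW h0).
have A1 : \sum_(0 <= k < i) v * Ex P (Yy i k) <= 16 * h * Num.sqrt S.
  apply: (@le_trans _ _ (\sum_(0 <= k < i) 8 * h * Num.sqrt v * (Num.sqrt (i - k.+1).+1%:R)^-1)).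
    apply: ler_sum_nat => k /andP[_ ki].
    have aV : Fm (G k) (V k) by exact: (walk_adapted wk).
    have := walk_ball wk ki rho0 aV (m1 _) mo1 o1.
    rewrite Ex_cst mul1r => H.
    apply: (@le_trans _ _ (v * (2 * (4 * h) / Num.sqrt ((i - k)%:R * v)))).
      rewrite ler_wpM2l ?(ltW v0)//; apply: le_trans H.
      rewrite le_eqVlt; apply/orP; left; apply/eqP; apply: eq_Ex => w.
      by rewrite mul1r /Yy distrC.
    rewrite subnSK// sqrtrM//.
    have l0 : Num.sqrt (i - k)%:R != 0 :> R by rewrite gt_eqF// sqrtr_gt0 ltr0n subn_gt0.
    have vs : v = Num.sqrt v ^+ 2 by rewrite sqr_sqrtr ?(ltW v0).
    rewrite {1}vs le_eqVlt; apply/orP; left; apply/eqP; field.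
    by rewrite l0 gt_eqF.
  rewrite -mulr_sumr.
  have -> : \sum_(0 <= k < i) (Num.sqrt (i - k.+1).+1%:R)^-1 =
     \sum_(0 <= k < i) (Num.sqrt k.+1%:R)^-1 :> R.
    rewrite big_nat_rev/=; apply: eq_big_nat => k /andP[_ ki].
    by have -> : (i - (0 + i - k.+1).+1).+1 = k.+1 by clear -ki; lia.
  apply: (@le_trans _ _ (8 * h * Num.sqrt v * (2 * Num.sqrt i%:R))).
    by rewrite ler_wpM2l ?inv_sqrt_sum// mulr_ge0 ?mulr_ge0 ?(ltW sv) ?(ltW h0).
  rewrite (_ : 8 * h * Num.sqrt v * (2 * Num.sqrt i%:R) = 16 * h * Num.sqrt (i%:R * v)).
    by rewrite ler_wpM2l ?sS// mulr_ge0 ?(ltW h0).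
  by rewrite sqrtrM//; ring.
apply: (le_trans (lerD A1 A2)).
rewrite /K4 -/S; have := le_trans vh hh; set q := h * _.
have : 0 <= Num.sqrt S := sqrtr_ge0 _.
move=> s0 vh1; rewrite (_ : q = v + (h - v) + (16 * h * Num.sqrt S + 16 * h * Num.sqrt S)).
  by rewrite addrCA -addrA lerD2l lerDr subr_ge0.
by rewrite /q; ring.
Qed.

Let count_Yy J : (J <= n)%N ->
  \sum_(0 <= i < J) \sum_(0 <= j < J) v ^+ 2 * Ex P (Yy i j) <= S * (h * K4).
Proof.
move=> Jn.
have E0 i j : 0 <= Ex P (Yy i j) by apply: Ex_ge0.
apply: (@le_trans _ _ (\sum_(0 <= i < J) v * (h * K4))).
  apply: ler_sum_nat => i /andP[_ iJ].
  apply: (@le_trans _ _ (v * \sum_(0 <= j < n) v * Ex P (Yy i j))).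
    rewrite mulr_sumr [leRHS](@big_cat_nat _ _ _ J)//=.
    rewrite -[leLHS]addr0 lerD//.
      by apply: ler_sum => j _; rewrite expr2 mulrA.
    by apply: sumr_ge0 => j _; rewrite !mulr_ge0 ?(ltW v0).
  by rewrite ler_wpM2l ?(ltW v0)// count_Yy1// (leq_trans (ltnW iJ)).
apply: (le_trans (@big_sum_le _ _ _ (v * (h * K4)) (fun _ _ => lexx _))).
by rewrite [leLHS]mulrA ler_wpM2r ?mulr_ge0 ?(ltW h0)// ler_wpM2r ?(ltW v0)// ler_nat.
Qed.

(** Exchanging the sums gives a martingale along [V'] whose coefficients are time integrals along
    [V]. In its variance the factor 16/h from [cc] meets two occupation times of order h, one from
    [Yy] and one from [chi], leaving order h. *)
Lemma weak_bound J : (J <= n)%N ->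
  Ex P (fun w => (\sum_(0 <= j < J) v * aa j w) ^+ 2) <= 16 * K1 * S * K4 * h.
Proof.
move=> Jn.
have -> : Ex P (fun w => (\sum_(0 <= j < J) v * aa j w) ^+ 2) =
  Ex P (fun w => (\sum_(0 <= k < n) (\sum_(0 <= j < J) v * cc j k w) * incr V' k w) ^+ 2).
  apply: eq_Ex => w; congr (_ ^+ 2).
  rewrite /aa; under eq_bigr do rewrite mulr_sumr.
  rewrite exchange_big/=; apply: eq_bigr => k _; rewrite mulr_suml.
  by apply: eq_bigr => j _; rewrite mulrA.
rewrite (orthogonality1 wk'); last 2 first.
- move=> k _; apply: Fm_sum => j; apply: FmM; first exact: Fm_cst.
  by apply: Fm_cc => //; exact: (walk_adapted wk').
- by move=> k _; momt.
apply: (@le_trans _ _ (16 / h * \sum_(0 <= i < J) \sum_(0 <= j < J) v ^+ 2 *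
   \sum_(0 <= k < n) v' * Ex P (fun w => Yy i j w * chi i k w))).
  rewrite mulr_sumr.
  apply: (@le_trans _ _ (\sum_(0 <= k < n) v' * (16 / h *
    \sum_(0 <= i < J) \sum_(0 <= j < J) v ^+ 2 * Ex P (fun w => Yy i j w * chi i k w)))).
    apply: ler_sum => k _; rewrite ler_wpM2l ?(ltW v0')//.
    rewrite mulr_sumr; under [leRHS]eq_bigr do rewrite mulr_sumr.
    apply: (@le_trans _ _ (Ex P (fun w => \sum_(0 <= i < J) \sum_(0 <= j < J)
        (v * cc i k w) ^+ 2 * Yy i j w))).
      apply: le_Ex; [by apply: mom_Intg; momt|by apply: mom_Intg; momt|].
      move=> w; apply: sqr_sum_sym => // i j.
      by rewrite mulrACA [in LHS]cc_Yy; ring.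
    rewrite Ex_sum; last by move=> i; apply: mom_Intg; momt.
    apply: ler_sum => i _; rewrite Ex_sum; last by move=> j; apply: mom_Intg; momt.
    apply: ler_sum => j _; rewrite -ExZ; last by apply: mom_Intg; momt.
    rewrite -ExZ; last by apply: mom_Intg; momt.
    apply: le_Ex; [by apply: mom_Intg; momt|by apply: mom_Intg; momt|].
    move=> w; rewrite exprMn -mulrA [leRHS]mulrCA ler_wpM2l ?sqr_ge0//.
    by rewrite [leRHS]mulrCA mulrC ler_wpM2l// cc2_chi.
  rewrite le_eqVlt; apply/orP; left; apply/eqP.
  under eq_bigr do rewrite mulrCA; rewrite -mulr_sumr; congr (_ * _).
  under eq_bigr do rewrite mulr_sumr; rewrite exchange_big/=; apply: eq_bigr => i _.
  under eq_bigr do rewrite mulr_sumr; rewrite exchange_big/=; apply: eq_bigr => j _.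
  by rewrite mulr_sumr; apply: eq_bigr => k _; rewrite mulrCA.
apply: (@le_trans _ _ (16 / h * \sum_(0 <= i < J) \sum_(0 <= j < J)
     (v ^+ 2 * Ex P (Yy i j)) * (h * K1))).
  rewrite ler_wpM2l ?divr_ge0 ?(ltW h0)//; apply: ler_sum => i _; apply: ler_sum => j _.
  by rewrite -mulrA ler_wpM2l ?sqr_ge0// count_chi.
under eq_bigr do rewrite -mulr_suml; rewrite -mulr_suml.
apply: (@le_trans _ _ (16 / h * (S * (h * K4) * (h * K1)))).
  rewrite ler_wpM2l ?divr_ge0 ?(ltW h0)// ler_wpM2r ?mulr_ge0 ?(ltW h0)//.
  exact: count_Yy.
by rewrite le_eqVlt; apply/orP; left; apply/eqP; field; rewrite gt_eqF.
Qed.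

(** The factor 16/h of the squared coefficients is compensated by the time of order h that [V']
    spends near [V j]; this is what the normalisation [kap] is for. *)
Let Ex_aa2 j : Ex P (fun w => aa j w ^+ 2) <= 16 * K1.
Proof.
rewrite (orthogonality1 wk'); last 2 first.
- by move=> k _; apply: Fm_cc => //; exact: (walk_adapted wk').
- by move=> k _.
have m1 (H : set (set T)) : Fm H (fun _ => 1 : R) by exact: Fm_cst.
have := count_chi j (m1 _) (mom_cst P 1) (fun _ => ler01).
rewrite Ex_cst mul1r => H.
apply: (@le_trans _ _ (16 / h * (\sum_(0 <= k < n) v' * Ex P (fun w => 1 * chi j k w)))).
  rewrite !mulr_sumr; apply: ler_sum => k _; rewrite [leRHS]mulrCA ler_wpM2l ?(ltW v0')//.
  rewrite -ExZ; last by apply: mom_Intg; momt.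
  apply: le_Ex; [by apply: mom_Intg; momt|by apply: mom_Intg; momt|].
  by move=> w; rewrite mul1r cc2_chi.
apply: (@le_trans _ _ (16 / h * (h * K1))).
  by rewrite ler_wpM2l ?divr_ge0 ?(ltW h0).
by rewrite le_eqVlt; apply/orP; left; apply/eqP; field; rewrite gt_eqF.
Qed.

Lemma Ex_BB : Ex P BB <= 16 * K1 * S.
Proof.
rewrite /BB Ex_sum; last by move=> j; apply: mom_Intg; momt.
apply: (@le_trans _ _ (n%:R * (16 * K1 * v))).
  apply: big_sum_le => j _; under eq_Ex do rewrite mulrC.
  rewrite ExZ; last by apply: mom_Intg; momt.
  by rewrite mulrC ler_wpM2r ?(ltW v0)// Ex_aa2.
by rewrite mulrCA.
Qed.

(** A window of [p] steps lasts between [h] and [2 * h]. For a window of length tau the early part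
    of [mart_sqr_local] costs about h^2 / sqrt tau and the late part about h sqrt tau; they balance
    at tau = h. *)
Let p := (Num.truncn (h / v')).+1.
Let pv1 : h <= p%:R * v'.
Proof.
rewrite -ler_pdivrMr//; apply: ltW; apply: truncnS_gt.
Qed.
Let pv2 : p%:R * v' <= 2 * h.
Proof.
rewrite /p -natr1 [leLHS]mulrDl mul1r; have : (Num.truncn (h / v'))%:R * v' <= h.
  by rewrite -ler_pdivlMr// truncn_le// divr_ge0 ?(ltW h0) ?(ltW v0').
by have := le_trans vh' hh; lra.
Qed.

Definition NN j k w := \sum_(0 <= l < k) cc j l w * incr V' l w.
Let mom_NN j k : mom P (NN j k).
Proof. by apply: mom_sum => l; apply: momM; [exact: mom_cc|exact: mi']. Qed.

Definition K5 : R := 21 + 32 * Num.sqrt (n%:R * v').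
Let K50 : 0 <= K5. Proof. by rewrite /K5 addr_ge0 ?mulr_ge0 ?sqrtr_ge0. Qed.

(** Here [mart_sqr_local] is used with radius [2 * h]. The early part contributes 4 (1 + 8 sqrt S')
    and the late part 17, both times h r, which add up to [K5]; the factor 32/h in front leaves a
    gain of [r]. *)
Let Ex_NN i j k : (k <= n)%N ->
  Ex P (fun w => Yy i j w * (NN i k w ^+ 2 * chi i k w)) <= 32 * r * K5 * Ex P (Yy i j).
Proof.
move=> kn.
have rho0 : 0 < 2 * h by rewrite mulr_gt0.
have ka0 : 0 <= 16 / h by rewrite divr_ge0 ?(ltW h0).
have EY0 : 0 <= Ex P (Yy i j) by apply: Ex_ge0.
have H := @mart_sqr_local _ _ _ P G' V' v' (V i) (Yy i j) (cc i) (2 * h) (16 / h) n p k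
  wk' rho0 ka0.
have mC l : Fm (G' l) (cc i l) by apply: Fm_cc => //; exact: (walk_adapted wk').
have {}H := H mC (fun l => mom_cc i l) (fun l w => cc2_chi i l w) (@cGV' 0%N i)
   (@Fm_Yy i j 0%N) (mom_Yy i j) (Yy0 i j) (YyYy i j) (ltn0Sn _) kn.
apply: (le_trans H) => {H}.
rewrite -/S'.
have sp1 : r <= Num.sqrt (p%:R * v').
  rewrite -[leLHS](ger0_norm (ltW r0)) -sqrtr_sqr ler_wsqrtr// -hE; exact: pv1.
have sp2 : Num.sqrt (p%:R * v') <= 2 * r.
  rewrite -[leRHS]ger0_norm ?mulr_ge0 ?(ltW r0)// -sqrtr_sqr ler_wsqrtr//.
  apply: (le_trans pv2); rewrite hE exprMn; have := sqr_ge0 r; lra.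
have vr : v' <= h * r.
  by apply: (le_trans vh'); rewrite expr2 ler_wpM2l ?(ltW h0).
set q := Num.sqrt _ in sp1 sp2 *.
have s0 : 0 <= Num.sqrt S' := sqrtr_ge0 _.
have A1 : 2 * (2 * h) / q <= 4 * r.
  rewrite ler_pdivrMr ?(lt_le_trans r0)//.
  by rewrite (_ : 2 * (2 * h) = 4 * r * r) ?ler_wpM2l ?mulr_ge0 ?(ltW r0)// hE; ring.
have A2 : v' + 4 * (2 * h) * Num.sqrt S' <= h * (1 + 8 * Num.sqrt S').
  by have := le_trans vh' hh; lra.
have A3 : (v' + 4 * (2 * h) * Num.sqrt S') * (2 * (2 * h) / q) <=
   h * (1 + 8 * Num.sqrt S') * (4 * r).
  apply: ler_pM => //.
    by rewrite addr_ge0 ?(ltW v0')// !mulr_ge0 ?(ltW h0).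
  by rewrite divr_ge0 ?mulr_ge0 ?(ltW h0)// (le_trans (ltW r0)).
have A4 : v' + 4 * (2 * h) * q <= 17 * (h * r).
  have : h * q <= h * (2 * r) by rewrite ler_wpM2l ?(ltW h0).
  by move: vr; lra.
apply: (@le_trans _ _ (2 * (16 / h) * Ex P (Yy i j) * (h * r * K5))).
  apply: ler_wpM2l; first by rewrite mulr_ge0// mulr_ge0.
  apply: (le_trans (lerD A3 A4)).
  by rewrite le_eqVlt; apply/orP; left; apply/eqP; rewrite /K5 -/S'; ring.
by rewrite le_eqVlt; apply/orP; left; apply/eqP; field; rewrite gt_eqF.
Qed.

(** Expand the square of each [aa j]. The diagonal minus its compensator is an orthogonal sum, small
    with the mesh. The off-diagonal part is a martingale along [V'] with coefficients [b2], whose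
    variance is of order [r] by [sqr_sum_sym] and [Ex_NN]. *)
Lemma bracket_bound : Ex P (fun w => (BB w - QQ w) ^+ 2) <=
  2 * (gq2 R * v' ^+ 2 * (n%:R * (16 / h * S) ^+ 2)) +
  8 * (16 * K4 * S * S' * (32 * r * K5)).
Proof.
pose b1 k w := \sum_(0 <= j < n) v * cc j k w ^+ 2.
pose b2 k w := \sum_(0 <= j < n) v * (NN j k w * cc j k w).
have mb1 k : mom P (b1 k) by rewrite /b1; momt.
have mb2 k : mom P (b2 k) by rewrite /b2; momt.
(* Off the diagonal, the sum over pairs is ordered by the larger index, so the coefficient [NN j k]
   only involves increments before [k]. *)
have E1 w : BB w - QQ w = \sum_(0 <= k < n) b1 k w * (incr V' k w ^+ 2 - v') +
    2 * \sum_(0 <= k < n) b2 k w * incr V' k w.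
  rewrite /BB /QQ -sumrB /b1 /b2.
  under [X in _ = X + _]eq_bigr do rewrite mulr_suml.
  under [X in _ = _ + _ * X]eq_bigr do rewrite mulr_suml.
  rewrite [X in _ = X + _]exchange_big/= [X in _ = _ + _ * X]exchange_big/=.
  rewrite mulr_sumr -big_split/=; apply: eq_bigr => j _.
  rewrite /aa sqr_sum_expand mulrDl -[2 * _ * v]mulrA !mulr_suml.
  rewrite addrAC -sumrB; congr (_ + 2 * _); apply: eq_bigr => k _; first by ring.
  by rewrite /NN; ring.
have g1 : measurable_fun setT (fun x : R => x ^+ 2 - v').
  by apply: measurable_funB => //; apply: measurable_funX.
have I1 : Intg P (fun w => (\sum_(0 <= k < n) b1 k w * (incr V' k w ^+ 2 - v')) ^+ 2).
  by apply: mom_Intg; momt.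
have I2 : Intg P (fun w => (\sum_(0 <= k < n) b2 k w * incr V' k w) ^+ 2).
  by apply: mom_Intg; momt.
apply: (@le_trans _ _ (Ex P (fun w =>
   2 * (\sum_(0 <= k < n) b1 k w * (incr V' k w ^+ 2 - v')) ^+ 2 +
   8 * (\sum_(0 <= k < n) b2 k w * incr V' k w) ^+ 2))).
  apply: le_Ex; [|by apply: mom_Intg; momt|].
    rewrite (_ : (fun w => _) = fun w => (\sum_(0 <= k < n) b1 k w * (incr V' k w ^+ 2 - v') +
      2 * \sum_(0 <= k < n) b2 k w * incr V' k w) ^+ 2); last by apply/funext => w; rewrite E1.
    by apply: mom_Intg; momt.
  by move=> w; rewrite E1; apply: (le_trans (sqrD_le _ _)); rewrite exprMn; lra.
rewrite ExD; [|exact: IntgZ|exact: IntgZ].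
rewrite !ExZ//.
have F1 k (H : set (set T)) : (forall j, Fm H (V j)) -> Fm H (V' k) -> Fm H (b1 k).
  move=> a b; apply: Fm_sum => j; apply: FmM; first exact: Fm_cst.
  by apply: FmX; apply: Fm_cc.
have F2 k : Fm (G' k) (b2 k).
  apply: Fm_sum => j; apply: FmM; first exact: Fm_cst.
  apply: FmM; last by apply: Fm_cc => //; exact: (walk_adapted wk').
  apply: Fm_sum_nat => l /andP[_ lk]; apply: FmM; last exact: (Fm_incr wk').
  apply: (walk_lift wk' (ltnW lk)); apply: Fm_cc => //; exact: (walk_adapted wk').
rewrite (orthogonality2 wk'); last 2 first.
- by move=> k _; apply: F1 => //; exact: (walk_adapted wk').
- by move=> k _.
rewrite (orthogonality1 wk')//.
apply: lerD; apply: ler_wpM2l => //.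
- apply: ler_wpM2l.
    have gi : gauss P v' (incr V' 0%N) by apply: (incr_gauss wk').
    have := Ex_gauss_sqr_dev v0' gi; move=> <-.
    by apply: Ex_ge0 => w; exact: sqr_ge0.
  apply: big_sum_le => k _.
  apply: (@le_trans _ _ (Ex P (fun _ => (16 / h * S) ^+ 2))); last by rewrite Ex_cst.
  apply: le_Ex; [by apply: mom_Intg; momt|exact: Intg_cst|].
  move=> w; rewrite lerXn2r ?nnegrE//.
  + by apply: sumr_ge0 => j _; rewrite mulr_ge0 ?sqr_ge0 ?(ltW v0).
  + by rewrite mulr_ge0 ?divr_ge0 ?(ltW h0).
  + rewrite /S [leRHS]mulrCA; apply: big_sum_le => j _.
    rewrite [leRHS]mulrC ler_wpM2l ?(ltW v0)//; apply: (le_trans (cc2_chi j k w)).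
    by rewrite ler_piMr ?divr_ge0 ?(ltW h0)//; case/andP: (chi01 j k w).
- apply: (@le_trans _ _ (v' * (n%:R * (16 / h * (S * (h * K4) * (32 * r * K5)))))); last first.
    by rewrite le_eqVlt; apply/orP; left; apply/eqP; rewrite /S'; field; rewrite gt_eqF.
  rewrite ler_wpM2l ?(ltW v0')//; apply: big_sum_le => k kn.
  apply: (@le_trans _ _ (16 / h * \sum_(0 <= i < n) \sum_(0 <= j < n) v ^+ 2 *
      Ex P (fun w => Yy i j w * (NN i k w ^+ 2 * chi i k w)))).
    rewrite mulr_sumr; under [leRHS]eq_bigr do rewrite mulr_sumr.
    apply: (@le_trans _ _ (Ex P (fun w => \sum_(0 <= i < n) \sum_(0 <= j < n)
        (v * (NN i k w * cc i k w)) ^+ 2 * Yy i j w))).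
      apply: le_Ex; [by apply: mom_Intg; momt|by apply: mom_Intg; momt|].
      move=> w; apply: sqr_sum_sym => // i j.
      transitivity (v ^+ 2 * NN i k w * NN j k w * (cc i k w * cc j k w)); first by ring.
      by rewrite cc_Yy; ring.
    rewrite Ex_sum; last by move=> i; apply: mom_Intg; momt.
    apply: ler_sum => i _; rewrite Ex_sum; last by move=> j; apply: mom_Intg; momt.
    apply: ler_sum => j _; rewrite -ExZ; last by apply: mom_Intg; momt.
    rewrite -ExZ; last by apply: mom_Intg; momt.
    apply: le_Ex; [by apply: mom_Intg; momt|by apply: mom_Intg; momt|].
    move=> w; rewrite exprMn [(NN i k w * _) ^+ 2]exprMn.
    have A : v ^+ 2 * (NN i k w ^+ 2 * Yy i j w) * cc i k w ^+ 2 <=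
       v ^+ 2 * (NN i k w ^+ 2 * Yy i j w) * (16 / h * chi i k w).
      by rewrite ler_wpM2l ?cc2_chi// mulr_ge0 ?sqr_ge0// mulr_ge0 ?sqr_ge0.
    apply: le_trans (le_trans A _).
      by rewrite le_eqVlt; apply/orP; left; apply/eqP; ring.
    by rewrite le_eqVlt; apply/orP; left; apply/eqP; ring.
  rewrite ler_wpM2l ?divr_ge0 ?(ltW h0)//.
  apply: (@le_trans _ _ (\sum_(0 <= i < n) \sum_(0 <= j < n) v ^+ 2 * Ex P (Yy i j) * (32 * r * K5))).
    apply: ler_sum => i _; apply: ler_sum => j _; rewrite -mulrA ler_wpM2l ?sqr_ge0//.
    by rewrite [leRHS]mulrC; apply: Ex_NN; exact: ltnW.
  under eq_bigr do rewrite -mulr_suml; rewrite -mulr_suml.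
  by rewrite ler_wpM2r ?mulr_ge0 ?(ltW r0)// count_Yy.
Qed.

(* [XX], [RR] and [RR'] are the boundary and remainder terms of the two discrete Ito
   expansions. *)
Definition XX j w := kern h e 4 (V j w - V' n w) - kern h e 4 (V j w - V' 0%N w).
Definition RR k w := kern h e 3 (V n w - V' k w) - kern h e 3 (V 0%N w - V' k w)
    - \sum_(0 <= j < n) kern h e 2 (V j w - V' k w) * incr V j w
    - \sum_(0 <= j < n) kern h e 1 (V j w - V' k w) * v / 2.
Definition RR' j w := XX j w
    + \sum_(0 <= k < n) kern h e 3 (V j w - V' k w) * incr V' k w
    - \sum_(0 <= k < n) kern h e 2 (V j w - V' k w) * v' / 2.

(** The expansion [RR] along [V] trades the time step [v] of [DD] for boundary terms and a
    martingale sum; the expansion [RR'] along [V'] does the same with [v'] in that sum. Each trade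
    carries the factor 1/2 of a second order term, whence the 4. *)
Let DD_ito w : kap / 4 * DD w + SS w =
  kap * (2^-1 * (\sum_(0 <= k < n) v' * kern h e 3 (V n w - V' k w)) -
         2^-1 * (\sum_(0 <= k < n) v' * kern h e 3 (V 0%N w - V' k w)) -
         \sum_(0 <= j < n) XX j w * incr V j w +
         \sum_(0 <= j < n) RR' j w * incr V j w -
         2^-1 * \sum_(0 <= k < n) v' * RR k w).
Proof.
pose sT := \sum_(0 <= j < n) (\sum_(0 <= k < n) kern h e 3 (V j w - V' k w) * incr V' k w) * incr V j w.
have ES : SS w = kap * sT.
  rewrite /SS mulr_sumr; apply: eq_bigr => j _.
  have -> : aa j w = kap * \sum_(0 <= k < n) kern h e 3 (V j w - V' k w) * incr V' k w.
    by rewrite /aa mulr_sumr; apply: eq_bigr => k _; rewrite /cc -mulrA.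
  by rewrite mulrA.
pose sD := \sum_(0 <= j < n) (\sum_(0 <= k < n) v' * kern h e 2 (V j w - V' k w)) * incr V j w.
have E2 : 2^-1 * sD = \sum_(0 <= j < n) XX j w * incr V j w + sT -
     \sum_(0 <= j < n) RR' j w * incr V j w.
  rewrite /sD /sT -big_split/= -sumrB mulr_sumr; apply: eq_bigr => j _.
  rewrite -mulrDl -mulrBl mulrA; congr (_ * _).
  rewrite /RR' opprB addrC subrK.
  by rewrite mulr_sumr; apply: eq_bigr => k _; rewrite mulrC [v' * _]mulrC.
have E1 : 2^-1 * DD w = \sum_(0 <= k < n) v' * kern h e 3 (V n w - V' k w) -
     \sum_(0 <= k < n) v' * kern h e 3 (V 0%N w - V' k w) - sD -
     \sum_(0 <= k < n) v' * RR k w.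
  have -> : sD = \sum_(0 <= k < n) v' * \sum_(0 <= j < n) kern h e 2 (V j w - V' k w) * incr V j w.
    rewrite /sD; under eq_bigr do rewrite mulr_suml.
    rewrite exchange_big/=; apply: eq_bigr => k _; rewrite mulr_sumr.
    by apply: eq_bigr => j _; rewrite -mulrA.
  rewrite -!sumrB /DD exchange_big/= mulr_sumr; apply: eq_bigr => k _.
  transitivity (v' * \sum_(0 <= j < n) kern h e 1 (V j w - V' k w) * v / 2).
    by rewrite !mulr_sumr; apply: eq_bigr => j _; field.
  by rewrite /RR; ring.
rewrite ES (_ : kap / 4 * DD w = kap / 2 * (2^-1 * DD w)); last by field.
rewrite E1 (_ : sD = 2 * (2^-1 * sD)); last by field.
by rewrite E2; field.
Qed.

Let mom_kern m K j k : (forall z, `|kern h e m z| <= K) ->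
  mom P (fun w => kern h e m (V j w - V' k w)).
Proof.
move=> bK; apply: (@mom_bd _ _ _ _ _ K) => //.
by apply: (measurableT_comp (@measurable_kern _ _ _ _)); exact: measurable_funB.
Qed.

Let bk3 z : `|kern h e 3 z| <= h.
Proof. by rewrite ger0_norm ?kern3_ge0 ?kern3_le. Qed.

Let m4 := fun j k => mom_kern j k (kern4_bd h0 e0).
Let m3 := fun j k => mom_kern j k bk3.
Let m2 := fun j k => mom_kern j k (kern2_bd h0 e0).
Let m1 := fun j k => mom_kern j k (kern1_bd h0 e0).

Let is_derive_kernN m x : is_derive x (1:R) (fun z => kern h e m.+2 (- z)) (- kern h e m.+1 (- x)).
Proof.
have dN : is_derive x (1:R) (fun t : R => - t) (-1) by exact: is_deriveNid.
have dK := is_derive_kern h e m (- x).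
by have := @is_derive1_comp _ (kern h e m.+2) (fun t : R => - t) x _ _ dK dN; rewrite mulrN1.
Qed.

Let RR_ito k : mom P (RR k) /\ Ex P (fun w => RR k w ^+ 2) <=
    2 * (4 * e ^- 2) ^+ 2 * gq6 R * n%:R ^+ 2 * v ^+ 3 +
    (4 * h * e ^- 2) ^+ 2 * gq2 R * n%:R * v ^+ 2.
Proof.
apply: (@ito_remainder _ _ _ _ _ _ _ wk (kern h e 3) (kern h e 2) (kern h e 1)) => //;
  try exact: measurable_kern.
- apply: taylor2; [exact: is_derive_kern|exact: is_derive_kern|exact: kern1_lip].
- exact: kern1_bd.
Qed.

Let RR'_ito j : mom P (RR' j) /\ Ex P (fun w => RR' j w ^+ 2) <=
    2 * (4 * h * e ^- 2) ^+ 2 * gq6 R * n%:R ^+ 2 * v' ^+ 3 +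
    (8 * h ^+ 2 * e ^- 2) ^+ 2 * gq2 R * n%:R * v' ^+ 2.
Proof.
have mN (f : R -> R) : measurable_fun setT f -> measurable_fun setT (fun z : R => f (- z)).
  by move=> mf; apply: (measurableT_comp mf).
(* The second walk enters the kernel with a minus sign, so the expansion is that of the reflected
   kernels. *)
have [] := @ito_remainder _ _ _ _ _ _ _ wk' (fun z => kern h e 4 (- z))
  (fun z => - kern h e 3 (- z)) (fun z => kern h e 2 (- z)) (4 * h * e ^- 2)
  (8 * h ^+ 2 * e ^- 2) (V j) n.
- by apply: mN; exact: measurable_kern.
- by apply: measurable_funN; apply: mN; exact: measurable_kern.
- by apply: mN; exact: measurable_kern.
- apply: taylor2; first exact: is_derive_kernN.
    move=> x; have i := is_derive_kernN 1 x.
    by apply: is_derive_eq; rewrite opprK.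
  move=> x y; have -> : `|x - y| = `|- x - - y| by rewrite -normrN opprB opprK addrC.
  by have := kern_lip_step (kern1_bd h0 e0) (- x) (- y).
- by move=> x; exact: kern2_bd.
- exact: cGV'.
have E : RR' j = (fun w => kern h e 4 (- (V' n w - V j w)) - kern h e 4 (- (V' 0%N w - V j w)) -
   \sum_(0 <= k < n) - kern h e 3 (- (V' k w - V j w)) * incr V' k w -
   \sum_(0 <= k < n) kern h e 2 (- (V' k w - V j w)) * v' / 2); last first.
  by move=> a b; rewrite E; split; [exact: a|exact: b].
apply/funext => w; rewrite /RR' /XX !opprB; congr (_ - _ + _ - _).
- by rewrite -sumrN; apply: eq_bigr => k _; rewrite opprB mulNr opprK.
- by apply: eq_bigr => k _; rewrite opprB.
Qed.

Let mRR k := proj1 (RR_ito k).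
Let mRR' j := proj1 (RR'_ito j).

Let Ex_kern3_row j : Ex P (fun w => \sum_(0 <= k < n) v' * kern h e 3 (V j w - V' k w)) <=
  h ^+ 2 * K1.
Proof.
have m3' k : mom P (fun w => v' * kern h e 3 (V j w - V' k w)).
  by apply: momM; [exact: mom_cst|exact: m3].
rewrite Ex_sum; last by move=> k; apply: mom_Intg; exact: m3'.
have o1 (H : set (set T)) : Fm H (fun _ => 1 : R) by exact: Fm_cst.
have := count_chi j (o1 _) (mom_cst P 1) (fun _ => ler01).
rewrite Ex_cst mul1r => H.
apply: (@le_trans _ _ (h * (\sum_(0 <= k < n) v' * Ex P (fun w => 1 * chi j k w)))).
  rewrite mulr_sumr; apply: ler_sum => k _.
  rewrite ExZ; last by apply: mom_Intg; exact: m3.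
  have mc : mom P (fun w => 1 * chi j k w) by apply: momM; [exact: mom_cst|exact: mom_chi].
  rewrite [leRHS]mulrCA ler_wpM2l ?(ltW v0')// -ExZ; last by apply: mom_Intg.
  apply: le_Ex; [by apply: mom_Intg; exact: m3|by apply: IntgZ; apply: mom_Intg|].
  by move=> w; rewrite mul1r; case/andP: (kern_chi j k w).
by rewrite expr2 -mulrA ler_wpM2l ?(ltW h0).
Qed.

Let Ex_mart (b : nat -> T -> R) (c : R) : 0 <= c ->
  (forall j, Fm (G j) (b j)) -> (forall j, mom P (b j)) ->
  (forall j, Ex P (fun w => b j w ^+ 2) <= c ^+ 2) ->
  Ex P (fun w => `|\sum_(0 <= j < n) b j w * incr V j w|) <= Num.sqrt S * c.
Proof.
move=> c0 mb momb bc; apply: Ex_norm_le; first by rewrite mulr_ge0.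
  by apply: mom_sum => j; apply: momM.
rewrite (orthogonality1 wk)// exprMn sqr_sqrtr// /S [n%:R * v]mulrC -mulrA ler_wpM2l ?(ltW v0)//.
exact: big_sum_le.
Qed.

(** All boundary terms are of order h^2, one factor [r] better than the normalisation h^(3/2). The
    Taylor remainders are bounded by [dl], which the choice of the mesh makes as small as
    desired. *)
Lemma ito_bound dl : 0 <= dl ->
  2 * (4 * e ^- 2) ^+ 2 * gq6 R * n%:R ^+ 2 * v ^+ 3 +
    (4 * h * e ^- 2) ^+ 2 * gq2 R * n%:R * v ^+ 2 <= dl ^+ 2 ->
  2 * (4 * h * e ^- 2) ^+ 2 * gq6 R * n%:R ^+ 2 * v' ^+ 3 +
    (8 * h ^+ 2 * e ^- 2) ^+ 2 * gq2 R * n%:R * v' ^+ 2 <= dl ^+ 2 ->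
  Ex P (fun w => `|kap / 4 * DD w + SS w|) <=
    r * (8 * K1 + 16 * Num.sqrt S) + kap * (Num.sqrt S + S') * dl.
Proof.
move=> dl0 c1 c2.
have mXX j : mom P (XX j) by apply: momB; exact: m4.
have k30 j k w : 0 <= kern h e 3 (V j w - V' k w) by case/andP: (kern_chi j k w).
pose A j w := \sum_(0 <= k < n) v' * kern h e 3 (V j w - V' k w).
have A0 j w : 0 <= A j w by apply: sumr_ge0 => k _; rewrite mulr_ge0 ?(ltW v0').
have mA j : mom P (A j).
  by apply: mom_sum => k; apply: momM; [exact: mom_cst|exact: m3].
pose B w := \sum_(0 <= j < n) XX j w * incr V j w.
have mB : mom P B by apply: mom_sum => j; apply: momM.
pose C w := \sum_(0 <= j < n) RR' j w * incr V j w.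
have mC : mom P C by apply: mom_sum => j; apply: momM.
pose D w := \sum_(0 <= k < n) v' * `|RR k w|.
have mD : mom P D by apply: mom_sum => k; apply: momM; [exact: mom_cst|exact: mom_norm].
have FXX j : Fm (G j) (XX j).
  by apply: FmB; apply: Fm_kern => //; exact: (walk_adapted wk).
have EB : Ex P (fun w => `|B w|) <= Num.sqrt S * (4 * h ^+ 2).
  apply: Ex_mart => // [|j]; first by rewrite mulr_ge0 ?sqr_ge0.
  apply: (@le_trans _ _ (Ex P (fun _ => (4 * h ^+ 2) ^+ 2))); last by rewrite Ex_cst.
  apply: le_Ex; [by apply: mom_Intg; exact: momX|exact: Intg_cst|].
  move=> w; rewrite -real_normK ?num_real// lerXn2r ?nnegrE ?mulr_ge0 ?(ltW h0)//.
  apply: (le_trans (ler_normB _ _)); apply: (le_trans (lerD (kern4_bd h0 e0 _) (kern4_bd h0 e0 _))).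
  by rewrite le_eqVlt; apply/orP; left; apply/eqP; ring.
have EC : Ex P (fun w => `|C w|) <= Num.sqrt S * dl.
  apply: Ex_mart => // j; last exact: (le_trans (proj2 (RR'_ito j))).
  apply: FmB; first apply: FmD => //; apply: Fm_sum => k.
    apply: FmM; first by apply: Fm_kern => //; exact: (walk_adapted wk).
    by apply: FmB.
  apply: FmM; last exact: Fm_cst.
  by apply: FmM; [apply: Fm_kern => //; exact: (walk_adapted wk)|exact: Fm_cst].
have ED : Ex P D <= S' * dl.
  rewrite /D Ex_sum; last first.
    by move=> k; apply: mom_Intg; apply: momM; [exact: mom_cst|exact: mom_norm].
  rewrite /S' -mulrA; apply: big_sum_le => k _.
  rewrite ExZ; last by apply: mom_Intg; exact: mom_norm.
  rewrite ler_wpM2l ?(ltW v0')//; apply: Ex_norm_le => //.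
  exact: (le_trans (proj2 (RR_ito k))).
have mAll : mom P (fun w => A n w + A 0%N w + (`|B w| + (`|C w| + D w))).
  by apply: momD; [apply: momD|apply: momD; [exact: mom_norm|apply: momD => //; exact: mom_norm]].
apply: (@le_trans _ _ (Ex P (fun w => kap * (A n w + A 0%N w + (`|B w| + (`|C w| + D w)))))).
  apply: le_Ex; [|by apply: mom_Intg; apply: momM; [exact: mom_cst|exact: mAll]|move=> w].
    apply: Intg_norm; apply: mom_Intg.
    apply: momD; last by apply: mom_sum => j; apply: momM.
    apply: momM; first exact: mom_cst.
    by apply: mom_sum => j; apply: mom_sum => k; apply: momM; [exact: mom_cst|exact: m1].
  rewrite DD_ito normrM (gtr0_norm kap0) ler_wpM2l ?(ltW kap0)//.
  have : `|\sum_(0 <= k < n) v' * RR k w| <= D w.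
    apply: (le_trans (ler_norm_sum _ _ _)); apply: ler_sum => k _.
    by rewrite normrM (gtr0_norm v0').
  rewrite -/(A n w) -/(A 0%N w) -/(B w) -/(C w).
  exact: norm_sum5_le.
rewrite ExZ; last by apply: mom_Intg.
have I1 : Intg P (fun w => A n w + A 0%N w) by apply: mom_Intg; exact: momD.
have I3 : Intg P (fun w => `|C w| + D w) by apply: IntgD; apply: mom_Intg => //; exact: mom_norm.
have I2 : Intg P (fun w => `|B w| + (`|C w| + D w)).
  by apply: IntgD => //; apply: mom_Intg; exact: mom_norm.
rewrite (ExD I1 I2) (ExD (mom_Intg (mA n)) (mom_Intg (mA 0%N))).
rewrite (ExD (mom_Intg (mom_norm mB)) I3) (ExD (mom_Intg (mom_norm mC)) (mom_Intg mD)).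
apply: (@le_trans _ _ (kap * (h ^+ 2 * K1 + h ^+ 2 * K1 + (Num.sqrt S * (4 * h ^+ 2) +
   (Num.sqrt S * dl + S' * dl))))).
  rewrite ler_wpM2l ?(ltW kap0)//.
  apply: lerD; first by apply: lerD; exact: Ex_kern3_row.
  by apply: lerD => //; apply: lerD.
have -> : kap * (h ^+ 2 * K1 + h ^+ 2 * K1 + (Num.sqrt S * (4 * h ^+ 2) +
   (Num.sqrt S * dl + S' * dl))) = r * (8 * K1 + 16 * Num.sqrt S) + kap * (Num.sqrt S + S') * dl.
  by rewrite kapE hE; field; rewrite gt_eqF.
by [].
Qed.

End biwalk.

(** * Stable convergence of martingale sums *)

Lemma sum_nat_block (R : realType) (f : nat -> R) N q :
  \sum_(0 <= j < N * q) f j = \sum_(0 <= u < N) \sum_(0 <= l < q) f (u * q + l)%N.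
Proof.
elim: N => [|N IH]; first by rewrite mul0n !big_geq.
by rewrite mulSn addnC sum_nat_split IH [RHS]big_nat_recr.
Qed.

Lemma expR_dist1 (R : realType) (x : R) : `|1 - expR x| <= `|x| * expR `|x|.
Proof.
have [x0|x0] := lerP 0 x.
  rewrite ler0_norm; last by rewrite subr_le0 -expR0 ler_expR.
  have := expR_ge1Dx (- x); rewrite expRN => h.
  have : (1 - x) * expR x <= 1.
    by rewrite -[leRHS](@mulVf _ (expR x)) ?gt_eqF ?expR_gt0// ler_wpM2r ?expR_ge0.
  by rewrite opprB ger0_norm// mulrBl mul1r; lra.
rewrite ger0_norm; last by rewrite subr_ge0 -expR0 ler_expR ltW.
have := expR_ge1Dx x => h.
have : - x * 1 <= - x * expR (- x).
  by rewrite ler_wpM2l ?oppr_ge0 ?(ltW x0)// -expR0 ler_expR oppr_ge0 ltW.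
by rewrite mulr1 ltr0_norm//; lra.
Qed.

(** * Truncation of the bracket *)

Section stopping.
Context d (T : measurableType d) (R : realType).
Variables (a : nat -> T -> R) (v K : R).
Hypotheses (v0 : 0 < v) (K0 : 0 <= K).

Definition brk n w := \sum_(0 <= j < n) a j w ^+ 2 * v.
(** The test includes step [j] itself: since [a j] is known at time [j], so is [brk j.+1]. The
    truncated coefficients thus remain adapted and their bracket never exceeds [K]. *)
Definition stp j w := a j w * b2r R (brk j.+1 w <= K).

Lemma brk_ge0 n w : 0 <= brk n w.
Proof. by apply: sumr_ge0 => j _; rewrite mulr_ge0 ?sqr_ge0 ?(ltW v0). Qed.

Lemma brk_mono m n w : (m <= n)%N -> brk m w <= brk n w.
Proof.
move=> mn; rewrite /brk [leRHS](@big_cat_nat _ _ _ m)//= lerDl.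
by apply: sumr_ge0 => j _; rewrite mulr_ge0 ?sqr_ge0 ?(ltW v0).
Qed.

Lemma stp_brk n w : \sum_(0 <= j < n) stp j w ^+ 2 * v <= K.
Proof.
elim: n => [|n IH]; first by rewrite big_geq.
have [h|h] := lerP (brk n.+1 w) K; last first.
  by rewrite big_nat_recr//= /stp (leNgt (brk n.+1 w)) h /b2r mulr0 expr0n mul0r addr0.
apply: le_trans h; apply: ler_sum => j _; rewrite ler_wpM2r ?(ltW v0)// /stp /b2r.
by case: (_ <= K); rewrite ?mulr1// mulr0 expr0n sqr_ge0.
Qed.

Lemma stp_full n w : brk n w <= K -> forall j, (j < n)%N -> stp j w = a j w.
Proof.
by move=> h j jn; rewrite /stp (le_trans (brk_mono _ jn) h) /b2r mulr1.
Qed.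

(** The bracket is monotone, so truncation amounts to stopping: once a coefficient is cut, all later
    ones are. Bounds on prefix sums of [a] therefore carry over to [stp]. *)
Lemma stp_prefix J w : exists2 J', (J' <= J)%N &
  \sum_(0 <= j < J) v * stp j w = \sum_(0 <= j < J') v * a j w.
Proof.
elim: J => [|J [J' J'J IH]]; first by exists 0%N; rewrite // !big_geq.
have [h|h] := lerP (brk J.+1 w) K.
  exists J.+1 => //; apply: eq_big_nat => j /andP[_ jJ].
  by rewrite (stp_full h).
exists J'; first exact: leqW.
by rewrite big_nat_recr//= IH /stp leNgt h /b2r !mulr0 addr0.
Qed.

(* An upper bound of the square of every prefix sum [\sum_(j < J) v * a j], in which only
   the prefix sums at multiples of [p] occur. *)
Definition envl p n w := 2 * (\sum_(0 <= u < (n %/ p).+1) (\sum_(0 <= j < p * u) v * a j w) ^+ 2)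
  + 2 * (p%:R * v * brk n w).

(** Round [J] down to a multiple of [p]; the fewer than [p] remaining steps are bounded by
    Cauchy-Schwarz and the bracket. *)
Lemma prefix_envl p n J w : (0 < p)%N -> (J <= n)%N ->
  (\sum_(0 <= j < J) v * a j w) ^+ 2 <= envl p n w.
Proof.
move=> p0 Jn; set u := (J %/ p)%N.
have uJ : (p * u <= J)%N by rewrite mulnC leq_trunc_div.
rewrite -{1}(subnKC uJ) sum_nat_split; apply: (le_trans (sqrD_le _ _)).
rewrite mulrDr /envl; apply: lerD; rewrite ler_wpM2l//.
  have un : (u < (n %/ p).+1)%N by rewrite ltnS leq_div2r.
  rewrite [leRHS](@big_cat_nat _ _ _ u.+1)//= [X in _ <= X + _]big_nat_recr//= -addrA addrCA lerDl.
  by apply: addr_ge0; apply: sumr_ge0 => j _; apply: sqr_ge0.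
apply: (le_trans (sum_sqr_le _ _)).
have Jp : (J - p * u <= p)%N.
  by have h1 := divn_eq J p; have h2 := ltn_pmod J p0; rewrite -/u in h1; clear -h1 h2; lia.
apply: (@le_trans _ _ (p%:R * \sum_(0 <= i < J - p * u) (v * a (p * u + i)%N w) ^+ 2)).
  by rewrite ler_wpM2r ?ler_nat//; apply: sumr_ge0 => j _; apply: sqr_ge0.
rewrite -mulrA ler_wpM2l//.
apply: (@le_trans _ _ (v * (brk (p * u) w + \sum_(0 <= i < J - p * u) a (p * u + i)%N w ^+ 2 * v))).
  rewrite mulrDr mulr_sumr -[leLHS]add0r lerD//.
    by rewrite mulr_ge0 ?(ltW v0)//; exact: brk_ge0.
  by apply: ler_sum => i _; rewrite exprMn expr2 -mulrA [a _ _ ^+ 2 * v]mulrC.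
by rewrite /brk -sum_nat_split subnKC// ler_wpM2l ?(ltW v0)//; exact: brk_mono.
Qed.

Lemma envl_ge0 p n w : (0 < p)%N -> 0 <= envl p n w.
Proof. by move=> p0; apply: (le_trans (sqr_ge0 _) (prefix_envl w p0 (leq0n n))). Qed.

(** A block is the difference of two prefix sums. *)
Lemma stp_block p n u q w : (0 < p)%N -> (u.+1 * q <= n)%N ->
  `|\sum_(0 <= l < q) v * stp (u * q + l)%N w| <= 2 * Num.sqrt (envl p n w).
Proof.
move=> p0 un.
have B J : (J <= n)%N -> `|\sum_(0 <= j < J) v * stp j w| <= Num.sqrt (envl p n w).
  move=> Jn; have [J' J'J ->] := stp_prefix J w.
  by rewrite -sqrtr_sqr ler_wsqrtr// prefix_envl// (leq_trans J'J).
have un' : (u * q <= n)%N by apply: leq_trans un; rewrite leq_mul2r leqnSn orbT.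
have := B _ un; rewrite mulSn addnC sum_nat_split => h1; have h2 := B _ un'.
set x := \sum_(0 <= j < u * q) _ in h1 h2; set y := \sum_(0 <= l < q) _ in h1 *.
have -> : y = (x + y) - x by ring.
by apply: (le_trans (ler_normB _ _)); lra.
Qed.

End stopping.

Section expZ.
Context d (T : measurableType d) (R : realType).
Variables (V : nat -> T -> R) (v : R) (n : nat) (lam ph : R).
(** The real part of e^(i ph) times the complex exponential martingale. With the phase [ph] free,
    its real and imaginary parts are both covered. *)
Definition expZ (b : nat -> T -> R) w :=
  expR (lam ^+ 2 / 2 * \sum_(0 <= k < n) b k w ^+ 2 * v) *
  cos (ph + lam * \sum_(0 <= k < n) b k w * incr V k w).

Lemma expZ_bd b K w : \sum_(0 <= k < n) b k w ^+ 2 * v <= K ->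
  `|expZ b w| <= expR (lam ^+ 2 / 2 * K).
Proof.
move=> bK; rewrite /expZ normrM ger0_norm ?expR_ge0//.
rewrite -[leRHS]mulr1 ler_pM ?expR_ge0//.
  by rewrite ler_expR ler_wpM2l// divr_ge0 ?sqr_ge0.
by rewrite ler_norml cos_geN1 cos_le1.
Qed.

Lemma measurable_expZ b : (forall k, measurable_fun setT (V k)) ->
  (forall k, measurable_fun setT (b k)) -> measurable_fun setT (expZ b).
Proof.
move=> mV mb; apply: measurable_funM.
  apply: measurableT_comp => //; apply: measurable_funM => //.
  apply: measurable_fun_bigsum => k; apply: measurable_funM => //.
  exact: measurable_funX.
apply: (measurableT_comp (continuous_measurable_fun (@continuous_cos R))).
apply: measurable_funD => //; apply: measurable_funM => //.
apply: measurable_fun_bigsum => k; apply: measurable_funM => //.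
exact: measurable_funB.
Qed.
End expZ.

(** * Products of two exponential martingales *)

Section cross.
Context d (T : measurableType d) (R : realType) (P : probability T R).
Variables (G : nat -> set (set T)) (V : nat -> T -> R) (v : R).
Hypothesis wk : walk P G V v.
Variables (n : nat) (lam ph K : R) (b c : nat -> T -> R).
Hypotheses (mb : forall k, Fm (G k) (b k)) (mc : forall k, (k < n)%N -> Fm (G k) (c k)).
Hypotheses (mmc : forall k, measurable_fun setT (c k)).
Hypotheses (bK : forall w, \sum_(0 <= k < n) b k w ^+ 2 * v <= K).
Hypotheses (cK : forall w, \sum_(0 <= k < n) c k w ^+ 2 * v <= K).
Let v0 := walk_gt0 wk.
Let GG w := \sum_(0 <= k < n) b k w * c k w * v.
Let expb := expZ V v n lam ph b.
Let expc := expZ V v n lam ph c.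

Let mV := walk_meas wk.
Let mb' k : measurable_fun setT (b k). Proof. exact: (@Fm_measT _ _ _ _ _ _ _ wk k _ (@mb k)). Qed.
Let mG : measurable_fun setT GG.
Proof.
by apply: measurable_fun_bigsum => k; apply: measurable_funM => //; apply: measurable_funM.
Qed.

Let GK w : `|GG w| <= K.
Proof.
apply: (le_trans (ler_norm_sum _ _ _)).
apply: (@le_trans _ _ (2^-1 * (\sum_(0 <= k < n) b k w ^+ 2 * v + \sum_(0 <= k < n) c k w ^+ 2 * v))).
  rewrite -big_split/= mulr_sumr; apply: ler_sum => k _.
  rewrite !normrM (gtr0_norm v0) -mulrDl mulrA ler_wpM2r ?(ltW v0)//.
  rewrite -[b k w ^+ 2]real_normK ?num_real// -[c k w ^+ 2]real_normK ?num_real//.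
  by have := sqr_ge0 (`|b k w| - `|c k w|); rewrite sqrrB; lra.
by have := bK w; have := cK w; lra.
Qed.

Let pm (s : R) : s ^+ 2 = 1 -> forall w,
  \sum_(0 <= k < n) (lam * (b k w + s * c k w)) ^+ 2 * v =
  lam ^+ 2 * (\sum_(0 <= k < n) b k w ^+ 2 * v + \sum_(0 <= k < n) c k w ^+ 2 * v
    + 2 * s * GG w).
Proof.
move=> s1 w; rewrite /GG [2 * s * _]mulr_sumr -!big_split/= mulr_sumr; apply: eq_bigr => k _.
transitivity (lam ^+ 2 * (b k w ^+ 2 + s ^+ 2 * c k w ^+ 2 + 2 * s * b k w * c k w) * v).
  by ring.
by rewrite s1; ring.
Qed.

Let Zs s ps w := expR ((\sum_(0 <= k < n) (lam * (b k w + s * c k w)) ^+ 2 * v) / 2) *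
  cos (ps + \sum_(0 <= k < n) (lam * (b k w + s * c k w)) * incr V k w).

Let mZs s ps : measurable_fun setT (Zs s ps).
Proof.
have m1 k : measurable_fun setT (fun w => lam * (b k w + s * c k w)).
  by apply: measurable_funM => //; apply: measurable_funD => //; exact: measurable_funM.
apply: measurable_funM.
  apply: measurableT_comp => //; apply: measurable_funM => //.
  apply: measurable_fun_bigsum => k; apply: measurable_funM => //.
  exact: measurable_funX.
apply: (measurableT_comp (continuous_measurable_fun (@continuous_cos R))).
apply: measurable_funD => //; apply: measurable_fun_bigsum => k; apply: measurable_funM => //.
exact: measurable_funB.
Qed.

Let ZsK s : s ^+ 2 = 1 -> forall w,
  \sum_(0 <= k < n) (lam * (b k w + s * c k w)) ^+ 2 * v <= lam ^+ 2 * (4 * K).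
Proof.
move=> s1 w; rewrite pm// ler_wpM2l ?sqr_ge0//.
have s1' : `|s| = 1 by apply/eqP; rewrite -sqrp_eq1// real_normK ?num_real// s1.
have : `|s * GG w| <= K by rewrite normrM s1' mul1r.
rewrite ler_norml => /andP[_ h]; have := bK w; have := cK w; lra.
Qed.

Let Zs_bd s ps : s ^+ 2 = 1 -> forall w, `|Zs s ps w| <= expR (lam ^+ 2 * (4 * K) / 2).
Proof.
move=> s1 w; rewrite /Zs normrM ger0_norm ?expR_ge0// -[leRHS]mulr1 ler_pM ?expR_ge0//.
  by rewrite ler_expR ler_wpM2r// ZsK.
by rewrite ler_norml cos_geN1 cos_le1.
Qed.

Let ExZs s ps : s ^+ 2 = 1 -> Ex P (Zs s ps) = cos ps.
Proof.
move=> s1; apply: (@exp_martingale _ _ _ _ _ _ _ wk (fun k w => lam * (b k w + s * c k w)) n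
  (lam ^+ 2 * (4 * K)) ps _ (ZsK s1)) => k kn.
apply: FmM; first exact: Fm_cst.
by apply: FmD => //; apply: FmM; [exact: Fm_cst|exact: mc].
Qed.

Let prodE w : expb w * expc w =
  2^-1 * (Zs 1 (2 * ph) w * expR (- (lam ^+ 2 * GG w)) +
          Zs (-1) 0 w * expR (lam ^+ 2 * GG w)).
Proof.
rewrite /expb /expc /expZ /Zs.
have -> : \sum_(0 <= k < n) lam * (b k w + 1 * c k w) * incr V k w =
  lam * (\sum_(0 <= k < n) b k w * incr V k w) + lam * \sum_(0 <= k < n) c k w * incr V k w.
  by rewrite -mulrDr -big_split/= mulr_sumr; apply: eq_bigr => k _; ring.
have -> : \sum_(0 <= k < n) lam * (b k w + -1 * c k w) * incr V k w =
  lam * (\sum_(0 <= k < n) b k w * incr V k w) - lam * \sum_(0 <= k < n) c k w * incr V k w.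
  by rewrite -mulrBr -sumrB mulr_sumr; apply: eq_bigr => k _; ring.
rewrite !pm ?expr1n// ?sqrrN ?expr1n//.
set X := lam * _; set Y := lam * _.
set bb := \sum_(0 <= k < n) b k w ^+ 2 * v; set cc := \sum_(0 <= k < n) c k w ^+ 2 * v.
have -> : 2 * ph + (X + Y) = (ph + X) + (ph + Y) by ring.
have -> : 0 + (X - Y) = (ph + X) - (ph + Y) by ring.
generalize (ph + X) (ph + Y) => x1 y1.
rewrite cosD cosB.
have E1 : expR (lam ^+ 2 * (bb + cc + 2 * 1 * GG w) / 2) * expR (- (lam ^+ 2 * GG w)) =
  expR (lam ^+ 2 / 2 * bb) * expR (lam ^+ 2 / 2 * cc).
  by rewrite -!expRD; congr expR; field.
have E2 : expR (lam ^+ 2 * (bb + cc + 2 * -1 * GG w) / 2) * expR (lam ^+ 2 * GG w) =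
  expR (lam ^+ 2 / 2 * bb) * expR (lam ^+ 2 / 2 * cc).
  by rewrite -!expRD; congr expR; field.
rewrite [X in 2^-1 * (X + _)]mulrAC E1 [X in 2^-1 * (_ + X)]mulrAC E2.
by field.
Qed.

(** A product of cosines is half the cosine of the sum plus half that of the difference. Each half
    is an exponential martingale with coefficients b + c or b - c, up to the factor exp(-lam^2 GG)
    or exp(lam^2 GG) from the mixed bracket [GG]. If [GG] were 0 the mean would be (cos (2 ph) + 1)
    / 2 = (cos ph)^2. *)
Lemma cross_bound : 0 <= K ->
  `|Ex P (fun w => expb w * expc w) - cos ph ^+ 2| <=
  expR (lam ^+ 2 * (4 * K) / 2) * (lam ^+ 2 * expR (lam ^+ 2 * K)) * Ex P (fun w => `|GG w|).
Proof.
move=> K0.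
have s1 : (1 : R) ^+ 2 = 1 by rewrite expr1n.
have s2 : (-1 : R) ^+ 2 = 1 by rewrite sqrrN expr1n.
have -> : cos ph ^+ 2 = Ex P (fun w => 2^-1 * (Zs 1 (2 * ph) w + Zs (-1) 0 w)).
  rewrite ExZ; last by apply: IntgD; apply: (Intg_bd P); [exact: mZs|exact: Zs_bd|exact: mZs|exact: Zs_bd].
  rewrite ExD; [|by apply: (Intg_bd P); [exact: mZs|exact: Zs_bd]|by apply: (Intg_bd P); [exact: mZs|exact: Zs_bd]].
  rewrite !ExZs// cos0 (_ : 2 * ph = ph + ph); last by ring.
  by rewrite cosD; have := cos2Dsin2 ph; rewrite -!expr2 => h; lra.
have mexp : measurable_fun setT (fun w => expb w * expc w).
  by apply: measurable_funM; exact: measurable_expZ.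
have I1 : Intg P (fun w => expb w * expc w).
  apply: (@Intg_bd _ _ _ _ _ (expR (lam ^+ 2 / 2 * K) * expR (lam ^+ 2 / 2 * K))) => // w.
  by rewrite normrM ler_pM// expZ_bd.
have I2 : Intg P (fun w => 2^-1 * (Zs 1 (2 * ph) w + Zs (-1) 0 w)).
  by apply: IntgZ; apply: IntgD; apply: (Intg_bd P); [exact: mZs|exact: Zs_bd|exact: mZs|exact: Zs_bd].
rewrite -ExB//; apply: (le_trans (le_norm_Ex _)).
  by apply: IntgD => //; exact: IntgN.
have IG : Intg P (fun w => `|GG w|).
  by apply: Intg_norm; apply: (Intg_bd P mG GK).
rewrite -ExZ//; apply: le_Ex; [|exact: IntgZ|].
  by apply: Intg_norm; apply: IntgD => //; exact: IntgN.
move=> w; rewrite prodE.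
set A := Zs 1 _ w; set B := Zs (-1) _ w; set g := GG w.
have -> : 2^-1 * (A * expR (- (lam ^+ 2 * g)) + B * expR (lam ^+ 2 * g)) - 2^-1 * (A + B) =
  - (2^-1 * (A * (1 - expR (- (lam ^+ 2 * g))) + B * (1 - expR (lam ^+ 2 * g)))) by ring.
rewrite normrN normrM ger0_norm ?invr_ge0//.
set M := expR (lam ^+ 2 * (4 * K) / 2).
have H (x y : R) : `|x| <= M -> `|y| = lam ^+ 2 * `|g| ->
   `|x * (1 - expR y)| <= M * (lam ^+ 2 * expR (lam ^+ 2 * K)) * `|g|.
  move=> xM yg; rewrite normrM -mulrA ler_pM//.
  apply: (le_trans (expR_dist1 _)); rewrite yg [leRHS]mulrAC ler_wpM2l ?(mulr_ge0 (sqr_ge0 _) (normr_ge0 _))//.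
  by rewrite ler_expR ler_wpM2l ?sqr_ge0 ?GK.
have ng : `|lam ^+ 2 * g| = lam ^+ 2 * `|g| by rewrite normrM ger0_norm ?sqr_ge0.
have h1 := H _ (- (lam ^+ 2 * g)) (Zs_bd (2 * ph) s1 w); rewrite normrN in h1.
have h2 := H _ (lam ^+ 2 * g) (Zs_bd 0 s2 w).
have := h1 ng; have := h2 ng; rewrite -/A -/B => {}h1 {}h2.
have := ler_normD (A * (1 - expR (- (lam ^+ 2 * g)))) (B * (1 - expR (lam ^+ 2 * g))).
move: h1 h2; set x := `|_ * _|; set y := `|_ * _|; set z := `|_ + _|; set t := _ * `|g|; lra.
Qed.

End cross.

Section renyi.
Context d (T : measurableType d) (R : realType) (P : probability T R).

(* Renyi's mixing lemma: if [Ex (z n * Y)] stayed away from 0, the averages of an almost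
   orthogonal subsequence would contradict Cauchy-Schwarz. *)
Lemma renyi_mixing (z : nat -> T -> R) (Y : T -> R) (B M : R) :
  (forall n, measurable_fun setT (z n)) -> measurable_fun setT Y ->
  (forall n w, `|z n w| <= B) -> (forall w, `|Y w| <= M) ->
  (forall m, Ex P (fun w => z n w * z m w) @[n --> \oo] --> 0) ->
  Ex P (fun w => z n w * Y w) @[n --> \oo] --> 0.
Proof.
move=> mz mY zB YM cr.
have B0 : 0 <= B by have := le_trans (normr_ge0 _) (zB 0%N point).
have M0 : 0 <= M by have := le_trans (normr_ge0 _) (YM point).
apply/cvgrPdist_lt => /= eps eps0.
apply: contrapT => H.
have inf N : exists2 n, (N <= n)%N & eps <= `|Ex P (fun w => z n w * Y w)|.
  apply: contrapT => H'; apply: H; exists N => // n /= Nn.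
  by rewrite sub0r normrN ltNge; apply/negP => h; apply: H'; exists n.
pose sg n : R := if 0 <= Ex P (fun w => z n w * Y w) then 1 else -1.
have sgE n : sg n * Ex P (fun w => z n w * Y w) = `|Ex P (fun w => z n w * Y w)|.
  rewrite /sg; case: ifPn => [h|]; first by rewrite mul1r ger0_norm.
  by rewrite -ltNge => h; rewrite mulN1r ltr0_norm.
have sg1 n : `|sg n| = 1 by rewrite /sg; case: ifP; rewrite ?normrN normr1.
pose x n w := sg n * z n w.
have mx n : measurable_fun setT (x n) by exact: measurable_funM.
have xB n w : `|x n w| <= B by rewrite normrM sg1 mul1r.
have IxY n : Intg P (fun w => x n w * Y w).
  apply: (@Intg_bd _ _ _ _ _ (B * M)); first exact: measurable_funM.
  by move=> w; rewrite normrM ler_pM.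
have Ixx n m : Intg P (fun w => x n w * x m w).
  apply: (@Intg_bd _ _ _ _ _ (B * B)); first exact: measurable_funM.
  by move=> w; rewrite normrM ler_pM.
(* Only finitely many indices have been selected so far, so a far enough index is almost orthogonal
   to all of them at once. *)
have small (del : R) (s : seq nat) : 0 < del -> exists n, eps <= Ex P (fun w => x n w * Y w) /\
    forall m, m \in s -> Ex P (fun w => x n w * x m w) <= del.
  move=> del0.
  have [N HN] : exists N, forall n, (N <= n)%N -> forall m, m \in s ->
      `|Ex P (fun w => z n w * z m w)| <= del.
    elim: s => [|m s [N HN]]; first by exists 0%N.
    have /cvgrPdist_le/(_ _ del0)[N' _ HN'] := cr m.
    exists (maxn N N') => n; rewrite geq_max => /andP[h1 h2] m'.
    rewrite inE => /orP[/eqP->|]; last exact: HN.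
    by have := HN' n h2; rewrite /= sub0r normrN.
  have [n Nn hn] := inf N; exists n; split.
    rewrite (_ : (fun w => x n w * Y w) = fun w => sg n * (z n w * Y w)).
      rewrite ExZ ?sgE//; apply: (@Intg_bd _ _ _ _ _ (B * M)); first exact: measurable_funM.
      by move=> w; rewrite normrM ler_pM.
    by apply/funext => w; rewrite /x mulrA.
  move=> m ms; apply: le_trans (HN n Nn m ms).
  rewrite (_ : (fun w => x n w * x m w) = fun w => sg n * sg m * (z n w * z m w)).
    rewrite ExZ; last first.
      apply: (@Intg_bd _ _ _ _ _ (B * B)); first exact: measurable_funM.
      by move=> w; rewrite normrM ler_pM.
    apply: (le_trans (ler_norm _)); by rewrite !normrM !sg1 !mul1r.
  by apply/funext => w; rewrite /x; ring.
pose X (s : seq nat) w := \sum_(m <- s) x m w.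
have mX s : measurable_fun setT (X s) by exact: measurable_fun_bigsum.
have IX (s : seq nat) : Intg P (fun w => X s w ^+ 2) /\ Intg P (fun w => X s w * Y w).
  have XB w : `|X s w| <= \sum_(m <- s) B.
    by apply: (le_trans (ler_norm_sum _ _ _)); apply: ler_sum.
  split.
    apply: (@Intg_bd _ _ _ _ _ ((\sum_(m <- s) B) ^+ 2)); first exact: measurable_funX.
    by move=> w; rewrite normrX lerXn2r ?nnegrE//; apply: sumr_ge0.
  apply: (@Intg_bd _ _ _ _ _ ((\sum_(m <- s) B) * M)); first exact: measurable_funM.
  by move=> w; rewrite normrM ler_pM//; apply: sumr_ge0.
have build (del : R) N : 0 < del -> exists s : seq nat,
    N%:R * eps <= Ex P (fun w => X s w * Y w) /\
    Ex P (fun w => X s w ^+ 2) <= N%:R * B ^+ 2 + N%:R ^+ 2 * del.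
  move=> del0; suff [s [h1 h2 _]] : exists s : seq nat,
    [/\ N%:R * eps <= Ex P (fun w => X s w * Y w),
    Ex P (fun w => X s w ^+ 2) <= N%:R * B ^+ 2 + N%:R ^+ 2 * del & size s = N] by exists s.
  elim: N => [|N [s [h1 h2 sN]]].
    exists [::]; split => //.
      by rewrite mul0r; apply: Ex_ge0 => w; rewrite /X big_nil mul0r.
    rewrite !mul0r expr0n/= mul0r addr0.
    rewrite (_ : (fun w => _) = fun _ => 0) ?Ex_cst//.
    by apply/funext => w; rewrite /X big_nil expr0n.
  have [n [hn1 hn2]] := small del s del0; exists (n :: s); split; last by rewrite /= sN.
    rewrite (_ : (fun w => _) = fun w => x n w * Y w + X s w * Y w).
      by rewrite ExD ?(proj2 (IX s))// -natr1 mulrDl mul1r addrC lerD.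
    by apply/funext => w; rewrite /X big_cons mulrDl.
  rewrite (_ : (fun w => _) = fun w => x n w * x n w + (2 * (\sum_(m <- s) x n w * x m w) + X s w ^+ 2)).
    have Is : Intg P (fun w => \sum_(m <- s) x n w * x m w) by exact: Intg_sum.
    rewrite ExD//; last by apply: IntgD; [exact: IntgZ|exact: (proj1 (IX s))].
    rewrite ExD; [|exact: IntgZ|exact: (proj1 (IX s))].
    rewrite ExZ// Ex_sum//.
    have e1 : Ex P (fun w => x n w * x n w) <= B ^+ 2.
      rewrite -[leRHS](Ex_cst P); apply: le_Ex => //; first exact: Intg_cst.
      move=> w; rewrite -expr2 -real_normK ?num_real// lerXn2r ?nnegrE//.
    have e2 : \sum_(m <- s) Ex P (fun w => x n w * x m w) <= N%:R * del.
      apply: (@le_trans _ _ (\sum_(m <- s) del)).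
        by rewrite big_seq [leRHS]big_seq; apply: ler_sum => m ms; exact: hn2.
      have -> : \sum_(m <- s) del = (size s)%:R * del.
        elim: (s) => [|m s' IH]; first by rewrite big_nil mul0r.
        by rewrite big_cons IH/= -natr1 mulrDl mul1r addrC.
      by rewrite sN.
    rewrite (_ : N.+1%:R = N%:R + 1 :> R); last by rewrite natr1.
    rewrite sqrrD expr1n mulr1.
    by move: e1 e2 h2 del0; set p := Ex P _; set q := \sum_(m <- s) _; set t := Ex P _; nra.
  apply/funext => w; rewrite /X big_cons sqrrD -mulr_sumr -expr2 -addrA; congr (_ + _).
  by rewrite mulrA [2 * _ * _]mulrC -mulr_natr; ring.
have key N (del : R) : 0 < del -> (0 < N)%N -> eps ^+ 2 <= (B ^+ 2 / N%:R + del) * M ^+ 2.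
  move=> del0 N0; have [s [h1 h2]] := build del N del0.
  have N0' : 0 < N%:R :> R by rewrite ltr0n.
  (* Cauchy-Schwarz via a square with a free multiplier *)
  have cs (t : R) : 2 * t * Ex P (fun w => X s w * Y w) <=
      Ex P (fun w => X s w ^+ 2) + t ^+ 2 * M ^+ 2.
    rewrite -ExZ ?(proj2 (IX s))// -[t ^+ 2 * _](Ex_cst P) -ExD; [|exact: (proj1 (IX s))|exact: Intg_cst].
    apply: le_Ex; [exact: IntgZ (proj2 (IX s))|apply: IntgD; [exact: (proj1 (IX s))|exact: Intg_cst]|].
    move=> w; have : Y w ^+ 2 <= M ^+ 2 by rewrite -real_normK ?num_real// lerXn2r ?nnegrE.
    have := sqr_ge0 (X s w - t * Y w); have := sqr_ge0 t; nra.
  (* The optimal multiplier below divides by [M ^+ 2]. For M = 0 the term in t^2 disappears, and a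
     large enough multiplier contradicts the lower bound [N%:R * eps]. *)
  have [M00|M00] := eqVneq M 0.
    have := cs (N%:R * eps * 0 + (N%:R * B ^+ 2 + N%:R ^+ 2 * del + 1) / (N%:R * eps)).
    rewrite M00 expr0n/= !mulr0 add0r addr0 => h.
    have Ne : 0 < N%:R * eps by rewrite mulr_gt0.
    set q := N%:R * B ^+ 2 + _ in h2 h.
    have q0 : 0 < q + 1.
      by rewrite /q ltr_wpDl// addr_ge0 ?mulr_ge0 ?sqr_ge0 ?(ltW del0)// ltW.
    have : (q + 1) / (N%:R * eps) * (N%:R * eps) <= (q + 1) / (N%:R * eps) * Ex P (fun w => X s w * Y w).
      by rewrite ler_wpM2l// divr_ge0// ltW.
    by rewrite divfK ?gt_eqF//; move: h h2; rewrite -mulrA; lra.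
  have Mp : 0 < M by rewrite lt_def M00.
  (* This multiplier maximises 2 t N eps - t^2 M^2, with value (N eps)^2 / M^2. *)
  have := cs (N%:R * eps / M ^+ 2); set E1 := Ex P _ in h1 *; set E2 := Ex P _ in h2 *.
  have M2 : 0 < M ^+ 2 by rewrite exprn_gt0.
  rewrite exprMn exprVn => h.
  have h3 : 2 * (N%:R * eps / M ^+ 2) * (N%:R * eps) <= 2 * (N%:R * eps / M ^+ 2) * E1.
    by rewrite ler_wpM2l// !mulr_ge0 ?invr_ge0 ?(ltW eps0) ?(ltW M2).
  have h4 : (N%:R * eps) ^+ 2 / M ^+ 2 <= N%:R * B ^+ 2 + N%:R ^+ 2 * del.
    have e : (N%:R * eps) ^+ 2 * (M ^+ 2) ^- 2 * M ^+ 2 = (N%:R * eps) ^+ 2 / M ^+ 2.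
      by field; rewrite gt_eqF.
    have e' : 2 * (N%:R * eps / M ^+ 2) * (N%:R * eps) = 2 * ((N%:R * eps) ^+ 2 / M ^+ 2).
      by field; rewrite gt_eqF.
    by move: h h3; rewrite e e'; lra.
  rewrite ler_pdivrMr// in h4.
  have N2 : 0 < N%:R ^+ 2 :> R by rewrite exprn_gt0.
  rewrite -(ler_pM2l N2) -exprMn; apply: (le_trans h4).
  rewrite le_eqVlt; apply/orP; left; apply/eqP.
  by field; rewrite gt_eqF.
(* With [N] such that B^2/N is at most [del], the bound in [key] is at most eps^2/2, which is
   absurd. *)
pose del := eps ^+ 2 / (4 * (M ^+ 2 + 1)).
have M1 : 0 < M ^+ 2 + 1 by rewrite ltr_wpDl ?sqr_ge0.
have del0 : 0 < del by rewrite divr_gt0 ?exprn_gt0 ?mulr_gt0.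
pose N := (Num.truncn (B ^+ 2 / del)).+1.
have N0 : 0 < N%:R :> R by rewrite ltr0n.
have BN : B ^+ 2 / N%:R <= del.
  by rewrite ler_pdivrMr// mulrC -ler_pdivrMr// ltW// truncnS_gt.
have := key N del del0 (ltn0Sn _).
have : (B ^+ 2 / N%:R + del) * M ^+ 2 <= (2 * del) * (M ^+ 2 + 1).
  apply: ler_pM; [|exact: sqr_ge0|by move: BN; lra|by rewrite lerDl].
  by rewrite addr_ge0 ?(ltW del0)// divr_ge0 ?sqr_ge0// ltW.
have -> : 2 * del * (M ^+ 2 + 1) = eps ^+ 2 / 2 by rewrite /del; field; rewrite gt_eqF.
by have := exprn_gt0 2 eps0; lra.
Qed.

End renyi.

(** * Mixing and stable convergence along nested grids *)

Section mixing.
Context d (T : measurableType d) (R : realType) (P : probability T R).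
Variables (G : nat -> nat -> set (set T)) (V : nat -> nat -> T -> R) (v : nat -> R)
  (n : nat -> nat) (a : nat -> nat -> T -> R) (r : nat -> R) (S C : R).
Hypothesis wk : forall i, walk P (G i) (V i) (v i).
Hypothesis nv : forall i, (n i)%:R * v i = S.
Hypothesis ma : forall i j, Fm (G i j) (a i j).
Hypothesis moma : forall i j, mom P (a i j).
Hypothesis nest : forall m i, (m <= i)%N -> exists2 q : nat, (0 < q)%N &
  [/\ n i = (n m * q)%N, v m = q%:R * v i, (forall u, V m u = V i (u * q)%N) &
      forall u, <<s G m u >> `<=` <<s G i (u * q)%N >>].
Hypotheses (r0 : forall i, 0 < r i) (r1 : forall i, r i <= 1) (vr : forall i, v i <= r i).
Hypothesis rcv : r i @[i --> \oo] --> (0 : R).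
Hypothesis weak : forall i J, (J <= n i)%N ->
  Ex P (fun w => (\sum_(0 <= j < J) v i * a i j w) ^+ 2) <= C * r i ^+ 2.
Hypothesis EB : forall i, Ex P (brk (a i) (v i) (n i)) <= C.

Let v0 i : 0 < v i. Proof. exact: walk_gt0 (wk i). Qed.
Let mV i k : measurable_fun setT (V i k). Proof. exact: (walk_meas (wk i)). Qed.
Let ma' i j : measurable_fun setT (a i j). Proof. exact: mom_meas (moma i j). Qed.
Let S0 : 0 <= S. Proof. by rewrite -(nv 0%N) mulr_ge0 ?(ltW (v0 _)). Qed.
Let C0 : 0 <= C.
Proof. by apply: le_trans (EB 0%N); apply: Ex_ge0 => w; apply: brk_ge0. Qed.

(** The coarse mesh [p i * v i] is of order [r i]. There are then about S/r prefix sums with mean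
    square at most C r^2 each, and the remainder term costs about r C, so both parts of the envelope
    are of order r. This summation does the work of a maximal inequality. *)
Let p i := (Num.truncn (r i / v i)).+1.
Let pv1 i : r i <= (p i)%:R * v i.
Proof. by rewrite -ler_pdivrMr//; apply: ltW; apply: truncnS_gt. Qed.
Let pv2 i : (p i)%:R * v i <= 2 * r i.
Proof.
rewrite /p -natr1 [leLHS]mulrDl mul1r; have : (Num.truncn (r i / v i))%:R * v i <= r i.
  by rewrite -ler_pdivlMr// truncn_le// divr_ge0 ?(ltW (r0 _)) ?(ltW (v0 _)).
by have := vr i; lra.
Qed.

Let env i := envl (a i) (v i) (p i) (n i).

Let mom_brk i m : mom P (brk (a i) (v i) m).
Proof. by apply: mom_sum => j; apply: momM; [exact: momX|exact: mom_cst]. Qed.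

Let mom_pre i m : mom P (fun w => (\sum_(0 <= j < m) v i * a i j w) ^+ 2).
Proof. by apply: momX; apply: mom_sum => j; apply: momM; [exact: mom_cst|exact: moma]. Qed.

Let mom_env i : mom P (env i).
Proof.
apply: momD; apply: momM; try exact: mom_cst.
  by apply: mom_sum => u.
by apply: momM; [exact: mom_cst|].
Qed.

Let Ex_env i : Ex P (env i) <= C * (2 * S + 6) * r i.
Proof.
rewrite /env /envl ExD; last 2 first.
- by apply: IntgZ; apply: mom_Intg; apply: mom_sum => u.
- by apply: IntgZ; apply: IntgZ; apply: mom_Intg.
rewrite ExZ; last by apply: mom_Intg; apply: mom_sum => u.
rewrite ExZ; last by apply: IntgZ; apply: mom_Intg.
rewrite ExZ; last by apply: mom_Intg.
rewrite Ex_sum; last by move=> u; apply: mom_Intg.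
have A1 : \sum_(0 <= u < (n i %/ p i).+1)
    Ex P (fun w => (\sum_(0 <= j < p i * u) v i * a i j w) ^+ 2) <=
    (n i %/ p i).+1%:R * (C * r i ^+ 2).
  apply: big_sum_le => u un; apply: weak.
  by rewrite mulnC; apply: leq_trans (leq_trunc_div (n i) (p i)); rewrite leq_mul2r -ltnS un orbT.
have A2 : (n i %/ p i).+1%:R * r i <= S + 1.
  rewrite -natr1 mulrDl mul1r lerD//; apply: (@le_trans _ _ ((n i %/ p i)%:R * ((p i)%:R * v i))).
    by rewrite ler_wpM2l.
  by rewrite mulrA -natrM -(nv i) ler_wpM2r ?(ltW (v0 _))// ler_nat leq_trunc_div.
have A3 : (n i %/ p i).+1%:R * (C * r i ^+ 2) <= C * r i * (S + 1).
  rewrite (_ : _ * (C * r i ^+ 2) = C * r i * ((n i %/ p i).+1%:R * r i)); last by ring.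
  by rewrite ler_wpM2l ?mulr_ge0 ?(ltW (r0 _)).
have A4 : (p i)%:R * v i * Ex P (brk (a i) (v i) (n i)) <= 2 * r i * C.
  rewrite ler_pM ?mulr_ge0 ?(ltW (v0 _))//.
  by apply: Ex_ge0 => w; apply: brk_ge0.
have := le_trans A1 A3; set x := \sum_(_ <= _ < _) _; set y := _ * Ex P _ in A4 *.
move=> {A1 A3}A1.
have -> : C * (2 * S + 6) * r i = 2 * (C * r i * (S + 1)) + 2 * (2 * r i * C) by ring.
by apply: lerD; rewrite ler_wpM2l.
Qed.

Section fixed_truncation.
Variables (lam ph K : R).
Hypothesis K0 : 0 <= K.

Let b i := stp (a i) (v i) K.
Let Z i := expZ (V i) (v i) (n i) lam ph (b i).

Let mb i j : Fm (G i j) (b i j).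
Proof.
apply: FmM; first exact: ma.
apply: Fm_ler; last exact: Fm_cst.
apply: Fm_sum_nat => l /andP[_ lj]; apply: FmM; last exact: Fm_cst.
by apply: FmX; apply: (walk_lift (wk i) (_ : (l <= j)%N)).
Qed.

Let mb' i j : measurable_fun setT (b i j).
Proof. exact: (@Fm_measT _ _ _ _ _ _ _ (wk i) j _ (@mb i j)). Qed.

Let bK i w : \sum_(0 <= k < n i) b i k w ^+ 2 * v i <= K.
Proof. exact: stp_brk. Qed.

Let Zbd i w : `|Z i w| <= expR (lam ^+ 2 / 2 * K).
Proof. by apply: expZ_bd. Qed.

Let mZ i : measurable_fun setT (Z i).
Proof. exact: measurable_expZ. Qed.

Let ExZi i : Ex P (Z i) = cos ph.
Proof.
have H := @exp_martingale _ _ _ _ _ _ _ (wk i) (fun k w => lam * b i k w) (n i)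
  (lam ^+ 2 * K) ph _ _.
rewrite -H => [|k _|w]; last 2 first.
- by apply: FmM; [exact: Fm_cst|].
- rewrite (_ : \sum_(0 <= k < n i) _ = lam ^+ 2 * \sum_(0 <= k < n i) b i k w ^+ 2 * v i).
    by rewrite ler_wpM2l ?sqr_ge0.
  by rewrite mulr_sumr; apply: eq_bigr => k _; rewrite [(lam * _) ^+ 2]exprMn mulrA.
apply: eq_Ex => w; rewrite /Z /expZ; congr (expR _ * cos (_ + _)).
  by rewrite mulr_sumr mulr_suml; apply: eq_bigr => k _; rewrite [(lam * _) ^+ 2]exprMn; field.
by rewrite mulr_sumr; apply: eq_bigr => k _; rewrite mulrA.
Qed.

(** The coefficients of the coarse martingale [m] are repeated on blocks of [q] steps of the fine
    grid, which changes neither its sum nor its bracket. On a block the mixed bracket is then a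
    fixed number times a time integral of the coefficients of [i], which the envelope controls. *)
Let cross m i q : (0 < q)%N -> n i = (n m * q)%N -> v m = q%:R * v i ->
  (forall u, V m u = V i (u * q)%N) -> (forall u, <<s G m u >> `<=` <<s G i (u * q)%N >>) ->
  `|Ex P (fun w => Z i w * Z m w) - cos ph ^+ 2| <=
  expR (lam ^+ 2 * (4 * K) / 2) * (lam ^+ 2 * expR (lam ^+ 2 * K)) *
  ((n m)%:R * ((K / v m + 1) * (2 * Num.sqrt (C * (2 * S + 6) * r i)))).
Proof.
move=> q0 nE vE VE GE.
pose c j := b m (j %/ q)%N.
have cE u l : (l < q)%N -> c (u * q + l)%N = b m u.
  by move=> lq; rewrite /c divnMDl// divn_small// addn0.
have sqE w : \sum_(0 <= k < n i) c k w ^+ 2 * v i = \sum_(0 <= u < n m) b m u w ^+ 2 * v m.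
  rewrite nE sum_nat_block; apply: eq_bigr => u _.
  under eq_big_nat => l lq do rewrite cE//.
  by rewrite sumr_const_nat subn0 vE -mulr_natl; ring.
have incE w : \sum_(0 <= k < n i) c k w * incr (V i) k w =
    \sum_(0 <= u < n m) b m u w * incr (V m) u w.
  rewrite nE sum_nat_block; apply: eq_bigr => u _.
  under eq_big_nat => l lq do rewrite cE//.
  rewrite -mulr_sumr; congr (_ * _); rewrite /incr !VE.
  under eq_bigr do rewrite -addnS.
  rewrite (@telescope_sumr _ 0 q (fun l => V i (u * q + l)%N w))//.
  by rewrite addn0 mulSn addnC.
have ZE w : Z m w = expZ (V i) (v i) (n i) lam ph c w by rewrite /Z /expZ sqE incE.
have mc k : (k < n i)%N -> Fm (G i k) (c k).
  move=> _; apply: (walk_lift (wk i) (_ : (k %/ q * q <= k)%N)); first exact: leq_trunc_div.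
  by apply: (Fm_sub (GE _)); exact: mb.
have mmc k : measurable_fun setT (c k) by exact: mb'.
have cK w : \sum_(0 <= k < n i) c k w ^+ 2 * v i <= K by rewrite sqE.
have H := cross_bound (wk i) lam ph (@mb i) mc mmc (bK i) cK K0.
under eq_Ex do rewrite ZE.
apply: (le_trans H); rewrite ler_wpM2l//.
  by rewrite mulr_ge0 ?expR_ge0// mulr_ge0 ?expR_ge0 ?sqr_ge0.
have mGb : measurable_fun setT (fun w => \sum_(0 <= k < n i) b i k w * c k w * v i).
  by apply: measurable_fun_bigsum => k; apply: measurable_funM => //; apply: measurable_funM.
(* A crude bound from x <= x^2 + 1; it depends on [m] only, and [m] is fixed while [i] grows. *)
have bmK u w : (u < n m)%N -> `|b m u w| <= K / v m + 1.
  move=> um; have : b m u w ^+ 2 <= K / v m.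
    rewrite ler_pdivlMr//; apply: le_trans (bK m w).
    rewrite (@big_cat_nat _ _ _ u.+1)//= big_nat_recr//= -addrA addrCA lerDl.
    by apply: addr_ge0; apply: sumr_ge0 => j _; rewrite mulr_ge0 ?sqr_ge0 ?(ltW (v0 _)).
  rewrite -real_normK ?num_real//; have := sqr_ge0 (`|b m u w| - 1); have := normr_ge0 (b m u w).
  by rewrite sqrrB; lra.
have Kv : 0 <= K / v m + 1 by rewrite addr_ge0// divr_ge0 ?(ltW (v0 _)).
have GB w : `|\sum_(0 <= k < n i) b i k w * c k w * v i| <=
    (n m)%:R * ((K / v m + 1) * (2 * Num.sqrt (env i w))).
  rewrite {1}nE sum_nat_block; apply: (le_trans (ler_norm_sum _ _ _)).
  apply: big_sum_le => u um.
  under eq_big_nat => l lq do rewrite cE//.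
  have -> : \sum_(0 <= l < q) b i (u * q + l)%N w * b m u w * v i =
     b m u w * \sum_(0 <= l < q) v i * b i (u * q + l)%N w.
    by rewrite mulr_sumr; apply: eq_bigr => l _; ring.
  rewrite normrM ler_pM ?bmK//; apply: stp_block => //.
  by rewrite nE leq_mul2r um orbT.
have msq : mom P (fun w => Num.sqrt (env i w)).
  apply: (@mom_le _ _ _ _ _ (fun w => env i w + 1)).
  - apply: (measurableT_comp (continuous_measurable_fun (@sqrt_continuous R))).
    exact: mom_meas (mom_env i).
  - move=> w; have e0 : 0 <= env i w by apply: envl_ge0.
    rewrite ger0_norm ?sqrtr_ge0//.
    have := sqr_sqrtr e0; have := sqr_ge0 (Num.sqrt (env i w) - 1).
    by have := sqrtr_ge0 (env i w); rewrite sqrrB; lra.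
  - by apply: momD; [exact: mom_env|exact: mom_cst].
apply: (@le_trans _ _ (Ex P (fun w => (n m)%:R * ((K / v m + 1) * (2 * Num.sqrt (env i w)))))).
  apply: le_Ex; last exact: GB.
    apply: Intg_norm; apply: (Intg_le mGb GB).
    by do 3 apply: IntgZ; apply: mom_Intg.
  by do 3 apply: IntgZ; apply: mom_Intg.
rewrite !ExZ; try by do ?apply: IntgZ; apply: mom_Intg.
rewrite ler_wpM2l// ler_wpM2l// ler_wpM2l//.
have -> : Ex P (fun w => Num.sqrt (env i w)) = Ex P (fun w => `|Num.sqrt (env i w)|).
  by apply: eq_Ex => w; rewrite ger0_norm ?sqrtr_ge0.
apply: Ex_norm_le => //.
rewrite sqr_sqrtr; last by rewrite !mulr_ge0 ?(ltW (r0 _))// addr_ge0// mulr_ge0.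
apply: le_trans (Ex_env i); rewrite le_eqVlt; apply/orP; left; apply/eqP.
by apply: eq_Ex => w; rewrite sqr_sqrtr//; apply: envl_ge0.
Qed.

(** Renyi's lemma for [Z i - cos ph]: as every [Z i] has mean [cos ph], the centred products have
    mean [Ex (Z i * Z m) - cos ph ^+ 2], which [cross] sends to 0. *)
Lemma mixing (Y : T -> R) (M : R) : measurable_fun setT Y -> (forall w, `|Y w| <= M) ->
  Ex P (fun w => Z i w * Y w) @[i --> \oo] --> cos ph * Ex P Y.
Proof.
move=> mY YM.
have IZ i : Intg P (Z i) by apply: (Intg_bd P (mZ i) (Zbd i)).
have IY : Intg P Y by apply: (Intg_bd P mY YM).
have IZZ i m : Intg P (fun w => Z i w * Z m w).
  apply: (@Intg_bd _ _ _ _ _ (expR (lam ^+ 2 / 2 * K) * expR (lam ^+ 2 / 2 * K))).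
    exact: measurable_funM.
  by move=> w; rewrite normrM ler_pM// Zbd.
have IZY i : Intg P (fun w => Z i w * Y w).
  apply: (@Intg_bd _ _ _ _ _ (expR (lam ^+ 2 / 2 * K) * M)); first exact: measurable_funM.
  by move=> w; rewrite normrM ler_pM// Zbd.
pose z i w := Z i w - cos ph.
have : Ex P (fun w => z i w * Y w) @[i --> \oo] --> 0.
  apply: (@renyi_mixing _ _ _ P z Y (expR (lam ^+ 2 / 2 * K) + 1) M) => //.
  - by move=> i; apply: measurable_funB.
  - move=> i w; apply: (le_trans (ler_normB _ _)); rewrite lerD ?Zbd//.
    by rewrite ler_norml cos_geN1 cos_le1.
  move=> m.
  have E i : Ex P (fun w => z i w * z m w) = Ex P (fun w => Z i w * Z m w) - cos ph ^+ 2.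
    rewrite (_ : (fun w => _) = fun w => Z i w * Z m w - (cos ph * (Z i w + Z m w) - cos ph ^+ 2)).
      have I1 : Intg P (fun w => cos ph * (Z i w + Z m w)) by apply: IntgZ; apply: IntgD.
      rewrite ExB//; last by apply: IntgD => //; apply: IntgN; exact: Intg_cst.
      rewrite ExB//; last exact: Intg_cst.
      by rewrite ExZ ?ExD ?Ex_cst ?ExZi//; [ring|exact: IntgD].
    by apply/funext => w; rewrite /z; ring.
  pose cst := expR (lam ^+ 2 * (4 * K) / 2) * (lam ^+ 2 * expR (lam ^+ 2 * K)).
  have H : cst * ((n m)%:R * ((K / v m + 1) * (2 * Num.sqrt (C * (2 * S + 6) * r i))))
     @[i --> \oo] --> (0 : R).
    rewrite (_ : 0 = cst * ((n m)%:R * ((K / v m + 1) * (2 * Num.sqrt (C * (2 * S + 6) * 0))))).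
      do 4 (apply: cvgM; first exact: cvg_cst).
      apply: continuous_cvg; first exact: sqrt_continuous.
      by apply: cvgM; first exact: cvg_cst.
    by rewrite mulr0 sqrtr0 !mulr0.
  apply/cvgrPdist_le => eps eps0; move/cvgrPdist_le : H => /(_ _ eps0) H.
  near=> i; rewrite sub0r normrN E.
  have mi : (m <= i)%N by near: i; exact: nbhs_infty_ge.
  have [q q0 [nE vE VE GE]] := nest mi.
  apply: (le_trans (cross q0 nE vE VE GE)).
  apply: (@le_trans _ _ `|0 - (cst * ((n m)%:R *
    ((K / v m + 1) * (2 * Num.sqrt (C * (2 * S + 6) * r i)))))|).
    by rewrite sub0r normrN; exact: ler_norm.
  by near: i.
move=> h.
have E i : Ex P (fun w => Z i w * Y w) = Ex P (fun w => z i w * Y w) + cos ph * Ex P Y.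
  rewrite (_ : (fun w => z i w * Y w) = fun w => Z i w * Y w - cos ph * Y w).
    by rewrite ExB ?ExZ ?subrK//; exact: IntgZ.
  by apply/funext => w; rewrite /z mulrBl.
have h2 := cvgD h (cvg_cst (cos ph * Ex P Y)); rewrite add0r in h2.
rewrite (_ : (fun i => Ex P (fun w => Z i w * Y w)) =
  (fun i => Ex P (fun w => z i w * Y w) + cos ph * Ex P Y)); last by apply/funext => i; exact: E.
exact: h2.
Unshelve. all: by end_near. Qed.

End fixed_truncation.

Definition Smart i w := \sum_(0 <= k < n i) a i k w * incr (V i) k w.

(** Mixing is applied with [Y] equal to exp(-lam^2/2 s2) on the event that [s2] is at most [k]. On
    this event, when the bracket is close to [s2], the exponential factors of [Z i * Y] nearly
    cancel and the cosine of the martingale sum remains. *)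
Lemma stable_limit (s2 : T -> R) (lam ph : R) : measurable_fun setT s2 ->
  (forall w, 0 <= s2 w) ->
  Ex P (fun w => Num.min `|brk (a i) (v i) (n i) w - s2 w| 1) @[i --> \oo] --> (0 : R) ->
  Ex P (fun w => cos (ph + lam * Smart i w)) @[i --> \oo] -->
    cos ph * Ex P (fun w => expR (- (lam ^+ 2 / 2 * s2 w))).
Proof.
move=> ms s20 Bcv.
have mcos := continuous_measurable_fun (@continuous_cos R).
have mS i : measurable_fun setT (Smart i).
  apply: measurable_fun_bigsum => k; apply: measurable_funM => //.
  exact: measurable_funB.
have mC i : measurable_fun setT (fun w => cos (ph + lam * Smart i w)).
  by apply: (measurableT_comp mcos); apply: measurable_funD => //; exact: measurable_funM.
have IC i : Intg P (fun w => cos (ph + lam * Smart i w)).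
  by apply: (@Intg_bd _ _ _ _ _ 1) => // w; rewrite ler_norml cos_geN1 cos_le1.
have mB i : measurable_fun setT (brk (a i) (v i) (n i)) by exact: mom_meas (mom_brk i (n i)).
pose L w := expR (- (lam ^+ 2 / 2 * s2 w)).
have mL : measurable_fun setT L.
  by apply: measurableT_comp => //; apply: measurable_funN; exact: measurable_funM.
have L01 w : 0 <= L w <= 1.
  rewrite expR_ge0/= -expR0 ler_expR oppr_le0 mulr_ge0//.
  by rewrite divr_ge0 ?sqr_ge0.
have IL : Intg P L.
  by apply: (@Intg_bd _ _ _ _ _ 1) => // w; case/andP: (L01 w) => ? ?; rewrite ger0_norm.
pose chi (k : nat) w := b2r R (s2 w <= k%:R).
have mchi k : measurable_fun setT (chi k) by apply: measurable_ler_ind.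
have chi01 k w : 0 <= chi k w <= 1 by rewrite b2r_ge0 b2r_le1.
have Ichi k : Intg P (chi k).
  by apply: (@Intg_bd _ _ _ _ _ 1) => // w; case/andP: (chi01 k w) => ? ?; rewrite ger0_norm.
have chicv : Ex P (chi k) @[k --> \oo] --> (1 : R).
  rewrite -[X in _ --> X](Ex_cst P); apply: (@Ex_cvg_dom _ _ _ P _ _ 1) => //.
    by move=> k w; case/andP: (chi01 k w) => ? ?; rewrite ger0_norm.
  apply: aeW => w; apply: cvg_near_cst.
  exists (Num.truncn (s2 w)).+1 => // k /= hk.
  rewrite /chi (_ : _ <= _ = true)//; apply: (le_trans (ltW (truncnS_gt _))).
  by rewrite ler_nat.
pose D i w := Num.min `|brk (a i) (v i) (n i) w - s2 w| 1.
have mD i : measurable_fun setT (D i).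
  apply: measurable_minr => //; apply: measurableT_comp => //.
  exact: measurable_funB.
have D01 i w : 0 <= D i w <= 1 by rewrite /D le_min normr_ge0 ler01 ge_min lexx orbT.
have ID i : Intg P (D i).
  by apply: (@Intg_bd _ _ _ _ _ 1) => // w; case/andP: (D01 i w) => ? ?; rewrite ger0_norm.
apply/cvgrPdist_le => /= eps eps0.
have e4 : 0 < eps / 4 by rewrite divr_gt0.
move/cvgrPdist_le : (chicv) => /(_ _ e4)[k _ /(_ k (leqnn k))/= Hk].
(* If [s2 <= k] and the bracket is within 1 of [s2], then the bracket is at most [K] and the
   truncation is inactive. *)
pose K : R := k%:R + 1.
have K0 : 0 <= K by rewrite addr_ge0.
pose Z i := expZ (V i) (v i) (n i) lam ph (stp (a i) (v i) K).
pose Y w := L w * chi k w.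
have mY : measurable_fun setT Y by exact: measurable_funM.
have Y01 w : 0 <= Y w <= 1.
  case/andP: (L01 w) => ? ?; case/andP: (chi01 k w) => ? ?; apply/andP; split.
    exact: mulr_ge0.
  by rewrite mulr_ile1.
have YM w : `|Y w| <= 1 by case/andP: (Y01 w) => ? ?; rewrite ger0_norm.
have IY : Intg P Y by apply: (Intg_bd P mY YM).
have Hm := @mixing lam ph K K0 Y 1 mY YM.
set Cc := expR (lam ^+ 2 / 2 * K) + 1 + lam ^+ 2 / 2 * expR (lam ^+ 2 / 2).
have l2 : 0 <= lam ^+ 2 / 2 by rewrite divr_ge0 ?sqr_ge0.
have Cc0 : 0 < Cc.
  have := expR_ge0 (lam ^+ 2 / 2 * K); have := mulr_ge0 l2 (expR_ge0 (lam ^+ 2 / 2)).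
  by rewrite /Cc; lra.
have Zbd i w : `|Z i w| <= expR (lam ^+ 2 / 2 * K) by apply: expZ_bd; apply: stp_brk.
have mZ i : measurable_fun setT (Z i).
  apply: measurable_expZ => // j; apply: measurable_funM => //.
  apply: measurable_ler_ind => //; exact: mom_meas (mom_brk i j.+1).
have IZY i : Intg P (fun w => Z i w * Y w).
  apply: (@Intg_bd _ _ _ _ _ (expR (lam ^+ 2 / 2 * K) * 1)); first exact: measurable_funM.
  by move=> w; rewrite normrM ler_pM.
have key i w : `|Z i w * Y w - cos (ph + lam * Smart i w) * chi k w| <= Cc * D i w.
  have CcA : expR (lam ^+ 2 / 2 * K) + 1 <= Cc by rewrite /Cc lerDl mulr_ge0 ?expR_ge0.
  rewrite /Y /chi; have [h|h] := lerP (s2 w) k%:R; last first.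
    by rewrite /b2r !mulr0 subrr normr0 mulr_ge0 ?(ltW Cc0)//; case/andP: (D01 i w).
  rewrite /b2r !mulr1.
  have crude : `|Z i w * L w - cos (ph + lam * Smart i w)| <= Cc.
    apply: le_trans CcA; apply: (le_trans (ler_normB _ _)); apply: lerD.
      rewrite normrM -[leRHS]mulr1 ler_pM//; case/andP: (L01 w) => ? ?.
      by rewrite ger0_norm.
    by rewrite ler_norml cos_geN1 cos_le1.
  (* When the bracket is far from [s2] the trivial bound suffices, because then [D i w] is 1;
     otherwise the two exponentials are compared. *)
  have [h1|h1] := lerP 1 `|brk (a i) (v i) (n i) w - s2 w|.
    by rewrite /D (min_idPr h1) mulr1.
  have BK : brk (a i) (v i) (n i) w <= K.
    by move: (ltW h1); rewrite ler_norml /K => /andP[_]; move: h; lra.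
  rewrite /D (min_idPl (ltW h1)).
  have -> : Z i w = expR (lam ^+ 2 / 2 * brk (a i) (v i) (n i) w) * cos (ph + lam * Smart i w).
    rewrite /Z /expZ /brk /Smart; congr (expR (_ * _) * cos (_ + _ * _)).
      by apply: eq_big_nat => j /andP[_ jn]; rewrite (stp_full (v0 i) BK).
    by apply: eq_big_nat => j /andP[_ jn]; rewrite (stp_full (v0 i) BK).
  rewrite mulrAC /L -expRD -mulrN -mulrDr.
  set x := brk _ _ _ _ - _ in h1 *.
  rewrite -[X in _ - X]mul1r -mulrBl normrM -[leRHS]mulr1 ler_pM//; last first.
    by rewrite ler_norml cos_geN1 cos_le1.
  rewrite distrC; apply: (le_trans (expR_dist1 _)).
  rewrite normrM ger0_norm// mulrAC ler_wpM2r//.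
  apply: (@le_trans _ _ (lam ^+ 2 / 2 * expR (lam ^+ 2 / 2))).
    by rewrite ler_wpM2l// ler_expR ler_piMr// ltW.
  by rewrite /Cc lerDr addr_ge0 ?expR_ge0.
have eD : 0 < eps / 4 / Cc by rewrite divr_gt0.
move/cvgrPdist_le : Bcv => /(_ _ eD) HB.
move/cvgrPdist_le : Hm => /(_ _ e4) HM.
near=> i.
have hB : Ex P (D i) <= eps / 4 / Cc.
  have : `|0 - Ex P (D i)| <= eps / 4 / Cc by near: i.
  by rewrite sub0r normrN ger0_norm//; apply: Ex_ge0 => w; case/andP: (D01 i w).
have hM : `|cos ph * Ex P Y - Ex P (fun w => Z i w * Y w)| <= eps / 4 by near: i.
have chi4 : 1 - Ex P (chi k) <= eps / 4 by apply: (le_trans (ler_norm _)).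
have IC' j : Intg P (fun w => cos (ph + lam * Smart j w) * chi k w).
  apply: (@Intg_bd _ _ _ _ _ (1 * 1)); first exact: measurable_funM.
  move=> w; rewrite normrM ler_pM//; first by rewrite ler_norml cos_geN1 cos_le1.
  by case/andP: (chi01 k w) => ? ?; rewrite ger0_norm.
have a1 : `|Ex P (fun w => Z i w * Y w) - Ex P (fun w => cos (ph + lam * Smart i w) * chi k w)| <= eps / 4.
  rewrite -ExB//; apply: (le_trans (le_norm_Ex (IntgD (IZY i) (IntgN (IC' i))))).
  apply: (@le_trans _ _ (Ex P (fun w => Cc * D i w))).
    apply: le_Ex; [|exact: IntgZ|exact: key].
    by apply: Intg_norm; apply: IntgD => //; exact: IntgN.
  by rewrite ExZ// mulrC -ler_pdivlMr.
have mainb (f : T -> R) : Intg P f -> (forall w, `|f w| <= 1) ->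
   Intg P (fun w => f w * chi k w) -> `|Ex P f - Ex P (fun w => f w * chi k w)| <= eps / 4.
  move=> If f1 Ifc; rewrite -ExB//; apply: (le_trans (le_norm_Ex (IntgD If (IntgN Ifc)))).
  apply: le_trans chi4; rewrite -[X in X - _](Ex_cst P) -ExB//; last exact: Intg_cst.
  apply: le_Ex; [by apply: Intg_norm; apply: IntgD => //; exact: IntgN|by apply: IntgD; [exact: Intg_cst|exact: IntgN]|].
  move=> w; rewrite -[X in X - _]mulr1 -mulrBr normrM.
  case/andP: (chi01 k w) => ? ?; rewrite -[leRHS]mul1r ler_pM// ger0_norm// subr_ge0//.
have {}a2 : `|Ex P (fun w => cos (ph + lam * Smart i w)) - Ex P (fun w => cos (ph + lam * Smart i w) * chi k w)| <= eps / 4.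
  by apply: mainb => // w; rewrite ler_norml cos_geN1 cos_le1.
have a3 : `|Ex P L - Ex P Y| <= eps / 4.
  by apply: mainb => // w; case/andP: (L01 w) => ? ?; rewrite ger0_norm.
have a4 : `|cos ph * (Ex P L - Ex P Y)| <= eps / 4.
  rewrite normrM -[leRHS]mul1r ler_pM//.
  by rewrite ler_norml cos_geN1 cos_le1.
rewrite (_ : cos ph * Ex P L - _ = cos ph * (Ex P L - Ex P Y) +
  (cos ph * Ex P Y - Ex P (fun w => Z i w * Y w)) +
  (Ex P (fun w => Z i w * Y w) - Ex P (fun w => cos (ph + lam * Smart i w) * chi k w)) -
  (Ex P (fun w => cos (ph + lam * Smart i w)) - Ex P (fun w => cos (ph + lam * Smart i w) * chi k w))); last by rewrite /L; ring.
apply: (le_trans (ler_normB _ _)); rewrite (_ : eps = eps / 4 + eps / 4 + eps / 4 + eps / 4); last by field.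
apply: lerD => //; apply: (le_trans (ler_normD _ _)); apply: lerD => //.
by apply: (le_trans (ler_normD _ _)); apply: lerD.
Unshelve. all: by end_near. Qed.

End mixing.

(** * Occupation densities *)

Section real_analysis.
Context (R : realType).
Implicit Types F : R -> R.
Local Notation leb := (@lebesgue_measure R).

Lemma heine F (s eta : R) : continuous F -> 0 < eta -> exists2 del, 0 < del &
  forall x y : R, 0 <= x <= s -> 0 <= y <= s -> `|x - y| <= del -> `|F x - F y| <= eta.
Proof.
move=> cF eta0.
have /compact_near_coveringP cov := @segment_compact R 0 s.
pose Pr (del x : R) := forall y, `|x - y| <= del -> `|F x - F y| <= eta.
have Hcov : \forall del \near (0 : R)^'+, `[0, s]%classic `<=` Pr del.
  apply: cov => x _.
  have e2 : 0 < eta / 2 by rewrite divr_gt0.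
  have /cvgrPdist_le/(_ _ e2)/nbhs_ballP[rho /= rho0 Hr] := cF x.
  exists (ball x (rho / 2), [set del | del < rho / 2]).
    split; first by apply/nbhs_ballP; exists (rho / 2) => //=; rewrite divr_gt0.
    by apply: nbhs_right_lt; rewrite divr_gt0.
  move=> [x' del] [/= xx' dr] y xy.
  have h1 : `|F x - F x'| <= eta / 2.
    apply: Hr; rewrite /ball/=; apply: lt_le_trans xx' _; lra.
  have h2 : `|F x - F y| <= eta / 2.
    apply: Hr; rewrite /ball/=; rewrite (_ : x - y = (x - x') + (x' - y)); last by ring.
    apply: (le_lt_trans (ler_normD _ _)); move: xx'; rewrite /ball/=; lra.
  rewrite (_ : F x' - F y = (F x - F y) - (F x - F x')); last by ring.
  by apply: (le_trans (ler_normB _ _)); lra.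
have [B /= B0 HB] := Hcov.
exists (B / 2); first by rewrite divr_gt0.
move=> x y x01 y01 xy; apply: (HB (B / 2)) => //=.
- by rewrite /ball/= sub0r normrN gtr0_norm ?divr_gt0//; lra.
- by rewrite divr_gt0.
Qed.

Lemma cont_integrable F a b : continuous F -> leb.-integrable `[a, b] (EFin \o F).
Proof.
move=> cF; apply: continuous_compact_integrable; first exact: segment_compact.
exact: continuous_subspaceT.
Qed.

Lemma Rint_seg_cst a b (c : R) : a <= b -> \int[leb]_(x in `[a, b]) c = c * (b - a).
Proof.
move=> ab; rewrite Rintegral_cst//.
have := lebesgue_measure_itv `[a, b]; rewrite /= lte_fin => ->.
by case: ltP => //= h; rewrite (@le_anti _ _ a b) ?ab// subrr.
Qed.

Lemma Rint_seg_near F a b c eta : continuous F -> a <= b ->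
  (forall x, a <= x <= b -> `|F x - c| <= eta) ->
  `|\int[leb]_(x in `[a, b]) F x - c * (b - a)| <= eta * (b - a).
Proof.
move=> cF ab Fc; rewrite -!Rint_seg_cst//.
have cc (k : R) : continuous (cst k : R -> R) by move=> x; exact: cvg_cst.
have i1 := @cont_integrable F a b cF.
have i2 := @cont_integrable _ a b (cc c).
have cFc : continuous (fun x => F x - c) by move=> x; apply: cvgB; [exact: cF|exact: cvg_cst].
have i3 := @cont_integrable _ a b cFc.
have := @RintegralB _ _ _ leb `[a, b] F (cst c) (measurable_itv _) i1 i2 => <-.
apply: (le_trans (le_normr_Rintegral _ i3)) => //.
apply: le_Rintegral => //.
- apply: (@cont_integrable (fun x => `|F x - c|)) => x.
  by apply: cvg_norm; exact: cFc.
- exact: (@cont_integrable (fun _ => eta) a b (cc eta)).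
Qed.

Lemma Rint_seg_bd F a b eta : continuous F -> a <= b ->
  (forall x, a <= x <= b -> `|F x| <= eta) ->
  `|\int[leb]_(x in `[a, b]) F x| <= eta * (b - a).
Proof.
move=> cF ab Fe; have := @Rint_seg_near F a b 0 eta cF ab.
by rewrite mul0r subr0; apply => x /Fe; rewrite subr0.
Qed.

Lemma Rint_seg_cat F a b c : continuous F -> a <= b -> b <= c ->
  \int[leb]_(x in `[a, c]) F x = \int[leb]_(x in `[a, b]) F x + \int[leb]_(x in `[b, c]) F x.
Proof.
move=> cF ab bc.
have i := @cont_integrable F a c cF.
have := @Rintegral_itvB R F (BLeft a) (BRight c) b i.
rewrite !bnd_simp => /(_ ab bc) h.
have h2 : \int[leb]_(x in `]b, c]) F x = \int[leb]_(x in `[b, c]) F x.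
  apply: Rintegral_itv_obnd_cbnd; apply: (integrableS _ _ _ i) => //.
  by apply: subset_itv; rewrite bnd_simp.
by rewrite -h2 -h addrC subrK.
Qed.

Lemma riemann_sum F (v eta : R) n : continuous F -> 0 <= v ->
  (forall j r, (j < n)%N -> j%:R * v <= r <= j.+1%:R * v -> `|F r - F (j%:R * v)| <= eta) ->
  `|\sum_(0 <= j < n) v * F (j%:R * v) - \int[leb]_(x in `[0, n%:R * v]) F x| <= n%:R * v * eta.
Proof.
move=> cF v0; elim: n => [|n IH] H.
  rewrite big_geq// !mul0r sub0r normrN set_itv1 Rintegral_set1 normr0//.
rewrite big_nat_recr//=.
have e1 : n.+1%:R * v = n%:R * v + v by rewrite -natr1 mulrDl mul1r.
rewrite (@Rint_seg_cat F 0 (n%:R * v) (n.+1%:R * v))//; last 2 first.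
- by rewrite mulr_ge0.
- by rewrite e1 lerDl.
have h1 := IH (fun j r jn => H j r (leqW jn)).
have h2 := @Rint_seg_near F (n%:R * v) (n.+1%:R * v) (F (n%:R * v)) eta cF.
have e3 : n.+1%:R * v - n%:R * v = v by rewrite e1 addrC addKr.
have le1 : n%:R * v <= n.+1%:R * v by rewrite e1 lerDl.
have {}h2 := h2 le1 (fun x => H n x (ltnSn n)); rewrite e3 in h2.
rewrite -/(n%:R * v) in h1.
rewrite opprD addrACA (_ : n.+1%:R * v * eta = n%:R * v * eta + eta * v); last by rewrite e1; ring.
apply: (le_trans (ler_normD _ _)); apply: lerD => //.
by rewrite distrC [v * F _]mulrC.
Qed.

Lemma Rint_cvg (A : nat -> R -> R) (a g : R -> R) (M : R) :
  (forall i, measurable_fun setT (A i)) -> measurable_fun setT a ->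
  (forall i y, `|A i y| <= M) -> leb.-integrable setT (EFin \o g) ->
  (forall y, A i y @[i --> \oo] --> a y) ->
  \int[leb]_y (A i y * g y) @[i --> \oo] --> \int[leb]_y (a y * g y).
Proof.
move=> mA ma AM ig cv.
have mg : measurable_fun setT g by move/integrableP : ig => [/measurable_EFinP].
have mAg i : measurable_fun setT (fun y => A i y * g y) by exact: measurable_funM.
have mag : measurable_fun setT (fun y => a y * g y) by exact: measurable_funM.
have [|||||ia _ c] := @dominated_convergence _ _ _ leb setT measurableT
  (fun i y => (A i y * g y)%:E) (fun y => (a y * g y)%:E) (fun y => (M%:E * (`|g y|)%:E)%E).
- by move=> i; apply/measurable_EFinP; exact: mAg.
- by apply/measurable_EFinP; exact: mag.
- apply: aeW => y _; apply: cvg_EFin; first by near=> i.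
  by apply: cvgM; [exact: cv|exact: cvg_cst].
- apply: integrableZl => //.
  by have := integrable_abse ig; apply: eq_integrable.
- by apply: aeW => y i _; rewrite -EFinM lee_fin normrM ler_wpM2r.
apply: fine_cvg; rewrite fineK//; exact: integrable_fin_num.
Unshelve. all: by end_near. Qed.

Section csupp.
Variables (F : R -> R) (M : R).
Hypotheses (cF : continuous F) (FM : forall x, M < `|x| -> F x = 0).

Lemma csupp_patch : F = F \_ `[- M, M].
Proof.
apply/funext => x; rewrite patchE; case: ifPn => //.
rewrite notin_setE/= in_itv/= => /negP h; apply: FM.
by rewrite ltNge ler_norml.
Qed.

Lemma csupp_integrable : leb.-integrable setT (EFin \o F).
Proof.
rewrite csupp_patch -restrict_EFin; apply/integrable_restrict => //.
by rewrite setTI; exact: cont_integrable.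
Qed.

Lemma csupp_Rint : \int[leb]_x F x = \int[leb]_(x in `[- M, M]) F x.
Proof. by rewrite [RHS]Rintegral_mkcond -csupp_patch. Qed.
End csupp.

Lemma FTC_seg (F g : R -> R) a b : a < b -> (forall x : R, is_derive x (1:R) F (g x)) ->
  continuous g -> \int[leb]_(x in `[a, b]) g x = F b - F a.
Proof.
move=> ab dF cg.
have cF : continuous F.
  by move=> x; apply/differentiable_continuous/derivable1_diffP; case: (dF x).
rewrite /Rintegral (@continuous_FTC2 _ g F a b)//.
- exact: continuous_subspaceT.
- split.
  + by move=> x _; case: (dF x).
  + by apply: cvg_at_right_filter; exact: cF.
  + by apply: cvg_at_left_filter; exact: cF.
- by move=> x _; rewrite derive1E; case: (dF x).
Qed.

(** Split [f x] into [f y] and the deviation, which is small on the shrinking support. The second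
    conclusion, uniform in [y], is there for dominated convergence. *)
Lemma approx_id (rho : nat -> R -> R) (dl : nat -> R) (c M : R) (f : R -> R) (y : R) :
  (forall i z, 0 <= rho i z) -> (forall i, continuous (rho i)) ->
  (forall i z, dl i < `|z| -> rho i z = 0) -> dl i @[i --> \oo] --> (0 : R) ->
  \int[leb]_z rho i z @[i --> \oo] --> c ->
  continuous f -> (forall x, `|f x| <= M) ->
  \int[leb]_x (rho i (x - y) * f x) @[i --> \oo] --> c * f y /\
  (forall i, `|\int[leb]_x (rho i (x - y) * f x)| <= M * \int[leb]_z rho i z).
Proof.
move=> rho0 crho srho dl0 ic cf fM.
have mrho i : measurable_fun setT (rho i) by exact: continuous_measurable_fun.
have irho i : leb.-integrable setT (EFin \o rho i) by exact: (csupp_integrable (crho i) (srho i)).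
have cs i : continuous (fun x => rho i (x - y)).
  move=> x; apply: (@continuous_comp _ _ _ (fun x => x - y)); last exact: crho.
  by apply: cvgB; [exact: cvg_id|exact: cvg_cst].
have ish i : leb.-integrable setT (EFin \o (fun x => rho i (x - y))).
  exact: (@integrable_shift R (- y)).
have iM (k : R -> R) i (N : R) : continuous k -> (forall x, `|k x| <= N) ->
    leb.-integrable setT (EFin \o (fun x => rho i (x - y) * k x)).
  move=> ck kN; apply: (@le_integrable _ _ _ leb setT _ _ (fun x => (N * rho i (x - y))%:E)) => //.
  - by apply/measurable_EFinP; apply: measurable_funM; exact: continuous_measurable_fun.
  - by move=> x _ /=; rewrite lee_fin !normrM mulrC ler_wpM2r// (le_trans (kN x))// ler_norm.
  - by have := @integrableZl _ _ _ leb setT measurableT N _ (ish i); apply: eq_integrable.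
have eqs i : \int[leb]_x rho i (x - y) = \int[leb]_x rho i x by exact: Rintegral_shift.
have bnd i (k : R -> R) (N : R) : continuous k -> (exists N', forall x, `|k x| <= N') ->
    (forall x, `|x - y| <= dl i -> `|k x| <= N) ->
    `|\int[leb]_x (rho i (x - y) * k x)| <= N * \int[leb]_z rho i z.
  move=> ck [N' kN'] kN; apply: (le_trans (le_normr_Rintegral _ (iM k i N' ck kN'))) => //.
  rewrite -eqs -RintegralZl//; apply: le_Rintegral => //.
  - by have := integrable_abse (iM k i N' ck kN'); apply: eq_integrable.
  - by have := @integrableZl _ _ _ leb setT measurableT N _ (ish i); apply: eq_integrable.
  - move=> x _; rewrite normrM (ger0_norm (rho0 _ _)) mulrC.
    have [h|h] := lerP `|x - y| (dl i); first by rewrite ler_wpM2r// kN.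
    by rewrite srho// !mulr0.
split; last by move=> i; apply: bnd => //; exists M.
have cfy : continuous (fun x => f x - f y) by move=> x; apply: cvgB; [exact: cf|exact: cvg_cst].
have bfy x : `|f x - f y| <= M + M by apply: (le_trans (ler_normB _ _)); exact: lerD.
have E i : \int[leb]_x (rho i (x - y) * f x) =
    f y * \int[leb]_z rho i z + \int[leb]_x (rho i (x - y) * (f x - f y)).
  rewrite -eqs -RintegralZl// -RintegralD//; last 2 first.
  - by have := @integrableZl _ _ _ leb setT measurableT (f y) _ (ish i); apply: eq_integrable.
  - exact: iM bfy.
  by apply: eq_Rintegral => x _; ring.
have small : \int[leb]_x (rho i (x - y) * (f x - f y)) @[i --> \oo] --> (0 : R).
  apply/cvgrPdist_le => eps eps0.
  pose e1 := eps / (`|c| + 1).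
  have c1 : 0 < `|c| + 1 by rewrite ltr_wpDl.
  have e10 : 0 < e1 by rewrite divr_gt0.
  have /cvgrPdist_le/(_ _ e10)/nbhs_ballP[del /= del0 Hd] := cf y.
  near=> i.
  rewrite sub0r normrN.
  have dd : dl i < del.
    by near: i; move/cvgrPdist_lt : dl0 => /(_ _ del0); apply: filterS => i; rewrite sub0r normrN; exact: le_lt_trans (ler_norm _).
  have ii : \int[leb]_z rho i z <= `|c| + 1.
    have : `|c - \int[leb]_z rho i z| <= 1.
      by near: i; move/cvgrPdist_le : ic; apply.
    have := ler_norm c; have := ler_norm (- (c - \int[leb]_z rho i z)); rewrite normrN; lra.
  apply: (@le_trans _ _ (e1 * \int[leb]_z rho i z)).
    apply: bnd => //; first by exists (M + M).
    move=> x xy; rewrite distrC; apply: Hd; rewrite /ball/= distrC.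
    exact: le_lt_trans xy dd.
  apply: (@le_trans _ _ (e1 * (`|c| + 1))); first by rewrite ler_wpM2l// ltW.
  by rewrite /e1 divfK// gt_eqF.
under eq_cvg do rewrite E.
rewrite (_ : c * f y = f y * c + 0); last by rewrite addr0 mulrC.
by apply: cvgD => //; apply: cvgM => //; exact: cvg_cst.
Unshelve. all: by end_near. Qed.

Section kernel_integrals.

Lemma int_tent (e : R) : 0 < e -> \int[leb]_z tent e z = e ^+ 2.
Proof.
move=> e0.
have ct : continuous (tent e).
  move=> x; apply/cvgrPdist_le => eps eps0; apply/nbhs_ballP; exists eps => //= y xy.
  by apply: (le_trans (tent_lip _ _ (ltW e0))); exact: ltW.
rewrite (@csupp_Rint _ e)//; last by move=> x /ltW h; rewrite tent0// ltW.
have ee : - e < e by lra.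
rewrite (@FTC_seg (d2 e (pp 2)) (tent e) (- e) e ee (is_derive_d2 e (is_derive_pp 0)) ct).
rewrite /d2 !addNr !subrr.
rewrite (@pp_le0 _ 1 (- e)) ?(@pp_le0 _ 1 (- e - e)) ?(@pp_le0 _ 1 0)//; try lra.
rewrite !pp_ge0; [|lra|lra].
by rewrite (_ : 2`! = 2%N)//; field.
Qed.

Lemma int_tent_sqr (h : R) : 0 < h -> \int[leb]_z tent h z ^+ 2 = 2 / 3 * h ^+ 3.
Proof.
move=> h0.
have ct : continuous (tent h).
  move=> x; apply/cvgrPdist_le => eps eps0; apply/nbhs_ballP; exists eps => //= y xy.
  by apply: (le_trans (tent_lip _ _ (ltW h0))); exact: ltW.
have ct2 : continuous (fun z => tent h z ^+ 2).
  by move=> x; rewrite /=; apply: (@continuous_comp _ _ _ (tent h) (fun x => x ^+ 2)); [exact: ct|exact: exprn_continuous].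
rewrite (@csupp_Rint _ h)//; last by move=> x /ltW hx; rewrite tent0 ?expr0n// ltW.
(* On [-h, h] the squared tent is itself a combination of truncated powers: (z + h)^2 - 4 h z equals
   (h - z)^2 for z >= 0. [Q] is a primitive of it. *)
pose Q (z : R) := 2 * pp 3 (z + h) - 4 * h * pp 2 z - 2 * pp 3 (z - h).
pose q (z : R) := 2 * pp 2 (z + h) - 4 * h * pp 1 z - 2 * pp 2 (z - h).
have dQ (x : R) : is_derive x (1:R) Q (q x).
  have i1 := is_derive_comp_shift h x (is_derive_pp 1).
  have i2 := is_derive_comp_shift (- h) x (is_derive_pp 1).
  have i3 := is_derive_pp 0 x.
  by apply: is_derive_eq; rewrite /q /GRing.scale /=; ring.
have qE z : - h <= z <= h -> q z = tent h z ^+ 2.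
  move=> /andP[z1 z2]; rewrite /q (@pp_le0 _ 1 (z - h)); last by lra.
  rewrite (@pp_ge0 _ 2 (z + h)); last by lra.
  rewrite tentE; last exact: ltW.
  have -> : Num.max (h - `|z|) 0 = h - `|z| by apply/max_idPl; rewrite subr_ge0 ler_norml z1 z2.
  rewrite (_ : 2`! = 2%N)// pp1E.
  have [z0|z0] := lerP 0 z.
    by rewrite ?ger0_norm//; field.
  by rewrite ?ltr0_norm//; field.
have cq : continuous q.
  have cpp k : continuous (@pp R k.+2).
    by move=> x; apply/differentiable_continuous/derivable1_diffP; case: (is_derive_pp k x).
  have cp1 : continuous (@pp R 1).
    move=> x; apply/cvgrPdist_le => eps eps0; apply/nbhs_ballP; exists eps => //= y xy.
    by rewrite !pp1E; apply: (le_trans (max0_lip _ _)); exact: ltW.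
  have cs (a : R) : continuous (fun z : R => pp 2 (z + a)).
    move=> x; apply: (@continuous_comp _ _ _ (fun z => z + a)); last exact: cpp.
    by apply: cvgD; [exact: cvg_id|exact: cvg_cst].
  move=> x; apply: cvgB; first apply: cvgB.
  - by apply: cvgM; [exact: cvg_cst|exact: cs].
  - by apply: cvgM; [exact: cvg_cst|exact: cp1].
  - by apply: cvgM; [exact: cvg_cst|exact: cs].
rewrite (_ : \int[leb]_(x in `[- h, h]) tent h x ^+ 2 = \int[leb]_(x in `[- h, h]) q x).
  have hh : - h < h by lra.
  rewrite (@FTC_seg Q q (- h) h hh dQ cq).
  rewrite /Q addNr subrr.
  rewrite (@pp_le0 _ 1 (- h)) ?(@pp_le0 _ 2 (- h - h)) ?(@pp_le0 _ 2 0)//; try lra.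
  rewrite !pp_ge0; [|lra|lra].
  by rewrite (_ : 2`! = 2%N)// (_ : 3`! = 6%N)//; field.
by apply: eq_Rintegral => x; rewrite inE/= in_itv/= => /qE ->.
Qed.

Lemma int_kern3_sqr (h e : R) : 0 < h -> 0 < e -> e <= h ->
  `|\int[leb]_z (kern h e 3 z) ^+ 2 - 2 / 3 * h ^+ 3| <= 8 * h ^+ 2 * e.
Proof.
move=> h0 e0 eh.
have ct : continuous (tent h).
  move=> x; apply/cvgrPdist_le => eps eps0; apply/nbhs_ballP; exists eps => //= y xy.
  by apply: (le_trans (tent_lip _ _ (ltW h0))); exact: ltW.
have sq (F : R -> R) : continuous F -> continuous (fun z => F z ^+ 2).
  by move=> cF x; apply: (@continuous_comp _ _ _ F (fun x => x ^+ 2)); [exact: cF|exact: exprn_continuous].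
have c2 := sq _ (@kern_continuous R h e 1).
have c1 := sq _ ct.
have h2 : - (2 * h) <= 2 * h by lra.
rewrite -int_tent_sqr//.
rewrite (@csupp_Rint _ (2 * h)); last by move=> x hx; rewrite kern3_supp ?expr0n//; apply: ltW; lra.
rewrite [X in _ - X](@csupp_Rint _ (2 * h)); last by move=> x hx; rewrite tent0 ?expr0n//; lra.
have i1 := @cont_integrable _ (- (2 * h)) (2 * h) c2.
have i2 := @cont_integrable _ (- (2 * h)) (2 * h) c1.
rewrite -RintegralB//.
have -> : 8 * h ^+ 2 * e = 2 * h * e * (2 * h - - (2 * h)) by ring.
apply: Rint_seg_bd => // [x|x _]; first by apply: cvgB; [exact: c2|exact: c1].
rewrite subr_sqr normrM [leRHS]mulrC ler_pM ?kern3_near//.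
rewrite ger0_norm; last by rewrite addr_ge0 ?kern3_ge0 ?tent_ge0// ltW.
have -> : 2 * h = h + h by ring.
by rewrite lerD ?kern3_le ?tent_le// ltW.
Qed.

End kernel_integrals.

End real_analysis.

(** * Occupation densities of one path *)

Section occupation.
Context (R : realType).
Local Notation leb := (@lebesgue_measure R).
Variables (p f : R -> R) (s : R).
Hypotheses (cp : continuous p) (cf : continuous f) (s0 : 0 <= s).
Hypothesis occ : forall phi : R -> R, measurable_fun setT phi -> bounded_fun phi ->
  (\int[leb]_(r in `[0%R, s]) (phi (p r))%:E = \int[leb]_x (phi x * f x)%:E)%E.

Let ind (a b : R) (x : R) : R := \1_(`[a, b]%classic : set R) x.

Let mind a b : measurable_fun setT (ind a b). Proof. exact: measurable_indic. Qed.
Let ind01 a b x : 0 <= ind a b x <= 1.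
Proof. by rewrite /ind indicE; case: (x \in _); rewrite /= ler01 lexx. Qed.
Let bind a b : bounded_fun (ind a b).
Proof.
exists 1; split; first exact: num_real.
move=> x x1 y _ /=; case/andP: (ind01 a b y) => ? ?; rewrite ger0_norm//.
by apply: (le_trans _ (ltW x1)).
Qed.

Let bump (g : R -> R) a b c : continuous g -> a < b -> 0 < c ->
  (forall x, a <= x <= b -> c <= g x) -> (0 < \int[leb]_x (ind a b x * g x)%:E)%E.
Proof.
move=> cg ab c0 gc.
apply: (@lt_le_trans _ _ (\int[leb]_x (ind a b x * c)%:E)%E).
  have -> : (\int[leb]_x (ind a b x * c)%:E = (c * (b - a))%:E)%E.
    transitivity (\int[leb]_(x in `[a, b]) (cst c%:E x))%E.
      rewrite [RHS]integral_mkcond; apply: eq_integral => x _.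
      by rewrite /ind indicE patchE; case: ifP => _; rewrite ?mul1r ?mul0r.
    rewrite integral_cst//.
    by have := lebesgue_measure_itv `[a, b]; rewrite /= lte_fin ab => ->; rewrite EFinM.
  by rewrite lte_fin mulr_gt0// subr_gt0.
have mg : measurable_fun setT g by exact: continuous_measurable_fun.
have m1 : measurable_fun setT (fun x => ind a b x * c) by exact: measurable_funM.
have m2 : measurable_fun setT (fun x => ind a b x * g x) by exact: measurable_funM.
have le x : ind a b x * c <= ind a b x * g x.
  rewrite /ind indicE; case: (boolP (x \in _)) => h; last by rewrite !mul0r.
  by rewrite !mul1r gc//; move: h; rewrite inE/= in_itv.
have ge x : 0 <= ind a b x * c by rewrite mulr_ge0 ?(ltW c0)//; case/andP: (ind01 a b x).
apply: ge0_le_integral => //.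
- by move=> x _; rewrite lee_fin.
- exact/measurable_EFinP.
- exact/measurable_EFinP.
- by move=> x _; rewrite lee_fin.
Qed.

Let near (g : R -> R) x : continuous g -> 0 < g x -> forall d0, 0 < d0 ->
  exists2 dl, 0 < dl <= d0 & forall y, x - dl <= y <= x + dl -> g x / 2 <= g y.
Proof.
move=> cg gx d0 d00.
have g2 : 0 < g x / 2 by rewrite divr_gt0.
have /cvgrPdist_le/(_ _ g2)/nbhs_ballP[del /= del0 Hd] := cg x.
exists (Num.min (del / 2) d0).
  by rewrite lt_min d00 divr_gt0//= ge_min lexx orbT.
move=> y /andP[y1 y2].
have m1 : Num.min (del / 2) d0 <= del / 2 by rewrite ge_min lexx.
have : `|g x - g y| <= g x / 2.
  apply: Hd; rewrite /ball/= ltr_norml; apply/andP; split; lra.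
by have := ler_norm (g x - g y); lra.
Qed.

(** A negative value would, by continuity, persist on an interval, and the occupation formula for
    its indicator would equate a nonnegative time with a negative integral. *)
Lemma occ_ge0 x : 0 <= f x.
Proof.
rewrite leNgt; apply/negP => fx.
have cN : continuous (fun x => - f x) by move=> y; apply: cvgN; exact: cf.
have fx' : 0 < - f x by rewrite oppr_gt0.
have [dl /andP[dl0 _] H] := near cN fx' ltr01.
have ab : x - dl < x + dl by lra.
have c0 : 0 < - f x / 2 by rewrite divr_gt0.
have := bump cN ab c0 H.
have : (0 <= \int[leb]_x0 (ind (x - dl) (x + dl) x0 * f x0)%:E)%E.
  rewrite -(occ (mind _ _) (bind _ _)); apply: integral_ge0 => y _.
  by rewrite lee_fin; case/andP: (ind01 (x - dl) (x + dl) (p y)).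
have mf : measurable_fun setT f by exact: continuous_measurable_fun.
have le0 y : 0 <= ind (x - dl) (x + dl) y * - f y.
  rewrite /ind indicE; case: (boolP (y \in _)) => h; last by rewrite mul0r.
  rewrite mul1r (le_trans (ltW c0))// H//; by move: h; rewrite inE/= in_itv.
have -> : (\int[leb]_x0 (ind (x - dl) (x + dl) x0 * f x0)%:E =
  - \int[leb]_x0 (ind (x - dl) (x + dl) x0 * - f x0)%:E)%E.
  rewrite -integral_ge0N//; last by move=> y _; rewrite lee_fin.
  by apply: eq_integral => y _; rewrite -EFinN mulrN opprK.
by rewrite oppe_ge0 leNgt => /negP.
Qed.

Lemma occ_eq0 : s = 0 -> forall x, f x = 0.
Proof.
move=> s_eq0 x; apply/eqP; rewrite eq_le occ_ge0 andbT leNgt; apply/negP => fx.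
have [dl /andP[dl0 _] H] := near cf fx ltr01.
have ab : x - dl < x + dl by lra.
have c0 : 0 < f x / 2 by rewrite divr_gt0.
have := bump cf ab c0 H.
by rewrite -(occ (mind _ _) (bind _ _)) s_eq0 set_itv1 integral_set1 ltxx.
Qed.

(** The path is bounded on [0, s]. A positive density at a point beyond its range would give
    positive time to an interval that the path does not visit. *)
Lemma occ_supp : exists2 M, 0 < M & forall x, M < `|x| -> f x = 0.
Proof.
have [M0 HM0] : exists M0, forall r, 0 <= r <= s -> `|p r| <= M0.
  have cn : {within `[0, s]%classic, continuous (fun r => `|p r|)}.
    by apply: continuous_subspaceT => r; apply: cvg_norm; exact: cp.
  have [c _ H] := EVT_max s0 cn.
  by exists `|p c| => r rs; apply: H; rewrite in_itv.
have M00 : 0 <= M0 by have := HM0 0; rewrite lexx s0 => /(_ isT); exact: le_trans.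
exists (M0 + 1); first by rewrite ltr_wpDl.
move=> x Mx; apply/eqP; rewrite eq_le occ_ge0 andbT leNgt; apply/negP => fx.
have [dl /andP[dl0 dl1] H] := near cf fx ltr01.
have ab : x - dl < x + dl by lra.
have c0 : 0 < f x / 2 by rewrite divr_gt0.
have := bump cf ab c0 H.
rewrite -(occ (mind _ _) (bind _ _)).
rewrite (eq_integral (fun _ => 0%E)) ?integral0 ?ltxx// => r.
rewrite inE/= in_itv/= => rs; have := HM0 r rs => pr.
rewrite /ind indicE memNset//= in_itv/= => /andP[h1 h2].
have : `|x| <= `|p r| + `|x - p r|.
  by rewrite -{1}(subrK (p r) x) addrC; exact: ler_normD.
have : `|x - p r| <= 1 by rewrite ler_norml; apply/andP; split; lra.
by lra.
Qed.

Lemma occ_R (phi : R -> R) : measurable_fun setT phi -> bounded_fun phi ->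
  \int[leb]_(r in `[0, s]) phi (p r) = \int[leb]_x (phi x * f x).
Proof. by move=> mphi bphi; rewrite /Rintegral occ. Qed.

End occupation.

Section riemann_double.
Context (R : realType).
Local Notation leb := (@lebesgue_measure R).
Variables (p p' psi : R -> R) (s t K M : R).
Hypotheses (cp : continuous p) (cp' : continuous p') (s0 : 0 < s) (t0 : 0 < t).
Hypotheses (psiK : forall x y, `|psi x - psi y| <= K * `|x - y|).

Let K0 : 0 <= K.
Proof. by have := le_trans (normr_ge0 _) (psiK 1 0); rewrite subr0 normr1 mulr1. Qed.

Lemma lip_continuous (g : R -> R) k : (forall x y, `|g x - g y| <= k * `|x - y|) -> continuous g.
Proof.
move=> gk x; apply/cvgrPdist_le => eps eps0.
have k0 : 0 <= k by have := le_trans (normr_ge0 _) (gk 1 0); rewrite subr0 normr1 mulr1.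
have k1 : 0 < k + 1 by rewrite ltr_wpDl.
apply/nbhs_ballP; exists (eps / (k + 1)) => /=; first by rewrite divr_gt0.
move=> y; rewrite /ball/= => xy; apply: (le_trans (gk _ _)).
apply: (@le_trans _ _ ((k + 1) * `|x - y|)); first by rewrite ler_wpM2r// lerDl.
by rewrite mulrC -ler_pdivlMr// ltW.
Qed.

Definition avg (y : R) := \int[leb]_(r in `[0, s]) psi (p r - y).

Let cpsi := lip_continuous psiK.
Let cpy y : continuous (fun r => psi (p r - y)).
Proof.
move=> r; apply: (@continuous_comp _ _ _ (fun r => p r - y) psi); last exact: cpsi.
by apply: cvgB; [exact: cp|exact: cvg_cst].
Qed.

Lemma avg_lip x y : `|avg x - avg y| <= s * K * `|x - y|.
Proof.
rewrite /avg -RintegralB//; try exact: cont_integrable.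
have -> : s * K * `|x - y| = K * `|x - y| * (s - 0) by rewrite subr0; ring.
apply: Rint_seg_bd => [r||r _]; first by apply: cvgB; exact: cpy.
  exact: ltW.
apply: (le_trans (psiK _ _)); rewrite le_eqVlt; apply/orP; left; apply/eqP.
by congr (_ * _); rewrite -normrN; congr `|_|; ring.
Qed.

Let cavg := lip_continuous avg_lip.

(** Uniform continuity of the two paths bounds the oscillation of the integrand on each cell. The
    inner sums are close to [avg] uniformly in [y], and [avg] is again Lipschitz, so the outer sum
    is treated in the same way. *)
Lemma riemann_double :
  \sum_(0 <= j < n) \sum_(0 <= k < n) (s / n%:R) * (t / n%:R) *
      psi (p (j%:R * (s / n%:R)) - p' (k%:R * (t / n%:R))) @[n --> \oo] -->
  \int[leb]_(u in `[0, t]) avg (p' u).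
Proof.
apply/cvgrPdist_le => eps eps0.
pose c := 2 * (s * t * K) + 1.
have stK : 0 <= s * t * K by rewrite !mulr_ge0 ?(ltW s0) ?(ltW t0).
have c0 : 0 < c by rewrite /c; lra.
pose eta := eps / c.
have eta0 : 0 < eta by rewrite divr_gt0.
have [d1 d10 H1] := heine s cp eta0.
have [d2 d20 H2] := heine t cp' eta0.
have cvv (a dl : R) : 0 < dl -> \forall n \near \oo, a / n%:R <= dl.
  move=> dl0; exists (Num.truncn (`|a| / dl)).+1 => // n /= hn.
  have n0 : 0 < n%:R :> R by rewrite ltr0n (leq_trans _ hn).
  rewrite ler_pdivrMr// mulrC -ler_pdivrMr//.
  apply: (@le_trans _ _ (`|a| / dl)); first by rewrite ler_wpM2r ?invr_ge0 ?(ltW dl0) ?ler_norm.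
  apply: (le_trans (ltW (truncnS_gt _))); by rewrite ler_nat.
near=> n.
have n0 : 0 < n%:R :> R by rewrite ltr0n; near: n; exact: nbhs_infty_gt.
have vd : s / n%:R <= d1 by near: n; exact: (cvv s d1 d10).
have vd' : t / n%:R <= d2 by near: n; exact: (cvv t d2 d20).
set v := s / n%:R in vd *; set v' := t / n%:R in vd' *.
have v0 : 0 <= v by rewrite divr_ge0 ?(ltW s0)// ltW.
have v0' : 0 <= v' by rewrite divr_ge0 ?(ltW t0)// ltW.
have nv : n%:R * v = s by rewrite /v mulrC divfK ?gt_eqF.
have nv' : n%:R * v' = t by rewrite /v' mulrC divfK ?gt_eqF.
have step (a : R) (j : nat) r : 0 <= a -> (j < n)%N -> j%:R * a <= r <= j.+1%:R * a ->
    [/\ 0 <= r <= n%:R * a, 0 <= j%:R * a <= n%:R * a & `|r - j%:R * a| <= a].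
  move=> a0 jn /andP[h1 h2].
  have ja : 0 <= j%:R * a by rewrite mulr_ge0.
  have jn' : j.+1%:R * a <= n%:R * a by rewrite ler_wpM2r// ler_nat.
  have e : j.+1%:R * a = j%:R * a + a by rewrite -natr1 mulrDl mul1r.
  split; [apply/andP; split; lra|apply/andP; split; lra|].
  by rewrite ler_norml; apply/andP; split; lra.
have A y : `|\sum_(0 <= j < n) v * psi (p (j%:R * v) - y) - avg y| <= s * (K * eta).
  have := @riemann_sum _ (fun r => psi (p r - y)) v (K * eta) n (@cpy y) v0.
  rewrite nv; apply => j r jn jr; have [r1 r2 r3] := step v j r v0 jn jr.
  apply: (le_trans (psiK _ _)); rewrite ler_wpM2l//.
  rewrite (_ : p r - y - _ = p r - p (j%:R * v)); last by ring.
  by apply: H1; rewrite -?nv// (le_trans r3).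
have B : `|\sum_(0 <= k < n) v' * avg (p' (k%:R * v')) - \int[leb]_(u in `[0, t]) avg (p' u)|
    <= t * (s * K * eta).
  have cap : continuous (fun u => avg (p' u)).
    by move=> u; apply: (@continuous_comp _ _ _ p' avg); [exact: cp'|exact: cavg].
  have := @riemann_sum _ (fun u => avg (p' u)) v' (s * K * eta) n cap v0'.
  rewrite nv'; apply => j r jn jr; have [r1 r2 r3] := step v' j r v0' jn jr.
  apply: (le_trans (avg_lip _ _)); rewrite ler_wpM2l ?mulr_ge0 ?(ltW s0)//.
  by apply: H2; rewrite -?nv'// (le_trans r3).
rewrite distrC exchange_big/=.
have -> : \sum_(0 <= k < n) \sum_(0 <= j < n) v * v' * psi (p (j%:R * v) - p' (k%:R * v')) =
   \sum_(0 <= k < n) v' * (\sum_(0 <= j < n) v * psi (p (j%:R * v) - p' (k%:R * v')) - avg (p' (k%:R * v')))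
   + \sum_(0 <= k < n) v' * avg (p' (k%:R * v')).
  rewrite -big_split/=; apply: eq_bigr => k _; rewrite -mulrDr subrK mulr_sumr.
  by apply: eq_bigr => j _; ring.
rewrite -addrA; apply: (le_trans (ler_normD _ _)).
apply: (@le_trans _ _ (t * (s * (K * eta)) + t * (s * K * eta))).
  apply: lerD => //; apply: (le_trans (ler_norm_sum _ _ _)).
  apply: (@le_trans _ _ (\sum_(0 <= k < n) v' * (s * (K * eta)))).
    by apply: ler_sum => k _; rewrite normrM ger0_norm// ler_wpM2l.
  by rewrite sumr_const_nat subn0 -mulr_natl mulrA nv'.
have -> : t * (s * (K * eta)) + t * (s * K * eta) = (c - 1) * eta by rewrite /c; ring.
have : c * eta = eps by rewrite /eta mulrC divfK// gt_eqF.
by move: (ltW eta0); lra.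
Unshelve. all: by end_near. Qed.

End riemann_double.

Lemma lip_bounded_fun (R : realType) (psi : R -> R) (M : R) :
  (forall x, `|psi x| <= M) -> bounded_fun psi.
Proof.
move=> pM; exists M; split; first exact: num_real.
by move=> x x1 y _ /=; apply: (le_trans (pM y)); exact: ltW.
Qed.

Section shift_product.
Context (R : realType).
Local Notation leb := (@lebesgue_measure R).
Variables (f g : R -> R).
Hypotheses (cf : continuous f) (cg : continuous g) (M : R).
Hypotheses (fM : forall x, M < `|x| -> f x = 0) (gM : forall x, M < `|x| -> g x = 0).

Let csh (k : R -> R) (a : R) : continuous k -> continuous (fun x => k (x + a)).
Proof.
move=> ck x; apply: (@continuous_comp _ _ _ (fun x => x + a) k); last exact: ck.
by apply: cvgD; [exact: cvg_id|exact: cvg_cst].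
Qed.

Let cM (k l : R -> R) : continuous k -> continuous l -> continuous (fun x => k x * l x).
Proof. by move=> ck cl x; apply: cvgM; [exact: ck|exact: cl]. Qed.

Let iM (k l : R -> R) : continuous k -> continuous l ->
  (exists N, forall x, N < `|x| -> k x * l x = 0) ->
  leb.-integrable setT (EFin \o (fun x => k x * l x)).
Proof. by move=> ck cl [N kN]; exact: (csupp_integrable (cM ck cl) kN). Qed.

(** Summation by parts, through translation invariance of Lebesgue measure. This is where the minus
    sign in front of the product of the increments comes from. *)
Lemma second_difference_product h :
  \int[leb]_x (d2 h f x * g x) = - \int[leb]_x ((f (x + h) - f x) * (g (x + h) - g x)).
Proof.
have i1 : leb.-integrable setT (EFin \o (fun x => f (x + h) * g x)).
  by apply: iM => //; [exact: csh|exists M => x xM; rewrite gM// mulr0].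
have i2 : leb.-integrable setT (EFin \o (fun x => f x * g x)).
  by apply: iM => //; exists M => x xM; rewrite gM// mulr0.
have i3 : leb.-integrable setT (EFin \o (fun x => f (x - h) * g x)).
  by apply: iM => //; [exact: csh|exists M => x xM; rewrite gM// mulr0].
have i4 : leb.-integrable setT (EFin \o (fun x => f x * g (x + h))).
  by apply: iM => //; [exact: csh|exists M => x xM; rewrite fM// mul0r].
have i5 : leb.-integrable setT (EFin \o (fun x => f (x + h) * g (x + h))).
  exact: (@integrable_shift R h (fun x => f x * g x)).
have m2 : measurable_fun setT (fun x => f x * g x).
  by apply: continuous_measurable_fun; exact: cM.
have m4 : measurable_fun setT (fun x : R => f (x - h) * g x).
  by apply: continuous_measurable_fun; apply: cM => //; exact: csh.
have e5 : \int[leb]_x (f (x + h) * g (x + h)) = \int[leb]_x (f x * g x).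
  exact: (@Rintegral_shift R h (fun x => f x * g x)).
have e4 : \int[leb]_x (f x * g (x + h)) = \int[leb]_x (f (x - h) * g x).
  rewrite -(@Rintegral_shift R h (fun x => f (x - h) * g x))//.
  by apply: eq_Rintegral => x _; rewrite addrK.
have -> : \int[leb]_x (d2 h f x * g x) =
   \int[leb]_x (f (x + h) * g x) - 2 * \int[leb]_x (f x * g x) + \int[leb]_x (f (x - h) * g x).
  rewrite -RintegralZl//.
  have i22 : leb.-integrable setT (EFin \o (fun x => 2 * (f x * g x))).
    by have := @integrableZl _ _ _ leb setT measurableT 2 _ i2; apply: eq_integrable.
  rewrite -RintegralB// -RintegralD//.
    by apply: eq_Rintegral => x _; rewrite /d2; ring.
  by have := integrableB measurableT i1 i22; apply: eq_integrable.
have -> : \int[leb]_x ((f (x + h) - f x) * (g (x + h) - g x)) =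
   (\int[leb]_x (f (x + h) * g (x + h)) - \int[leb]_x (f (x + h) * g x)) -
   (\int[leb]_x (f x * g (x + h)) - \int[leb]_x (f x * g x)).
  rewrite -!RintegralB//.
    by apply: eq_Rintegral => x _; ring.
  - by have := integrableB measurableT i5 i1; apply: eq_integrable.
  - by have := integrableB measurableT i4 i2; apply: eq_integrable.
by rewrite e5 e4; ring.
Qed.

End shift_product.

(** * Limits for a fixed pair of paths *)

Section good_paths.
Context (R : realType).
Local Notation leb := (@lebesgue_measure R).
Variables (p p' f g : R -> R) (s t : R).
Hypotheses (cp : continuous p) (cp' : continuous p') (s0 : 0 < s) (t0 : 0 < t).
Hypotheses (cf : continuous f) (cg : continuous g).
Hypothesis occ : forall phi : R -> R, measurable_fun setT phi -> bounded_fun phi ->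
  (\int[leb]_(r in `[0%R, s]) (phi (p r))%:E = \int[leb]_x (phi x * f x)%:E)%E.
Hypothesis occ' : forall phi : R -> R, measurable_fun setT phi -> bounded_fun phi ->
  (\int[leb]_(r in `[0%R, t]) (phi (p' r))%:E = \int[leb]_x (phi x * g x)%:E)%E.

Let supp : exists2 M, 0 < M & (forall x, M < `|x| -> f x = 0) /\ (forall x, M < `|x| -> g x = 0).
Proof.
have [M M0 fM] := occ_supp cp cf (ltW s0) occ.
have [N N0 gN] := occ_supp cp' cg (ltW t0) occ'.
exists (Num.max M N); first by rewrite lt_max M0.
by split=> x; rewrite gt_max => /andP[? ?]; [exact: fM|exact: gN].
Qed.

Let bounded (k : R -> R) : continuous k -> (exists N, forall x, N < `|x| -> k x = 0) ->
  exists K, forall x, `|k x| <= K.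
Proof.
move=> ck [N kN].
have cn : {within `[- `|N|, `|N|]%classic, continuous (fun r => `|k r|)}.
  by apply: continuous_subspaceT => r; apply: cvg_norm; exact: ck.
have NN : - `|N| <= `|N| by have := normr_ge0 N; lra.
have [c _ H] := EVT_max NN cn.
exists `|k c| => x; have [h|h] := lerP `|x| `|N|.
  by apply: H; rewrite in_itv/= -ler_norml.
by rewrite kN ?normr0//; apply: le_lt_trans h; exact: ler_norm.
Qed.

(** The double time integral of psi(p_r - p'_u), of which only the integral along the second path
    has been written through its occupation density. *)
Definition Jint (psi : R -> R) := \int[leb]_y (avg p psi s y * g y).

Lemma double_sum_cvg (psi : R -> R) (K M : R) :
  (forall x y, `|psi x - psi y| <= K * `|x - y|) -> (forall x, `|psi x| <= M) ->
  \sum_(0 <= j < n) \sum_(0 <= k < n) (s / n%:R) * (t / n%:R) *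
      psi (p (j%:R * (s / n%:R)) - p' (k%:R * (t / n%:R))) @[n --> \oo] --> Jint psi.
Proof.
move=> psiK psiM; have := @riemann_double _ p p' psi s t K cp cp' s0 t0 psiK.
rewrite /Jint (occ_R occ')//.
  apply: continuous_measurable_fun; apply: lip_continuous.
  exact: (avg_lip cp s0 psiK).
apply: (@lip_bounded_fun _ _ (M * (s - 0))) => y.
apply: Rint_seg_bd => // [r|]; last exact: ltW.
apply: (@continuous_comp _ _ _ (fun r => p r - y) psi).
  by apply: cvgB; [exact: cp|exact: cvg_cst].
exact: (lip_continuous psiK).
Qed.

Let avgE (psi : R -> R) (K M : R) y :
  (forall x y, `|psi x - psi y| <= K * `|x - y|) -> (forall x, `|psi x| <= M) ->
  avg p psi s y = \int[leb]_x (psi (x - y) * f x).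
Proof.
move=> psiK psiM; rewrite /avg (occ_R occ (phi := fun x => psi (x - y)))//.
  apply: continuous_measurable_fun => x.
  apply: (@continuous_comp _ _ _ (fun x => x - y) psi); last exact: (lip_continuous psiK).
  by apply: cvgB; [exact: cvg_id|exact: cvg_cst].
by apply: (@lip_bounded_fun _ _ M).
Qed.

(** The two second differences commute, so [kern h e 1] is the second difference at scale [h] of
    [e ^- 2 * tent e]. The latter is an approximate identity, since the tent of width [e] has
    integral e^2. *)
Lemma J1_cvg h (e : nat -> R) : 0 < h -> (forall i, 0 < e i) -> e i @[i --> \oo] --> (0 : R) ->
  Jint (kern h (e i) 1) @[i --> \oo] -->
  - \int[leb]_x ((f (x + h) - f x) * (g (x + h) - g x)).
Proof.
move=> h0 e0 ec.
have [M M0 [fM gM]] := supp.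
have [Kf fK] : exists K, forall x, `|f x| <= K by apply: bounded => //; exists M.
rewrite -(second_difference_product cf cg fM gM).
pose rho i z := e i ^- 2 * tent (e i) z.
have r0 i z : 0 <= rho i z by rewrite mulr_ge0 ?invr_ge0 ?sqr_ge0 ?tent_ge0 ?(ltW (e0 i)).
have ctent i : continuous (tent (e i)).
  by apply: (@lip_continuous _ _ 1) => x y; rewrite mul1r; apply: tent_lip; exact: ltW.
have cr i : continuous (rho i) by move=> z; apply: cvgM; [exact: cvg_cst|exact: ctent].
have sr i z : e i < `|z| -> rho i z = 0.
  by move=> h1; rewrite /rho tent0 ?mulr0//; exact: ltW.
have itent i : leb.-integrable setT (EFin \o tent (e i)).
  by apply: (@csupp_integrable _ _ (e i)) => // x hx; rewrite tent0//; exact: ltW.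
have ir i : \int[leb]_z rho i z = 1.
  by rewrite RintegralZl// int_tent// mulVf// expf_neq0// gt_eqF.
have irc : \int[leb]_z rho i z @[i --> \oo] --> (1 : R).
  by under eq_cvg do rewrite ir; exact: cvg_cst.
have AI y := @approx_id R rho e 1 Kf f y r0 cr sr ec irc cf fK.
pose A i y := \int[leb]_x (rho i (x - y) * f x).
have irf i y : leb.-integrable setT (EFin \o (fun x => rho i (x - y) * f x)).
  apply: (@csupp_integrable _ _ M) => [x|x xM]; last by rewrite fM// mulr0.
  apply: cvgM; last exact: cf.
  apply: (@continuous_comp _ _ _ (fun x => x - y)); last exact: cr.
  by apply: cvgB; [exact: cvg_id|exact: cvg_cst].
have kE i z : kern h (e i) 1 z = rho i (z + h) - 2 * rho i z + rho i (z - h).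
  by rewrite /kern d2C /rho /tent [d2 h _ z]/d2; ring.
have lip i := @kern1_lip R h (e i) h0 (e0 i).
have bd i := @kern1_bd R h (e i) h0 (e0 i).
have EA i y : avg p (kern h (e i) 1) s y = A i (y - h) - 2 * A i y + A i (y + h).
  rewrite (avgE y (lip i) (bd i)) /A -RintegralZl//.
  have i22 : leb.-integrable setT (EFin \o (fun x => 2 * (rho i (x - y) * f x))).
    by have := @integrableZl _ _ _ leb setT measurableT 2 _ (irf i y); apply: eq_integrable.
  rewrite -RintegralB// -RintegralD//.
    apply: eq_Rintegral => x _; rewrite kE.
    rewrite (_ : x - (y - h) = x - y + h); last by ring.
    rewrite (_ : x - (y + h) = x - y - h); last by ring.
    by ring.
  by have := integrableB measurableT (irf i (y - h)) i22; apply: eq_integrable.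
have Ab i y : `|A i y| <= Kf by have [_ /(_ i)] := AI y; rewrite ir mulr1.
apply: (@Rint_cvg _ _ _ _ (4 * Kf)).
- move=> i; apply: continuous_measurable_fun; apply: lip_continuous.
  exact: (avg_lip cp s0 (lip i)).
- apply: continuous_measurable_fun => x.
  have cs a : continuous (fun x => f (x + a)).
    move=> z; apply: (@continuous_comp _ _ _ (fun x => x + a) f); last exact: cf.
    by apply: cvgD; [exact: cvg_id|exact: cvg_cst].
  apply: cvgD; last exact: cs.
  by apply: cvgB; [exact: cs|apply: cvgM; [exact: cvg_cst|exact: cf]].
- move=> i y; rewrite EA; have := Ab i (y - h); have := Ab i y; have := Ab i (y + h).
  rewrite !ler_norml => /andP[? ?] /andP[? ?] /andP[? ?]; apply/andP; split; lra.
- exact: (csupp_integrable cg gM).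
- move=> y; under eq_cvg do rewrite EA.
  have AC z : A i z @[i --> \oo] --> f z by have [+ _] := AI z; rewrite mul1r.
  rewrite (_ : d2 h f y = f (y - h) - 2 * f y + f (y + h)); last by rewrite /d2; ring.
  apply: cvgD; last exact: AC.
  by apply: cvgB; [exact: AC|apply: cvgM; [exact: cvg_cst|exact: AC]].
Qed.

Lemma kern3_sqr_lip h (e : R) : 0 < h -> 0 < e -> forall x y,
  `|kern h e 3 x ^+ 2 - kern h e 3 y ^+ 2| <= 16 * h ^+ 3 * e ^- 2 * `|x - y|.
Proof.
move=> h0 e0 x y; rewrite subr_sqr normrM.
have l := kern_lip_step (kern2_bd h0 e0) x y.
have b : `|kern h e 3 x + kern h e 3 y| <= 2 * h.
  rewrite ger0_norm ?addr_ge0 ?kern3_ge0//; have := kern3_le h0 e0 x; have := kern3_le h0 e0 y; lra.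
apply: (le_trans (ler_pM _ _ l b)) => //.
by rewrite le_eqVlt; apply/orP; left; apply/eqP; ring.
Qed.

Lemma kern3_sqr_bd h (e : R) x : 0 < h -> 0 < e -> `|kern h e 3 x ^+ 2| <= h ^+ 2.
Proof.
move=> h0 e0; rewrite ger0_norm ?sqr_ge0// lerXn2r ?nnegrE ?kern3_ge0 ?kern3_le//.
exact: ltW.
Qed.

(** The normalised squared kernel is an approximate identity of limiting mass 32/3. Smoothing
    changes the mass by at most 128 e/h, which [e <= h ^+ 2] sends to 0. *)
Lemma J3_cvg (h e : nat -> R) : (forall i, 0 < h i) -> (forall i, h i <= 1) ->
  (forall i, 0 < e i) -> (forall i, e i <= h i ^+ 2) -> h i @[i --> \oo] --> (0 : R) ->
  16 / h i ^+ 3 * Jint (fun z => kern (h i) (e i) 3 z ^+ 2) @[i --> \oo] -->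
  32 / 3 * \int[leb]_x (f x * g x).
Proof.
move=> h0 h1 e0 eh hc.
have [M M0 [fM gM]] := supp.
have [Kf fK] : exists K, forall x, `|f x| <= K by apply: bounded => //; exists M.
have eh' i : e i <= h i.
  by apply: (le_trans (eh i)); rewrite expr2 ler_piMl// ltW.
pose rho i z := 16 / h i ^+ 3 * kern (h i) (e i) 3 z ^+ 2.
have h30 i : 0 < 16 / h i ^+ 3 by rewrite divr_gt0 ?exprn_gt0.
have r0 i z : 0 <= rho i z by rewrite mulr_ge0 ?sqr_ge0 ?(ltW (h30 i)).
have lip i := kern3_sqr_lip (h0 i) (e0 i).
have bd i x := kern3_sqr_bd x (h0 i) (e0 i).
have ck i : continuous (fun z => kern (h i) (e i) 3 z ^+ 2) by exact: (lip_continuous (lip i)).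
have cr i : continuous (rho i) by move=> z; apply: cvgM; [exact: cvg_cst|exact: ck].
have sr i z : 2 * h i < `|z| -> rho i z = 0.
  by move=> hz; rewrite /rho kern3_supp ?expr0n ?mulr0//; have := eh' i; lra.
have h2c : 2 * h i @[i --> \oo] --> (0 : R).
  by rewrite -[X in _ --> X](mulr0 2); apply: cvgM => //; exact: cvg_cst.
have ik i : leb.-integrable setT (EFin \o (fun z => kern (h i) (e i) 3 z ^+ 2)).
  apply: (@csupp_integrable _ _ (2 * h i)) => // x hx.
  by rewrite kern3_supp ?expr0n//; have := eh' i; lra.
have irc : \int[leb]_z rho i z @[i --> \oo] --> (32 / 3 : R).
  apply/cvgrPdist_le => eps eps0.
  have e128 : 0 < eps / 128 by rewrite divr_gt0.
  near=> i.
  have hi : h i <= eps / 128.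
    near: i; move/cvgrPdist_le : hc => /(_ _ e128); apply: filterS => i.
    by rewrite sub0r normrN; exact: le_trans (ler_norm _).
  rewrite /rho RintegralZl// distrC.
  have := int_kern3_sqr (h0 i) (e0 i) (eh' i); set I := \int[leb]_z _ => hI.
  have hn0 : h i != 0 by rewrite gt_eqF.
  have -> : 16 / h i ^+ 3 * I - 32 / 3 = 16 / h i ^+ 3 * (I - 2 / 3 * h i ^+ 3) by field.
  rewrite normrM (gtr0_norm (h30 i)).
  apply: (@le_trans _ _ (16 / h i ^+ 3 * (8 * h i ^+ 2 * e i))); first by rewrite ler_wpM2l ?(ltW (h30 i)).
  have -> : 16 / h i ^+ 3 * (8 * h i ^+ 2 * e i) = 128 * (e i / h i) by field.
  have : e i / h i <= h i by rewrite ler_pdivrMr// -expr2.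
  by lra.
have AI y := @approx_id R rho (fun i => 2 * h i) (32 / 3) Kf f y r0 cr sr h2c irc cf fK.
pose A i y := \int[leb]_x (rho i (x - y) * f x).
have EA i y : 16 / h i ^+ 3 * avg p (fun z => kern (h i) (e i) 3 z ^+ 2) s y = A i y.
  rewrite (avgE y (lip i) (bd i)) /A -RintegralZl//.
    by apply: eq_Rintegral => x _; rewrite /rho mulrA.
  apply: (@csupp_integrable _ _ M) => [x|x xM]; last by rewrite fM// mulr0.
  apply: cvgM; last exact: cf.
  apply: (@continuous_comp _ _ _ (fun x => x - y) (fun z => kern (h i) (e i) 3 z ^+ 2)); last exact: ck.
  by apply: cvgB; [exact: cvg_id|exact: cvg_cst].
have cA i : continuous (avg p (fun z => kern (h i) (e i) 3 z ^+ 2) s).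
  by apply: lip_continuous; exact: (avg_lip cp s0 (lip i)).
have EJ i : 16 / h i ^+ 3 * Jint (fun z => kern (h i) (e i) 3 z ^+ 2) =
  \int[leb]_y (A i y * g y).
  rewrite /Jint -RintegralZl//.
    by apply: eq_Rintegral => y _; rewrite mulrA EA.
  apply: (@csupp_integrable _ _ M) => [x|x xM]; last by rewrite gM// mulr0.
  by apply: cvgM; [exact: cA|exact: cg].
under eq_cvg do rewrite EJ.
have ig : leb.-integrable setT (EFin \o g) by exact: (csupp_integrable cg gM).
have ifg : leb.-integrable setT (EFin \o (fun x => f x * g x)).
  apply: (@csupp_integrable _ _ M) => [x|x xM]; last by rewrite gM// mulr0.
  by apply: cvgM; [exact: cf|exact: cg].
have [N HN] : exists N, forall i, \int[leb]_z rho i z <= N.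
  have [N [_ HN]] := cvg_seq_bounded (cvgP _ irc).
  by exists (N + 1) => i; apply: (le_trans (ler_norm _)); apply: HN => //; rewrite ltrDl.
rewrite -RintegralZl//.
rewrite (_ : \int[leb]_x (32 / 3 * (f x * g x)) = \int[leb]_x (32 / 3 * f x * g x)); last first.
  by apply: eq_Rintegral => x _; rewrite mulrA.
have Kf0 : 0 <= Kf by apply: (le_trans (normr_ge0 _) (fK 0)).
apply: (@Rint_cvg _ _ _ _ (Kf * N)) => //.
- move=> i; rewrite (_ : A i = fun y => 16 / h i ^+ 3 * avg p (fun z => kern (h i) (e i) 3 z ^+ 2) s y).
    by apply: measurable_funM => //; exact: continuous_measurable_fun.
  by apply/funext => y; rewrite EA.
- by apply: measurable_funM => //; exact: continuous_measurable_fun.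
- by move=> i y; have [_ /(_ i) h'] := AI y; apply: (le_trans h'); rewrite ler_wpM2l.
- by move=> y; have [] := AI y.
Unshelve. all: by end_near. Qed.

Lemma beta_ge0 : 0 <= \int[leb]_x (f x * g x).
Proof.
apply: Rintegral_ge0 => x _.
by rewrite mulr_ge0 ?(occ_ge0 cf occ)//; exact: (occ_ge0 cg occ').
Qed.

End good_paths.

Section caratheodory.
Context d (T : measurableType d) (R : realType).
Local Notation leb := (@lebesgue_measure R).

Let grid (n : nat) (x : R) : R := (Num.floor (n.+1%:R * x))%:~R / n.+1%:R.

Let grid_near n x : `|x - grid n x| <= n.+1%:R^-1.
Proof.
have n0 : 0 < n.+1%:R :> R by rewrite ltr0n.
have /andP[h1 h2] := floor_itv (n.+1%:R * x).
rewrite /grid; set z := (Num.floor _)%:~R in h1 *.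
have h2' : n.+1%:R * x < z + 1 by move: h2; rewrite intrD.
have -> : x - z / n.+1%:R = (n.+1%:R * x - z) / n.+1%:R by field; rewrite gt_eqF.
rewrite ger0_norm; last by rewrite divr_ge0// subr_ge0.
by rewrite ler_pdivrMr// mulVf ?gt_eqF//; lra.
Qed.

(** Replacing the level by the nearest grid point below it gives a function that is jointly
    measurable on countably many strips; continuity in the level lets the grid be refined. *)
Lemma caratheodory_measurable (F : R -> T -> R) : (forall w, continuous (F^~ w)) ->
  (forall x, measurable_fun setT (F x)) ->
  measurable_fun setT (fun z : T * measurableTypeR R => F z.2 z.1).
Proof.
move=> cF mF.
apply: (@measurable_fun_cvg _ _ _ setT (fun n (z : T * measurableTypeR R) => F (grid n z.2) z.1)).
  move=> n _ B mB; rewrite setTI.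
  have -> : (fun z : T * measurableTypeR R => F (grid n z.2) z.1) @^-1` B =
    \bigcup_(k : int) ((F (k%:~R / n.+1%:R) @^-1` B) `*`
      ((fun x : R => n.+1%:R * x) @^-1` `[(k%:~R : R), (k + 1)%:~R[%classic)).
    apply/seteqP; split => [[w x] /= h|[w x] [k _ [/= h1]]].
      exists (Num.floor (n.+1%:R * x)) => //; split => //=.
      by rewrite in_itv/=; exact: floor_itv.
    by rewrite in_itv/= => /floor_def h2; rewrite /grid h2.
  apply: countable_bigcupT_measurable; first exact: countableP.
  move=> k; apply: measurableX.
    by rewrite -[X in measurable X]setTI; exact: mF.
  have mm : measurable_fun setT (fun x : R => n.+1%:R * x) by exact: measurable_funM.
  by rewrite -[X in measurable X]setTI; exact: mm.
move=> [w x] _ /=.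
apply: (@cvg_comp _ _ _ (fun n => grid n x) (F^~ w) _ (nbhs x)); last exact: cF.
apply/cvgrPdist_le => eps eps0; near=> n; apply: (le_trans (grid_near n x)).
by apply: ltW; near: n; exact: (near_infty_natSinv_lt (PosNum eps0)).
Unshelve. all: by end_near. Qed.

Lemma measurable_Rintegral (F : R -> T -> R) : (forall w, continuous (F^~ w)) ->
  (forall x, measurable_fun setT (F x)) ->
  measurable_fun setT (fun w => \int[leb]_x F x w).
Proof.
move=> cF mF; have mm := caratheodory_measurable cF mF.
apply: measurableT_comp => //.
under eq_fun do rewrite integralE.
have pos (G : R -> T -> R) : (forall x w, 0 <= G x w) ->
   measurable_fun setT (fun z : T * measurableTypeR R => G z.2 z.1) ->
   measurable_fun setT (fun w => \int[leb]_x (G x w)%:E)%E.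
  move=> G0 mG.
  apply: (@measurable_fun_fubini_tonelli_F _ _ T (measurableTypeR R) R leb
    (fun z : T * measurableTypeR R => (G z.2 z.1)%:E)).
    exact/measurable_EFinP.
  by move=> z; rewrite lee_fin.
apply: emeasurable_funB.
  under eq_fun do under eq_integral do rewrite funeposE -EFin_max.
  apply: (pos (fun x w => Num.max (F x w) 0)).
    by move=> x w; rewrite le_max lexx orbT.
  exact: measurable_maxr.
under eq_fun do under eq_integral do rewrite funenegE -EFinN -EFin_max.
apply: (pos (fun x w => Num.max (- F x w) 0)).
  by move=> x w; rewrite le_max lexx orbT.
apply: measurable_maxr => //; exact: measurable_funN.
Qed.

End caratheodory.

Section iterated_limit.
Context d (T : measurableType d) (R : realType) (P : probability T R).

(** Two applications of dominated convergence, first in [n] and then in [m]. The conclusion is in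
    the form needed to choose the mesh after the smoothing scale. *)
Lemma iterated_limit (Q : nat -> nat -> T -> R) (q : nat -> T -> R) :
  (forall m n, measurable_fun setT (Q m n)) -> (forall m n w, 0 <= Q m n w <= 1) ->
  {ae P, forall w, forall m, Q m n w @[n --> \oo] --> q m w} ->
  {ae P, forall w, q m w @[m --> \oo] --> (0 : R)} ->
  exists2 u : nat -> R, u m @[m --> \oo] --> (0 : R) &
    forall m, exists N, forall n, (N <= n)%N -> Ex P (Q m n) <= u m.
Proof.
move=> mQ Q01 Qq q0.
(* The limit [q] exists only almost surely and comes without measurability; its clipped upper limit
   is a measurable version. *)
pose q' m w := Num.max 0 (Num.min 1 (limn_sup (fun n => Q m n w))).
have Qn m n w : `|Q m n w| <= 1 by have /andP[? ?] := Q01 m n w; rewrite ger0_norm.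
have mq' m : measurable_fun setT (q' m).
  apply: measurable_maxr => //; apply: measurable_minr => //.
  apply: measurable_fun_limn_sup => // w _.
    by exists 1 => _ [n _ <-]; case/andP: (Q01 m n w).
  by exists 0 => _ [n _ <-]; case/andP: (Q01 m n w).
have qq : {ae P, forall w, forall m, q m w = q' m w}.
  apply: filterS Qq => w h m; have /cvg_limn_inf_sup[_ e] := h m.
  have e' : limn_sup (fun n => Q m n w) = q m w by exact: e.
  have l : limn (fun n => Q m n w) = q m w by apply/cvg_lim => //; exact: h.
  have c : cvgn (fun n => Q m n w) by apply: cvgP; exact: h.
  have q1 : q m w <= 1.
    by rewrite -l; apply: limr_le => //; apply: nearW => n; case/andP: (Q01 m n w).
  have q2 : 0 <= q m w.
    by rewrite -l; apply: limr_ge => //; apply: nearW => n; case/andP: (Q01 m n w).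
  by rewrite /q' e' (min_idPr q1) (max_idPr q2).
have q'01 m w : `|q' m w| <= 1.
  rewrite ger0_norm; last by rewrite le_max lexx.
  by rewrite ge_max ler01 ge_min lexx.
pose u m := Ex P (q' m) + m.+1%:R^-1.
exists u.
  rewrite -[X in _ --> X]addr0; apply: cvgD; last exact: cvg_harmonic.
  have -> : 0 = Ex P (fun _ => 0 : R) by rewrite Ex_cst.
  apply: (@Ex_cvg_dom _ _ _ P q' (fun _ => 0) 1) => //.
  move: qq q0; apply: filterS2 => w h1 h2.
  have <- : (fun m => q m w) = (fun m => q' m w) by apply/funext.
  exact: h2.
move=> m.
have cv : Ex P (Q m n) @[n --> \oo] --> Ex P (q' m).
  apply: (@Ex_cvg_dom _ _ _ P (Q m) (q' m) 1) => //.
  move: qq Qq; apply: filterS2 => w h1 h2.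
  by rewrite -h1; exact: h2.
have m0 : 0 < (m.+1%:R^-1 : R) by rewrite invr_gt0 ltr0n.
have /cvgrPdist_le/(_ _ m0)[N _ HN] := cv.
exists N => n nN; have := HN n nN; rewrite /u distrC => h.
by rewrite -lerBlDl; exact: le_trans (ler_norm _) h.
Qed.

End iterated_limit.

(** * Brownian motion along grids *)

Section brownian_walk.
Context d (T : measurableType d) (R : realType) (P : probability T R).

Lemma sigma_process_measurable (X : R -> T -> R) (D : set R) :
  (forall t, D t -> measurable_fun setT (X t)) -> sigma_process D X `<=` measurable.
Proof.
move=> mX; apply: smallest_sub; first exact: sigma_algebra_measurable.
move=> A [t Dt [B mB <-]]; rewrite setTI.
by rewrite -[X in measurable X]setTI; exact: (mX t Dt).
Qed.

Lemma sigma_process_mono (X : R -> T -> R) (D D' : set R) : D `<=` D' ->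
  sigma_process D X `<=` sigma_process D' X.
Proof. by move=> DD'; apply: sub_sigma_algebra2 => A [t Dt h]; exists t => //; exact: DD'. Qed.

Lemma sigma_process_var (X : R -> T -> R) (D : set R) t : D t ->
  sigma_var (X t) `<=` sigma_process D X.
Proof. by move=> Dt A At; apply: sub_sigma_algebra; exists t. Qed.

Lemma sigma_processI (X : R -> T -> R) (D : set R) : setI_closed (sigma_process D X).
Proof.
move=> A B hA hB; have s := smallest_sigma_algebra setT (\bigcup_(t in D) sigma_var (X t)).
have [s0 sC sU] := s.
have e : A `&` B = setT `\` (\bigcup_i (if i == 0%N then setT `\` A else setT `\` B)).
  apply/seteqP; split => [w [wA wB]|w [_ nw]].
    by split => // -[i _]; case: eqP => _ [].
  split; apply: contrapT => h; apply: nw.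
    by exists 0%N.
  by exists 1%N.
rewrite e; apply: (sC); apply: (sU) => i; case: ifP => _; exact: sC.
Qed.

Lemma indep_systemsC (F G : set (set T)) :
  independent_systems P F G -> independent_systems P G F.
Proof. by move=> h A B hA hB; rewrite setIC h// muleC. Qed.

(** The intersections [A] with [C] form a generating class stable under intersection, on which the
    finite measures P(E and B) and P(E) P(B) agree. *)
Lemma indep_union (F F' : set (set T)) (B : set T) :
  F `<=` measurable -> F' `<=` measurable -> setI_closed F -> setI_closed F' ->
  F setT -> F' setT -> measurable B ->
  (forall A C, F A -> F' C -> P (A `&` C `&` B) = (P (A `&` C) * P B)%E) ->
  forall E, <<s F `|` F' >> E -> P (E `&` B) = (P E * P B)%E.
Proof.
move=> Fm F'm FI F'I FT F'T mB H.
pose C0 := [set E | exists A C, [/\ F A, F' C & E = A `&` C]].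
have PB : P B = (fine (P B))%:E by rewrite fineK// fin_num_measure.
have PB0 : 0 <= fine (P B) by rewrite fine_ge0.
pose m1 := mrestr P mB.
pose m2 := mscale (NngNum PB0) P.
have C0m : C0 `<=` measurable.
  by move=> _ [A [C [/Fm hA /F'm hC ->]]]; exact: measurableI.
have C0T : C0 setT by exists setT, setT; rewrite setIT.
have C0I : setI_closed C0.
  move=> _ _ [A [C [hA hC ->]]] [A' [C' [hA' hC' ->]]].
  by exists (A `&` A'), (C `&` C'); split; [exact: FI|exact: F'I|rewrite setIACA].
have sub : <<s F `|` F' >> `<=` <<s C0 >>.
  apply: smallest_sub; first exact: smallest_sigma_algebra.
  move=> E [hE|hE]; apply: sub_sigma_algebra.
    by exists E, setT; rewrite setIT.
  by exists setT, E; rewrite setTI.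
move=> E /sub hE.
have cov : \bigcup_(k : nat) (setT : set T) = setT.
  by apply/seteqP; split => // w _; exists 0%N.
have eqm A : C0 A -> m1 A = m2 A.
  by move=> [A1 [C [hA hC ->]]]; rewrite /m1 /m2 /mrestr /mscale/= H// -PB muleC.
have fin (k : nat) : (m1 setT < +oo)%E.
  by rewrite /m1 /mrestr setTI -ge0_fin_numE// fin_num_measure.
have := @g_sigma_algebra_measure_unique _ _ _ C0 C0m (fun _ : nat => setT)
  (fun _ => C0T) cov m1 m2 C0I eqm fin E hE.
move=> H0; transitivity ((fine (P B))%:E * P E)%E; first exact: H0.
by rewrite -PB muleC.
Qed.

(** An increment and the past of [W] both lie in the sigma-algebra of [W]. Hence [W'] splits off
    first by independence of the motions, then the past of [W] by independence of increments. *)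
Lemma walk_of_brownian (W W' : R -> T -> R) (v : R) : 0 < v ->
  brownian_motion P W -> (forall t, 0 <= t -> measurable_fun setT (W' t)) ->
  independent_systems P (sigma_process `[0, +oo[ W) (sigma_process `[0, +oo[ W') ->
  walk P (fun j => sigma_process `[0, j%:R * v] W `|` sigma_process `[0, +oo[ W')
         (fun j => W (j%:R * v)) v.
Proof.
move=> v0 bW mW' ind.
have jv (j : nat) : 0 <= j%:R * v by rewrite mulr_ge0 ?(ltW v0).
have mW t : 0 <= t -> measurable_fun setT (W t) by exact: (bm_measurable bW).
have mF k : sigma_process `[0, k] W `<=` measurable.
  by apply: sigma_process_measurable => t /=; rewrite in_itv/= => /andP[t0 _]; exact: mW.
have mF' : sigma_process `[0, +oo[ W' `<=` measurable.
  by apply: sigma_process_measurable => t /=; rewrite in_itv/= andbT => t0; exact: mW'.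
have sF k : sigma_process `[0, k] W `<=` sigma_process `[0, +oo[ W.
  by apply: sigma_process_mono => t /=; rewrite !in_itv/= andbT => /andP[].
have T1 (X : R -> T -> R) (D : set R) : sigma_process D X setT.
  have [s0 sC _] := smallest_sigma_algebra setT (\bigcup_(t in D) sigma_var (X t)).
  by have := sC _ s0; rewrite setD0.
split => //.
- by move=> k; rewrite subUset; split.
- move=> k l kl; apply: sub_sigma_algebra2; apply: setSU; apply: sigma_process_mono => t /=.
  rewrite !in_itv/= => /andP[-> h]; apply: (le_trans h).
  by rewrite ler_wpM2r ?(ltW v0)// ler_nat.
- move=> k; apply: Fm_sigma_var => A hA; apply: sub_sigma_algebra; left.
  by apply: (sigma_process_var _ hA); rewrite /= in_itv/= jv lexx.
- move=> k l kl A B hA hB.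
  have kl' : k%:R * v <= l%:R * v by rewrite ler_wpM2r ?(ltW v0)// ler_nat ltnW.
  have mB : measurable B.
    case: hB => B' mB' <-; apply: measurable_funB => //; exact: mW.
  have sB : sigma_process `[0, +oo[ W B.
    case: hB => B' mB' <-.
    have mm t : 0 <= t -> Fm (\bigcup_(t in `[0%R, +oo[%classic) sigma_var (W t)) (W t).
      move=> t0; apply: Fm_sigma_var; apply: sigma_process_var.
      by rewrite /= in_itv/= andbT.
    by have := FmB (mm _ (jv l)) (mm _ (jv k)); apply.
  have bi := bm_indep_increments bW (jv k) kl'.
  apply: (@indep_union _ _ B _ _ _ _ _ _ _ _ A hA) => //; try exact: sigma_processI.
  move=> A0 C0 hA0 hC0.
  have hA1 := sF _ _ hA0.
  rewrite setIAC ind//; last exact: sigma_processI.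
  by rewrite bi// ind// muleAC.
- move=> k l kl.
  have kl' : k%:R * v < l%:R * v by rewrite ltr_pM2r// ltr_nat.
  split; first by apply: measurable_funB; exact: mW.
  move=> A mA; rewrite (bm_gaussian_increments bW (jv k) kl' mA).
  by rewrite -mulrBl natrB// ltnW.
Qed.

Lemma Fm_other (W W' : R -> T -> R) (v : R) j t : 0 <= t ->
  Fm (sigma_process `[0, j%:R * v] W `|` sigma_process `[0, +oo[ W') (W' t).
Proof.
move=> t0; apply: Fm_sigma_var => A hA; apply: sub_sigma_algebra; right.
by apply: (sigma_process_var _ hA); rewrite /= in_itv/= andbT.
Qed.

End brownian_walk.

Lemma ev_div (R : realType) (a dl : R) : 0 < dl ->
  exists N, forall n : nat, (N <= n)%N -> a / n%:R <= dl.
Proof.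
move=> dl0; exists (Num.truncn (`|a| / dl)).+1 => n hn.
have n0 : 0 < n%:R :> R by rewrite ltr0n (leq_trans _ hn).
rewrite ler_pdivrMr// mulrC -ler_pdivrMr//.
apply: (@le_trans _ _ (`|a| / dl)); first by rewrite ler_wpM2r ?invr_ge0 ?(ltW dl0) ?ler_norm.
by apply: (le_trans (ltW (truncnS_gt _))); rewrite ler_nat.
Qed.

Lemma cos_dist (R : realType) (x y : R) : `|cos x - cos y| <= `|x - y|.
Proof.
have dc (z : R) : is_derive z (1:R) (@cos R) (- sin z) by exact: is_derive_cos.
have [c [_ _ ->]] := mvt_between y x dc.
by rewrite normrM ler_piMl// normrN ler_norml sin_geN1 sin_le1.
Qed.

Section clip.
Context (R : realType).
(** Its expectation metrises convergence in probability, so that approximations of [Xh] can be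
    measured without moment bounds on [Xh]. *)
Definition clip (x : R) := Num.min `|x| 1.
Lemma clip01 x : 0 <= clip x <= 1.
Proof. by rewrite /clip le_min normr_ge0 ler01 ge_min lexx orbT. Qed.
Lemma clip_le x : clip x <= `|x|. Proof. by rewrite /clip ge_min lexx. Qed.
Lemma clipD x y : clip (x + y) <= `|x| + clip y.
Proof.
rewrite {2}/clip; have [h|h] := lerP `|y| 1.
  by apply: (le_trans (clip_le _)); exact: ler_normD.
by case/andP: (clip01 (x + y)) => _ /le_trans -> //; rewrite lerDr.
Qed.
Lemma clip_cvg (u : nat -> R) l : u n @[n --> \oo] --> l -> clip (u n) @[n --> \oo] --> clip l.
Proof.
move=> ul; apply: (@cvg_comp _ _ _ u clip _ (nbhs l)) => //.
apply: (@lip_continuous _ _ 1) => x y; rewrite mul1r /clip.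
have mm (a b : R) : `|Num.min a 1 - Num.min b 1| <= `|a - b|.
  have := max0_lip (1 - a) (1 - b).
  have e (c : R) : Num.max (1 - c) 0 = 1 - Num.min c 1.
    by rewrite maxEle minEle; case: (lerP (1 - c) 0) => ?; case: (lerP c 1) => ?; lra.
  rewrite !e; set x1 := Num.min a 1; set y1 := Num.min b 1.
  rewrite (_ : 1 - x1 - (1 - y1) = - (x1 - y1)); last by ring.
  by rewrite (_ : 1 - a - (1 - b) = - (a - b)) ?normrN//; ring.
by apply: (le_trans (mm _ _)); exact: ler_dist_dist.
Qed.
Lemma clip0 : clip 0 = 0.
Proof. by rewrite /clip normr0 minEle ler01. Qed.

Context d (T : measurableType d) (P : probability T R).
Lemma measurable_clip (f : T -> R) : measurable_fun setT f ->
  measurable_fun setT (fun w => clip (f w)).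
Proof. by move=> mf; apply: measurable_minr => //; exact: measurableT_comp. Qed.
Lemma Intg_clip (f : T -> R) : measurable_fun setT f -> Intg P (fun w => clip (f w)).
Proof.
move=> mf; apply: (@Intg_bd _ _ _ _ _ 1); first exact: measurable_clip.
by move=> w; case/andP: (clip01 (f w)) => ? ?; rewrite ger0_norm.
Qed.

End clip.

Section paths.
Context d (T : measurableType d) (R : realType) (P : probability T R).
Variables (W : R -> T -> R) (L : R -> R -> T -> R).
Hypothesis LW : local_time P W L.

Lemma local_time_continuous s w : 0 <= s -> continuous (fun x => L x s w).
Proof.
move=> s0 x; have /subspace_continuousP c := @lt_continuous _ _ _ _ _ _ LW w.
have {}c := c (x, s) s0.
apply: (@cvg_trans _ ((fun xt : R * R => L xt.1 xt.2 w) @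
  within [set xt : R * R | 0 <= xt.2] (nbhs (x, s)))) => //.
move=> A /= [[U1 U2] /= [hU1 hU2] HU].
apply: filterS hU1 => y Uy; apply: (HU (y, s)) => //; split => //=.
exact: nbhs_singleton hU2.
Qed.

(* [W] is only constrained at nonnegative times. *)
Definition cpath w r := W (Num.max r 0) w.

Lemma cpath_continuous w : {within `[0, +oo[, continuous (fun t => W t w)} ->
  continuous (cpath w).
Proof.
move=> /subspace_continuousP c r.
have m0 : 0 <= Num.max r 0 by rewrite le_max lexx orbT.
have m1 : `[(0:R), +oo[%classic (Num.max r 0) by rewrite /= in_itv/= andbT.
have cm : continuous (fun r : R => Num.max r 0).
  apply: (@lip_continuous _ _ 1) => x y; rewrite mul1r; exact: max0_lip.
have := c _ m1 => {}c A /c /= h.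
have hc : nbhs r ((fun r => Num.max r 0) @^-1` [set y | `[(0:R), +oo[%classic y -> A (W y w)]) := cm r _ h.
change (nbhs r (cpath w @^-1` A)); apply: filterS hc => y; apply => /=.
by rewrite in_itv/= andbT le_max lexx orbT.
Qed.

Lemma cpath_ge0 w r : 0 <= r -> cpath w r = W r w.
Proof. by move=> r0; rewrite /cpath (max_idPl r0). Qed.

Lemma cpath_occ w s : 0 <= s -> (forall (t : R) (f : R -> R),
    0 <= t -> measurable_fun setT f -> bounded_fun f ->
    (\int[lebesgue_measure]_(r in `[0%R, t]) (f (W r w))%:E =
     \int[lebesgue_measure]_x (f x * L x t w)%:E)%E) ->
  forall phi : R -> R, measurable_fun setT phi -> bounded_fun phi ->
  (\int[lebesgue_measure]_(r in `[0%R, s]) (phi (cpath w r))%:E =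
   \int[lebesgue_measure]_x (phi x * L x s w)%:E)%E.
Proof.
move=> s0 occ phi mphi bphi; rewrite -occ//.
apply: eq_integral => r; rewrite inE/= in_itv/= => /andP[r0 _].
by rewrite cpath_ge0.
Qed.

End paths.

(** * The first limit along a sequence, for positive times *)

Section limit.
Context d (T : measurableType d) (R : realType) (P : probability T R).
Variables (W W' : R -> T -> R) (L L' : R -> R -> T -> R).
Hypotheses (BW : brownian_motion P W) (BW' : brownian_motion P W').
Hypothesis WW' : independent_systems P (sigma_process `[0, +oo[ W)
                                       (sigma_process `[0, +oo[ W').
Hypotheses (LW : local_time P W L) (LW' : local_time P W' L').
Variables (s t : R).

Lemma measurable_increment_product h : 0 <= s -> 0 <= t ->
  measurable_fun setT (increment_product L L' h s t).
Proof.
move=> s0 t0; apply: measurable_Rintegral => [w x|x].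
  have c1 := @local_time_continuous _ _ _ _ _ _ LW _ w s0.
  have c2 := @local_time_continuous _ _ _ _ _ _ LW' _ w t0.
  have cs (k : R -> R) : continuous k -> continuous (fun x => k (x + h)).
    move=> ck y; apply: (@continuous_comp _ _ _ (fun x => x + h) k); last exact: ck.
    by apply: cvgD; [exact: cvg_id|exact: cvg_cst].
  by apply: cvgM; apply: cvgB; [exact: (cs _ c1)|exact: c1|exact: (cs _ c2)|exact: c2].
by apply: measurable_funM; apply: measurable_funB;
  [exact: (lt_measurable LW)|exact: (lt_measurable LW)|exact: (lt_measurable LW')|exact: (lt_measurable LW')].
Qed.

Lemma measurable_intersection : 0 <= s -> 0 <= t ->
  measurable_fun setT (intersection_local_time L L' s t).
Proof.
move=> s0 t0; apply: measurable_Rintegral => [w x|x].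
  by apply: cvgM; [exact: (local_time_continuous LW)|exact: (local_time_continuous LW')].
by apply: measurable_funM; [exact: (lt_measurable LW)|exact: (lt_measurable LW')].
Qed.

Hypotheses (s0 : 0 < s) (t0 : 0 < t).

Definition Xh h w := increment_product L L' h s t w / Num.sqrt h ^+ 3.
(* The maximum only matters on the null set where the intersection local time is
   negative; it matches [Num.sqrt x = 0] for [x < 0] in the limit law. *)
Definition sig2 w := Num.max (32 / 3 * intersection_local_time L L' s t w) 0.

Lemma measurable_Xh h : measurable_fun setT (Xh h).
Proof. by apply: measurable_funM => //; apply: measurable_increment_product; exact: ltW. Qed.

Lemma measurable_sig2 : measurable_fun setT sig2.
Proof.
apply: measurable_maxr => //; apply: measurable_funM => //.
by apply: measurable_intersection; exact: ltW.
Qed.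

Let Vn n j := W (j%:R * (s / n%:R)).
Let Vn' n k := W' (k%:R * (t / n%:R)).
Let DDn n e h w := DD (Vn n) (Vn' n) (s / n%:R) (t / n%:R) n e h w.
Let QQn n e h k w := QQ (Vn n) (Vn' n) (s / n%:R) (t / n%:R) n e h k w.

Let mW r : 0 <= r -> measurable_fun setT (W r). Proof. exact: (bm_measurable BW). Qed.
Let mW' r : 0 <= r -> measurable_fun setT (W' r). Proof. exact: (bm_measurable BW'). Qed.
Let mVn n j : measurable_fun setT (Vn n j).
Proof. by apply: mW; rewrite mulr_ge0// divr_ge0// ltW. Qed.
Let mVn' n j : measurable_fun setT (Vn' n j).
Proof. by apply: mW'; rewrite mulr_ge0// divr_ge0// ltW. Qed.
Let mkV h e m n j k : measurable_fun setT (fun w => kern h e m (Vn n j w - Vn' n k w)).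
Proof. by apply: (measurableT_comp (@measurable_kern _ _ _ _)); exact: measurable_funB. Qed.

Let mDD n e h : measurable_fun setT (DDn n e h).
Proof. by do 2 apply: measurable_fun_bigsum => ?; exact: measurable_funM. Qed.

Let mQQ n e h k : measurable_fun setT (QQn n e h k).
Proof.
do 2 apply: measurable_fun_bigsum => ?.
by do 2 apply: measurable_funM => //; apply: measurable_funX; exact: measurable_funM.
Qed.

Let good : {ae P, forall w,
  [/\ continuous (cpath W w), continuous (cpath W' w),
   (forall phi : R -> R, measurable_fun setT phi -> bounded_fun phi ->
    (\int[lebesgue_measure]_(r in `[0%R, s]) (phi (cpath W w r))%:E =
     \int[lebesgue_measure]_x (phi x * L x s w)%:E)%E) &
   (forall phi : R -> R, measurable_fun setT phi -> bounded_fun phi ->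
    (\int[lebesgue_measure]_(r in `[0%R, t]) (phi (cpath W' w r))%:E =
     \int[lebesgue_measure]_x (phi x * L' x t w)%:E)%E)]}.
Proof.
have H1 : {ae P, forall w, continuous (cpath W w) /\ continuous (cpath W' w)}.
  move: (bm_continuous BW) (bm_continuous BW'); apply: filterS2 => w c c'.
  by split; exact: cpath_continuous.
have H2 := lt_occupation LW; have H3 := lt_occupation LW'.
have H12 : {ae P, forall w, [/\ continuous (cpath W w), continuous (cpath W' w) &
   (forall phi : R -> R, measurable_fun setT phi -> bounded_fun phi ->
    (\int[lebesgue_measure]_(r in `[0%R, s]) (phi (cpath W w r))%:E =
     \int[lebesgue_measure]_x (phi x * L x s w)%:E)%E)]}.
  move: H1 H2; apply: filterS2 => w [c c'] o.
  by split=> //; exact: (cpath_occ (ltW s0) o).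
move: H12 H3; apply: filterS2 => w [c c' o] o'.
split=> //.
exact: (cpath_occ (ltW t0) o').
Qed.

Let pathE (psi : R -> R) n w :
  \sum_(0 <= j < n) \sum_(0 <= k < n) (s / n%:R) * (t / n%:R) * psi (Vn n j w - Vn' n k w) =
  \sum_(0 <= j < n) \sum_(0 <= k < n) (s / n%:R) * (t / n%:R) *
    psi (cpath W w (j%:R * (s / n%:R)) - cpath W' w (k%:R * (t / n%:R))).
Proof.
apply: eq_bigr => j _; apply: eq_bigr => k _.
by rewrite !cpath_ge0 ?mulr_ge0 ?divr_ge0 ?(ltW s0) ?(ltW t0).
Qed.

(** Both [S] and [X] are close to [-D], the former in mean and the latter only in probability; hence
    an absolute value for one and a clip for the other. *)
Lemma cos_approx (lam ph S X D : R) :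
  `|cos (ph + lam * S) - cos (ph + lam * X)| <= `|lam| * `|D + S| + (`|lam| + 2) * clip (D + X).
Proof.
have e : ph + lam * S - (ph + lam * X) = lam * ((D + S) - (D + X)) by ring.
rewrite /clip; have [h|h] := lerP `|D + X| 1.
  apply: (le_trans (cos_dist _ _)); rewrite e normrM.
  apply: (@le_trans _ _ (`|lam| * (`|D + S| + `|D + X|))).
    by rewrite ler_wpM2l// ler_normB.
  by rewrite mulrDr lerD2l ler_wpM2r// lerDl.
rewrite mulr1; apply: (@le_trans _ _ 2); last first.
  by rewrite addrA lerDr addr_ge0// mulr_ge0.
apply: (le_trans (ler_normB _ _)); rewrite (_ : 2 = 1 + 1 :> R)//.
by rewrite lerD// ler_norml cos_geN1 cos_le1.
Qed.

Lemma walk_approx (h : R) : 0 < h ->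
  exists2 u : nat -> R, u m @[m --> \oo] --> (0 : R) &
  forall m, exists N, forall n, (N <= n)%N ->
    Ex P (fun w => clip ((Num.sqrt h ^+ 3)^-1 * DD (fun j => W (j%:R * (s / n%:R)))
      (fun k => W' (k%:R * (t / n%:R))) (s / n%:R) (t / n%:R) n (h ^+ 2 / m.+1%:R) h w +
      Xh h w)) <= u m.
Proof.
move=> h0; pose em (m : nat) := h ^+ 2 / m.+1%:R.
have em0 m : 0 < em m by rewrite divr_gt0// exprn_gt0.
have emc : em m @[m --> \oo] --> (0 : R).
  rewrite -[X in _ --> X](mulr0 (h ^+ 2)); apply: cvgM; first exact: cvg_cst.
  exact: cvg_harmonic.
have [||||u uc Hu] := @iterated_limit _ _ _ P
  (fun m n w => clip ((Num.sqrt h ^+ 3)^-1 * DDn n (em m) h w + Xh h w))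
  (fun m w => clip ((Num.sqrt h ^+ 3)^-1 * Jint (cpath W w) (fun x => L' x t w) s (kern h (em m) 1) + Xh h w)).
- by move=> m n; apply: measurable_clip; apply: measurable_funD; [exact: measurable_funM|exact: measurable_Xh].
- by move=> m n w; exact: clip01.
- apply: filterS good => w [c c' o o'] m.
  apply: clip_cvg; apply: cvgD; last exact: cvg_cst.
  apply: cvgM; first exact: cvg_cst.
  have cg := @local_time_continuous _ _ _ _ _ _ LW' _ w (ltW t0).
  have := double_sum_cvg c c' s0 t0 o' (kern1_lip h0 (em0 m)) (kern1_bd h0 (em0 m)).
  by under eq_fun do rewrite -pathE.
- apply: filterS good => w [c c' o o'].
  have cf := @local_time_continuous _ _ _ _ _ _ LW _ w (ltW s0).
  have cg := @local_time_continuous _ _ _ _ _ _ LW' _ w (ltW t0).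
  have J := J1_cvg c c' s0 t0 cf cg o o' h0 em0 emc.
  rewrite -clip0; apply: clip_cvg.
  rewrite (_ : 0 = (Num.sqrt h ^+ 3)^-1 * - increment_product L L' h s t w + Xh h w).
    by apply: cvgD; [apply: cvgM; [exact: cvg_cst|exact: J]|exact: cvg_cst].
  by rewrite /Xh mulrN [_^-1 * _]mulrC addNr.
by exists u.
Qed.

Let Sc := 16 * (1 + 8 * Num.sqrt t) * s * (1 + 32 * Num.sqrt s).

(** For each [i] the smoothing scale and then the grid are chosen so that the normalised integral is
    close to minus the double sum, the double sum to minus the martingale sum, and its bracket to
    [QQ], hence to [sig2]; [stable_limit] concludes. *)
Lemma limit_along_sequence (h : nat -> R) (lam ph : R) :
  (forall i, 0 < h i) -> (forall i, h i <= 1) -> h i @[i --> \oo] --> (0 : R) ->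
  Ex P (fun w => cos (ph + lam * Xh (h i) w)) @[i --> \oo] -->
    cos ph * Ex P (fun w => expR (- (lam ^+ 2 / 2 * sig2 w))).
Proof.
move=> h0 h1 hc.
pose r i := Num.sqrt (h i).
have r0 i : 0 < r i by rewrite sqrtr_gt0.
have hE i : h i = r i ^+ 2 by rewrite sqr_sqrtr// ltW.
have r1 i : r i <= 1 by rewrite -[leRHS]sqrtr1 ler_wsqrtr.
have rc : r i @[i --> \oo] --> (0 : R).
  rewrite -[X in _ --> X](@sqrtr0 R).
  by apply: (@cvg_comp _ _ _ h (@Num.sqrt R) _ (nbhs (0:R))) => //; exact: sqrt_continuous.
pose kap i := 4 / r i ^+ 3.
have h20 i : 0 < h i ^+ 2 by rewrite exprn_gt0.
have kE i : kap i / 4 = (Num.sqrt (h i) ^+ 3)^-1.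
  by rewrite /kap -/(r i); field; rewrite gt_eqF.
have choose_e i : exists e, [/\ 0 < e, e <= h i ^+ 2 & exists N, forall n, (N <= n)%N ->
    Ex P (fun w => clip (kap i / 4 * DDn n e (h i) w + Xh (h i) w)) <= 2 / i.+1%:R].
  have [u uc Hu] := walk_approx (h0 i).
  have i0 : 0 < (i.+1%:R : R)^-1 by rewrite invr_gt0 ltr0n.
  move/cvgrPdist_le : uc => /(_ _ i0)[m _ /(_ m (leqnn m))/= um].
  exists (h i ^+ 2 / m.+1%:R); split; first by rewrite divr_gt0.
    by rewrite ler_pdivrMr ?ltr0n// ler_peMr ?(ltW (h20 i))// ler1n.
  rewrite kE; have [N HN] := Hu m; exists N => n nN; apply: (le_trans (HN n nN)).
  move: um; rewrite sub0r normrN => /(le_trans (ler_norm _)) um.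
  by apply: (le_trans um); rewrite mulrC ler_peMr ?(ltW i0)// ler1n.
pose e i := projT1 (cid (choose_e i)).
have e0 i : 0 < e i by rewrite /e; case: cid => ? [].
have eh2 i : e i <= h i ^+ 2 by rewrite /e; case: cid => ? [].
have eD i : exists N, forall n, (N <= n)%N ->
    Ex P (fun w => clip (kap i / 4 * DDn n (e i) (h i) w + Xh (h i) w)) <= 2 / i.+1%:R.
  by rewrite /e; case: cid => ? [].
have eh i : e i <= h i.
  by apply: (le_trans (eh2 i)); rewrite expr2 ler_piMl// ltW.
have kapE i : kap i ^+ 2 = 16 / h i ^+ 3.
  by rewrite hE /kap; field; rewrite gt_eqF.
have [||||u uc Hu] := @iterated_limit _ _ _ P
    (fun i n w => clip (QQn n (e i) (h i) (kap i) w - sig2 w))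
    (fun i w => clip (16 / h i ^+ 3 * Jint (cpath W w) (fun x => L' x t w) s
        (fun z => kern (h i) (e i) 3 z ^+ 2) - sig2 w)).
- by move=> i n; apply: measurable_clip; apply: measurable_funB; [exact: mQQ|exact: measurable_sig2].
- by move=> i n w; exact: clip01.
- apply: filterS good => w [c c' o o'] i.
  apply: clip_cvg; apply: cvgB; last exact: cvg_cst.
  have cg := @local_time_continuous _ _ _ _ _ _ LW' _ w (ltW t0).
  have := double_sum_cvg c c' s0 t0 o' (kern3_sqr_lip (h0 i) (e0 i)) (fun x => kern3_sqr_bd x (h0 i) (e0 i)).
  move=> H.
  have eQ n : QQn n (e i) (h i) (kap i) w = 16 / h i ^+ 3 *
     \sum_(0 <= j < n) \sum_(0 <= k < n) s / n%:R * (t / n%:R) * kern (h i) (e i) 3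
      (cpath W w (j%:R * (s / n%:R)) - cpath W' w (k%:R * (t / n%:R))) ^+ 2.
    have /= <- := pathE (fun z => kern (h i) (e i) 3 z ^+ 2) n w.
    rewrite /QQn /QQ mulr_sumr; apply: eq_bigr => j _; rewrite mulr_sumr; apply: eq_bigr => k _.
    by rewrite /cc exprMn kapE; ring.
  under eq_cvg do rewrite eQ.
  by apply: cvgM; [exact: cvg_cst|exact: H].
- apply: filterS good => w [c c' o o'].
  have cf := @local_time_continuous _ _ _ _ _ _ LW _ w (ltW s0).
  have cg := @local_time_continuous _ _ _ _ _ _ LW' _ w (ltW t0).
  have J := J3_cvg c c' s0 t0 cf cg o o' h0 h1 e0 eh2 hc.
  rewrite -clip0; apply: clip_cvg.
  rewrite -[X in _ --> X](subrr (sig2 w)); apply: cvgB; last exact: cvg_cst.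
  have e2 : sig2 w = 32 / 3 * \int[lebesgue_measure]_x (L x s w * L' x t w).
    by apply/max_idPl; rewrite mulr_ge0//; exact: (beta_ge0 cf cg o o').
  by rewrite e2; exact: J.
(* The Taylor remainders are required to be at most [r i ^+ 4], because [kap i] is [4 / r i ^+ 3]
   and an error of order [r i] is wanted. The last condition makes the diagonal part of
   [bracket_bound] at most [r i]. *)
pose cond i (n : nat) := [/\ s / n%:R <= h i ^+ 2, t / n%:R <= h i ^+ 2,
  2 * (4 * e i ^- 2) ^+ 2 * gq6 R * n%:R ^+ 2 * (s / n%:R) ^+ 3 +
    (4 * h i * e i ^- 2) ^+ 2 * gq2 R * n%:R * (s / n%:R) ^+ 2 <= (r i ^+ 4) ^+ 2,
  2 * (4 * h i * e i ^- 2) ^+ 2 * gq6 R * n%:R ^+ 2 * (t / n%:R) ^+ 3 +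
    (8 * h i ^+ 2 * e i ^- 2) ^+ 2 * gq2 R * n%:R * (t / n%:R) ^+ 2 <= (r i ^+ 4) ^+ 2 &
  2 * (gq2 R * (t / n%:R) ^+ 2 * (n%:R * (16 / h i * s) ^+ 2)) <= r i].
have choose_n i : exists N, forall n, (N <= n)%N -> [/\ cond i n,
    Ex P (fun w => clip (kap i / 4 * DDn n (e i) (h i) w + Xh (h i) w)) <= 2 / i.+1%:R &
    Ex P (fun w => clip (QQn n (e i) (h i) (kap i) w - sig2 w)) <= u i].
  have [N1 H1] := eD i; have [N2 H2] := Hu i.
  have [N3 H3] := ev_div s (h20 i); have [N4 H4] := ev_div t (h20 i).
  have r8 : 0 < (r i ^+ 4) ^+ 2 by rewrite !exprn_gt0.
  have [N5 H5] := ev_div (2 * (4 * e i ^- 2) ^+ 2 * gq6 R * s ^+ 3 +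
     (4 * h i * e i ^- 2) ^+ 2 * gq2 R * s ^+ 2) r8.
  have [N6 H6] := ev_div (2 * (4 * h i * e i ^- 2) ^+ 2 * gq6 R * t ^+ 3 +
     (8 * h i ^+ 2 * e i ^- 2) ^+ 2 * gq2 R * t ^+ 2) r8.
  have [N7 H7] := ev_div (2 * (gq2 R * t ^+ 2 * (16 / h i * s) ^+ 2)) (r0 i).
  exists (N1 + N2 + N3 + N4 + N5 + N6 + N7 + 1)%N => n hn.
  have nn0 : n%:R != 0 :> R by rewrite pnatr_eq0; apply/eqP => n0; move: hn; rewrite n0; clear; lia.
  have hh : [/\ (N1 <= n)%N, (N2 <= n)%N, (N3 <= n)%N & (N4 <= n)%N] /\
     [/\ (N5 <= n)%N, (N6 <= n)%N & (N7 <= n)%N] by clear -hn; split; split; lia.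
  case: hh => -[n1 n2 n3 n4] [n5 n6 n7].
  split; [split|exact: H1|exact: H2].
  - exact: H3.
  - exact: H4.
  - apply: le_trans (H5 n n5); rewrite le_eqVlt; apply/orP; left; apply/eqP.
    move: (gq6 R) (gq2 R) (e i ^- 2) => g6 g2 ee; by field.
  - apply: le_trans (H6 n n6); rewrite le_eqVlt; apply/orP; left; apply/eqP.
    move: (gq6 R) (gq2 R) (e i ^- 2) => g6 g2 ee; by field.
  - apply: le_trans (H7 n n7); rewrite le_eqVlt; apply/orP; left; apply/eqP.
    move: (gq2 R) (16 / h i) => g2 ee; by field.
pose N i := projT1 (cid (choose_n i)).
have HN i n : (N i <= n)%N -> [/\ cond i n,
    Ex P (fun w => clip (kap i / 4 * DDn n (e i) (h i) w + Xh (h i) w)) <= 2 / i.+1%:R &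
    Ex P (fun w => clip (QQn n (e i) (h i) (kap i) w - sig2 w)) <= u i].
  by rewrite /N; case: cid => /= N0; apply.
(* Summing the thresholds makes the exponents nondecreasing, so every grid refines the earlier ones,
   while [2 ^ k i] still exceeds [N i]. *)
pose k i := (\sum_(0 <= l < i.+1) N l)%N.
pose n i := (2 ^ k i)%N.
have nN i : (N i <= n i)%N.
  apply: (leq_trans _ (ltnW (ltn_expl (k i) (ltnSn 1)))).
  by rewrite /k big_nat_recr//= leq_addl.
have n0 i : 0 < (n i)%:R :> R by rewrite ltr0n expn_gt0.
pose v i := s / (n i)%:R; pose v' i := t / (n i)%:R.
have v0 i : 0 < v i by rewrite divr_gt0.
have v0' i : 0 < v' i by rewrite divr_gt0.
have nv i : (n i)%:R * v i = s by rewrite /v mulrC divfK// gt_eqF.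
have nv' i : (n i)%:R * v' i = t by rewrite /v' mulrC divfK// gt_eqF.
pose G i j := sigma_process `[0, j%:R * v i] W `|` sigma_process `[0, +oo[ W'.
pose G' i j := sigma_process `[0, j%:R * v' i] W' `|` sigma_process `[0, +oo[ W.
have wk i : walk P (G i) (Vn (n i)) (v i) by exact: walk_of_brownian.
have wk' i : walk P (G' i) (Vn' (n i)) (v' i).
  by apply: walk_of_brownian => //; exact: indep_systemsC.
have cGV i j k0 : Fm (G i j) (Vn' (n i) k0).
  by apply: Fm_other; apply: mulr_ge0 => //; exact: ltW (v0' i).
have cGV' i k0 j : Fm (G' i k0) (Vn (n i) j).
  by apply: Fm_other; apply: mulr_ge0 => //; exact: ltW (v0 i).
pose a i := aa (Vn (n i)) (Vn' (n i)) (n i) (e i) (h i) (kap i).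
have vh i : v i <= h i ^+ 2 by have [[]] := HN i _ (nN i).
have vh' i : v' i <= h i ^+ 2 by have [[]] := HN i _ (nN i).
have K1E i : K1 (v' i) (n i) = 1 + 8 * Num.sqrt t by rewrite /K1 nv'.
have K4E i : K4 (v i) (n i) = 1 + 32 * Num.sqrt s by rewrite /K4 nv.
have K5E i : K5 (v' i) (n i) = 21 + 32 * Num.sqrt t by rewrite /K5 nv'.
have st0 : 0 <= Num.sqrt t := sqrtr_ge0 _.
have ss0 : 0 <= Num.sqrt s := sqrtr_ge0 _.
have Hw i J : (J <= n i)%N ->
  Ex P (fun w => (\sum_(0 <= j < J) v i * a i j w) ^+ 2) <= Sc * r i ^+ 2.
  move=> Jn; have := weak_bound (wk i) (wk' i) (@cGV' i) (r0 i) (r1 i) (e0 i)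
    (hE i) (erefl (kap i)) (eh i) (vh i) (vh' i) Jn.
  by rewrite K1E K4E nv -hE.
have HB i : Ex P (brk (a i) (v i) (n i)) <= Sc.
  have := Ex_BB (wk i) (wk' i) (@cGV' i) (n i) (r0 i) (r1 i) (e0 i)
    (hE i) (erefl (kap i)) (eh i) (vh' i).
  rewrite K1E nv => /le_trans; apply.
  rewrite /Sc ler_peMr//; last by rewrite lerDl mulr_ge0.
  by rewrite !mulr_ge0 ?addr_ge0 ?mulr_ge0 ?(ltW s0).
have kap0 i : 0 <= kap i by rewrite /kap divr_ge0// exprn_ge0// ltW.
have momc i j k0 : mom P (cc (Vn (n i)) (Vn' (n i)) (e i) (h i) (kap i) j k0).
  apply: (@mom_bd _ _ _ _ _ (kap i * h i)); first exact: measurable_funM.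
  move=> w; rewrite /cc normrM (ger0_norm (kap0 i)); apply: ler_wpM2l => //.
  by rewrite ger0_norm ?kern3_le ?kern3_ge0.
have moma i j : mom P (a i j).
  by apply: mom_sum => k0; apply: momM => //; exact: (mom_incr (wk' i)).
have maF i j : Fm (G i j) (a i j).
  apply: Fm_sum => k0; apply: FmM; last by apply: FmB.
  apply: FmM; first exact: Fm_cst.
  apply: (Fm_comp (@measurable_kern _ _ _ _)); apply: FmB => //.
  exact: (walk_adapted (wk i)).
have kmono m i : (m <= i)%N -> (k m <= k i)%N.
  by move=> mi; rewrite /k [leqRHS](@big_cat_nat _ _ _ m.+1)//= leq_addr.
have nest m i : (m <= i)%N -> exists2 q : nat, (0 < q)%N &
  [/\ n i = (n m * q)%N, v m = q%:R * v i, (forall u0, Vn (n m) u0 = Vn (n i) (u0 * q)%N) &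
      forall u0, <<s G m u0 >> `<=` <<s G i (u0 * q)%N >>].
  move=> mi; exists (2 ^ (k i - k m))%N; first by rewrite expn_gt0.
  have e1 : n i = (n m * 2 ^ (k i - k m))%N by rewrite /n -expnD subnKC// kmono.
  have e2 : v m = (2 ^ (k i - k m))%:R * v i.
    by apply: (@mulfI _ (n m)%:R); [rewrite gt_eqF|rewrite nv mulrA -natrM -e1 nv].
  have e3 u0 : u0%:R * v m = (u0 * 2 ^ (k i - k m))%:R * v i by rewrite e2 natrM mulrA.
  split=> // u0; first by rewrite /Vn -/(v m) -/(v i) e3.
  by rewrite /G e3.
have vr i : v i <= r i.
  apply: (le_trans (vh i)); rewrite hE -exprM.
  by rewrite -[leRHS]expr1 ler_wiXn2l// ltW.
have mB i : mom P (BB (Vn (n i)) (Vn' (n i)) (v i) (n i) (e i) (h i) (kap i)).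
  by apply: mom_sum => j; apply: momM; [apply: momX; exact: (moma i j)|exact: mom_cst].
have mQ i : mom P (QQn (n i) (e i) (h i) (kap i)).
  apply: mom_sum => j; apply: mom_sum => k0; apply: momM; last exact: mom_cst.
  by apply: momM; [apply: momX; exact: momc|exact: mom_cst].
pose cB := 1 + 8 * (16 * (1 + 32 * Num.sqrt s) * s * t * (32 * (21 + 32 * Num.sqrt t))).
have cB0 : 0 <= cB.
  by rewrite /cB !(addr_ge0, mulr_ge0)// ltW.
have EBQ i : Ex P (fun w => `|BB (Vn (n i)) (Vn' (n i)) (v i) (n i) (e i) (h i) (kap i) w -
    QQn (n i) (e i) (h i) (kap i) w|) <= Num.sqrt (cB * r i).
  apply: Ex_norm_le => //; first exact: momB.
  rewrite sqr_sqrtr; last by rewrite mulr_ge0// ltW.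
  have := bracket_bound (wk i) (wk' i) (@cGV' i) (n i) (r0 i) (r1 i) (e0 i)
    (hE i) (erefl (kap i)) (eh i) (vh i) (vh' i).
  rewrite K4E K5E nv nv' => /le_trans; apply.
  have [[_ _ _ _ c5] _ _] := HN i _ (nN i).
  rewrite (_ : cB * r i = r i + 8 * (16 * (1 + 32 * Num.sqrt s) * s * t *
    (32 * r i * (21 + 32 * Num.sqrt t)))); last by rewrite /cB; ring.
  by apply: lerD; first exact: c5.
have s20 w : 0 <= sig2 w by rewrite /sig2 le_max lexx orbT.
have sqc (c0 : R) : Num.sqrt (c0 * r i) @[i --> \oo] --> (0 : R).
  rewrite -[X in _ --> X](@sqrtr0 R) -[X in Num.sqrt X](mulr0 c0).
  apply: (@cvg_comp _ _ _ (fun i => c0 * r i) (@Num.sqrt R) _ (nbhs (c0 * 0))); last exact: sqrt_continuous.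
  by apply: cvgM => //; exact: cvg_cst.
have HD : Ex P (fun w => Num.min `|brk (a i) (v i) (n i) w - sig2 w| 1) @[i --> \oo] --> (0 : R).
  apply: (@squeeze_cvgr _ _ _ _ (fun=> 0) (fun i => Num.sqrt (cB * r i) + u i)).
  - apply: nearW => i; apply/andP; split.
      by apply: Ex_ge0 => w; case/andP: (clip01 (brk (a i) (v i) (n i) w - sig2 w)).
    have [_ _ hu] := HN i _ (nN i).
    apply: (le_trans _ (lerD (EBQ i) hu)).
    have I1 : Intg P (fun w => `|BB (Vn (n i)) (Vn' (n i)) (v i) (n i) (e i) (h i) (kap i) w -
       QQn (n i) (e i) (h i) (kap i) w|) by apply: Intg_norm; apply: mom_Intg; exact: momB.
    have I2 : Intg P (fun w => clip (QQn (n i) (e i) (h i) (kap i) w - sig2 w)).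
      by apply: Intg_clip; apply: measurable_funB => //; exact: measurable_sig2.
    rewrite -ExD//; apply: le_Ex; [|exact: IntgD|].
      apply: Intg_clip; apply: measurable_funB; last exact: measurable_sig2.
      exact: (mom_meas (mB i)).
    move=> w; rewrite -/(clip _) (_ : brk (a i) (v i) (n i) w - sig2 w =
      (BB (Vn (n i)) (Vn' (n i)) (v i) (n i) (e i) (h i) (kap i) w -
       QQn (n i) (e i) (h i) (kap i) w) + (QQn (n i) (e i) (h i) (kap i) w - sig2 w)).
      exact: clipD.
    by rewrite addrA subrK.
  - exact: cvg_cst.
  - by rewrite -[X in _ --> X]addr0; apply: cvgD.
have stab := @stable_limit _ _ _ P G (fun i => Vn (n i)) v n a r s Sc wk nv maF moma nest
  r0 r1 vr rc Hw HB sig2 lam ph measurable_sig2 s20 HD.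
pose cI := 8 * (1 + 8 * Num.sqrt t) + 16 * Num.sqrt s + 4 * (Num.sqrt s + t).
have EI i : Ex P (fun w => `|kap i / 4 * DDn (n i) (e i) (h i) w + Smart (fun i => Vn (n i)) n a i w|) <= cI * r i.
  have [[_ _ c3 c4 _] _ _] := HN i _ (nN i).
  have r40 : 0 <= r i ^+ 4 by rewrite exprn_ge0// ltW.
  have := ito_bound (wk i) (wk' i) (@cGV i) (@cGV' i) (r0 i) (r1 i) (e0 i)
    (hE i) (erefl (kap i)) (eh i) (vh' i) r40 c3 c4.
  rewrite K1E nv nv' => /le_trans; apply.
  rewrite le_eqVlt; apply/orP; left; apply/eqP; rewrite /cI /kap; field.
  by rewrite gt_eqF.
have mSm i : measurable_fun setT (Smart (fun i => Vn (n i)) n a i).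
  apply: measurable_fun_bigsum => j; apply: measurable_funM; first exact: mom_meas.
  exact: measurable_funB.
have mcos := continuous_measurable_fun (@continuous_cos R).
have Ic (f : T -> R) : measurable_fun setT f -> Intg P (fun w => cos (ph + lam * f w)).
  move=> mf; apply: (@Intg_bd _ _ _ _ _ 1).
    apply: (measurableT_comp mcos); apply: measurable_funD => //; exact: measurable_funM.
  by move=> w; rewrite ler_norml cos_geN1 cos_le1.
have dif i : `|Ex P (fun w => cos (ph + lam * Smart (fun i => Vn (n i)) n a i w)) -
    Ex P (fun w => cos (ph + lam * Xh (h i) w))| <=
    `|lam| * (cI * r i) + (`|lam| + 2) * (2 / i.+1%:R).
  have J1 := Ic _ (mSm i); have J2 := Ic _ (measurable_Xh (h i)).
  have I1 : Intg P (fun w => `|kap i / 4 * DDn (n i) (e i) (h i) w + Smart (fun i => Vn (n i)) n a i w|).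
    apply: Intg_norm; apply: mom_Intg; apply: momD.
      apply: momM; first exact: mom_cst.
      apply: mom_sum => j; apply: mom_sum => k0; apply: momM; first exact: mom_cst.
      by apply: (@mom_bd _ _ _ _ _ (4 * h i * e i ^- 2)) => // w; exact: kern1_bd.
    by apply: mom_sum => j; apply: momM => //; exact: (mom_incr (wk i)).
  have I2 : Intg P (fun w => clip (kap i / 4 * DDn (n i) (e i) (h i) w + Xh (h i) w)).
    by apply: Intg_clip; apply: measurable_funD; [exact: measurable_funM|exact: measurable_Xh].
  rewrite -ExB//; apply: (le_trans (le_norm_Ex (IntgD J1 (IntgN J2)))).
  have [_ hd _] := HN i _ (nN i).
  apply: (le_trans _ (lerD (ler_wpM2l (normr_ge0 lam) (EI i)) (ler_wpM2l (_ : 0 <= `|lam| + 2) hd))).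
    rewrite -!ExZ// -ExD; [|exact: IntgZ|exact: IntgZ].
    apply: le_Ex; [|by apply: IntgD; exact: IntgZ|by move=> w; exact: cos_approx].
    by apply: Intg_norm; apply: IntgD => //; exact: IntgN.
  by rewrite addr_ge0.
have dc : Ex P (fun w => cos (ph + lam * Smart (fun i => Vn (n i)) n a i w)) -
    Ex P (fun w => cos (ph + lam * Xh (h i) w)) @[i --> \oo] --> (0 : R).
  have bc : `|lam| * (cI * r i) + (`|lam| + 2) * (2 / i.+1%:R) @[i --> \oo] --> (0 : R).
    rewrite (_ : 0 = `|lam| * (cI * 0) + (`|lam| + 2) * (2 * 0)); last by rewrite !mulr0 addr0.
    by apply: cvgD; (do 2 (apply: cvgM; first exact: cvg_cst)) => //; exact: cvg_harmonic.
  apply/cvgrPdist_le => eps eps0; move/cvgrPdist_le : bc => /(_ _ eps0); apply: filterS => i.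
  rewrite !sub0r !normrN => H; apply: (le_trans (dif i)); exact: le_trans (ler_norm _) H.
have eX i : Ex P (fun w => cos (ph + lam * Xh (h i) w)) =
  Ex P (fun w => cos (ph + lam * Smart (fun i => Vn (n i)) n a i w)) -
  (Ex P (fun w => cos (ph + lam * Smart (fun i => Vn (n i)) n a i w)) -
    Ex P (fun w => cos (ph + lam * Xh (h i) w))) by rewrite opprB addrC subrK.
under eq_cvg do rewrite eX.
have := cvgB stab dc; rewrite subr0 => H; exact: H.
Qed.

End limit.

(** * Law invariance and Brownian scaling *)

Section iterated_law.
Context (R : realType) (mu : probability (measurableTypeR R) R).

(** Measurability is tested by composition with all measurable sequences of variables, which avoids
    a sigma-algebra on the space of sequences. *)
Definition measurable_functional (F : (nat -> R) -> R) :=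
  forall d (T : measurableType d) (f : nat -> T -> R),
    (forall i, measurable_fun setT (f i)) -> measurable_fun setT (fun w => F (f^~ w)).

Definition upd (u : nat -> R) m x : nat -> R := fun i => if i == m then x else u i.

(* The expectation of [F] at independent variables of law [mu] in the first [m]
   coordinates and 0 in the others, by successive integrations. *)
Fixpoint iter_int m (F : (nat -> R) -> R) : R :=
  if m is m'.+1 then iter_int m' (fun u => Ex mu (fun x : R => F (upd u m' x)))
  else F (fun _ => 0).

Lemma measurable_functional_int m F (M : R) : (forall u, `|F u| <= M) ->
  measurable_functional F ->
  measurable_functional (fun u => Ex mu (fun x : R => F (upd u m x))).
Proof.
move=> FM mF d T f mf.
pose TM := (T * measurableTypeR R)%type.
have mz : measurable_fun setT (fun z : TM => F (upd (f^~ z.1) m z.2)).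
  apply: (mF _ TM (fun i z => upd (f^~ z.1) m z.2 i)) => i; rewrite /upd.
  by case: eqP => _; [exact: measurable_snd|apply: measurableT_comp => //; exact: mf].
exact: (@measurable_Ex _ _ _ T (measurableTypeR R) mu (fun w x => F (upd (f^~ w) m x)) M mz (fun w x => FM _)).
Qed.

Context d (T : measurableType d) (P : probability T R).
Variables (G : nat -> set (set T)) (z : nat -> T -> R).
Hypotheses (Gm : forall k, G k `<=` measurable) (mz : forall k, measurable_fun setT (z k))
  (ind : forall k, indep_of P (G k) (z k)) (law : forall k, has_law P mu (z k))
  (ad : forall j k, (j < k)%N -> Fm (G k) (z j)).

Let tr m w : nat -> R := fun i => if (i < m)%N then z i w else 0.

(** The last variable is integrated out by freezing the earlier ones. The right-hand side mentions
    [mu] but neither the space nor the variables, which is what makes laws comparable. *)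
Lemma Ex_iter_int m F (M : R) : (forall u, `|F u| <= M) -> measurable_functional F ->
  Ex P (fun w => F (fun i => if (i < m)%N then z i w else 0)) = iter_int m F.
Proof.
elim: m F => [|m IH] F FM mF.
  by rewrite -[RHS](Ex_cst P); apply: eq_Ex => w; congr F.
pose H w x := F (upd (tr m w) m x).
have mH : measurable_fun setT (fun y : g_sigma_algebraType (G m) * measurableTypeR R => H y.1 y.2).
  apply: (mF _ _ (fun i (y : g_sigma_algebraType (G m) * measurableTypeR R) => upd (tr m y.1) m y.2 i)) => i.
  rewrite /upd /tr; case: eqP => _; first exact: measurable_snd.
  case: ltnP => im; last exact: measurable_cst.
  by apply: (@measurableT_comp _ _ _ _ _ _ (z i : g_sigma_algebraType (G m) -> R)) => //; exact: ad.
have HE : (fun w => F (fun i => if (i < m.+1)%N then z i w else 0)) = fun w => H w (z m w).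
  apply/funext => w; congr F; apply/funext => i; rewrite /upd /tr ltnS leq_eqVlt.
  by case: eqP => [->|].
have mtr i : measurable_fun setT (fun w => tr m.+1 w i).
  rewrite /tr; case: (ltnP i m.+1) => _; [exact: mz|exact: measurable_cst].
have [||_ e] := freezing (@Gm m) (mz m) (@ind m) (@law m) mH.
- move=> w; apply: (@Intg_bd _ _ _ mu _ M); last by move=> x; exact: FM.
  apply: (mF _ (measurableTypeR R) (fun i x => upd (tr m w) m x i)) => i; rewrite /upd.
  by case: eqP => _; [exact: measurable_id|exact: measurable_cst].
- rewrite -HE; apply: (@Intg_bd _ _ _ _ _ M); last by move=> x; exact: FM.
  exact: (mF _ _ (fun i w => tr m.+1 w i)).
rewrite HE e /= -(IH (fun u => Ex mu (fun x : R => F (upd u m x)))) //.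
- move=> u.
  have I1 : Intg mu (fun x : R => F (upd u m x)).
    apply: (@Intg_bd _ _ _ _ _ M) => //.
    apply: (mF _ (measurableTypeR R) (fun i x => upd u m x i)) => i; rewrite /upd.
    by case: eqP => _; [exact: measurable_id|exact: measurable_cst].
  apply: (le_trans (le_norm_Ex I1)); rewrite -[leRHS](Ex_cst mu).
  by apply: le_Ex => //; [exact: Intg_norm|exact: Intg_cst].
- exact: (measurable_functional_int _ FM).
Qed.

End iterated_law.

Section law_of_double_sums.
Context d (T : measurableType d) (R : realType) (P : probability T R).
Variables (W W' : R -> T -> R).
Hypotheses (BW : brownian_motion P W) (BW' : brownian_motion P W').
Hypothesis WW' : independent_systems P (sigma_process `[0, +oo[ W)
                                       (sigma_process `[0, +oo[ W').

(** The first [n] coordinates are the increments of [W'] and the next [n] those of [W]. This order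
    suits the filtrations, in which all of [W'] is known before [W] starts. *)
Definition double_sum_functional (n : nat) (v h e ph c : R) (u : nat -> R) : R :=
  cos (ph + c * \sum_(0 <= j < n) \sum_(0 <= k < n) v * v *
    kern h e 1 (\sum_(0 <= i < j) u (n + i)%N - \sum_(0 <= i < k) u i)).

Lemma measurable_double_sum_functional n v h e ph c :
  measurable_functional (double_sum_functional n v h e ph c).
Proof.
move=> d0 T0 f mf; apply: (measurableT_comp (continuous_measurable_fun (@continuous_cos R))).
apply: measurable_funD => //; apply: measurable_funM => //.
do 2 (apply: measurable_fun_bigsum => ?); apply: measurable_funM => //.
apply: (measurableT_comp (@measurable_kern _ _ _ _)).
by apply: measurable_funB; apply: measurable_fun_bigsum => ?; exact: mf.
Qed.

Lemma Ex_double_sum n v h e ph c : 0 < v ->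
  Ex P (fun w => cos (ph + c * DD (fun j => W (j%:R * v)) (fun k => W' (k%:R * v)) v v n e h w)) =
  iter_int (normal_prob 0 (Num.sqrt v)) (n + n) (double_sum_functional n v h e ph c).
Proof.
move=> v0.
have mW r : 0 <= r -> measurable_fun setT (W r) by exact: (bm_measurable BW).
have mW' r : 0 <= r -> measurable_fun setT (W' r) by exact: (bm_measurable BW').
have jv (j : nat) : 0 <= j%:R * v by rewrite mulr_ge0 ?(ltW v0).
have wk := walk_of_brownian v0 BW mW' WW'.
have wk' := walk_of_brownian v0 BW' mW (indep_systemsC WW').
pose V j := W (j%:R * v); pose V' j := W' (j%:R * v).
pose z i := if (i < n)%N then incr V' i else incr V (i - n)%N.
pose G (i : nat) : set (set T) := if (i < n)%N then sigma_process `[0, i%:R * v] W'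
  else sigma_process `[0, (i - n)%N%:R * v] W `|` sigma_process `[0, +oo[ W'.
have mz i : measurable_fun setT (z i).
  by rewrite /z; case: ifP => _; apply: measurable_funB; [exact: mW'|exact: mW'|exact: mW|exact: mW].
have mG i : G i `<=` measurable.
  rewrite /G; case: ifP => _; last exact: (@walk_sub _ _ _ _ _ _ _ wk).
  by apply: sigma_process_measurable => r /=; rewrite in_itv/= => /andP[r0 _]; exact: mW'.
have iG i : indep_of P (G i) (z i).
  rewrite /G /z; case: ifP => _; last exact: (incr_indep wk).
  rewrite /indep_of sigma_algebra_id; last exact: smallest_sigma_algebra.
  by apply: (bm_indep_increments BW' (jv i)); rewrite ler_pM2r// ler_nat.
have lz i : has_law P (normal_prob 0 (Num.sqrt v)) (z i).
  by rewrite /z; case: ifP => _; [case: (incr_gauss wk' i)|case: (incr_gauss wk (i - n))].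
have ad j k : (j < k)%N -> Fm (G k) (z j).
  move=> jk; rewrite /G /z; case: (ltnP k n) => kn.
    rewrite (ltn_trans jk kn); apply: FmB; apply: Fm_sigma_var => A hA; apply: sub_sigma_algebra;
      apply: (sigma_process_var _ hA); rewrite /= in_itv/= jv ler_pM2r// ler_nat//.
    exact: ltnW.
  case: ltnP => jn; first by apply: FmB; exact: Fm_other.
  by apply: (Fm_incr wk); lia.
have mcos := continuous_measurable_fun (@continuous_cos R).
rewrite -(Ex_iter_int mG mz iG lz ad (n + n) (M := 1)); last 2 first.
- by move=> u; rewrite ler_norml cos_geN1 cos_le1.
- exact: measurable_double_sum_functional.
apply: Ex_eq_ae.
- apply: (measurableT_comp mcos); apply: measurable_funD => //; apply: measurable_funM => //.
  do 2 (apply: measurable_fun_bigsum => ?); apply: measurable_funM => //.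
  apply: (measurableT_comp (@measurable_kern _ _ _ _)).
  by apply: measurable_funB; [exact: mW|exact: mW'].
- apply: (@measurable_double_sum_functional n v h e ph c d T
    (fun i w => if (i < n + n)%N then z i w else 0)) => i.
  by case: (ltnP i (n + n)) => _; [exact: mz|exact: measurable_cst].
(* The motions start at 0 only almost surely, and the values on the grid are sums of increments only
   on that event. *)
move: (bm_start BW) (bm_start BW'); apply: filterS2 => w h0 h0'.
rewrite /double_sum_functional /DD; congr (cos (_ + _ * _)).
apply: eq_big_nat => j /andP[_ jn]; apply: eq_big_nat => k /andP[_ kn].
have -> : \sum_(0 <= i < j) (if (n + i < n + n)%N then z (n + i)%N w else 0) = W (j%:R * v) w.
  rewrite (_ : W _ w = V j w - V 0%N w); last by rewrite /V mul0r h0 subr0.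
  rewrite -(telescope_sumr (fun i => V i w))//; apply: eq_big_nat => i /andP[_ ij].
  by rewrite /z ltn_add2l (ltn_trans ij jn) ltnNge leq_addr/= addKn.
have -> // : \sum_(0 <= i < k) (if (i < n + n)%N then z i w else 0) = W' (k%:R * v) w.
rewrite (_ : W' _ w = V' k w - V' 0%N w); last by rewrite /V' mul0r h0' subr0.
rewrite -(telescope_sumr (fun i => V' i w))//; apply: eq_big_nat => i /andP[_ ij].
by rewrite /z (ltn_trans ij kn) (ltn_addr _ (ltn_trans ij kn)).
Qed.

End law_of_double_sums.

Section law_of_increment_product.
Context d (T : measurableType d) (R : realType) (P : probability T R).

Lemma Ex_cos_approx (lam ph : R) (D X : T -> R) :
  measurable_fun setT D -> measurable_fun setT X ->
  `|Ex P (fun w => cos (ph - lam * D w)) - Ex P (fun w => cos (ph + lam * X w))| <=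
  (`|lam| + 2) * Ex P (fun w => clip (D w + X w)).
Proof.
move=> mD mX.
have Ic (c : R) (f : T -> R) : measurable_fun setT f -> Intg P (fun w => cos (ph + c * f w)).
  move=> mf; apply: (@Intg_bd _ _ _ _ _ 1).
    apply: (measurableT_comp (continuous_measurable_fun (@continuous_cos R))).
    by apply: measurable_funD => //; exact: measurable_funM.
  by move=> w; rewrite ler_norml cos_geN1 cos_le1.
have J1 := Ic (- lam) _ mD; have J2 := Ic lam _ mX.
have mC : measurable_fun setT (fun w => D w + X w) by exact: measurable_funD.
under eq_Ex do rewrite -mulNr.
rewrite -ExB//; apply: (le_trans (le_norm_Ex (IntgD J1 (IntgN J2)))).
rewrite -ExZ; last exact: Intg_clip.
apply: le_Ex; [by apply: Intg_norm; apply: IntgD => //; exact: IntgN|by apply: IntgZ; exact: Intg_clip|].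
move=> w; have := cos_approx lam ph (- D w) (X w) (D w).
by rewrite subrr normr0 mulr0 add0r mulrN -mulNr.
Qed.

(** The iterated integrals are built from [n], [h], [m], [ph] and [lam] alone, so this limit shows
    that the law of the integral at times 1 is the same for every pair of motions. *)
Lemma increment_product_char (W W' : R -> T -> R) (L L' : R -> R -> T -> R) (h ph lam : R) :
  brownian_motion P W -> brownian_motion P W' ->
  independent_systems P (sigma_process `[0, +oo[ W) (sigma_process `[0, +oo[ W') ->
  local_time P W L -> local_time P W' L' -> 0 < h ->
  exists2 u : nat -> R, u m @[m --> \oo] --> (0 : R) &
  forall m, exists N, forall n, (N <= n)%N -> (0 < n)%N ->
    `|iter_int (normal_prob 0 (Num.sqrt (1 / n%:R))) (n + n)
        (double_sum_functional n (1 / n%:R) h (h ^+ 2 / m.+1%:R) ph (- lam / Num.sqrt h ^+ 3)) -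
      Ex P (fun w => cos (ph + lam * Xh L L' 1 1 h w))| <= (`|lam| + 2) * u m.
Proof.
move=> BW BW' WW' LW LW' h0.
have [u uc Hu] := @walk_approx _ _ _ _ _ _ _ _ BW BW' LW LW' 1 1 ltr01 ltr01 _ h0.
exists u => // m; have [N HN] := Hu m; exists N => n nN n0.
have v0 : 0 < 1 / n%:R :> R by rewrite divr_gt0// ltr0n.
have := HN n nN; set Dn := DD _ _ _ _ _ _ _ => HD.
have mX : measurable_fun setT (Xh L L' 1 1 h) by exact: (measurable_Xh LW LW').
have mD : measurable_fun setT Dn.
  do 2 (apply: measurable_fun_bigsum => ?); apply: measurable_funM => //.
  apply: (measurableT_comp (@measurable_kern _ _ _ _)).
  by apply: measurable_funB; [apply: (bm_measurable BW)|apply: (bm_measurable BW')]; rewrite !mulr_ge0// invr_ge0.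
have mqD : measurable_fun setT (fun w => (Num.sqrt h ^+ 3)^-1 * Dn w) by exact: measurable_funM.
have := Ex_double_sum BW BW' WW' n h (h ^+ 2 / m.+1%:R) ph (- lam / Num.sqrt h ^+ 3) v0.
rewrite -/Dn => <-.
have eD w : ph + - lam / Num.sqrt h ^+ 3 * Dn w = ph - lam * ((Num.sqrt h ^+ 3)^-1 * Dn w).
  by rewrite !mulNr mulrA.
under eq_Ex do rewrite eD.
apply: (le_trans (Ex_cos_approx lam ph mqD mX)).
by rewrite ler_wpM2l// addr_ge0.
Qed.

Lemma increment_product_law (W1 W1' W2 W2' : R -> T -> R) (L1 L1' L2 L2' : R -> R -> T -> R)
    (h ph lam : R) :
  brownian_motion P W1 -> brownian_motion P W1' ->
  independent_systems P (sigma_process `[0, +oo[ W1) (sigma_process `[0, +oo[ W1') ->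
  local_time P W1 L1 -> local_time P W1' L1' ->
  brownian_motion P W2 -> brownian_motion P W2' ->
  independent_systems P (sigma_process `[0, +oo[ W2) (sigma_process `[0, +oo[ W2') ->
  local_time P W2 L2 -> local_time P W2' L2' -> 0 < h ->
  Ex P (fun w => cos (ph + lam * Xh L1 L1' 1 1 h w)) =
  Ex P (fun w => cos (ph + lam * Xh L2 L2' 1 1 h w)).
Proof.
move=> B1 B1' I1 LL1 LL1' B2 B2' I2 LL2 LL2' h0.
have [u1 u1c H1] := increment_product_char ph lam B1 B1' I1 LL1 LL1' h0.
have [u2 u2c H2] := increment_product_char ph lam B2 B2' I2 LL2 LL2' h0.
set E1 := Ex P _ in H1 *; set E2 := Ex P _ in H2 *.
have H m : `|E1 - E2| <= (`|lam| + 2) * (u1 m + u2 m).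
  have [N1 {}H1] := H1 m; have [N2 {}H2] := H2 m.
  have := H1 (maxn N1 N2).+1 (leqW (leq_maxl _ _)) isT.
  have := H2 (maxn N1 N2).+1 (leqW (leq_maxr _ _)) isT.
  set I := iter_int _ _ _ => {}H2 {}H1; rewrite distrC in H1.
  rewrite (_ : E1 - E2 = (E1 - I) + (I - E2)); last by rewrite addrA subrK.
  by apply: (le_trans (ler_normD _ _)); rewrite mulrDr; exact: lerD.
have cv : (`|lam| + 2) * (u1 m + u2 m) @[m --> \oo] --> (0 : R).
  have := cvgM (cvg_cst (`|lam| + 2)) (cvgD u1c u2c).
  by rewrite addr0 mulr0 => h1; exact: h1.
apply/eqP; rewrite -subr_eq0 -normr_le0.
have := @cvgr_to_ge _ _ _ _ _ _ _ cv; apply; first exact: nearW.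
Qed.

End law_of_increment_product.

Lemma gt0_muleBr (R : realType) (a : R) (x y : \bar R) : 0 < a ->
  (a%:E * (x - y) = a%:E * x - a%:E * y)%E.
Proof.
move=> a0; have a0' : (0 < a%:E)%E by rewrite lte_fin.
case: x => [x||]; case: y => [y||] //=;
  rewrite ?gt0_muley ?gt0_muleNy//= -?EFinB -?EFinM ?mulrBr//=.
all: by rewrite ?gt0_muley ?gt0_muleNy.
Qed.

(** * Brownian scaling of motions and local times *)

Section scaling.
Context (R : realType).
Local Notation leb := (@lebesgue_measure R).

Lemma integral_affine_scale (a b c : R) (f : R -> \bar R) : 0 < a -> 0 < c ->
  measurable_fun setT f ->
  (\int[leb]_x (c%:E * f (a * x + b)%R) = (c / a)%:E * \int[leb]_x f x)%E.
Proof.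
move=> a0 c0 mf.
have h (g : R -> \bar R) : measurable_fun setT g -> (forall x, 0 <= g x)%E ->
    (\int[leb]_x (c%:E * g (a * x + b)%R) = (c / a)%:E * \int[leb]_x g x)%E.
  move=> mg g0; rewrite (@ge0_integral_affine _ a b g)// muleA -EFinM divfK ?gt_eqF//.
  rewrite ge0_integralZl_EFin ?(ltW c0)//.
  by apply: measurableT_comp => //; apply: measurable_funD => //; exact: measurable_funM.
rewrite integralE ge0_funeposM ?(ltW c0)// ge0_funenegM ?(ltW c0)// [in RHS]integralE.
rewrite gt0_muleBr ?divr_gt0// -(h f^\+%E)//; last exact: measurable_funepos.
rewrite -(h f^\-%E)//; last exact: measurable_funeneg.
by congr (_ - _)%E; apply: eq_integral => x _; rewrite ?funeposE ?funenegE.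
Qed.

Lemma normal_rescale (a v : R) (A : set R) : 0 < a -> 0 < v -> measurable A ->
  normal_prob 0 (a * v) ((fun x => x / a) @^-1` A) = normal_prob 0 v A.
Proof.
move=> a0 v0 mA; have av0 : 0 < a * v by rewrite mulr_gt0.
have ms (c : R) (B : set R) : measurable B -> measurable ((fun x : R => x * c) @^-1` B).
  move=> mB; rewrite -[X in measurable X]setTI.
  have mc : measurable_fun setT (fun x : R => x * c) by exact: measurable_funM.
  exact: mc.
have e : (fun x : R => x / a) @^-1` A = (fun x => x / (a * v)) @^-1` ((fun x => x * v) @^-1` A).
  by apply/seteqP; split => x /=; rewrite invfM mulrA mulfVK ?gt_eqF.
rewrite e; apply: (etrans (normal_scale av0 (ms v _ mA))).
apply: (etrans (esym (normal_scale v0 (ms v _ mA)))).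
have -> // : (fun x => x / v) @^-1` ((fun x => x * v) @^-1` A) = A.
by apply/seteqP; split => x /=; rewrite mulfVK ?gt_eqF.
Qed.

Context d (T : measurableType d) (P : probability T R).
Variable a : R.
Hypothesis a0 : 0 < a.

Definition bm_scale (W : R -> T -> R) : R -> T -> R := fun r w => W (a ^+ 2 * r) w / a.

Definition lt_scale (L : R -> R -> T -> R) : R -> R -> T -> R :=
  fun x r w => L (a * x) (a ^+ 2 * r) w / a.

Let a20 : 0 < a ^+ 2. Proof. by rewrite exprn_gt0. Qed.

Let mdiv (B : set R) : measurable B -> measurable ((fun x : R => x / a) @^-1` B).
Proof.
move=> mB; rewrite -[X in measurable X]setTI.
have mc : measurable_fun setT (fun x : R => x / a) by exact: measurable_funM.
exact: mc.
Qed.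

Lemma sigma_process_scale (W : R -> T -> R) (D D' : set R) :
  (forall r, D r -> D' (a ^+ 2 * r)) ->
  sigma_process D (bm_scale W) `<=` sigma_process D' W.
Proof.
move=> DD'; apply: smallest_sub; first exact: smallest_sigma_algebra.
move=> A [r Dr [B mB <-]]; apply: (sigma_process_var (DD' r Dr)).
by exists ((fun x => x / a) @^-1` B) => //; exact: mdiv.
Qed.

Lemma brownian_scale (W : R -> T -> R) : brownian_motion P W -> brownian_motion P (bm_scale W).
Proof.
move=> BW; have ar r : 0 <= r -> 0 <= a ^+ 2 * r by move=> r0; rewrite mulr_ge0// ltW.
split.
- by move=> r r0; apply: measurable_funM => //; exact: (bm_measurable BW (ar r r0)).
- by apply: filterS (bm_start BW) => w; rewrite /bm_scale mulr0 => ->; rewrite mul0r.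
- apply: filterS (bm_continuous BW) => w c.
  have cc := cpath_continuous c.
  apply: (@subspace_eq_continuous _ _ _ (fun r => cpath W w (a ^+ 2 * r) / a)).
    by move=> r; rewrite inE/= in_itv/= andbT => r0; rewrite /= cpath_ge0// ar.
  apply: continuous_subspaceT => r; apply: cvgM; last exact: cvg_cst.
  apply: (@continuous_comp _ _ _ (fun r => a ^+ 2 * r) (cpath W w)); last exact: cc.
  by apply: cvgM; [exact: cvg_cst|exact: cvg_id].
- move=> s t s0 st A B hA [C mC <-].
  have st' : a ^+ 2 * s <= a ^+ 2 * t by rewrite ler_pM2l.
  apply: (bm_indep_increments BW (ar _ s0) st').
    apply: sigma_process_scale hA => r /=; rewrite !in_itv/= => /andP[r0 rs].
    by rewrite ar// ler_pM2l.
  exists ((fun x => x / a) @^-1` C); first exact: mdiv.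
  by apply/seteqP; split => w /=; rewrite /bm_scale mulrBl.
- move=> s t s0 st A mA.
  have st' : a ^+ 2 * s < a ^+ 2 * t by rewrite ltr_pM2l.
  have := bm_gaussian_increments BW (ar _ s0) st' (mdiv mA).
  have v0 : 0 < Num.sqrt (t - s) by rewrite sqrtr_gt0 subr_gt0.
  rewrite (_ : Num.sqrt (a ^+ 2 * t - _) = a * Num.sqrt (t - s)); last first.
    by rewrite -mulrBr sqrtrM ?sqr_ge0// sqrtr_sqr gtr0_norm.
  move=> H; apply: (etrans _ (etrans H (normal_rescale a0 v0 mA))).
  have -> // : (fun w => bm_scale W t w - bm_scale W s w) @^-1` A =
    (fun w => W (a ^+ 2 * t) w - W (a ^+ 2 * s) w) @^-1` ((fun x => x / a) @^-1` A).
  by apply/seteqP; split => w /=; rewrite /bm_scale mulrBl.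
Qed.

(** Two changes of variable: time by a^2 on the left of the occupation formula, space by a on the
    right. The factors 1/a^2 and a leave the 1/a in [lt_scale]. *)
Lemma local_time_scale (W : R -> T -> R) (L : R -> R -> T -> R) :
  brownian_motion P W -> local_time P W L -> local_time P (bm_scale W) (lt_scale L).
Proof.
move=> BW LW; have ar r : 0 <= r -> 0 <= a ^+ 2 * r by move=> r0; rewrite mulr_ge0// ltW.
split.
- by move=> x t t0; apply: measurable_funM => //; exact: (lt_measurable LW _ (ar t t0)).
- move=> w; apply/subspace_continuousP => -[x t] /= t0.
  have /subspace_continuousP c := @lt_continuous _ _ _ _ _ _ LW w.
  have {}c := c (a * x, a ^+ 2 * t) (ar _ t0).
  apply: cvgM; last exact: cvg_cst.
  have cf : (fun xt : R * R => (a * xt.1, a ^+ 2 * xt.2)) xt @[xt --> (x, t)] --> (a * x, a ^+ 2 * t).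
    apply: (@cvg_pair _ _ _ (nbhs (x, t)) (nbhs (a * x)) (nbhs (a ^+ 2 * t)) _ _ _ (fun xt : R * R => a * xt.1) (fun xt : R * R => a ^+ 2 * xt.2)).
      by apply: cvgM; [exact: cvg_cst|exact: cvg_fst].
    by apply: cvgM; [exact: cvg_cst|exact: cvg_snd].
  move=> A /c /= hA.
  have hB : nbhs (x, t) (fun xt : R * R => 0 <= a ^+ 2 * xt.2 -> A (L (a * xt.1) (a ^+ 2 * xt.2) w)) := cf _ hA.
  change (nbhs (x, t) (fun xt : R * R => 0 <= xt.2 -> A (L (a * xt.1) (a ^+ 2 * xt.2) w))).
  by apply: filterS hB => -[y r] /= h r0; apply: h; exact: ar.
move: (bm_continuous BW) (lt_occupation LW); apply: filterS2 => w c o t f t0 mf bf.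
have cc := cpath_continuous c.
have mW : measurable_fun setT (cpath W w) by exact: continuous_measurable_fun.
have mfa : measurable_fun setT (fun x : R => f (x / a)).
  by apply: measurableT_comp => //; exact: measurable_funM.
have bfa : bounded_fun (fun x : R => f (x / a)).
  case: bf => M [Mr HM]; exists M; split => // x Mx y _; exact: HM.
have := o (a ^+ 2 * t) _ (ar _ t0) mfa bfa => {}o.
(* The restriction of the time interval goes into the integrand, so that the change of variables is
   one on the whole line. *)
pose g : R -> \bar R := (fun r : R => (f (cpath W w r / a))%:E) \_ `[0, a ^+ 2 * t]%classic.
have mg : measurable_fun setT g.
  apply/(measurable_restrictT _ (measurable_itv `[0, a ^+ 2 * t])).
  by apply: measurable_funTS; apply/measurable_EFinP; exact: (measurableT_comp mfa).
rewrite integral_mkcond.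
transitivity (\int[leb]_r (1%:E * g (a ^+ 2 * r + 0)%R))%E.
  apply: eq_integral => r _; rewrite mul1e /g addr0 !patchE.
  have -> : (r \in `[0, t]%classic) = (a ^+ 2 * r \in `[0, a ^+ 2 * t]%classic).
    by apply/idP/idP; rewrite !inE/= !in_itv/= pmulr_rge0// ler_pM2l.
  case: ifPn => //; rewrite inE/= in_itv/= => /andP[r0 _].
  by rewrite /bm_scale cpath_ge0.
rewrite (integral_affine_scale 0 a20 ltr01 mg).
have -> : (\int[leb]_x g x = \int[leb]_(r in `[0%R, (a ^+ 2 * t)%R]) (f (W r w / a))%:E)%E.
  rewrite [RHS]integral_mkcond; apply: eq_integral => r _; rewrite /g !patchE.
  by case: ifPn => //; rewrite inE/= in_itv/= => /andP[r0 _]; rewrite cpath_ge0.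
rewrite o.
have cL : continuous (fun x => L x (a ^+ 2 * t) w).
  exact: (@local_time_continuous _ _ _ _ _ _ LW _ w (ar _ t0)).
have mG : measurable_fun setT (fun x : R => (f (x / a) * L x (a ^+ 2 * t) w)%:E).
  by apply/measurable_EFinP; apply: measurable_funM => //; exact: continuous_measurable_fun.
have ia : 0 < a^-1 by rewrite invr_gt0.
have := integral_affine_scale 0 a0 ia mG.
rewrite (_ : a^-1 / a = 1 / a ^+ 2) => [<-|]; last by rewrite div1r expr2 invfM.
apply: eq_integral => x _; rewrite -EFinM /lt_scale addr0; congr EFin.
by rewrite [a * x / a]mulrAC mulfV ?gt_eqF// mul1r; ring.
Qed.

(** With t = a^2, the shift 1 at time t becomes the shift h = 1/a at time 1. Dividing a^(-3) by
    h^(3/2) leaves a^(-3/2) = t^(-3/4), the normalisation of the second limit. *)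
Lemma increment_product_scale (W W' : R -> T -> R) (L L' : R -> R -> T -> R) w :
  local_time P W L -> local_time P W' L' ->
  increment_product (lt_scale L) (lt_scale L') a^-1 1 1 w =
  increment_product L L' 1 (a ^+ 2) (a ^+ 2) w / a ^+ 3.
Proof.
move=> LW LW'; rewrite /increment_product /lt_scale !mulr1.
have c1 := @local_time_continuous _ _ _ _ _ _ LW _ w (ltW a20).
have c2 := @local_time_continuous _ _ _ _ _ _ LW' _ w (ltW a20).
have mL (k : R -> R) : continuous k -> measurable_fun setT (fun x : R => k (x + 1) - k x).
  move=> ck; have mk := continuous_measurable_fun ck.
  by apply: measurable_funB => //; apply: measurableT_comp => //; exact: measurable_funD.
have mG : measurable_fun setT (fun x : R => ((L (x + 1) (a ^+ 2) w - L x (a ^+ 2) w) *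
    (L' (x + 1) (a ^+ 2) w - L' x (a ^+ 2) w))%:E).
  apply/measurable_EFinP; apply: measurable_funM.
    exact: (mL (fun x => L x (a ^+ 2) w)).
  exact: (mL (fun x => L' x (a ^+ 2) w)).
have ia : 0 < (a ^+ 2)^-1 by rewrite invr_gt0.
have := integral_affine_scale 0 a0 ia mG.
rewrite /Rintegral => H.
transitivity (fine (\int[leb]_x ((a ^- 2)%:E * ((L (a * x + 0 + 1) (a ^+ 2) w - L (a * x + 0) (a ^+ 2) w) *
    (L' (a * x + 0 + 1) (a ^+ 2) w - L' (a * x + 0) (a ^+ 2) w))%:E))%E).
  congr fine; apply: eq_integral => x _; rewrite -EFinM; congr EFin.
  rewrite !addr0 !mulrDr mulfV ?gt_eqF//; field; by rewrite gt_eqF.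
have fineZ (r : R) (y : \bar R) : 0 < r -> fine (r%:E * y) = r * fine y.
  move=> r0; case: y => [y||] //=; rewrite ?gt0_muley ?gt0_muleNy ?lte_fin//= ?mulr0//.
rewrite H fineZ ?divr_gt0// mulrC; congr (_ * _).
by rewrite -invfM -exprSr.
Qed.

End scaling.

(** * Levy continuity *)

Lemma fine_pos_scale (R : realType) (r : R) (y : \bar R) : 0 < r -> fine (r%:E * y) = r * fine y.
Proof.
by move=> r0; case: y => [y||] //=; rewrite ?gt0_muley ?gt0_muleNy ?lte_fin//= ?mulr0.
Qed.

Lemma ler_normM (R : realType) (a b A B : R) : `|a| <= A -> `|b| <= B -> `|a * b| <= A * B.
Proof. by move=> hA hB; rewrite normrM ler_pM. Qed.

Lemma gauss_le1 (R : realType) (z : R) : `|expR (- (z ^+ 2 / 2))| <= 1.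
Proof. by rewrite ger0_norm ?expR_ge0// -expR0 ler_expR oppr_le0 divr_ge0// sqr_ge0. Qed.

Section smoothing.
Context (R : realType).
Local Notation leb := (@lebesgue_measure R).
Let mu : probability (measurableTypeR R) R := normal_prob 0 1.

Lemma Ex_normal (g : R -> R) (C : R) : measurable_fun setT g -> (forall x, `|g x| <= C) ->
  Ex mu g = \int[leb]_x (g x * npdf x).
Proof.
move=> mg gC; apply: Rintegral_normal => //.
apply: (@npdf_integrable _ _ C 0) => // x; rewrite expr0.
apply: (le_trans (gC x)); have := le_trans (normr_ge0 _) (gC x); lra.
Qed.

Lemma Ex_normal_cos (c b : R) : Ex mu (fun u : R => cos (c + b * u)) = cos c * expR (- (b ^+ 2 / 2)).
Proof.
rewrite (@Ex_normal _ 1) ?gauss_cos// => [|x]; last by rewrite ler_norml cos_geN1 cos_le1.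
apply: (measurableT_comp (continuous_measurable_fun (@continuous_cos R))).
by apply: measurable_funD => //; exact: measurable_funM.
Qed.

Lemma Rintegral_affine (a b : R) (f : R -> R) : 0 < a -> measurable_fun setT f ->
  \int[leb]_x f (a * x + b) = a^-1 * \int[leb]_x f x.
Proof.
move=> a0 mf; have := integral_affine_scale b a0 ltr01 (proj2 (measurable_EFinP _ _) mf).
rewrite div1r => H; rewrite /Rintegral -fine_pos_scale ?invr_gt0//; congr fine.
by rewrite -H; apply: eq_integral => x _; rewrite mul1e.
Qed.

Lemma csupp_bounded (k : R -> R) (M : R) : continuous k -> (forall x, M < `|x| -> k x = 0) ->
  exists C : R, forall x : R, `|k x| <= C.
Proof.
move=> ck kM; have M0 : - `|M| <= `|M| by apply: (@le_trans _ _ 0); rewrite ?oppr_le0.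
have [|c _ H] := @EVT_max _ (fun r => `|k r|) _ _ M0.
  by apply: continuous_subspaceT => r; apply: cvg_norm; exact: ck.
exists `|k c| => x; have [h|h] := lerP `|x| `|M|.
  by apply: H; rewrite in_itv/= -ler_norml.
by rewrite kM ?normr0//; apply: le_lt_trans h; exact: ler_norm.
Qed.

Lemma csupp_uniform (f : R -> R) (M eta : R) : 0 < M -> continuous f ->
  (forall x, M < `|x| -> f x = 0) -> 0 < eta ->
  exists2 del : R, 0 < del & forall x y, `|x - y| <= del -> `|f x - f y| <= eta.
Proof.
move=> M0 cf fM eta0.
have cF : continuous (fun r => f (r - (M + 1))).
  move=> r; apply: (@continuous_comp _ _ _ (fun r => r - (M + 1)) f); last exact: cf.
  by apply: cvgB; [exact: cvg_id|exact: cvg_cst].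
have [del0 d0 H] := heine (2 * (M + 1)) cF eta0.
exists (Num.min del0 1); first by rewrite lt_min d0 ltr01.
move=> x y; rewrite le_min => /andP[h1 h2].
have [hx|hx] := lerP `|x| (M + 1); last first.
  rewrite (fM x); last by lra.
  rewrite (fM y) ?subrr ?normr0 ?(ltW eta0)//.
  by have := ler_distD x 0 y; rewrite !sub0r !normrN => ?; move: (ler_dist_dist x y); rewrite ler_norml => /andP[? ?]; lra.
have [hy|hy] := lerP `|y| (M + 1); last first.
  rewrite (fM y); last by lra.
  rewrite (fM x) ?subrr ?normr0 ?(ltW eta0)//.
  by move: (ler_dist_dist x y); rewrite ler_norml => /andP[? ?]; lra.
have := H (x + (M + 1)) (y + (M + 1)); rewrite !addrK; apply.
- by move: hx; rewrite ler_norml => /andP[? ?]; apply/andP; split; lra.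
- by move: hy; rewrite ler_norml => /andP[? ?]; apply/andP; split; lra.
- by rewrite opprD addrACA subrr addr0.
Qed.

Lemma npdf_gt0 y : 0 < npdf y :> R.
Proof. by rewrite npdfE mulr_gt0 ?expR_gt0// normal_peak_gt0// oner_neq0. Qed.

Lemma continuous_npdf : continuous (@npdf R).
Proof.
rewrite (_ : @npdf R = fun y => normal_peak 1 * expR (- (y ^+ 2 / 2))); last first.
  by apply/funext => y; exact: npdfE.
move=> y; apply: cvgM; first exact: cvg_cst.
apply: (@continuous_comp _ _ _ (fun y : R => - (y ^+ 2 / 2)) (@expR R)); last exact: continuous_expR.
by apply: cvgN; apply: cvgM; [exact: exprn_continuous|exact: cvg_cst].
Qed.

Lemma continuous_div_npdf (f : R -> R) : continuous f -> continuous (fun y => f y / npdf y).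
Proof.
move=> cf; by move=> y; apply: cvgM; [exact: cf|apply: cvgV; [rewrite gt_eqF// npdf_gt0|exact: continuous_npdf]].
Qed.

Section smooth_one.
Variables (f : R -> R) (M sg : R).
Hypotheses (M0 : 0 < M) (cf : continuous f) (fM : forall x, M < `|x| -> f x = 0) (sg0 : 0 < sg).

Let F (y : R) : R := f y / npdf y.

Let peak : R := normal_peak 1.

(** A substitution in the Gaussian convolution. Dividing [f] by the normal density turns the
    Lebesgue integral over [y] into an expectation, so [Ex_swap] can later exchange it with the
    expectation of the random variable. *)
Lemma smoothE (x : R) : Ex mu (fun u : R => f (x + sg * u)) =
  peak / sg * Ex mu (fun y : R => F y * expR (- (((y - x) / sg) ^+ 2 / 2))).
Proof.
have [C fC] := csupp_bounded cf fM.
have FM y : M < `|y| -> F y = 0 by move=> /fM; rewrite /F => ->; rewrite mul0r.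
have cF := continuous_div_npdf cf.
have [C' FC] := csupp_bounded cF FM.
have mf := continuous_measurable_fun cf; have mF := continuous_measurable_fun cF.
have ma (a b : R) : measurable_fun setT (fun y : R => a + b * y).
  by apply: measurable_funD => //; exact: measurable_funM.
rewrite (@Ex_normal _ C) => [|//|//]; last exact: (measurableT_comp mf (ma x sg)).
have me : measurable_fun setT (fun y : R => expR (- (((y - x) / sg) ^+ 2 / 2))).
  apply: (measurableT_comp (@measurable_expR R)); apply: measurable_funN.
  apply: measurable_funM => //; apply: measurable_funX; apply: measurable_funM => //.
  exact: measurable_funB.
rewrite (@Ex_normal _ C'); last 2 first.
- exact: measurable_funM.
- by move=> y; rewrite -[leRHS]mulr1; exact: ler_normM (FC y) (gauss_le1 _).
have mg : measurable_fun setT (fun y : R => f y * npdf ((y - x) / sg)).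
  apply: measurable_funM => //; apply: (measurableT_comp (@measurable_npdf R)).
  by apply: measurable_funM => //; exact: measurable_funB.
have := @Rintegral_affine sg x _ sg0 mg.
under eq_Rintegral do rewrite addrK [sg * _]mulrC mulfK ?gt_eqF// addrC [_ * sg]mulrC.
move=> ->; rewrite [peak / sg]mulrC -mulrA; congr (_ * _).
rewrite -RintegralZl//=; last first.
  apply: (@npdf_integrable _ _ C' 0); first exact: measurable_funM.
  move=> y; rewrite expr0; apply: (@le_trans _ _ C'); last first.
    by have := le_trans (normr_ge0 _) (FC 0); lra.
  by rewrite -[leRHS]mulr1; exact: ler_normM (FC y) (gauss_le1 _).
apply: eq_Rintegral => y _.
by rewrite [npdf (_ / _)]npdfE -/peak /F; field; rewrite ?gt_eqF// npdf_gt0.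
Qed.

End smooth_one.

(** Uniform continuity handles small [sg * u]; for large ones [2 * C] is dominated by 2 C (sg u /
    del)^2, whose mean is small because u has variance 1. *)
Lemma smooth_near (f : R -> R) (M eta : R) : 0 < M -> continuous f ->
  (forall x, M < `|x| -> f x = 0) -> 0 < eta -> exists2 sg : R, 0 < sg &
  forall x, `|Ex mu (fun u : R => f (x + sg * u)) - f x| <= eta.
Proof.
move=> M0 cf fM eta0.
have [C fC] := csupp_bounded cf fM.
have C0 : 0 <= C by exact: le_trans (normr_ge0 _) (fC 0).
have eta2 : 0 < eta / 2 by rewrite divr_gt0.
have [del del0 H] := csupp_uniform M0 cf fM eta2.
pose K := 2 * C / del ^+ 2.
have K0 : 0 <= K by rewrite /K divr_ge0 ?exprn_ge0 ?(ltW del0)// mulr_ge0.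
pose sg := Num.min 1 (eta / 2 / (K + 1)).
have sg0 : 0 < sg by rewrite lt_min ltr01 divr_gt0// ltr_wpDl.
have sg1 : sg <= 1 by rewrite ge_min lexx.
have sgK : K * sg ^+ 2 <= eta / 2.
  have h : sg * (K + 1) <= eta / 2.
    by rewrite -ler_pdivlMr ?ltr_wpDl// ge_min lexx orbT.
  have h1 : K * sg ^+ 2 <= K * sg by rewrite ler_wpM2l// expr2 ler_piMl// ltW.
  by rewrite mulrDr mulr1 mulrC in h; have := ltW sg0; lra.
exists sg => // x.
have gmu : gauss mu 1 (fun u : measurableTypeR R => u).
  by split; [exact: measurable_id|move=> A mA; rewrite sqrtr1].
have mf := continuous_measurable_fun cf.
have mfx : measurable_fun setT (fun u : R => f (x + sg * u)).
  by apply: (measurableT_comp mf); apply: measurable_funD => //; exact: measurable_funM.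
have I1 : Intg mu (fun u : R => f (x + sg * u)) by exact: (@Intg_bd _ _ _ mu _ C).
have I2 : Intg mu (fun u : R => u ^+ 2).
  by apply: mom_Intg; apply: momX; exact: mom_gauss gmu.
have E2 : Ex mu (fun u : R => u ^+ 2) = 1 by exact: Ex_gauss2 gmu.
rewrite -(Ex_cst mu (f x)) -ExB//; last exact: Intg_cst.
apply: (le_trans (le_norm_Ex (IntgD I1 (IntgN (Intg_cst mu (f x)))))).
have I3 := IntgD (Intg_cst mu (eta / 2)) (IntgZ (K * sg ^+ 2) I2).
apply: (@le_trans _ _ (Ex mu (fun u : R => eta / 2 + K * sg ^+ 2 * u ^+ 2))).
  apply: le_Ex => //.
    by apply: Intg_norm; apply: IntgD => //; exact: Intg_cst.
  move=> u; have [h|h] := lerP `|sg * u| del.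
    apply: (@le_trans _ _ (eta / 2)); first by apply: H; rewrite addrC addKr.
    by rewrite lerDl mulr_ge0 ?sqr_ge0// mulr_ge0// sqr_ge0.
  apply: (@le_trans _ _ (2 * C)).
    apply: (le_trans (ler_normB _ _)); have := fC (x + sg * u); have := fC x; lra.
  apply: (@le_trans _ _ (K * sg ^+ 2 * u ^+ 2)); last by rewrite lerDr ltW.
  rewrite (_ : K * sg ^+ 2 * u ^+ 2 = 2 * C * (`|sg * u| / del) ^+ 2); last first.
    by rewrite expr_div_n real_normK ?num_real// /K; field; rewrite gt_eqF.
  by rewrite ler_peMr ?mulr_ge0// exprn_ege1// ler_pdivlMr// mul1r ltW.
rewrite ExD; [|exact: Intg_cst|exact: IntgZ].
rewrite Ex_cst ExZ// E2 mulr1; lra.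
Qed.

(** * From characteristic functions to convergence in law *)

Section levy.
Context d d' (T : measurableType d) (T' : measurableType d').
Variables (P : probability T R) (P' : probability T' R).
Variables (X : nat -> T -> R) (Y : T' -> R).
Hypotheses (mX : forall n, measurable_fun setT (X n)) (mY : measurable_fun setT Y).
Hypothesis XY : forall lam ph : R, Ex P (fun w => cos (ph + lam * X n w)) @[n --> \oo] -->
  Ex P' (fun w => cos (ph + lam * Y w)).

(** The Gaussian is its own characteristic function: exp(-z^2/2) is the mean of cos(z u) over a
    standard normal u. Gaussian functionals of [Z] are therefore mixtures of its trigonometric
    moments. *)
Lemma gauss_of_char d0 (T0 : measurableType d0) (Q : probability T0 R) (Z : T0 -> R) (y sg : R) :
  measurable_fun setT Z ->
  Ex Q (fun w => expR (- (((y - Z w) / sg) ^+ 2 / 2))) =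
  Ex mu (fun u : R => Ex Q (fun w => cos (u * y / sg + (- u / sg) * Z w))).
Proof.
move=> mZ; pose H w (u : measurableTypeR R) := cos (0 + (y - Z w) / sg * u).
have mH : measurable_fun setT (fun z : T0 * measurableTypeR R => H z.1 z.2).
  apply: (measurableT_comp (continuous_measurable_fun (@continuous_cos R))).
  apply: measurable_funD => //; apply: measurable_funM; last exact: measurable_snd.
  apply: measurable_funM => //; apply: measurable_funB => //.
  exact: (measurableT_comp mZ measurable_fst).
have H1 w u : `|H w u| <= 1 by rewrite ler_norml cos_geN1 cos_le1.
transitivity (Ex Q (fun w => Ex mu (H w))).
  by apply: eq_Ex => w; rewrite /H Ex_normal_cos cos0 mul1r.
rewrite (Ex_swap Q mu mH H1); apply: eq_Ex => u; apply: eq_Ex => w.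
by congr cos; ring.
Qed.

Lemma gauss_cvg (y sg : R) :
  Ex P (fun w => expR (- (((y - X n w) / sg) ^+ 2 / 2))) @[n --> \oo] -->
  Ex P' (fun w => expR (- (((y - Y w) / sg) ^+ 2 / 2))).
Proof.
under eq_cvg do rewrite gauss_of_char//.
rewrite gauss_of_char//.
have bd d0 (T0 : measurableType d0) (Q : probability T0 R) (Z : T0 -> R) :
    measurable_fun setT Z ->
    measurable_fun setT (fun u : R => Ex Q (fun w => cos (u * y / sg + (- u / sg) * Z w))) /\
    (forall u : R, `|Ex Q (fun w => cos (u * y / sg + (- u / sg) * Z w))| <= 1).
  move=> mZ; pose H (u : measurableTypeR R) w := cos (u * y / sg + (- u / sg) * Z w).
  have mH : measurable_fun setT (fun z : measurableTypeR R * T0 => H z.1 z.2).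
    apply: (measurableT_comp (continuous_measurable_fun (@continuous_cos R))).
    have m1 : measurable_fun setT (fun z : measurableTypeR R * T0 => z.1 : R) by exact: measurable_fst.
    apply: measurable_funD; first by do 2 apply: measurable_funM => //.
    apply: measurable_funM; last exact: (measurableT_comp mZ measurable_snd).
    by apply: measurable_funM => //; exact: measurable_funN.
  have H1 u w : `|H u w| <= 1 by rewrite ler_norml cos_geN1 cos_le1.
  by split; [exact: (measurable_Ex Q mH H1)|exact: (Ex_le_bound Q mH H1)].
apply: (@Ex_cvg_dom _ _ _ mu _ _ 1).
- by move=> n; case: (bd _ _ P _ (mX n)).
- by case: (bd _ _ P' _ mY).
- by move=> n; case: (bd _ _ P _ (mX n)).
- by apply: aeW => u; exact: XY.
Qed.

Lemma smooth_cvg (f : R -> R) (M sg : R) : 0 < M -> continuous f ->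
  (forall x, M < `|x| -> f x = 0) -> 0 < sg ->
  Ex P (fun w => Ex mu (fun u : R => f (X n w + sg * u))) @[n --> \oo] -->
  Ex P' (fun w => Ex mu (fun u : R => f (Y w + sg * u))).
Proof.
move=> M0 cf fM sg0; pose F (y : R) := f y / npdf y.
pose g (z : R) := expR (- ((z / sg) ^+ 2 / 2)) : R.
have g1 z : `|g z| <= 1.
  exact: gauss_le1.
have mg : measurable_fun setT g.
  apply: (measurableT_comp (@measurable_expR R)); apply: measurable_funN.
  by apply: measurable_funM => //; apply: measurable_funX; exact: measurable_funM.
have [C FC] : exists C : R, forall x : R, `|F x| <= C.
  by apply: (csupp_bounded (continuous_div_npdf cf)) => x /fM; rewrite /F => ->; rewrite mul0r.
have C0 : 0 <= C := le_trans (normr_ge0 _) (FC 0).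
have mF := continuous_measurable_fun (continuous_div_npdf cf).
have sw d0 (T0 : measurableType d0) (Q : probability T0 R) (Z : T0 -> R) :
    measurable_fun setT Z ->
    [/\ Ex Q (fun w => Ex mu (fun u : R => f (Z w + sg * u))) =
      normal_peak 1 / sg * Ex mu (fun y : R => F y * Ex Q (fun w => g (y - Z w))),
     measurable_fun setT (fun y : R => Ex Q (fun w => g (y - Z w))) &
     (forall y : R, `|Ex Q (fun w => g (y - Z w))| <= 1)].
  move=> mZ; pose H (y : measurableTypeR R) w := F y * g (y - Z w).
  have mH0 : measurable_fun setT (fun z : measurableTypeR R * T0 => g ((z.1 : R) - Z z.2)).
    apply: (measurableT_comp mg); apply: measurable_funB; first exact: measurable_fst.
    exact: (measurableT_comp mZ measurable_snd).
  have mH : measurable_fun setT (fun z : measurableTypeR R * T0 => H z.1 z.2).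
    by apply: measurable_funM => //; exact: (measurableT_comp mF measurable_fst).
  have HC u w : `|H u w| <= C.
    by rewrite normrM -[leRHS]mulr1 ler_pM.
  have my y : measurable_fun setT (fun w => g (y - Z w)).
    by apply: (measurableT_comp mg); exact: measurable_funB.
  have Ig y : Intg Q (fun w => g (y - Z w)) by exact: (@Intg_bd _ _ _ _ _ 1).
  split.
  - have e y : F y * Ex Q (fun w => g (y - Z w)) = Ex Q (H y) by rewrite ExZ.
    under [in RHS]eq_Ex do rewrite e.
    rewrite (Ex_swap mu Q mH HC).
    under eq_Ex do rewrite (smoothE cf fM sg0).
    rewrite ExZ//.
    apply: (@Intg_bd _ _ _ _ _ C); first exact: (measurable_Ex_r mu mH HC).
    move=> w; have mHw : measurable_fun setT (H^~ w).
      exact: (measurableT_comp mH (pair2_measurable w)).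
    have I1 : Intg mu (H^~ w) by exact: (@Intg_bd _ _ _ mu _ C).
    apply: (le_trans (le_norm_Ex I1)); rewrite -[leRHS](Ex_cst mu).
    by apply: le_Ex => //; [exact: Intg_norm|exact: Intg_cst].
  - exact: (@measurable_Ex _ _ _ _ _ Q (fun (y : measurableTypeR R) w => g (y - Z w)) 1 mH0 (fun y w => g1 _)).
  - exact: (@Ex_le_bound _ _ _ _ _ Q (fun (y : measurableTypeR R) w => g (y - Z w)) 1 mH0 (fun y w => g1 _)).
have [-> mYg Yg1] := sw _ _ P' _ mY.
have eX n := let: And3 e _ _ := sw _ _ P _ (mX n) in e.
under eq_cvg do rewrite eX.
apply: cvgM; first exact: cvg_cst.
apply: (@Ex_cvg_dom _ _ _ mu _ _ C).
- by move=> n; have [_ m _] := sw _ _ P _ (mX n); exact: measurable_funM.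
- exact: measurable_funM.
- move=> n y; have [_ _ b] := sw _ _ P _ (mX n).
  by rewrite normrM -[leRHS]mulr1 ler_pM.
- apply: aeW => y; apply: cvgM; first exact: cvg_cst.
  exact: gauss_cvg.
Qed.

Lemma cvg_csupp (f : R -> R) (M : R) : 0 < M -> continuous f ->
  (forall x, M < `|x| -> f x = 0) ->
  Ex P (fun w => f (X n w)) @[n --> \oo] --> Ex P' (fun w => f (Y w)).
Proof.
move=> M0 cf fM; apply/cvgrPdist_le => eps eps0.
have e3 : 0 < eps / 3 by rewrite divr_gt0.
have [sg sg0 Hs] := smooth_near M0 cf fM e3.
have [C fC] := csupp_bounded cf fM.
have mf := continuous_measurable_fun cf.
have near d0 (T0 : measurableType d0) (Q : probability T0 R) (Z : T0 -> R) :
    measurable_fun setT Z ->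
    `|Ex Q (fun w => Ex mu (fun u : R => f (Z w + sg * u))) - Ex Q (fun w => f (Z w))| <= eps / 3.
  move=> mZ; pose H w (u : measurableTypeR R) := f (Z w + sg * u).
  have mH : measurable_fun setT (fun z : T0 * measurableTypeR R => H z.1 z.2).
    apply: (measurableT_comp mf); apply: measurable_funD.
      exact: (measurableT_comp mZ measurable_fst).
    by apply: measurable_funM => //; exact: measurable_snd.
  have HC w u : `|H w u| <= C by exact: fC.
  have I1 : Intg Q (fun w => Ex mu (H w)).
    by apply: (@Intg_bd _ _ _ _ _ C (measurable_Ex mu mH HC)); exact: (Ex_le_bound mu mH HC).
  have I2 : Intg Q (fun w => f (Z w)).
    by apply: (@Intg_bd _ _ _ _ _ C) => //; exact: measurableT_comp.
  rewrite -ExB//; apply: (le_trans (le_norm_Ex (IntgD I1 (IntgN I2)))).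
  rewrite -[leRHS](Ex_cst Q); apply: le_Ex; last by move=> w; exact: Hs.
    by apply: Intg_norm; apply: IntgD => //; exact: IntgN.
  exact: Intg_cst.
have := smooth_cvg M0 cf fM sg0 => /cvgrPdist_le/(_ _ e3); apply: filterS => n Hn.
have h1 := near _ _ P' _ mY; have h2 := near _ _ P _ (mX n).
set a := Ex P' (fun w => f (Y w)) in h1 *; set b := Ex P (fun w => f (X n w)) in h2 *.
set a' := Ex P' _ in h1 Hn; set b' := Ex P _ in h2 Hn.
rewrite (_ : a - b = (a - a') + (a' - b') + (b' - b)); last by ring.
apply: (le_trans (ler_normD _ _)); apply: (le_trans (lerD (ler_normD _ _) (lexx _))).
rewrite distrC in h1; lra.
Qed.

(** Cut [f] off by [chi k]. Little mass of [Y] escapes the cut-off for large [k], and the same then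
    holds for [X n] because [chi k] is itself a compactly supported test function; tightness comes
    out of the convergence. *)
Lemma levy_continuity (f : R -> R) (C : R) : continuous f -> (forall x, `|f x| <= C) ->
  Ex P (fun w => f (X n w)) @[n --> \oo] --> Ex P' (fun w => f (Y w)).
Proof.
move=> cf fC; have C0 : 0 <= C := le_trans (normr_ge0 _) (fC 0).
pose chi (k : nat) (x : R) : R := Num.min (Num.max (k.+2%:R - `|x|) 0) 1.
have cchi k : continuous (chi k).
  move=> x; rewrite /chi.
  apply: (@continuous_min _ _ (fun x : R => Num.max (k.+2%:R - `|x|) 0) (fun=> 1)); last exact: cvg_cst.
  apply: (@continuous_max _ _ (fun x : R => k.+2%:R - `|x|) (fun=> 0)); last exact: cvg_cst.
  by apply: cvgB; [exact: cvg_cst|exact: norm_continuous].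
have chi0 k x : k.+2%:R < `|x| -> chi k x = 0.
  by move=> h; rewrite /chi (max_idPr _) ?subr_le0 ?(ltW h)// (min_idPl _).
have chi1 k x : `|x| <= k.+1%:R -> chi k x = 1.
  move=> h; rewrite /chi (min_idPr _)// le_max; apply/orP; left.
  by rewrite -[k.+2%:R]natr1; lra.
have chi01 k x : 0 <= chi k x <= 1.
  by rewrite /chi le_min ler01 ge_min lexx orbT le_max lexx orbT.
have chiY : Ex P' (fun w => chi k (Y w)) @[k --> \oo] --> (1 : R).
  rewrite -(Ex_cst P' 1); apply: (@Ex_cvg_dom _ _ _ P' _ _ 1).
  - by move=> k; apply: (measurableT_comp (continuous_measurable_fun (@cchi k))).
  - exact: measurable_cst.
  - by move=> k w; have /andP[? ?] := chi01 k (Y w); rewrite ger0_norm.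
  - apply: aeW => w; apply: cvg_near_cst; exists (Num.truncn `|Y w|) => // k /= hk.
    apply: chi1; apply: (le_trans (ltW (truncnS_gt _))).
    by rewrite ler_nat ltnS.
apply/cvgrPdist_le => eps eps0.
pose dl := eps / (4 * (C + 1)).
have dl0 : 0 < dl by rewrite divr_gt0// mulr_gt0// ltr_wpDl.
have Cd : C * dl <= eps / 4.
  have h : (C + 1) * dl = eps / 4 by rewrite /dl; field; rewrite gt_eqF// ltr_wpDl.
  by rewrite -h ler_wpM2r ?(ltW dl0)// lerDl.
move/cvgrPdist_le : (chiY) => /(_ _ dl0)[k _ /(_ k (leqnn k)) hk].
have k0 : 0 < k.+2%:R :> R by rewrite ltr0n.
have cfchi : continuous (fun x => f x * chi k x).
  by move=> x; apply: cvgM; [exact: cf|exact: cchi].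
have fchi0 x : k.+2%:R < `|x| -> f x * chi k x = 0 by move=> /chi0 ->; rewrite mulr0.
have c1 := cvg_csupp k0 cfchi fchi0.
have c2 := cvg_csupp k0 (@cchi k) (chi0 k).
have mf := continuous_measurable_fun cf; have mchi := continuous_measurable_fun (@cchi k).
have near d0 (T0 : measurableType d0) (Q : probability T0 R) (Z : T0 -> R) :
    measurable_fun setT Z ->
    `|Ex Q (fun w => f (Z w)) - Ex Q (fun w => f (Z w) * chi k (Z w))| <=
      C * (1 - Ex Q (fun w => chi k (Z w))).
  move=> mZ; have mfZ := measurableT_comp mf mZ; have mcZ := measurableT_comp mchi mZ.
  have I1 : Intg Q (fun w => f (Z w)) by exact: (@Intg_bd _ _ _ _ _ C).
  have I2 : Intg Q (fun w => chi k (Z w)).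
    apply: (@Intg_bd _ _ _ _ _ 1) => // w.
    by have /andP[? ?] := chi01 k (Z w); rewrite ger0_norm.
  have I3 : Intg Q (fun w => f (Z w) * chi k (Z w)).
    apply: (@Intg_bd _ _ _ _ _ C); first exact: measurable_funM.
    move=> w; rewrite normrM -[leRHS]mulr1 ler_pM//.
    by have /andP[? ?] := chi01 k (Z w); rewrite ger0_norm.
  have I4 := IntgD (Intg_cst Q 1) (IntgN I2).
  rewrite -(Ex_cst Q 1) -!ExB//; last exact: Intg_cst.
  rewrite -ExZ//; apply: (le_trans (le_norm_Ex (IntgD I1 (IntgN I3)))).
  apply: le_Ex.
  - by apply: Intg_norm; apply: IntgD => //; exact: IntgN.
  - exact: IntgZ.
  - move=> w; have /andP[h0 h1] := chi01 k (Z w).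
    rewrite -[X in `|X - _|]mulr1 -mulrBr normrM ler_pM// ger0_norm ?subr_ge0//.
have d4 : 0 < eps / 4 by rewrite divr_gt0.
move/cvgrPdist_le : c1 => /(_ _ d4) c1; move/cvgrPdist_le : c2 => /(_ _ dl0) c2.
move: c1 c2; apply: filterS2 => n h1 h2.
have g1 := near _ _ P' _ mY; have g2 := near _ _ P _ (mX n).
set a := Ex P' (fun w => f (Y w)) in g1 *; set b := Ex P (fun w => f (X n w)) in g2 *.
set a' := Ex P' (fun w => f (Y w) * _) in g1 h1; set b' := Ex P (fun w => f (X n w) * _) in g2 h1.
set p := Ex P' _ in g1 h2 hk; set q := Ex P _ in g2 h2.
have p1 : 1 - p <= dl by apply: le_trans hk; exact: ler_norm.
have q1 : 1 - q <= 2 * dl.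
  by rewrite (_ : 1 - q = (1 - p) + (p - q)); [have := le_trans (ler_norm _) h2; lra|ring].
have cp := ler_wpM2l C0 p1; have cq := ler_wpM2l C0 q1.
rewrite (_ : a - b = (a - a') + (a' - b') + (b' - b)); last by ring.
apply: (le_trans (ler_normD _ _)); apply: (le_trans (lerD (ler_normD _ _) (lexx _))).
rewrite distrC in g2; move: Cd cq cp g1 g2 h1; set z := C * dl; rewrite [C * (2 * dl)]mulrCA -/z; lra.
Qed.

End levy.
End smoothing.

(** * The limit theorem *)

Section law_of_variable.
Context d (T : measurableType d) (R : realType) (P : probability T R) (X : T -> R).
Hypothesis mX : measurable_fun setT X.

Let XM (w : T) : measurableTypeR R := X w.

HB.instance Definition _ := isMeasurableFun.Build _ _ _ _ XM mX.

Definition law_prob : probability (measurableTypeR R) R := distribution P XM.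

Lemma has_law_prob : has_law P law_prob X.
Proof. by []. Qed.

End law_of_variable.

Section mixture.
Context (R : realType) d d' (T : measurableType d) (T' : measurableType d').
Context (P : probability T R) (P' : probability T' R).

Lemma Ex_same_law (X : T -> R) (X' : T' -> R) (g : R -> R) (C : R) :
  measurable_fun setT X -> measurable_fun setT X' -> same_law P' P X' X ->
  measurable_fun setT g -> (forall x, `|g x| <= C) ->
  Ex P' (fun w => g (X' w)) = Ex P (fun w => g (X w)).
Proof.
move=> mX mX' XX' mg gC.
have I1 : Intg P (fun w => g (X w)).
  by apply: (@Intg_bd _ _ _ _ _ C) => //; exact: measurableT_comp.
have I2 : Intg P' (fun w => g (X' w)).
  by apply: (@Intg_bd _ _ _ _ _ C) => //; exact: measurableT_comp.
have l1 := has_law_prob P mX.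
have l2 : has_law P' (law_prob P mX) X' by move=> A mA; rewrite XX'// -l1.
have [_ ->] := law_integrable mX' l2 mg I2.
by have [_ ->] := law_integrable mX l1 mg I1.
Qed.

Variables (beta eta : T' -> R).
Hypotheses (mbeta : measurable_fun setT beta) (meta : measurable_fun setT eta).
Hypotheses (neta : standard_normal P' eta)
  (ind : independent_systems P' (sigma_var beta) (sigma_var eta)).

Let Y w := Num.sqrt (32 / 3) * Num.sqrt (beta w) * eta w.

Let msqrt : measurable_fun setT (@Num.sqrt R).
Proof. by apply: continuous_measurable_fun; exact: sqrt_continuous. Qed.

Lemma measurable_mixture : measurable_fun setT Y.
Proof.
apply: measurable_funM => //; apply: measurable_funM => //.
exact: (measurableT_comp msqrt).
Qed.

(** Freeze [beta] and integrate the normal variable [eta]. *)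
Lemma Ex_cos_mixture (lam ph : R) : Ex P' (fun w => cos (ph + lam * Y w)) =
  cos ph * Ex P' (fun w => expR (- (lam ^+ 2 / 2 * Num.max (32 / 3 * beta w) 0))).
Proof.
have eG : <<s sigma_var beta >> = sigma_var beta.
  by apply: sigma_algebra_id; apply: sigma_algebra_preimage; exact: sigma_algebra_measurable.
have Gm : sigma_var beta `<=` measurable.
  by move=> A [B mB <-]; rewrite setTI -[X in measurable X]setTI; exact: mbeta.
have ind' : indep_of P' (sigma_var beta) eta by rewrite /indep_of eG.
pose H w x : R := cos (ph + lam * Num.sqrt (32 / 3) * Num.sqrt (beta w) * x).
have mbG : Fm (sigma_var beta) beta by apply: Fm_sigma_var; rewrite eG.
have mcos := continuous_measurable_fun (@continuous_cos R).
have mH : measurable_fun setT (fun z : g_sigma_algebraType (sigma_var beta) * measurableTypeR R => H z.1 z.2).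
  apply: (measurableT_comp mcos); apply: measurable_funD => //.
  apply: measurable_funM; last exact: measurable_snd.
  apply: measurable_funM => //; apply: (measurableT_comp msqrt).
  exact: (@measurableT_comp _ _ _ _ _ _ (beta : g_sigma_algebraType (sigma_var beta) -> R)).
have HE w : cos (ph + lam * Y w) = H w (eta w) by rewrite /H /Y !mulrA.
have H1 w x : `|H w x| <= 1 by rewrite ler_norml cos_geN1 cos_le1.
have [||_ e] := freezing Gm meta ind' neta mH.
- move=> w; apply: (@Intg_bd _ _ _ (normal_prob 0 1 : probability (measurableTypeR R) R) _ 1) => //.
  by apply: (measurableT_comp mcos); apply: measurable_funD => //; exact: measurable_funM.
- apply: (@Intg_bd _ _ _ _ _ 1) => //; rewrite (_ : (fun w => _) = fun w => cos (ph + lam * Y w)).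
    apply: (measurableT_comp mcos); apply: measurable_funD => //; apply: measurable_funM => //.
    exact: measurable_mixture.
  by apply/funext => w; rewrite HE.
under eq_Ex do rewrite HE.
rewrite e -ExZ; last first.
  apply: (@Intg_bd _ _ _ _ _ 1).
    apply: (measurableT_comp (@measurable_expR R)); apply: measurable_funN.
    by apply: measurable_funM => //; apply: measurable_maxr => //; exact: measurable_funM.
  move=> w; rewrite ger0_norm ?expR_ge0// -expR0 ler_expR oppr_le0 mulr_ge0//.
    by rewrite divr_ge0// sqr_ge0.
  by rewrite le_max lexx orbT.
apply: eq_Ex => w.
have := @Ex_normal_cos R ph (lam * Num.sqrt (32 / 3) * Num.sqrt (beta w)).
rewrite /Ex => ->; congr (_ * expR (- _)).
rewrite !exprMn sqr_sqrtr//.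
have [b0|b0] := leP 0 (beta w).
  by rewrite sqr_sqrtr// (max_idPl _) ?mulr_ge0//; ring.
rewrite ler0_sqrtr ?(ltW b0)// expr0n/= mulr0 mul0r (max_idPr _) ?mulr0//.
by rewrite pmulr_rle0// ltW.
Qed.

End mixture.

Section limit_zero.
Context d (T : measurableType d) (R : realType) (P : probability T R).
Variables (W W' : R -> T -> R) (L L' : R -> R -> T -> R).
Hypotheses (BW : brownian_motion P W) (BW' : brownian_motion P W').
Hypothesis WW' : independent_systems P (sigma_process `[0, +oo[ W)
                                       (sigma_process `[0, +oo[ W').
Hypotheses (LW : local_time P W L) (LW' : local_time P W' L').

Lemma local_time0 (V : R -> T -> R) (K : R -> R -> T -> R) :
  local_time P V K -> {ae P, forall w, forall x, K x 0 w = 0}.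
Proof.
move=> LV; apply: filterS (lt_occupation LV) => w o.
have cK := @local_time_continuous _ _ _ _ _ _ LV _ w (lexx 0).
have oc := @cpath_occ _ _ _ V K w 0 (lexx 0) o.
exact: (@occ_eq0 R (cpath V w) (fun x => K x 0 w) 0 cK oc erefl).
Qed.

(** If a time is 0, one local time vanishes identically and both sides equal [cos ph]. Otherwise [h]
    is capped at 1, which changes only finitely many terms. *)
Lemma limit_char (s t : R) (h : nat -> R) (lam ph : R) : 0 <= s -> 0 <= t ->
  (forall i, 0 < h i) -> h i @[i --> \oo] --> (0 : R) ->
  Ex P (fun w => cos (ph + lam * Xh L L' s t (h i) w)) @[i --> \oo] -->
    cos ph * Ex P (fun w => expR (- (lam ^+ 2 / 2 * sig2 L L' s t w))).
Proof.
move=> s0 t0 h0 hc.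
have key : (s = 0 \/ t = 0) -> {ae P, forall w, (forall i, Xh L L' s t (h i) w = 0) /\ sig2 L L' s t w = 0}.
  move=> st.
  have z : {ae P, forall w, (forall x, L x s w = 0) \/ (forall x, L' x t w = 0)}.
    case: st => ->; [apply: filterS (local_time0 LW)|apply: filterS (local_time0 LW')] => w; tauto.
  apply: filterS z => w z.
  have zz x y : L x s w * L' y t w = 0 by case: z => ->; rewrite ?mul0r ?mulr0.
  split=> [i|].
    rewrite /Xh /increment_product /Rintegral (eq_integral (fun _ => 0%E)) ?integral0 ?mul0r//.
    by move=> x _; congr EFin; rewrite mulrBr !mulrBl !zz !subrr.
  rewrite /sig2 /intersection_local_time /Rintegral (eq_integral (fun _ => 0%E)).
    by rewrite integral0 mulr0 maxxx.
  by move=> x _; rewrite zz.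
have deg : (s = 0 \/ t = 0) -> Ex P (fun w => cos (ph + lam * Xh L L' s t (h i) w)) @[i --> \oo] -->
    cos ph * Ex P (fun w => expR (- (lam ^+ 2 / 2 * sig2 L L' s t w))).
  move=> /key z.
  have mcos := continuous_measurable_fun (@continuous_cos R).
  have mX i : measurable_fun setT (Xh L L' s t (h i)).
    by apply: measurable_funM => //; exact: (measurable_increment_product LW LW').
  have ms : measurable_fun setT (sig2 L L' s t).
    by apply: measurable_maxr => //; apply: measurable_funM => //; exact: (measurable_intersection LW LW').
  have -> : Ex P (fun w => expR (- (lam ^+ 2 / 2 * sig2 L L' s t w))) = 1.
    rewrite -[RHS](Ex_cst P); apply: Ex_eq_ae => //.
      apply: (measurableT_comp (@measurable_expR R)); apply: measurable_funN.
      exact: measurable_funM.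
    by apply: filterS z => w [_ ->]; rewrite mulr0 oppr0 expR0.
  rewrite mulr1; apply: cvg_near_cst; apply: nearW => i.
  rewrite -[RHS](Ex_cst P); apply: Ex_eq_ae => //.
    by apply: (measurableT_comp mcos); apply: measurable_funD => //; exact: measurable_funM.
  by apply: filterS z => w [-> _]; rewrite mulr0 addr0.
have [sE|sN] := eqVneq s 0; first by apply: deg; left.
have [tE|tN] := eqVneq t 0; first by apply: deg; right.
have sp : 0 < s by rewrite lt_neqAle eq_sym sN.
have tp : 0 < t by rewrite lt_neqAle eq_sym tN.
pose h' i := Num.min (h i) 1.
have hh' : \forall i \near \oo, h' i = h i.
  move/cvgrPdist_le : hc => /(_ _ ltr01); apply: filterS => i.
  by rewrite sub0r normrN => /(le_trans (ler_norm _)) /min_idPl.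
have h'c : h' i @[i --> \oo] --> (0 : R).
  apply: cvg_trans hc; apply: near_eq_cvg; apply: filterS hh' => i; exact: esym.
have h'0 i : 0 < h' i by rewrite lt_min h0 ltr01.
have h'1 i : h' i <= 1 by rewrite ge_min lexx orbT.
have := @limit_along_sequence _ _ _ _ _ _ _ _ BW BW' WW' LW LW' s t sp tp h' lam ph h'0 h'1 h'c.
apply: cvg_trans; apply: near_eq_cvg; apply: filterS hh' => i -> //.
Qed.

End limit_zero.

Lemma cvg_in_law_Ex (R : realType) d d' (T : measurableType d) (T' : measurableType d')
    (P : probability T R) (P' : probability T' R) (F : set_system R) (X : R -> T -> R)
    (Y : T' -> R) : Filter F ->
  (\forall i \near F, measurable_fun setT (X i)) -> measurable_fun setT Y ->
  (forall (f : R -> R) (C : R), continuous f -> (forall x, `|f x| <= C) ->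
    Ex P (fun w => f (X i w)) @[i --> F] --> Ex P' (fun w => f (Y w))) ->
  cvg_in_law P P' F X Y.
Proof.
move=> FF mX mY XY; split => // f cf [M [Mr fM]].
have fC x : `|f x| <= M + 1 by apply: fM => //; rewrite ltrDl.
have mf := continuous_measurable_fun cf.
have fin d0 (T0 : measurableType d0) (Q : probability T0 R) (Z : T0 -> R) :
    measurable_fun setT Z -> (\int[Q]_w (f (Z w))%:E)%E \is a fin_num.
  move=> mZ; apply: integrable_fin_num => //.
  by apply: (@Intg_bd _ _ _ Q (fun w => f (Z w)) (M + 1)) => //; exact: measurableT_comp.
rewrite -(fineK (fin _ _ P' _ mY)); apply/fine_cvgP; split.
  by apply: filterS mX => i; exact: fin.
exact: (XY f (M + 1)).
Qed.

Lemma powR_half_pow (R : realType) (x : R) n : 0 <= x -> x `^ (n%:R / 2) = Num.sqrt x ^+ n.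
Proof. by move=> x0; rewrite mulrC powRrM powR12_sqrt// powR_mulrn. Qed.

Theorem theorem1p2 (R : realType) (d : measure_display) (T : measurableType d)
    (P : probability T R) (W W' : R -> T -> R) (L L' : R -> R -> T -> R)
    (BW : brownian_motion P W) (BW' : brownian_motion P W')
    (WW' : independent_systems P (sigma_process `[0, +oo[ W)
                                 (sigma_process `[0, +oo[ W'))
    (LW : local_time P W L) (LW' : local_time P W' L') :
  (forall s t : R, 0 <= s -> 0 <= t ->
   forall (d' : measure_display) (T' : measurableType d')
     (P' : probability T' R) (beta eta : T' -> R),
     measurable_fun setT beta -> measurable_fun setT eta ->
     same_law P' P beta (intersection_local_time L L' s t) ->
     standard_normal P' eta ->
     independent_systems P' (sigma_var beta) (sigma_var eta) ->
     cvg_in_law P P' 0^'+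
       (fun h w => increment_product L L' h s t w / h `^ (3 / 2))
       (fun w => Num.sqrt (32 / 3) * Num.sqrt (beta w) * eta w)) /\
  (forall (d' : measure_display) (T' : measurableType d')
     (P' : probability T' R) (beta eta : T' -> R),
     measurable_fun setT beta -> measurable_fun setT eta ->
     same_law P' P beta (intersection_local_time L L' 1 1) ->
     standard_normal P' eta ->
     independent_systems P' (sigma_var beta) (sigma_var eta) ->
     cvg_in_law P P' +oo
       (fun t w => increment_product L L' 1 t t w / t `^ (3 / 4))
       (fun w => Num.sqrt (32 / 3) * Num.sqrt (beta w) * eta w)).
Proof.
have main (d' : measure_display) (T' : measurableType d') (P' : probability T' R)
    (beta eta : T' -> R) s t : 0 <= s -> 0 <= t ->
    measurable_fun setT beta -> measurable_fun setT eta ->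
    same_law P' P beta (intersection_local_time L L' s t) ->
    standard_normal P' eta -> independent_systems P' (sigma_var beta) (sigma_var eta) ->
    forall (h : nat -> R) (lam ph : R), (forall i, 0 < h i) -> h i @[i --> \oo] --> (0 : R) ->
    Ex P (fun w => cos (ph + lam * Xh L L' s t (h i) w)) @[i --> \oo] -->
    Ex P' (fun w => cos (ph + lam * (Num.sqrt (32 / 3) * Num.sqrt (beta w) * eta w))).
  move=> s0 t0 mb me sl sn ind h lam ph h0 hc.
  rewrite (Ex_cos_mixture mb me sn ind).
  pose g (b : R) : R := expR (- (lam ^+ 2 / 2 * Num.max (32 / 3 * b) 0)).
  rewrite (@Ex_same_law _ _ _ _ _ P P' (intersection_local_time L L' s t) beta g 1) //.
  - exact: (@limit_char _ _ _ _ _ _ _ _ BW BW' WW' LW LW' s t h lam ph s0 t0 h0 hc).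
  - exact: (measurable_intersection LW LW').
  - apply: (measurableT_comp (@measurable_expR R)); apply: measurable_funN.
    by apply: measurable_funM => //; apply: measurable_maxr => //; exact: measurable_funM.
  - move=> x; rewrite ger0_norm ?expR_ge0// -expR0 ler_expR oppr_le0 mulr_ge0//.
      by rewrite divr_ge0// sqr_ge0.
    by rewrite le_max lexx orbT.
split.
  move=> s t s0 t0 d' T' P' beta eta mb me sl sn ind.
  have mX h : measurable_fun setT (fun w => increment_product L L' h s t w / h `^ (3 / 2)).
    by apply: measurable_funM => //; exact: (measurable_increment_product LW LW').
  have mY := measurable_mixture mb me.
  apply: cvg_in_law_Ex => //; first exact: nearW.
  (* Convergence along every sequence decreasing into 0 from the right is enough, and it puts the
     statement within reach of the sequential continuity theorem. *)
  move=> f C cf fC; apply/cvg_at_rightP => u [u0 uc].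
  apply: (@levy_continuity R _ _ _ _ P P' (fun n w => increment_product L L' (u n) s t w / u n `^ (3 / 2))
    (fun w => Num.sqrt (32 / 3) * Num.sqrt (beta w) * eta w) _ _ _ f C) => // lam ph.
  have := main _ _ _ _ _ _ _ s0 t0 mb me sl sn ind u lam ph u0 uc.
  apply: cvg_trans; apply: near_eq_cvg; apply: nearW => n.
  by apply: eq_Ex => w; rewrite /Xh powR_half_pow// ltW.
move=> d' T' P' beta eta mb me sl sn ind.
have mY := measurable_mixture mb me.
have mX (t : R) : 0 <= t -> measurable_fun setT (fun w => increment_product L L' 1 t t w / t `^ (3 / 4)).
  by move=> t0; apply: measurable_funM => //; exact: (measurable_increment_product LW LW').
apply: cvg_in_law_Ex => //.
  by apply: filterS (nbhs_pinfty_ge (num_real 0)) => t; exact: mX.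
move=> f C cf fC; apply/cvg_pinftyP => u uc.
(* Along a sequence tending to infinity only finitely many terms change, and [u'] is positive
   throughout, so its square root can be used as a scaling factor. *)
pose u' n := Num.max (u n) 1.
have u'1 n : 1 <= u' n by rewrite le_max lexx orbT.
have u'0 n : 0 < u' n := lt_le_trans ltr01 (u'1 n).
have uu' : \forall n \near \oo, u' n = u n.
  by move/cvgryPge : uc => /(_ 1); apply: filterS => n /max_idPl.
have H : Ex P (fun w => f (increment_product L L' 1 (u' n) (u' n) w / u' n `^ (3 / 4))) @[n --> \oo] -->
    Ex P' (fun w => f (Num.sqrt (32 / 3) * Num.sqrt (beta w) * eta w)).
  apply: (@levy_continuity R _ _ _ _ P P' (fun n w => increment_product L L' 1 (u' n) (u' n) w / u' n `^ (3 / 4))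
    (fun w => Num.sqrt (32 / 3) * Num.sqrt (beta w) * eta w) _ _ _ f C) => //.
    by move=> n; apply: mX; exact: ltW.
  move=> lam ph; pose a n := Num.sqrt (u' n).
  have a0 n : 0 < a n by rewrite sqrtr_gt0.
  have h0 n : 0 < (a n)^-1 by rewrite invr_gt0.
  have hc : (a n)^-1 @[n --> \oo] --> (0 : R).
    apply/cvgrPdist_le => e e0; move/cvgryPge : uc => /(_ (e^-1 ^+ 2)); apply: filterS => n un.
    rewrite sub0r normrN gtr0_norm// -[leRHS]invrK lef_pV2 ?posrE ?invr_gt0//.
    rewrite -[e^-1]gtr0_norm ?invr_gt0// -sqrtr_sqr ler_wsqrtr//.
    by apply: (le_trans un); rewrite le_max lexx.
  have := main _ _ _ _ _ _ _ ler01 ler01 mb me sl sn ind _ lam ph h0 hc.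
  apply: cvg_trans; apply: near_eq_cvg; apply: nearW => n.
  (* The scaled motions depend on [n], but at shift 1/a and times 1 their integral has the same law
     as that of the original pair, to which the first limit applies with h = 1/a. *)
  rewrite -(@increment_product_law _ _ _ P (bm_scale (a n) W) (bm_scale (a n) W') W W'
    (lt_scale (a n) L) (lt_scale (a n) L') L L')//; last 5 first.
  - exact: brownian_scale.
  - exact: brownian_scale.
  - move=> A B hA hB.
    have half r : `[(0 : R), +oo[%classic r -> `[(0 : R), +oo[%classic (a n ^+ 2 * r).
      by rewrite /= !in_itv/= !andbT => r0; rewrite mulr_ge0// sqr_ge0.
    by apply: WW'; [exact: (sigma_process_scale half hA)|exact: (sigma_process_scale half hB)].
  - exact: (local_time_scale (a0 n) BW LW).
  - exact: (local_time_scale (a0 n) BW' LW').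
  apply: eq_Ex => w; rewrite /Xh (increment_product_scale (a0 n) w LW LW').
  have a2 : a n ^+ 2 = u' n by rewrite sqr_sqrtr// ltW.
  rewrite a2; congr (cos (_ + _ * _)).
  have -> : u' n `^ (3 / 4) = Num.sqrt (a n) ^+ 3.
    rewrite (_ : 3 / 4 = 2^-1 * (3 / 2)); last by field.
    by rewrite powRrM powR12_sqrt ?(ltW (u'0 n))// powR_half_pow// ltW.
  have b0 : Num.sqrt (a n) != 0 by rewrite gt_eqF// sqrtr_gt0.
  have ab : a n = Num.sqrt (a n) ^+ 2 by rewrite sqr_sqrtr// ltW.
  rewrite sqrtrV ?(ltW (a0 n))// {1}ab; field.
  exact: b0.
apply: cvg_trans H; apply: near_eq_cvg; apply: filterS uu' => n -> //.
Qed.
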